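(* Let $G$ be a finitely presented group and let $n\geq 3$ be an integer. There exists a closed smooth almost-complex $2n$-manifold $(M(G,2n),J)$ with fundamental group $\pi_1(M(G,2n))\cong G$ for which there exists a pseudo-holomorphic embedding $(M(G,2n),J)\hookrightarrow(\mathbb{R}^{2n+2},\hat{J})$ for some almost-complex structure $\hat{J}$ on $\mathbb{R}^{2n+2}$.
   Context: An almost-complex structure on a smooth manifold $M$ is a smooth bundle automorphism $J:TM\to TM$ with $J^2=-\mathrm{id}$; it is not required to be integrable. The pair $(M,J)$ is called an almost-complex manifold. A smooth embedding $f:M\hookrightarrow N$ between almost-complex manifolds $(M,J_M)$ and $(N,J_N)$ is a pseudo-holomorphic embedding if $Tf\circ J_M=J_N\circ Tf$. *)

(* Defs.v *)
From HB Require Import structures.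
From mathcomp Require Import all_boot all_order all_algebra.
From mathcomp Require Import all_classical all_reals all_analysis.
From mathcomp Require Import ring lra.
From mathcomp Require Import homotopy generic_quotient.

Set Implicit Arguments.
Unset Strict Implicit.
Unset Printing Implicit Defensive.

Import Order.TTheory GRing.Theory Num.Theory.
Import numFieldNormedType.Exports.

Local Open Scope classical_set_scope.
Local Open Scope ring_scope.
Local Open Scope quotient_scope.

Definition isomorphic_groups (G H : groupType) : Prop :=
  exists phi : {multiplicative G -> H}, bijective phi.

(* A letter (i, true) stands for the generator x_i, (i, false) for x_i^-1. *)
Notation word k := (seq ('I_k * bool)).

Definition inv_word k (w : word k) : word k :=
  rev [seq (l.1, ~~ l.2) | l <- w].

Section Presentation.
Variables (k : nat) (rels : seq (word k)).

Inductive presentation_eq : word k -> word k -> Prop :=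
| pres_refl u : presentation_eq u u
| pres_sym u v : presentation_eq u v -> presentation_eq v u
| pres_trans u v w :
    presentation_eq u v -> presentation_eq v w -> presentation_eq u w
| pres_cancel u v i b :
    presentation_eq (u ++ [:: (i, b); (i, ~~ b)] ++ v) (u ++ v)
| pres_relator u v r : r \in rels -> presentation_eq (u ++ r ++ v) (u ++ v).

Let pres_rel (u v : word k) : bool := `[< presentation_eq u v >].

Let pres_rel_refl : reflexive pres_rel.
Proof. by move=> u; apply/asboolP; exact: pres_refl. Qed.

Let pres_rel_sym : symmetric pres_rel.
Proof. by move=> u v; apply/asboolP/asboolP => /pres_sym. Qed.

Let pres_rel_trans : transitive pres_rel.
Proof.
by move=> v u w /asboolP uv /asboolP vw; apply/asboolP; exact: pres_trans uv vw.
Qed.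

Definition presentation_equiv :=
  EquivRel pres_rel pres_rel_refl pres_rel_sym pres_rel_trans.

Definition presented_group := {eq_quot presentation_equiv}.

HB.instance Definition _ := Choice.on presented_group.
HB.instance Definition _ := Quotient.on presented_group.

Let pgP u v : reflect (\pi_presented_group u = \pi_presented_group v)
  (pres_rel u v).
Proof. exact: eqmodP. Qed.

Let pres_catl w u v : presentation_eq u v -> presentation_eq (w ++ u) (w ++ v).
Proof.
elim=> {u v} [u|u v _|u v t _ + _|u v i b|u v r rr].
- exact: pres_refl.
- exact: pres_sym.
- exact: pres_trans.
- by rewrite !(catA w); exact: pres_cancel.
- by rewrite !(catA w); exact: pres_relator.
Qed.

Let pres_catr w u v : presentation_eq u v -> presentation_eq (u ++ w) (v ++ w).
Proof.
elim=> {u v} [u|u v _|u v t _ + _|u v i b|u v r rr].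
- exact: pres_refl.
- exact: pres_sym.
- exact: pres_trans.
- by rewrite -!(catA _ _ w); exact: pres_cancel.
- by rewrite -!(catA _ _ w); exact: pres_relator.
Qed.

Let pres_invl w : presentation_eq (inv_word w ++ w) [::].
Proof.
elim: w => [|[i b] w ih]; first exact: pres_refl.
rewrite /inv_word /= rev_cons cat_rcons -cat1s.
apply: (pres_trans _ ih).
by have := pres_cancel (inv_word w) w i (~~ b); rewrite negbK.
Qed.

Let inv_wordK (w : word k) : inv_word (inv_word w) = w.
Proof.
rewrite /inv_word map_rev revK -map_comp -[RHS]map_id.
by apply: eq_map => -[i b] /=; rewrite negbK.
Qed.

Let pres_invr w : presentation_eq (w ++ inv_word w) [::].
Proof. by have := pres_invl (inv_word w); rewrite inv_wordK. Qed.

Let pres_inv u v : presentation_eq u v -> presentation_eq (inv_word u) (inv_word v).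
Proof.
move=> uv.
apply: (@pres_trans _ (inv_word u ++ v ++ inv_word v)).
  apply: pres_sym; rewrite -[X in presentation_eq _ X]cats0.
  exact/pres_catl/pres_invr.
rewrite catA -[X in presentation_eq _ X]cat0s; apply: pres_catr.
apply: (pres_trans _ (pres_invl u)); exact/pres_catl/pres_sym.
Qed.

Definition pg_one : presented_group := \pi_presented_group [::].

Definition pg_mul (g h : presented_group) : presented_group :=
  \pi_presented_group (repr g ++ repr h).

Definition pg_inv (g : presented_group) : presented_group :=
  \pi_presented_group (inv_word (repr g)).

Let repr_pi u : presentation_eq (repr (\pi_presented_group u)) u.
Proof. by apply/asboolP/pgP; rewrite reprK. Qed.

Let pg_mulE u v : pg_mul (\pi_presented_group u) (\pi_presented_group v) =
  \pi_presented_group (u ++ v).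
Proof.
apply/pgP/asboolP/(@pres_trans _ (u ++ repr (\pi_presented_group v))).
  exact/pres_catr/repr_pi.
exact/pres_catl/repr_pi.
Qed.

Let pg_invE u : pg_inv (\pi_presented_group u) = \pi_presented_group (inv_word u).
Proof. exact/pgP/asboolP/pres_inv/repr_pi. Qed.

Let pg_mulA : associative pg_mul.
Proof.
elim/quotW=> u; elim/quotW=> v; elim/quotW=> w; 
by rewrite (pg_mulE v w) (pg_mulE u v) !pg_mulE catA.
Qed.

Let pg_mul1 : left_id pg_one pg_mul.
Proof. by elim/quotW=> u; rewrite pg_mulE. Qed.

Let pg_mulr1 : right_id pg_one pg_mul.
Proof. by elim/quotW=> u; rewrite pg_mulE cats0. Qed.

Let pg_mulV : left_inverse pg_one pg_inv pg_mul.
Proof.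
elim/quotW=> u; rewrite pg_invE pg_mulE.
exact/pgP/asboolP/pres_invl.
Qed.

Let pg_mulrV : right_inverse pg_one pg_inv pg_mul.
Proof.
elim/quotW=> u; rewrite pg_invE pg_mulE.
exact/pgP/asboolP/pres_invr.
Qed.

HB.instance Definition _ := isGroup.Build presented_group
  pg_mulA pg_mul1 pg_mulr1 pg_mulV pg_mulrV.

End Presentation.

Definition finitely_presented (G : groupType) : Prop :=
  exists (k : nat) (rels : seq (word k)),
    isomorphic_groups (presented_group rels) G.

Definition unit_itv (R : realType) : Type := set_type `[(0:R), 1]%classic.

Section UnitInterval.
Variable R : realType.

HB.instance Definition _ := Topological.on (unit_itv R).

Let clamp_itv (r : R) :
  Num.max 0 (Num.min r 1) \in (`[(0:R), 1]%classic : set R).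
Proof.
by rewrite inE /= in_itv /= le_max lexx /= ge_max ler01 /= ge_min lexx orbT.
Qed.

(* Retraction of the line onto the unit interval, so that reparametrizations
   can be written with real arithmetic. *)
Definition clamp (r : R) : unit_itv R :=
  exist (fun y => y \in (`[(0:R), 1]%classic : set R)) _ (clamp_itv r).

Definition uval (t : unit_itv R) : R := set_val t.

Lemma uval_itv t : 0 <= uval t <= 1.
Proof. by have := set_valP t; rewrite /= in_itv. Qed.

Lemma uval_inj : injective uval.
Proof. by move=> s t /val_inj. Qed.

Lemma clampE r : uval (clamp r) = Num.max 0 (Num.min r 1).
Proof. by []. Qed.

Lemma clampK r : 0 <= r <= 1 -> uval (clamp r) = r.
Proof. by move=> /andP[r0 r1]; rewrite clampE min_l// max_r. Qed.

Lemma uvalK t : clamp (uval t) = t.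
Proof. by apply: uval_inj; rewrite clampK// uval_itv. Qed.

Lemma uval_continuous : continuous uval.
Proof. exact: initial_continuous. Qed.

Lemma clamp_continuous : continuous clamp.
Proof.
apply: continuous_comp_initial => r.
rewrite (_ : _ \o _ = (fun r : R => Num.max 0 (Num.min r 1))) //.
apply: (@continuous_max _ _ (cst 0) (fun r : R => Num.min r 1)); first exact: cvg_cst.
apply: (@continuous_min _ _ id (cst 1)); [exact: cvg_id|exact: cvg_cst].
Qed.

Let zero_one : clamp 0 != clamp 1.
Proof.
apply/eqP => /(congr1 uval); rewrite !clampK ?lexx ?ler01// => /eqP.
by rewrite eq_sym oner_eq0.
Qed.

HB.instance Definition _ := isBiPointed.Build (unit_itv R) zero_one.

Lemma uval_zero : uval zero = 0.
Proof. by rewrite clampK// lexx ler01. Qed.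

Lemma uval_one : uval one = 1.
Proof. by rewrite clampK// lexx ler01. Qed.

End UnitInterval.
Section FundamentalGroup.
Variables (R : realType) (M : topologicalType) (x : M).
Local Notation I := (unit_itv R).

Definition loop := {path I from x to x in M}.

(* The second coordinate is the homotopy parameter. *)
Definition loop_homotopic (p q : loop) : Prop :=
  exists H : I * I -> M, [/\ continuous H,
    forall t, H (t, zero) = p t, forall t, H (t, one) = q t &
    forall s, H (zero, s) = x /\ H (one, s) = x].

Lemma pasting (T : topologicalType) (u : T -> R) (F G : T -> M) :
  continuous u -> continuous F -> continuous G ->
  (forall t, u t = 2^-1 -> F t = G t) ->
  continuous (fun t => if u t <= 2^-1 then F t else G t).
Proof.
move=> cu cF cG FG; 
have clA : closed [set t | u t <= 2^-1].
  by apply: (@preimage_closed _ _ u [set r | r <= 2^-1]); [by move=> t _; exact: cu|exact: closed_le].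
have clB : closed [set t | 2^-1 <= u t].
  by apply: (@preimage_closed _ _ u [set r | 2^-1 <= r]); [by move=> t _; exact: cu|exact: closed_ge].
apply/continuous_subspace_setT.
rewrite -(_ : [set t | u t <= 2^-1] `|` [set t | 2^-1 <= u t] = setT); last first.
  by apply/seteqP; split=> // t _; have [ut|/ltW ut] := leP (u t) 2^-1; [left|right].
apply: withinU_continuous => //.
- apply: (@subspace_eq_continuous _ _ _ F (fun t => if u t <= 2^-1 then F t else G t)); last exact: continuous_subspaceT.
  by move=> t; rewrite inE /= => ->.
- apply: (@subspace_eq_continuous _ _ _ G (fun t => if u t <= 2^-1 then F t else G t)); last exact: continuous_subspaceT.
  move=> t; rewrite inE /= => ut; case: ifP => // ut'.
  by apply/esym/FG/eqP; rewrite eq_le ut ut'.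
Qed.


Lemma clamp_comp (T : topologicalType) (g : T -> R) (p : I -> M) :
  continuous g -> continuous p -> continuous (fun t => p (clamp (g t))).
Proof.
move=> cg cp t; apply: (@continuous_comp _ _ _ (fun t => clamp (g t)) p); last exact: cp.
by apply: (@continuous_comp _ _ _ g (@clamp R)); [exact: cg|exact: clamp_continuous].
Qed.

Let pair_comp (T : topologicalType) (f : T -> I) (g : T -> R) (H : I * I -> M) :
  continuous f -> continuous g -> continuous H ->
  continuous (fun z => H (f z, clamp (g z))).
Proof.
move=> cf cg cH z.
apply: (@continuous_comp _ _ _ (fun z => (f z, clamp (g z))) H); last exact: cH.
have cgz : {for z, continuous (fun z => clamp (g z))}.
  by apply: (@continuous_comp _ _ _ g (@clamp R)); [exact: cg|exact: clamp_continuous].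
exact: (cvg_pair (cf z) cgz).
Qed.

Let pair_comp' (T : topologicalType) (f : T -> I) (g : T -> R) (H : I * I -> M) :
  continuous g -> continuous f -> continuous H ->
  continuous (fun z => H (clamp (g z), f z)).
Proof.
move=> cg cf cH z.
apply: (@continuous_comp _ _ _ (fun z => (clamp (g z), f z)) H); last exact: cH.
have cgz : {for z, continuous (fun z => clamp (g z))}.
  by apply: (@continuous_comp _ _ _ g (@clamp R)); [exact: cg|exact: clamp_continuous].
exact: (cvg_pair cgz (cf z)).
Qed.

Let cstC (T : topologicalType) (c : R) : continuous (fun _ : T => c).
Proof. exact: cst_continuous. Qed.

Let addC (T : topologicalType) (f g : T -> R) :
  continuous f -> continuous g -> continuous (fun t => f t + g t).
Proof. by move=> cf cg t; exact: (cvgD (cf t) (cg t)). Qed.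

Let subC (T : topologicalType) (f g : T -> R) :
  continuous f -> continuous g -> continuous (fun t => f t - g t).
Proof. by move=> cf cg t; exact: (cvgB (cf t) (cg t)). Qed.

Let mulC (T : topologicalType) (f g : T -> R) :
  continuous f -> continuous g -> continuous (fun t => f t * g t).
Proof. by move=> cf cg t; exact: (cvgM (cf t) (cg t)). Qed.

Let fstC (T : topologicalType) (f : I -> T) :
  continuous f -> continuous (fun z : I * I => f z.1).
Proof.
move=> cf z; apply: (@continuous_comp _ _ _ fst f); last exact: cf.
exact: cvg_fst.
Qed.

Let sndC (T : topologicalType) (f : I -> T) :
  continuous f -> continuous (fun z : I * I => f z.2).
Proof.
move=> cf z; apply: (@continuous_comp _ _ _ snd f); last exact: cf.
exact: cvg_snd.
Qed.

Let idC (T : topologicalType) : continuous (fun t : T => t).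
Proof. by move=> t; exact: cvg_id. Qed.

Let cuval : continuous (@uval R). Proof. exact: uval_continuous. Qed.

Local Ltac solveC := repeat lazymatch goal with
  | |- continuous (fun _ => (_ + - _)%R) => apply: subC
  | |- continuous (fun _ => (_ + _)%R) => apply: addC
  | |- continuous (fun _ => (_ * _)%R) => apply: mulC
  | |- continuous (fun t => uval (fst t)) => exact: (fstC cuval)
  | |- continuous (fun t => uval (snd t)) => exact: (sndC cuval)
  | |- continuous (fun t => fst t) => exact: (fstC (@idC _))
  | |- continuous (fun t => snd t) => exact: (sndC (@idC _))
  | |- continuous fst => exact: (fstC (@idC _))
  | |- continuous snd => exact: (sndC (@idC _))
  | |- continuous (@uval _) => exact: cuval
  | |- continuous (fun t => uval t) => exact: cuval
  | |- continuous (fun _ => _) => exact: cstC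
  end.

Definition concat_fun (p q : loop) (t : I) : M :=
  if uval t <= 2^-1 then p (clamp (2 * uval t)) else q (clamp (2 * uval t - 1)).

Let concat_continuous p q : continuous (concat_fun p q).
Proof.
apply: (@pasting _ (@uval R)
  (fun t => p (clamp (2 * uval t))) (fun t => q (clamp (2 * uval t - 1)))).
- exact: uval_continuous.
- by apply: clamp_comp; [solveC|exact: cts_fun].
- by apply: clamp_comp; [solveC|exact: cts_fun].
- move=> t ->; rewrite mulfV ?pnatr_eq0// subrr.
  by rewrite -/one -/zero path_one path_zero.
Qed.

Let concat_zero p q : concat_fun p q zero = x.
Proof. by rewrite /concat_fun uval_zero invr_ge0 ler0n mulr0 path_zero. Qed.

Let concat_one p q : concat_fun p q one = x.
Proof.
rewrite /concat_fun uval_one ifF; last by apply/negbTE; rewrite -ltNge; lra.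
by rewrite (_ : 2 * 1 - 1 = 1 :> R) ?path_one//; ring.
Qed.

Definition concat (p q : loop) : loop :=
  mk_path (@concat_continuous p q) (concat_zero p q) (concat_one p q).

Lemma concatE (p q : loop) t : concat p q t =
  if uval t <= 2^-1 then p (clamp (2 * uval t)) else q (clamp (2 * uval t - 1)).
Proof. by []. Qed.

Definition reverse_fun (p : loop) (t : I) : M := p (clamp (1 - uval t)).

Let reverse_continuous p : continuous (reverse_fun p).
Proof.
apply: clamp_comp; last exact: cts_fun.
by solveC.
Qed.

Let reverse_zero p : reverse_fun p zero = x.
Proof. by rewrite /reverse_fun uval_zero subr0 path_one. Qed.

Let reverse_one p : reverse_fun p one = x.
Proof. by rewrite /reverse_fun uval_one subrr path_zero. Qed.

Definition reverse (p : loop) : loop :=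
  mk_path (@reverse_continuous p) (reverse_zero p) (reverse_one p).

Lemma reverseE (p : loop) t : reverse p t = p (clamp (1 - uval t)).
Proof. by []. Qed.

Definition const_loop : loop := cst x.

Let homotopic_reparam (p q q' : loop) (phi psi : I -> R) :
  continuous phi -> continuous psi ->
  phi zero = psi zero -> phi one = psi one ->
  (forall t, q t = p (clamp (phi t))) -> (forall t, q' t = p (clamp (psi t))) ->
  loop_homotopic q q'.
Proof.
move=> cphi cpsi E0 E1 qE q'E.
exists (fun z => p (clamp ((1 - uval z.2) * phi z.1 + uval z.2 * psi z.1))).
split.
- apply: clamp_comp; last exact: cts_fun.
  by apply: addC; apply: mulC; solveC; exact: fstC.
- by move=> t; rewrite /= uval_zero subr0 mul1r mul0r addr0 qE.
- by move=> t; rewrite /= uval_one subrr mul1r mul0r add0r q'E.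
- move=> s /=; rewrite -E0 -E1 -!mulrDl subrK !mul1r -!qE.
  by rewrite path_zero path_one.
Qed.

Let homotopic_ext (p q : loop) : p =1 q -> loop_homotopic p q.
Proof.
move=> pq; apply: (@homotopic_reparam p p q (@uval R) (@uval R)) => // t.
  by rewrite uvalK.
by rewrite uvalK pq.
Qed.

Let homotopic_refl p : loop_homotopic p p.
Proof. exact: homotopic_ext. Qed.

Let homotopic_sym p q : loop_homotopic p q -> loop_homotopic q p.
Proof.
move=> [H [cH H0 H1 Hx]].
exists (fun z => H (z.1, clamp (1 - uval z.2))); split.
- by apply: pair_comp => //; solveC.
- by move=> t /=; rewrite uval_zero subr0 H1.
- by move=> t /=; rewrite uval_one subrr H0.
- by move=> s; exact: Hx.
Qed.

Let homotopic_trans q p r :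
  loop_homotopic p q -> loop_homotopic q r -> loop_homotopic p r.
Proof.
move=> [H [cH H0 H1 Hx]] [K [cK K0 K1 Kx]].
exists (fun z => if uval z.2 <= 2^-1 then H (z.1, clamp (2 * uval z.2))
  else K (z.1, clamp (2 * uval z.2 - 1))).
split.
- apply: (@pasting _ (fun z : I * I => uval z.2)
    (fun z => H (z.1, clamp (2 * uval z.2)))
    (fun z => K (z.1, clamp (2 * uval z.2 - 1)))).
  + by solveC.
  + by apply: pair_comp => //; solveC.
  + by apply: pair_comp => //; solveC.
  + move=> z ->; rewrite mulfV ?pnatr_eq0// subrr.
    by rewrite -/one -/zero H1 K0.
- by move=> t /=; rewrite uval_zero invr_ge0 ler0n mulr0 H0.
- move=> t /=; rewrite uval_one ifF; last by apply/negbTE; rewrite -ltNge; lra.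
  by rewrite (_ : 2 * 1 - 1 = 1 :> R) ?K1//; ring.
- by move=> s /=; case: ifP => _; [exact: Hx|exact: Kx].
Qed.

Let homotopic_concat p p' q q' : loop_homotopic p p' -> loop_homotopic q q' ->
  loop_homotopic (concat p q) (concat p' q').
Proof.
move=> [H [cH H0 H1 Hx]] [K [cK K0 K1 Kx]].
exists (fun z => if uval z.1 <= 2^-1 then H (clamp (2 * uval z.1), z.2)
  else K (clamp (2 * uval z.1 - 1), z.2)).
split.
- apply: (@pasting _ (fun z : I * I => uval z.1)
    (fun z => H (clamp (2 * uval z.1), z.2))
    (fun z => K (clamp (2 * uval z.1 - 1), z.2))).
  + by solveC.
  + by apply: pair_comp' => //; solveC.
  + by apply: pair_comp' => //; solveC.
  + move=> z ->; rewrite mulfV ?pnatr_eq0// subrr.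
    by rewrite -/one -/zero (Hx z.2).2 (Kx z.2).1.
- by move=> t /=; rewrite /concat/= /mk_path /= /concat_fun H0 K0.
- by move=> t /=; rewrite /concat/= /mk_path /= /concat_fun H1 K1.
- move=> s /=; rewrite uval_zero uval_one invr_ge0 ler0n mulr0.
  rewrite ifF; last by apply/negbTE; rewrite -ltNge; lra.
  by rewrite (_ : 2 * 1 - 1 = 1 :> R) ?(Hx s).1 ?(Kx s).2//; ring.
Qed.

Let homotopic_reverse p q :
  loop_homotopic p q -> loop_homotopic (reverse p) (reverse q).
Proof.
move=> [H [cH H0 H1 Hx]].
exists (fun z => H (clamp (1 - uval z.1), z.2)); split.
- by apply: pair_comp' => //; solveC.
- by move=> t /=; rewrite H0.
- by move=> t /=; rewrite H1.
- by move=> s /=; rewrite uval_zero uval_one subr0 subrr (Hx s).1 (Hx s).2.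
Qed.

Let loop_rel (p q : loop) : bool := `[< loop_homotopic p q >].

Let loop_rel_refl : reflexive loop_rel.
Proof. by move=> p; apply/asboolP; exact: homotopic_refl. Qed.

Let loop_rel_sym : symmetric loop_rel.
Proof. by move=> p q; apply/asboolP/asboolP => /homotopic_sym. Qed.

Let loop_rel_trans : transitive loop_rel.
Proof.
by move=> q p r /asboolP pq /asboolP qr; apply/asboolP; exact: homotopic_trans pq qr.
Qed.

Definition loop_equiv :=
  EquivRel loop_rel loop_rel_refl loop_rel_sym loop_rel_trans.

Definition pi1 := {eq_quot loop_equiv}.

HB.instance Definition _ := Choice.on pi1.
HB.instance Definition _ := Quotient.on pi1.

Let pi1P p q : reflect (\pi_pi1 p = \pi_pi1 q) (loop_rel p q).
Proof. exact: eqmodP. Qed.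

Definition pi1_one : pi1 := \pi_pi1 const_loop.

Definition pi1_mul (g h : pi1) : pi1 := \pi_pi1 (concat (repr g) (repr h)).

Definition pi1_inv (g : pi1) : pi1 := \pi_pi1 (reverse (repr g)).

Let repr_pi p : loop_homotopic (repr (\pi_pi1 p)) p.
Proof. by apply/asboolP/pi1P; rewrite reprK. Qed.

Let pi1_mulE p q : pi1_mul (\pi_pi1 p) (\pi_pi1 q) = \pi_pi1 (concat p q).
Proof. by apply/pi1P/asboolP/homotopic_concat; exact: repr_pi. Qed.

Let pi1_invE p : pi1_inv (\pi_pi1 p) = \pi_pi1 (reverse p).
Proof. exact/pi1P/asboolP/homotopic_reverse/repr_pi. Qed.

Let maxC (T : topologicalType) (f g : T -> R) :
  continuous f -> continuous g -> continuous (fun t => Num.max (f t) (g t)).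
Proof. by move=> cf cg t; exact: (@continuous_max _ _ f g t (cf t) (cg t)). Qed.

Let minC (T : topologicalType) (f g : T -> R) :
  continuous f -> continuous g -> continuous (fun t => Num.min (f t) (g t)).
Proof. by move=> cf cg t; exact: (@continuous_min _ _ f g t (cf t) (cg t)). Qed.

Let max_cases (a b : R) :
  (a <= b /\ Num.max a b = b) \/ (b <= a /\ Num.max a b = a).
Proof. by case: leP => ?; [left|right]; split => //; lra. Qed.

Let min_cases (a b : R) :
  (a <= b /\ Num.min a b = a) \/ (b <= a /\ Num.min a b = b).
Proof. by case: leP => ?; [left|right]; split => //; lra. Qed.

Local Ltac minmax := repeat match goal with
  | |- context [Num.max ?a ?b] =>
    lazymatch b with
    | context [Num.max _ _] => fail
    | _ => case: (max_cases a b) => -[? ->]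
    end
  | |- context [Num.min ?a ?b] => case: (min_cases a b) => -[? ->]
  end; lra.

Let concatA p q r :
  loop_homotopic (concat p (concat q r)) (concat (concat p q) r).
Proof.
apply: (@homotopic_reparam (concat (concat p q) r) _ _
  (fun t => Num.max (2^-1 * uval t) (Num.max (uval t - 4^-1) (2 * uval t - 1)))
  (@uval R)).
- by apply: maxC; [solveC|apply: maxC; solveC].
- exact: cuval.
- by rewrite uval_zero; minmax.
- by rewrite uval_one; minmax.
- move=> t; have /andP[t0 t1] := uval_itv t.
  set m := Num.max _ _.
  have m01 : 0 <= m <= 1.
    by rewrite /m; minmax.
  rewrite (concatE p (concat q r)) (concatE (concat p q) r) (clampK m01) (concatE q r).
  case: (leP (uval t) 2^-1) => ht.
    have mE : m = 2^-1 * uval t by rewrite /m; minmax.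
    have -> : (m <= 2^-1) = true by apply/idP; lra.
    rewrite (concatE p q) clampK; last by apply/andP; split; lra.
    have -> : (2 * m <= 2^-1) = true by apply/idP; lra.
    by congr (p (clamp _)); lra.
  rewrite clampK; last by apply/andP; split; lra.
  case: (leP (2 * uval t - 1) 2^-1) => ht'.
    have mE : m = uval t - 4^-1 by rewrite /m; minmax.
    have -> : (m <= 2^-1) = true by apply/idP; lra.
    rewrite (concatE p q) clampK; last by apply/andP; split; lra.
    have -> : (2 * m <= 2^-1) = false by apply/negbTE; rewrite -ltNge; lra.
    by congr (q (clamp _)); lra.
  have mE : m = 2 * uval t - 1 by rewrite /m; minmax.
  have -> : (m <= 2^-1) = false by apply/negbTE; rewrite -ltNge; lra.
  by congr (r (clamp _)); lra.
- by move=> t; rewrite uvalK.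
Qed.

Let concat1l p : loop_homotopic (concat const_loop p) p.
Proof.
apply: (@homotopic_reparam p _ _ (fun t => Num.max 0 (2 * uval t - 1)) (@uval R)).
- by apply: maxC; solveC.
- exact: cuval.
- by rewrite uval_zero; minmax.
- by rewrite uval_one; minmax.
- move=> t; have /andP[t0 t1] := uval_itv t.
  rewrite concatE; case: (leP (uval t) 2^-1) => ht.
    by rewrite max_l ?path_zero//; lra.
  by rewrite max_r//; lra.
- by move=> t; rewrite uvalK.
Qed.

Let concat1r p : loop_homotopic (concat p const_loop) p.
Proof.
apply: (@homotopic_reparam p _ _ (fun t => Num.min (2 * uval t) 1) (@uval R)).
- by apply: minC; solveC.
- exact: cuval.
- by rewrite uval_zero; minmax.
- by rewrite uval_one; minmax.
- move=> t; have /andP[t0 t1] := uval_itv t.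
  rewrite concatE; case: (leP (uval t) 2^-1) => ht.
    by rewrite min_l//; lra.
  by rewrite min_r ?path_one//; lra.
- by move=> t; rewrite uvalK.
Qed.

Let concatV p : loop_homotopic (concat p (reverse p)) const_loop.
Proof.
apply: (@homotopic_reparam p _ _
  (fun t => Num.min (2 * uval t) (2 - 2 * uval t)) (fun=> 0)).
- by apply: minC; solveC.
- exact: cstC.
- by rewrite uval_zero; minmax.
- by rewrite uval_one; minmax.
- move=> t; have /andP[t0 t1] := uval_itv t.
  rewrite concatE; case: (leP (uval t) 2^-1) => ht.
    by rewrite min_l//; lra.
  rewrite reverseE clampK; last by apply/andP; split; lra.
  by rewrite min_r; [congr (p (clamp _)); lra|lra].
- by move=> t; rewrite path_zero.
Qed.

Let reverseK p : loop_homotopic (reverse (reverse p)) p.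
Proof.
apply: homotopic_ext => t; have /andP[t0 t1] := uval_itv t.
rewrite !reverseE clampK; last by apply/andP; split; lra.
by rewrite (_ : 1 - (1 - uval t) = uval t) ?uvalK//; ring.
Qed.

Let pi1_mulA : associative pi1_mul.
Proof.
elim/quotW=> p; elim/quotW=> q; elim/quotW=> r.
rewrite (pi1_mulE q r) (pi1_mulE p q) !pi1_mulE.
exact/pi1P/asboolP/concatA.
Qed.

Let pi1_mul1 : left_id pi1_one pi1_mul.
Proof. by elim/quotW=> p; rewrite pi1_mulE; exact/pi1P/asboolP/concat1l. Qed.

Let pi1_mulr1 : right_id pi1_one pi1_mul.
Proof. by elim/quotW=> p; rewrite pi1_mulE; exact/pi1P/asboolP/concat1r. Qed.

Let pi1_mulrV : right_inverse pi1_one pi1_inv pi1_mul.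
Proof.
by elim/quotW=> p; rewrite pi1_invE pi1_mulE; exact/pi1P/asboolP/concatV.
Qed.

Let pi1_mulV : left_inverse pi1_one pi1_inv pi1_mul.
Proof.
elim/quotW=> p; rewrite pi1_invE pi1_mulE; apply/pi1P/asboolP.
apply: homotopic_trans (concatV (reverse p)).
by apply: homotopic_concat; [exact: homotopic_refl|exact/homotopic_sym/reverseK].
Qed.

HB.instance Definition _ := isGroup.Build pi1
  pi1_mulA pi1_mul1 pi1_mulr1 pi1_mulV pi1_mulrV.

End FundamentalGroup.

Arguments pi1 R {M} x.

Section Smooth.
Variables (R : realType) (V W : normedModType R).

(* U is meant to be open and V finite-dimensional; f is total, but only its
   values on U matter. *)
Fixpoint Ck (k : nat) (U : set V) (f : V -> W) : Prop :=
  if k is k'.+1 then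
    (forall x, U x -> differentiable f x) /\
    (forall v, Ck k' U (fun x => 'D_v f x))
  else forall x, U x -> {for x, continuous f}.

Definition smooth_on (U : set V) (f : V -> W) : Prop := forall k, Ck k U f.

Lemma smooth_on_differentiable U f x : smooth_on U f -> U x -> differentiable f x.
Proof. by move=> /(_ 1%N)[df _] /df. Qed.

Lemma smooth_on_cst U (c : W) : smooth_on U (cst c).
Proof.
move=> k; elim: k c => [|k ih] c /=; first by move=> x _; exact: cvg_cst.
split=> [x _|v]; first exact: differentiable_cst.
rewrite (_ : (fun x => _) = cst 0) //; apply/funext => x; exact: derive_cst.
Qed.

End Smooth.

Lemma smooth_on_id (R : realType) (V : normedModType R) (U : set V) :
  smooth_on U (fun x : V => x).
Proof.
case=> [|k] /=; first by move=> x _; exact: cvg_id.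
split=> [x _|v]; first exact: ex_diff.
rewrite (_ : (fun x => _) = cst v); first exact: smooth_on_cst.
by apply/funext => x; exact: derive_id.
Qed.

Lemma diff_chain (R : realType) (V W X : normedModType R) (g : V -> W) (h : W -> X) (k : V -> X)
    x y v :
  g x = y -> differentiable g x -> differentiable h y -> differentiable k x ->
  (\forall z \near x, k z = h (g z)) -> 'd k x v = 'd h y ('d g x v).
Proof.
move=> <- dg dh dk khg.
have -> : 'd h (g x) ('d g x v) = 'd (h \o g) x v.
  exact: (esym (congr1 (fun F : V -> X => F v) (diff_comp dg dh))).
have dc : differentiable (h \o g) x by exact: differentiable_comp.
by rewrite -(deriveE v dk) -(deriveE v dc); exact: near_eq_derive.
Qed.

(* cmap and cinv are total functions; only their values on cdom, resp. on
   cmap @` cdom, are meaningful. *)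
Record chart (R : realType) (m : nat) (T : topologicalType) := Chart {
  cdom : set T;
  cmap : T -> 'rV[R]_m;
  cinv : 'rV[R]_m -> T;
  cdom_open : open cdom;
  cimg_open : open (cmap @` cdom);
  cmap_continuous : forall p, cdom p -> {for p, continuous cmap};
  cinv_continuous : forall y, (cmap @` cdom) y -> {for y, continuous cinv};
  cmapK : forall p, cdom p -> cinv (cmap p) = p }.

Record manifold (R : realType) (m : nat) := Manifold {
  carrier :> topologicalType;
  manifold_hausdorff : hausdorff_space carrier;
  manifold_second_countable : @second_countable carrier;
  atlas : set (chart R m carrier);
  atlas_cover : forall p, exists2 a, atlas a & cdom a p;
  atlas_smooth : forall a b, atlas a -> atlas b ->
    smooth_on (cmap a @` (cdom a `&` cdom b)) (cmap b \o cinv a) }.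

Arguments atlas {R m} M a : rename.

Section Tangent.
Variables (R : realType) (m : nat) (M : manifold R m).

Definition chart_at (p : M) : Type :=
  set_type [set a : chart R m M | atlas M a /\ cdom a p].

Definition chart_of (p : M) (a : chart_at p) : chart R m M := set_val a.
Coercion chart_of : chart_at >-> chart.

Lemma chart_atlas (p : M) (a : chart_at p) : atlas M a.
Proof. by have [] := set_valP a. Qed.

Lemma chart_dom (p : M) (a : chart_at p) : cdom a p.
Proof. by have [] := set_valP a. Qed.

(* A tangent vector at p is a family of coordinate vectors, one for each chart
   around p, related by the differentials of the transition maps. *)
Definition is_tangent (p : M) : {pred (chart_at p -> 'rV[R]_m)} :=
  fun v => `[< forall a b : chart_at p,
    v b = 'd (cmap b \o cinv a) (cmap a p) (v a) >].

Record tangent (p : M) := Tangent {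
  coords :> chart_at p -> 'rV[R]_m;
  coordsP : is_tangent coords }.

HB.instance Definition _ p := [isSub for @coords p].
HB.instance Definition _ p := [Choice of tangent p by <:].

Lemma is_tangent_closed p : GRing.submod_closed (@is_tangent p).
Proof.
split=> [|c u v /asboolP uP /asboolP vP]; apply/asboolP => a b.
  by rewrite /= linear0.
by rewrite -![(c *: u + v) _]/(c *: u _ + v _) linearP -uP -vP.
Qed.

HB.instance Definition _ p :=
  GRing.isSubmodClosed.Build _ _ (@is_tangent p) (is_tangent_closed p).
HB.instance Definition _ p := [SubChoice_isSubLmodule of tangent p by <:].

Lemma chart_at_nonempty (p : M) : exists a : chart_at p, True.
Proof.
have [a aM ap] := atlas_cover p.
by exists (exist _ a (mem_set (conj aM ap))).
Qed.

Definition some_chart (p : M) : chart_at p := projT1 (cid (chart_at_nonempty p)).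

Lemma transition_diff (p : M) (a a' : chart_at p) :
  differentiable (cmap a' \o cinv a) (cmap a p).
Proof.
have := atlas_smooth (chart_atlas a) (chart_atlas a').
move=> /smooth_on_differentiable; apply; exists p => //.
by split; exact: chart_dom.
Qed.

Lemma cinv_chart_cvg (p : M) (a : chart_at p) : cinv a @ cmap a p --> p.
Proof.
have ap := chart_dom a.
have h : {for cmap a p, continuous (cinv a)}.
  by apply: cinv_continuous; exists p.
by move: h; rewrite /prop_for /continuous_at (cmapK ap).
Qed.

Lemma near_dom (p : M) (a a' : chart_at p) :
  \forall y \near cmap a p, cdom a' (cinv a y).
Proof.
have ap := chart_dom a.
have h := cinv_chart_cvg a; apply: (h (cdom a')).
apply: open_nbhs_nbhs.
by split; [exact: cdom_open|exact: chart_dom].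
Qed.

Lemma coords_bij (p : M) (a : chart_at p) : bijective (fun v : tangent p => v a).
Proof.
have tP (w : 'rV[R]_m) : is_tangent
    (fun b : chart_at p => 'd (cmap b \o cinv a) (cmap a p) w).
  apply/asboolP => b c; apply: diff_chain.
  - by rewrite /= (cmapK (chart_dom a)).
  - exact: transition_diff.
  - exact: transition_diff.
  - exact: transition_diff.
  - by near=> y; rewrite /= cmapK//; near: y; exact: near_dom.
exists (fun w => Tangent (tP w)) => [v|w].
  have /asboolP vE := coordsP v.
  by apply: val_inj; apply/funext => b /=; rewrite -vE.
have e : \forall z \near cmap a p, (cmap a \o cinv a) z = id z.
  have : (cmap a @` cdom a) (cmap a p) by exists p => //; exact: chart_dom.
  move=> /(conj (@cimg_open _ _ _ a)) /open_nbhs_nbhs.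
  by apply: filterS => _ [q aq <-] /=; rewrite cmapK.
rewrite /= -(deriveE w (transition_diff a a)) (near_eq_derive _ e).
exact: derive_id.
Unshelve. all: by end_near. Qed.

End Tangent.

Section Maps.
Variables (R : realType) (m n : nat) (M : manifold R m) (N : manifold R n).

Definition smooth_map (f : M -> N) : Prop :=
  continuous f /\
  forall a b, atlas M a -> atlas N b ->
    smooth_on (cmap a @` (cdom a `&` f @^-1` cdom b)) (cmap b \o f \o cinv a).

Record smoothMap := SmoothMap {
  smooth_fun :> M -> N;
  smooth_funP : smooth_map smooth_fun }.

Variable f : smoothMap.

Let rep (p : M) (a : chart_at p) (b : chart_at (f p)) :=
  cmap b \o f \o cinv a.

Let rep_diff p (a : chart_at p) (b : chart_at (f p)) :
  differentiable (rep a b) (cmap a p).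
Proof.
have [_ /(_ a b (chart_atlas a) (chart_atlas b))] := smooth_funP f.
move=> /smooth_on_differentiable; apply; exists p => //.
by split; exact: chart_dom.
Qed.

Let near_domf p (a : chart_at p) (b : chart_at (f p)) :
  \forall y \near cmap a p, cdom b (f (cinv a y)).
Proof.
have ap := chart_dom a; have [cf _] := smooth_funP f.
have h := cinv_chart_cvg a.
have : nbhs p (f @^-1` cdom b).
  by apply: cf; apply: open_nbhs_nbhs; split; [exact: cdom_open|exact: chart_dom].
exact: h.
Qed.

Let rep_changel p (a a' : chart_at p) (b : chart_at (f p)) (v : 'rV_m) :
  'd (rep a b) (cmap a p) v =
  'd (rep a' b) (cmap a' p) ('d (cmap a' \o cinv a) (cmap a p) v).
Proof.
apply: diff_chain.
- by rewrite /= (cmapK (chart_dom a)).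
- exact: transition_diff.
- exact: rep_diff.
- exact: rep_diff.
- by near=> y; rewrite /rep /= cmapK//; near: y; exact: near_dom.
Unshelve. all: by end_near. Qed.

Let rep_changer p (a : chart_at p) (b b' : chart_at (f p)) (v : 'rV_m) :
  'd (rep a b') (cmap a p) v =
  'd (cmap b' \o cinv b) (cmap b (f p)) ('d (rep a b) (cmap a p) v).
Proof.
apply: diff_chain.
- by rewrite /rep /= (cmapK (chart_dom a)).
- exact: rep_diff.
- exact: transition_diff.
- exact: rep_diff.
- by near=> y; rewrite /rep /= (cmapK (p := f _))//; near: y; exact: near_domf.
Unshelve. all: by end_near. Qed.

Definition tangent_map_coords (p : M) (v : tangent p) (b : chart_at (f p)) :
    'rV[R]_n :=
  let a := some_chart p in
  'd (cmap b \o f \o cinv a) (cmap a p) (v a).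

Let tangent_map_subproof p (v : tangent p) : is_tangent (tangent_map_coords v).
Proof. by apply/asboolP => b b'; exact: rep_changer. Qed.

Definition tangent_map (p : M) (v : tangent p) : tangent (f p) :=
  Tangent (tangent_map_subproof v).

Lemma tangent_mapE p (v : tangent p) (a : chart_at p) (b : chart_at (f p)) :
  tangent_map v b = 'd (cmap b \o f \o cinv a) (cmap a p) (v a).
Proof.
have /asboolP vE := coordsP v.
have h := rep_changel (some_chart p) a b (v (some_chart p)).
by rewrite -vE in h.
Qed.

End Maps.

Record almost_complex (R : realType) (m : nat) (M : manifold R m) :=
    AlmostComplex {
  acs :> forall p : M, {linear tangent p -> tangent p};
  acs_sq : forall p (v : tangent p), acs p (acs p v) = - v;
  acs_smooth : forall a, atlas M a -> exists A : 'rV[R]_m -> 'M[R]_m,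
    smooth_on (cmap a @` cdom a) A /\
    forall (p : M) (c : chart_at p) (v : tangent p), chart_of c = a ->
      acs p v c = v c *m A (cmap a p) }.

Section Embedding.
Variables (R : realType) (m n : nat) (M : manifold R m) (N : manifold R n).

Definition smooth_embedding (f : smoothMap M N) : Prop :=
  [/\ injective f,
      forall U : set M, open U -> exists2 V : set N, open V & U = f @^-1` V &
      forall p : M, injective (@tangent_map _ _ _ M N f p)].

Definition pseudo_holomorphic (JM : almost_complex M) (JN : almost_complex N)
    (f : smoothMap M N) : Prop :=
  forall (p : M) (v : tangent p),
    tangent_map f (JM p v) = JN (f p) (tangent_map f v).

Definition pseudo_holomorphic_embedding (JM : almost_complex M)
    (JN : almost_complex N) (f : smoothMap M N) : Prop :=
  smooth_embedding f /\ pseudo_holomorphic JM JN f.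

End Embedding.

Section Euclidean.
Variables (R : realType) (m : nat).
Local Notation E := 'rV[R]_m.

Let id_img_open : open ((fun y : E => y) @` [set: E]).
Proof. by rewrite image_id; exact: openT. Qed.

Definition id_chart : chart R m E :=
  @Chart R m E setT (fun y => y) (fun y => y) openT id_img_open
    (fun p _ => cvg_id) (fun p _ => cvg_id) (fun p _ => erefl).

Let E_hausdorff : hausdorff_space E.
Proof. exact: norm_hausdorff. Qed.

Let E_second_countable : @second_countable E.
Proof.
pose B (z : 'rV[rat]_m * nat) : set E :=
  (ball (map_mx ratr z.1 : E) (z.2.+1%:R^-1 : R))°.
exists (range B); first exact: (sub_countable (card_image_le _ _) (countableP _)).
split=> [_ [z _ <-]|x V]; first exact: open_interior.
move=> /nbhs_ballP[_/posnumP[e] xeV].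
have [//|N] := @ltr_add_invr R 0 (e%:num / 2) _; rewrite add0r => Ne.
have N0 : 0 < N.+1%:R^-1 :> R by rewrite invr_gt0.
have qx i : exists q : rat, `|x ord0 i - ratr q| < N.+1%:R^-1.
  have [|q] := @rat_in_itvoo R (x ord0 i - N.+1%:R^-1) (x ord0 i + N.+1%:R^-1).
    by rewrite ltrD2l gtrN.
  rewrite in_itv /= => /andP[q1 q2]; exists q.
  by rewrite distrC ltr_distl q1.
pose q : 'rV[rat]_m := \row_i projT1 (cid (qx i)).
have xq : ball (map_mx ratr q : E) (N.+1%:R^-1 : R) x.
  split=> // i j; rewrite !mxE (ord1 i) /ball /= distrC.
  exact: (projT2 (cid (qx j))).
exists (B (q, N)) => /=.
  split; first by exists (q, N).
  rewrite /B /=; apply: open_nbhs_nbhs; split => //; exact: ball_open.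
move=> y /interior_subset qy; apply: xeV.
rewrite [e%:num]splitr; apply: (@ball_triangle _ _ (map_mx ratr q : E)).
  by apply: (le_ball (ltW Ne)); exact: ball_sym.
exact: (le_ball (ltW Ne)).
Qed.

Definition euclidean : manifold R m.
refine (@Manifold R m E E_hausdorff E_second_countable [set id_chart] _ _).
- by move=> p; exists id_chart.
- by move=> _ _ -> ->; exact: smooth_on_id.
Defined.

End Euclidean.

(* Manifolds are modelled on open subsets of R^m, hence have no boundary. *)
Definition closed_manifold (R : realType) (m : nat) (M : manifold R m) : Prop :=
  compact [set: M].

(* Main.v *)
(* M is a regular level set of Phi = (F, S) in R^(2n+2), with coordinates (p, q, z, y) in
   R^2 x R^2 x R^2 x R^(2n-4), where S = (|q|^2 + |z|^2 - c^2) / 2 and F = |y|^2 - f(p, q).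

   The normal bundle of M is spanned by dF and dS.  It is joined, through pairs of independent
   covectors, to a bundle Psi of complex lines for the standard structure of R^(2n+2).  Conjugating
   the standard structure by a product of small rotations along this path gives Jhat, defined
   everywhere, with the tangent spaces of M as Jhat-stable subspaces.

   Rotating y and z to a fixed direction identifies pi_1(M) with pi_1(W), where
   W = {f >= 0, |q| <= c}.  For q away from finitely many points q_j, the slice of W over q is a disc
   with a row of holes, and the loops through the gaps between the holes carry labels: a generator, the
   inverse of one, or nothing.  Near q_j the slice shrinks to a ring that encircles some of the holes,
   and then becomes the disc bounded by this ring, so the class of the ring dies.  The rings used here
   are all those whose class is trivial in the presented group.  Among them, the ring around the holes
   between two gaps with equal labels identifies these gaps; when the letters of a relator alternate
   with unlabelled gaps, the ring around the holes that precede the letters gives the relator.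

   van Kampen's theorem is replaced by functors from paths to a group.  The universal functor, with
   values in pi_1, takes its values up to a cochain in the subgroup generated by the gap loops, and the
   holonomy of an explicit Alexander-Spanier cocycle with values in the presented group gives the
   inverse map. *)
From HB Require Import structures.
Require Import Defs.
From mathcomp Require Import all_boot all_order all_algebra.
From mathcomp Require Import all_classical all_reals all_analysis.
From mathcomp Require Import ring lra zify.
From mathcomp Require Import homotopy generic_quotient.

Set Implicit Arguments.
Unset Strict Implicit.
Unset Printing Implicit Defensive.

Import Order.TTheory GRing.Theory Num.Theory.
Import numFieldNormedType.Exports.

Local Open Scope classical_set_scope.
Local Open Scope ring_scope.

(** * Calculus of C^k functions *)

(** The normal planes can be turned into complex lines because F does not depend on z, nor on q near
    the points of M with z = 0. On these coordinates the path of covectors is (s J0 w, w), where w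
    restricts to dS; it is independent for s > 0, and at s = 0 only the regularity of M is at stake.
    The equation S = 0 ensures that one of the two blocks is nonzero.

    The profile f is shaped by one inequality: [bb >= 0] implies [aa > 0] and [om > 0], that is, a
    ring misses the holes and lies inside the disc that replaces it. Hence each interpolation has a
    nonzero radial derivative at its zeros, and q may move radially within W, away from q_j in the
    outer zone and towards it in the inner one.

    All trivial rings are used, rather than a list of useful ones, so that pi_1 and the presented
    group are compared by a single implication: a product over a set of holes that is trivial in the
    presented group is trivial in pi_1.

    Functors on paths need no base point: conjugations become 0-cochains, and local statements
    extend to long paths by Cousin's lemma. *)

Section DiffLemmas.
Variables (R : realType) (V W : normedModType R).

Lemma eq_near_differentiable (f g : V -> W) x :
  (\forall y \near x, f y = g y) -> differentiable f x -> differentiable g x.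
Proof.
move=> fg df; have [cdf dfo] := (diff_locallyP x f).1 df.
have gfo : g \o shift x = cst (g x) + 'd f x +o_ 0 id.
  apply/eqaddoP => e e0; move/eqaddoP : dfo => /(_ e e0) dfo.
  have fg0 : \forall h \near 0, f (h + x) = g (h + x).
    have : \forall y \near x, f y = g y by [].
    by rewrite (near_shift 0 x) subr0.
  have fgx : f x = g x by exact: nbhs_singleton fg.
  apply: filterS2 dfo fg0 => h; rewrite /= !fctE /= => dh gh.
  by rewrite -gh -fgx.
have e : 'd g x = 'd f x :> (V -> W) by exact: diff_unique.
by apply/diff_locallyP; rewrite e.
Qed.

Lemma eq_near_diff (f g : V -> W) x v :
  (\forall y \near x, f y = g y) -> 'D_v f x = 'D_v g x.
Proof. by move=> fg; exact: near_eq_derive. Qed.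

Lemma diff_eps (f : V -> W) x (L : {linear V -> W}) : continuous L ->
  (forall e, 0 < e -> \forall h \near (0 : V), `|f (h + x) - (f x + L h)| <= e * `|h|) ->
  differentiable f x /\ 'd f x = L :> (V -> W).
Proof.
move=> cL fe.
have fo : f \o shift x = cst (f x) + L +o_ 0 id.
  by apply/eqaddoP => e e0; apply: filterS (fe e e0) => h; rewrite /= !fctE.
have e : 'd f x = L :> (V -> W) by exact: diff_unique.
by split=> //; apply/diff_locallyP; rewrite e.
Qed.

Lemma diff_epsE (f : V -> W) x : differentiable f x ->
  forall e, 0 < e -> \forall h \near (0 : V), `|f (h + x) - (f x + 'd f x h)| <= e * `|h|.
Proof.
move=> /diff_locally /eqaddoP fo e e0; apply: filterS (fo e e0) => h.
by rewrite /= !fctE.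
Qed.

End DiffLemmas.

Section CkCalculus.
Variables (R : realType) (V : normedModType R) (U : set V).
Hypothesis oU : open U.

Lemma nearU x : U x -> \forall y \near x, U y.
Proof. by move=> Ux; exact: open_nbhs_nbhs. Qed.

Lemma eq_Ck (W : normedModType R) k (f g : V -> W) :
  (forall x, U x -> f x = g x) -> Ck k U f -> Ck k U g.
Proof.
have H (F G : V -> W) x : (forall x, U x -> F x = G x) -> U x ->
    \forall y \near x, F y = G y.
  by move=> FG /nearU; apply: filterS => y /FG.
elim: k f g => [|k ih] f g fg /=.
  move=> cf x Ux; have := cf x Ux; rewrite /prop_for /continuous_at -fg// => cfx.
  apply: cvg_trans cfx; apply: near_eq_cvg; exact: H.
move=> [df Df]; split=> [x Ux|v].
  by apply: eq_near_differentiable (df x Ux); exact: H.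
apply: ih (Df v) => x Ux; apply: eq_near_diff; exact: H.
Qed.

Lemma Ck_le (W : normedModType R) k (f : V -> W) : Ck k.+1 U f -> Ck k U f.
Proof.
elim: k f => [|k ih] f; first by move=> [df _] x Ux; exact: differentiable_continuous (df x Ux).
by move=> [df Df]; split => // v; exact: ih (Df v).
Qed.

Lemma Ck_sub (W : normedModType R) k (A : set V) (f : V -> W) :
  A `<=` U -> Ck k U f -> Ck k A f.
Proof.
elim: k f => [|k ih] f AU /=; first by move=> cf x /AU; exact: cf.
by move=> [df Df]; split=> [x /AU|v]; [exact: df|exact: ih].
Qed.

Lemma Ck_add (W : normedModType R) k (f g : V -> W) :
  Ck k U f -> Ck k U g -> Ck k U (fun x => f x + g x).
Proof.
elim: k f g => [|k ih] f g /=; first by move=> cf cg x Ux; exact: cvgD (cf x Ux) (cg x Ux).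
move=> [df Df] [dg Dg]; split=> [x Ux|v].
  exact: differentiableD (df x Ux) (dg x Ux).
apply: eq_Ck (ih _ _ (Df v) (Dg v)) => x Ux.
by rewrite -deriveD//; apply: diff_derivable; first [exact: df|exact: dg].
Qed.

Lemma Ck_cst (W : normedModType R) k (c : W) : Ck k U (fun=> c).
Proof. exact: smooth_on_cst. Qed.

Lemma Ck_sum (W : normedModType R) k (I : Type) (r : seq I) (P : pred I)
    (f : I -> V -> W) :
  (forall i, P i -> Ck k U (f i)) -> Ck k U (fun x => \sum_(i <- r | P i) f i x).
Proof.
move=> fk; elim: r => [|i r ih].
  by apply: eq_Ck (Ck_cst k 0) => x _; rewrite big_nil.
case Pi : (P i).
  by apply: eq_Ck (Ck_add (fk i Pi) ih) => x _; rewrite big_cons Pi.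
by apply: eq_Ck ih => x _; rewrite big_cons Pi.
Qed.

Lemma Ck_mul k (f g : V -> R) :
  Ck k U f -> Ck k U g -> Ck k U (fun x => f x * g x).
Proof.
elim: k f g => [|k ih] f g; first by move=> cf cg x Ux; exact: cvgM (cf x Ux) (cg x Ux).
move=> fk gk; have [df Df] := fk; have [dg Dg] := gk; split=> [x Ux|v].
  exact: differentiableM (df x Ux) (dg x Ux).
apply: (@eq_Ck _ _ (fun x => f x * 'D_v g x + g x * 'D_v f x)) => [x Ux|].
  by rewrite -[RHS]/('D_v (f * g) x) deriveM//; apply: diff_derivable; first [exact: df|exact: dg].
by apply: Ck_add; apply: ih; first [exact: Ck_le fk|exact: Ck_le gk|exact: Df|exact: Dg].
Qed.

Lemma Ck_opp k (f : V -> R) : Ck k U f -> Ck k U (fun x => - f x).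
Proof.
move=> fk; apply: eq_Ck (Ck_mul (Ck_cst k (-1 : R)) fk) => x _.
by rewrite mulN1r.
Qed.

Lemma Ck_prod k (I : Type) (r : seq I) (P : pred I) (f : I -> V -> R) :
  (forall i, P i -> Ck k U (f i)) -> Ck k U (fun x => \prod_(i <- r | P i) f i x).
Proof.
move=> fk; elim: r => [|i r ih].
  by apply: eq_Ck (Ck_cst k (1 : R)) => x _; rewrite big_nil.
case Pi : (P i).
  by apply: eq_Ck (Ck_mul (fk i Pi) ih) => x _; rewrite big_cons Pi.
by apply: eq_Ck ih => x _; rewrite big_cons Pi.
Qed.

Lemma Ck_exp k (f : V -> R) m : Ck k U f -> Ck k U (fun x => f x ^+ m).
Proof.
move=> fk; elim: m => [|m ih]; first by apply: eq_Ck (Ck_cst k (1 : R)) => x _.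
by apply: eq_Ck (Ck_mul fk ih) => x _; rewrite exprS.
Qed.

Lemma Ck_inv k (f : V -> R) : (forall x, U x -> f x != 0) ->
  Ck k U f -> Ck k U (fun x => (f x)^-1).
Proof.
move=> f0; elim: k => [|k ih] fk.
  by move=> x Ux; exact: cvgV (f0 x Ux) (fk x Ux).
have [df Df] := fk; split=> [x Ux|v].
  exact: differentiableV (df x Ux) (f0 x Ux).
have ihk := ih (Ck_le fk).
apply: (@eq_Ck _ _ (fun x => - ((f x)^-1 ^+ 2 * 'D_v f x))) => [x Ux|].
  have := @deriveV R V f x v (f0 x Ux) (diff_derivable (df x Ux)).
  by rewrite -[X in 'D_v X x]/(fun x => (f x)^-1) => ->; rewrite -exprVn scaleNr.
by apply: Ck_opp; apply: Ck_mul; [exact: (Ck_exp 2 ihk)|exact: Df].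
Qed.

Lemma Ck_mxE m n k (f : V -> 'M[R]_(m, n)) :
  (forall i j, Ck k U (fun x => f x i j)) -> Ck k U f.
Proof.
elim: k f => [|k ih] f fk /=.
  move=> x Ux; apply/cvgrPdist_lt => e e0.
  have : \forall y \near x, forall i j, `|f x i j - f y i j| < e / 2.
    apply: filter_forall => i; apply: filter_forall => j.
    by have /cvgrPdist_lt := fk i j x Ux; apply; rewrite divr_gt0.
  apply: filterS => y xy; rewrite /Num.norm /= mx_normrE.
  apply: (@le_lt_trans _ _ (e / 2)); last by rewrite ltr_pdivrMr// ltr_pMr// ltr1n.
  by apply: bigmax_le => [|i _]; [rewrite divr_ge0// ltW|rewrite !mxE ltW].
split=> [x Ux|v].
  have -> : f = \sum_(p < #|{: 'I_m * 'I_n}|)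
      (fun x => f x (enum_val p).1 (enum_val p).2 *:
        delta_mx (enum_val p).1 (enum_val p).2).
    apply/funext => y; rewrite fct_sumE.
    rewrite -(big_enum_val (fun p => f y p.1 p.2 *: delta_mx p.1 p.2)) /=.
    rewrite {1}[f y]matrix_sum_delta pair_big_dep /=.
    by apply: eq_bigl => p; rewrite !inE.
  apply: differentiable_sum => p.
  by apply: differentiableZl; have [+ _] := fk (enum_val p).1 (enum_val p).2; exact.
apply: ih => i j; have [_ /(_ v)] := fk i j; apply: eq_Ck => x Ux.
rewrite derive_mx ?mxE//; apply/derivable_mxP => a b; apply: diff_derivable.
by have [+ _] := fk a b; exact.
Qed.

Lemma Ck_coord m n k (f : V -> 'M[R]_(m, n)) i j :
  Ck k U f -> Ck k U (fun x => f x i j).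
Proof.
elim: k f => [|k ih] f.
  move=> cf x Ux; apply: (@continuous_comp _ _ _ f (fun M : 'M[R]_(m, n) => M i j)).
    exact: cf.
  exact: coord_continuous.
move=> [df Df]; split=> [x Ux|v].
  apply: (@differentiable_comp _ _ _ _ f (fun M : 'M[R]_(m, n) => M i j)).
    exact: df.
  exact: differentiable_coord.
apply: eq_Ck (ih _ (Df v)) => x Ux.
by rewrite derive_mx ?mxE//; apply: diff_derivable; exact: df.
Qed.

Lemma Ck_mulmx m n p k (f : V -> 'M[R]_(m, n)) (g : V -> 'M[R]_(n, p)) :
  Ck k U f -> Ck k U g -> Ck k U (fun x => f x *m g x).
Proof.
move=> fk gk; apply: Ck_mxE => i j.
apply: (@eq_Ck _ _ (fun x => \sum_l f x i l * g x l j)) => [x _|].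
  by rewrite mxE.
by apply: Ck_sum => l _; apply: Ck_mul; exact: Ck_coord.
Qed.

Lemma Ck_tr m n k (f : V -> 'M[R]_(m, n)) : Ck k U f -> Ck k U (fun x => (f x)^T).
Proof.
move=> fk; apply: Ck_mxE => i j.
apply: (@eq_Ck _ _ (fun x => f x j i)) => [x _|]; first by rewrite mxE.
exact: Ck_coord.
Qed.

Lemma Ck_det n k (f : V -> 'M[R]_n) : Ck k U f -> Ck k U (fun x => \det (f x)).
Proof.
move=> fk; apply: Ck_sum => s _; apply: Ck_mul; first exact: Ck_cst.
by apply: Ck_prod => i _; exact: Ck_coord.
Qed.

Lemma Ck_invmx n k (f : V -> 'M[R]_n) : (forall x, U x -> f x \in unitmx) ->
  Ck k U f -> Ck k U (fun x => invmx (f x)).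
Proof.
move=> fu fk; apply: Ck_mxE => i j.
apply: (@eq_Ck _ _ (fun x => (\det (f x))^-1 * cofactor (f x) j i)) => [x Ux|].
  by rewrite /invmx fu// !mxE.
apply: Ck_mul.
  apply: Ck_inv; last exact: Ck_det.
  by move=> x /fu; rewrite unitmxE unitfE.
apply: Ck_mul; first exact: Ck_cst.
apply: Ck_det; apply: Ck_mxE => a b.
by apply: (@eq_Ck _ _ (fun x => f x (lift j a) (lift i b))) => [x _|];
  [rewrite !mxE|exact: Ck_coord].
Qed.

End CkCalculus.

Section CkComp.
Variables (R : realType) (V : normedModType R) (U : set V).
Hypothesis oU : open U.

(** The induction uses the chain rule in coordinates: the derivative of the composition is a sum of
    products of entries of ['D_v f] with the functions ['D_('e_i) g \o f], and the latter are
    covered by the induction hypothesis. *)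
Lemma Ck_comp_rV n k (A : set 'rV[R]_n) (f : V -> 'rV[R]_n) (g : 'rV[R]_n -> R) :
  open A -> (forall x, U x -> A (f x)) ->
  Ck k U f -> Ck k A g -> Ck k U (fun x => g (f x)).
Proof.
move=> oA fA; elim: k f g fA => [|k ih] f g fA.
  by move=> cf cg x Ux; apply: continuous_comp; [exact: cf|exact/cg/fA].
move=> fk gk; have [df Df] := fk; have [dg Dg] := gk.
split=> [x Ux|v]; first exact: differentiable_comp (df x Ux) (dg _ (fA x Ux)).
apply: (@eq_Ck _ _ _ oU _ _ (fun x => \sum_i ('D_v f x) 0 i * 'D_(delta_mx 0 i) g (f x))).
  move=> x Ux; have dfx := df x Ux; have dgx := dg _ (fA x Ux).
  rewrite [RHS]deriveE; last exact: (@differentiable_comp _ _ _ _ f g x dfx dgx).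
  rewrite -[X in 'd X x]/(g \o f) diff_comp//= -(deriveE v dfx).
  rewrite [in RHS](row_sum_delta ('D_v f x)) raddf_sum; apply: eq_bigr => i _.
  rewrite (deriveE _ dgx).
  by have := linearZ_LR ('d g (f x)) (('D_v f x) 0 i) 'e_i => /esym.
apply: Ck_sum => // i _; apply: Ck_mul => //; first by apply: Ck_coord => //; exact: Df.
apply: (ih f (fun y => 'D_('e_i) g y)) => //; [exact: Ck_le fk|exact: Dg].
Qed.

Lemma Ck_comp_mx n a b k (A : set 'rV[R]_n) (f : V -> 'rV[R]_n)
    (g : 'rV[R]_n -> 'M[R]_(a, b)) :
  open A -> (forall x, U x -> A (f x)) ->
  Ck k U f -> Ck k A g -> Ck k U (fun x => g (f x)).
Proof.
move=> oA fA fk gk; apply: Ck_mxE => // i j.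
by apply: (Ck_comp_rV (g := fun y => g y i j) oA fA fk); exact: Ck_coord.
Qed.

Lemma Ck_comp_R k (A : set R) (f : V -> R) (g : R -> R) :
  open A -> (forall x, U x -> A (f x)) ->
  Ck k U f -> Ck k A g -> Ck k U (fun x => g (f x)).
Proof.
move=> oA fA; elim: k f g fA => [|k ih] f g fA.
  by move=> cf cg x Ux; apply: continuous_comp; [exact: cf|exact/cg/fA].
move=> fk gk; have [df Df] := fk; have [dg Dg] := gk.
split=> [x Ux|v]; first exact: differentiable_comp (df x Ux) (dg _ (fA x Ux)).
apply: (@eq_Ck _ _ _ oU _ _ (fun x => 'D_v f x * 'D_1 g (f x))).
  move=> x Ux; have dfx := df x Ux; have dgx := dg _ (fA x Ux).
  rewrite [RHS]deriveE; last exact: (@differentiable_comp _ _ _ _ f g x dfx dgx).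
  rewrite -[X in 'd X x]/(g \o f) diff_comp//= -(deriveE v dfx).
  rewrite -{2}['D_v f x]mulr1 -[X in 'd g _ X]/('D_v f x *: (1 : R)).
  by rewrite linearZ_LR -(deriveE _ dgx).
apply: Ck_mul => //; first exact: Df.
apply: (ih f (fun y => 'D_1 g y)) => //; [exact: Ck_le fk|exact: Dg].
Qed.

End CkComp.

(** * The inverse function theorem *)

HB.instance Definition _ (R : realType) (m n : nat) :=
  Uniform_isComplete.Build 'M[R]_(m, n) (@mx_complete R m n).

Section MxNorm.
Variable R : realType.

Lemma mx_entry_le m n (M : 'M[R]_(m, n)) i j : `|M i j| <= `|M|.
Proof.
rewrite [leRHS]/Num.norm /= mx_normrE.
exact: (le_bigmax _ (fun p => `|M p.1 p.2|) (i, j)).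
Qed.

Lemma mx_norm_le m n (M : 'M[R]_(m, n)) c :
  0 <= c -> (forall i j, `|M i j| <= c) -> `|M| <= c.
Proof.
move=> c0 Mc; rewrite /Num.norm /= mx_normrE.
by apply: bigmax_le => // i _; exact: Mc.
Qed.

Lemma sub_continuous (T : topologicalType) (W : normedModType R) (f : T -> W) c :
  continuous f -> continuous (fun x => f x - c).
Proof. by move=> cf x; exact: (cvgB (cf x) (cvg_cst c)). Qed.

Lemma comp_continuous (T U W : topologicalType) (f : T -> U) (g : U -> W) :
  continuous f -> continuous g -> continuous (fun x => g (f x)).
Proof. by move=> cf cg x; exact: (continuous_comp (cf x) (cg (f x))). Qed.

Lemma norm_comp_continuous (T : topologicalType) (W : normedModType R) (f : T -> W) :
  continuous f -> continuous (fun x => `|f x|).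
Proof. by move=> cf x; exact: (continuous_comp (cf x) (@norm_continuous _ _ _)). Qed.

Lemma mulmx_norm_le k l (v : 'rV[R]_k) (M : 'M[R]_(k, l)) :
  `|v *m M| <= k%:R * `|M| * `|v|.
Proof.
apply: mx_norm_le => [|i j]; first by rewrite !mulr_ge0.
rewrite mxE; apply: le_trans (ler_norm_sum _ _ _) _.
apply: (@le_trans _ _ (\sum_(a < k) `|M| * `|v|)); last first.
  by rewrite sumr_const card_ord -[leLHS]mulr_natl mulrA.
apply: ler_sum => a _; rewrite normrM mulrC.
by apply: ler_pM => //; exact: mx_entry_le.
Qed.

Lemma mulmxr_continuous k l (M : 'M[R]_(k, l)) :
  continuous (fun v : 'rV[R]_k => v *m M).
Proof.
move=> v; have h : Ck 0 setT (fun v : 'rV[R]_k => v *m M).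
  apply: Ck_mulmx; [exact: openT|exact: smooth_on_id|exact: smooth_on_cst].
exact: h.
Qed.

Lemma differentiable_mulmxr k l (M : 'M[R]_(k, l)) (x : 'rV[R]_k) :
  differentiable (fun v : 'rV[R]_k => v *m M) x.
Proof. exact: (@linear_differentiable R _ _ (mulmxr M) x (@mulmxr_continuous k l M)). Qed.

Lemma diff_mulmxr k l (M : 'M[R]_(k, l)) (x v : 'rV[R]_k) :
  'd (fun v : 'rV[R]_k => v *m M) x v = v *m M.
Proof.
by have := @diff_lin R _ _ (mulmxr M) x (@mulmxr_continuous k l M) => /(congr1 (fun F => F v)).
Qed.

Lemma Ck_mulmxr k l (V : normedModType R) (U : set V) (M : 'M[R]_(k, l)) j
  (f : V -> 'rV[R]_k) : open U ->
  Ck j U f -> Ck j U (fun v => f v *m M).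
Proof. by move=> oU fj; apply: Ck_mulmx => //; exact: smooth_on_cst. Qed.

(** A ball is convex, so the one-variable theorem applies along the segment from [y] to [x]. The
    factor [k] appears because each of the [k] partial derivatives contributes at most [c] times the
    sup norm. *)
Lemma mean_value_le k (f : 'rV[R]_k -> R) (x0 : 'rV[R]_k) (d c : R) :
  (forall x, `|x - x0| < d -> differentiable f x) ->
  (forall x i, `|x - x0| < d -> `|'D_('e_i) f x| <= c) ->
  forall x y, `|x - x0| < d -> `|y - x0| < d ->
  `|f x - f y| <= k%:R * c * `|x - y|.
Proof.
move=> df Df x y xd yd.
have k0 : 0 <= k%:R * c.
  have [->|k0] := eqVneq k 0%N; first by rewrite mul0r.
  rewrite mulr_ge0//; have i : 'I_k by case: k k0 {f x0 df Df x y xd yd} => // k _; exact: ord0.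
  by apply: le_trans (Df x i xd).
pose p (t : R) := y + t *: (x - y).
have pd t : 0 <= t <= 1 -> `|p t - x0| < d.
  move=> /andP[t0 t1].
  have -> : p t - x0 = t *: (x - x0) + (1 - t) *: (y - x0).
    by rewrite /p; apply/matrixP => i j; rewrite !mxE; ring.
  apply: le_lt_trans (ler_normD _ _) _; rewrite !normrZ !ger0_norm ?subr_ge0//.
  have [->|t0'] := eqVneq t 0; first by rewrite mul0r subr0 mul1r add0r.
  have tp : 0 < t by rewrite lt_def t0'.
  have -> : d = t * d + (1 - t) * d by ring.
  by apply: ltr_leD; [rewrite ltr_pM2l|rewrite ler_wpM2l ?subr_ge0// ltW].
have dp (t : R) : is_derive t 1 p (x - y).
  have di : differentiable (id : R -> R) t by exact: ex_diff.
  have dz : differentiable (fun t : R => id t *: (x - y)) t by exact: differentiableZl.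
  have dc : differentiable (cst y : R -> 'rV[R]_k) t by exact: differentiable_cst.
  have dp : differentiable p t by exact: differentiableD dc dz.
  apply: DeriveDef; first exact: diff_derivable.
  rewrite deriveE//.
  have h1 : 'd p t 1 = 'd (cst y) t 1 + 'd (fun t : R => id t *: (x - y)) t 1.
    exact: (congr1 (fun F : R -> 'rV[R]_k => F 1) (diffD dc dz)).
  have h2 : 'd (fun t : R => id t *: (x - y)) t 1 = 'd id t (1 : R) *: (x - y).
    exact: (congr1 (fun F : R -> 'rV[R]_k => F 1) (diffZl (x - y) di)).
  have h3 : 'd (cst y) t (1 : R) = 0.
    exact: (congr1 (fun F : R -> 'rV[R]_k => F 1) (diff_cst y t)).
  have h4 : 'd id t (1 : R) = 1 by rewrite -(@deriveE R R R id t 1 di); exact: derive_id.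
  apply: (etrans h1).
  rewrite [X in X + _]h3 add0r.
  apply: (etrans h2).
  rewrite [X in X *: _]h4.
  exact: scale1r.
have dfp (t : R) : 0 <= t <= 1 -> is_derive t (1 : R) (f \o p) ('D_(x - y) f (p t)).
  move=> /pd ptd; have dft := df _ ptd.
  have dpt : differentiable p t by apply/derivable1_diffP; have [] := dp t.
  apply: DeriveDef.
    by apply: diff_derivable; exact: differentiable_comp.
  rewrite deriveE; last exact: differentiable_comp.
  rewrite diff_comp//= deriveE//; congr ('d f (p t) _).
  by rewrite -deriveE//; exact: derive_val.
have := @MVT_segment R (f \o p) (fun t => 'D_(x - y) f (p t)) 0 1 ler01.
case.
- by move=> t /itvP tt; apply: dfp; rewrite !tt.
- apply: continuous_in_subspaceT => t; rewrite inE /= => /itvP tt.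
  apply: differentiable_continuous; apply: differentiable_comp.
    by apply/derivable1_diffP; have [] := dp t.
  by apply/df/pd; rewrite !tt.
move=> t /itvP tt; rewrite /= /p scale1r scale0r addr0 subrKC subr0 mulr1 => ->.
have ptd : `|p t - x0| < d by apply: pd; rewrite !tt.
rewrite deriveE; last exact: df.
rewrite [x in 'd f _ x]row_sum_delta raddf_sum.
apply: le_trans (ler_norm_sum _ _ _) _.
apply: (@le_trans _ _ (\sum_(a < k) c * `|x - y|)); last first.
  by rewrite sumr_const card_ord -[leLHS]mulr_natl mulrA.
apply: ler_sum => i _.
apply: (@le_trans _ _ `|(x - y) 0 i * 'D_('e_i) f (p t)|).
  rewrite le_eqVlt; apply/orP; left; apply/eqP; congr (`|_|).
  rewrite deriveE; last exact: df.
  exact: linearZ_LR.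
rewrite normrM mulrC ler_pM//; first exact: Df.
exact: mx_entry_le.
Qed.

End MxNorm.

Section InverseFunction.
Variables (R : realType) (k : nat).
Local Notation E := 'rV[R]_k.
Variables (F : E -> E) (x0 : E).
Hypothesis sF : smooth_on setT F.
Hypothesis uF : 'J F x0 \in unitmx.

Let dF x : differentiable F x.
Proof. by have [+ _] := sF 1%N; apply. Qed.

Lemma jacobianE x i j : 'J F x i j = 'D_('e_i) F x 0 j.
Proof.
rewrite (deriveEjacobian _ (dF x)).
by have := rowE i ('J F x) => /matrixP /(_ 0 j); rewrite mxE => ->.
Qed.

Lemma smooth_jacobian : smooth_on setT (fun x => 'J F x).
Proof.
move=> j; apply: Ck_mxE => [|a b]; first exact: openT.
have : Ck j setT (fun x => 'D_('e_a) F x 0 b).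
  by apply: Ck_coord; [exact: openT|have [_] := sF j.+1; apply].
by apply: eq_Ck => [|x _]; [exact: openT|rewrite jacobianE].
Qed.

Let B := invmx ('J F x0).

(** Newton's map with the derivative frozen at [x0]; its own derivative vanishes there, so it
    contracts nearby. *)
Let G x := x - F x *m B.

Let smoothG : smooth_on setT G.
Proof.
move=> j; apply: (Ck_add openT); first exact: smooth_on_id.
apply: Ck_mxE => [|a b]; first exact: openT.
have h : Ck j setT (fun x => F x *m B) by apply: Ck_mulmxr; [exact: openT|exact: sF].
have := Ck_opp openT (Ck_coord openT a b h).
by apply: eq_Ck => [|x _]; [exact: openT|rewrite [RHS]mxE].
Qed.

Let dG x v : 'D_v G x = v - v *m 'J F x *m B.
Proof.
have dF' : differentiable (fun x => F x *m B) x.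
  exact: differentiable_comp (dF x) (differentiable_mulmxr B (F x)).
have did : differentiable (fun x : E => x) x by exact: ex_diff.
have -> : 'D_v G x = 'D_v ((fun x : E => x) - (fun x => F x *m B)) x by [].
rewrite deriveB; [|exact: diff_derivable|exact: diff_derivable].
congr (_ - _); first exact: derive_id.
rewrite deriveE//.
have -> : 'd (fun x => F x *m B) x v = 'd (fun v : E => v *m B) (F x) ('d F x v).
  exact: (congr1 (fun F : E -> E => F v) (diff_comp (dF x) (differentiable_mulmxr B (F x)))).
by rewrite diff_mulmxr -deriveE// deriveEjacobian.
Qed.

(** Summed over [k] partial derivatives, this bound stays below 1/2, the contraction constant of [G]
    used below. *)
Let near_good : exists2 d : R, 0 < d & forall x, `|x - x0| < d ->
  'J F x \in unitmx /\ forall i j, `|'D_('e_i) (fun y => G y 0 j) x| <= (2 * k.+1%:R)^-1.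
Proof.
have dGij x (v : E) j : 'D_v (fun y => G y 0 j) x = (v - v *m 'J F x *m B) 0 j.
  have e : 'D_v (fun y => G y 0 j) x = ('D_v G x) 0 j.
    rewrite derive_mx ?mxE//; apply: diff_derivable.
    by have [+ _] := smoothG 1%N; apply.
  by rewrite e dG.
have h1 : \forall x \near x0, 'J F x \in unitmx.
  have c : {for x0, continuous (fun x => \det ('J F x))}.
    by have := Ck_det openT (smooth_jacobian 0%N); apply.
  have : \forall x \near x0, \det ('J F x) != 0.
    by apply: (c [set r : R | r != 0]); apply: open_nbhs_nbhs; split; [exact: open_neq|rewrite /= -unitfE -unitmxE].
  by apply: filterS => x; rewrite unitmxE unitfE.
have h2 : \forall x \near x0, forall i j : 'I_k,
    `|'D_('e_i) (fun y => G y 0 j) x| <= (2 * k.+1%:R)^-1.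
  apply: (@filter_forall _ _ _ (nbhs x0) (nbhs_filter x0)) => i.
  apply: (@filter_forall _ _ _ (nbhs x0) (nbhs_filter x0)) => j.
  have c : {for x0, continuous (fun x => 'D_('e_i) (fun y => G y 0 j) x)}.
    by have [_ /(_ 'e_i)] := Ck_coord openT 0 j (smoothG 1%N); apply.
  have e0 : 0 < (2 * k.+1%:R)^-1 :> R by rewrite invr_gt0 mulr_gt0.
  move/cvgrPdist_lt : c => /(_ _ e0); apply: filterS => x.
  rewrite dGij mulmxK// subrr mxE sub0r normrN; exact: ltW.
have : nbhs x0 ([set x | 'J F x \in unitmx] `&` [set x | forall i j : 'I_k,
    `|'D_('e_i) (fun y => G y 0 j) x| <= (2 * k.+1%:R)^-1]).
  exact: filterI h1 h2.
move=> /nbhs_ballP[d d0 dh].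
exists d; first exact: d0.
by move=> x xd; apply: (dh x); rewrite -ball_normE /ball_ /= distrC.
Qed.

Lemma inverse_function : exists (U : set E) (H : E -> E),
  [/\ open U, U x0, open (F @` U), forall x, U x -> H (F x) = x &
      smooth_on (F @` U) H].
Proof.
have [d d0 dgood] := near_good.
have contr x y : `|x - x0| < d -> `|y - x0| < d -> `|G x - G y| <= 2^-1 * `|x - y|.
  move=> xd yd; apply: mx_norm_le => [|i j]; first by rewrite mulr_ge0.
  rewrite (ord1 i) {i} !mxE.
  have := @mean_value_le R k (fun y => G y 0 j) x0 d (2 * k.+1%:R)^-1 _ _ x y xd yd.
  rewrite !mxE => h; apply: (le_trans (h _ _)) => [z zd|z i zd|].
  - by have [+ _] := Ck_coord openT 0 j (smoothG 1%N); apply.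
  - by have [_] := dgood z zd; apply.
  - apply: ler_wpM2r => //; rewrite invfM mulrCA -[leRHS]mulr1 ler_wpM2l//.
    by rewrite ler_pdivrMr// mul1r ler_nat.
(* The contraction of [G] makes [F] injective on the ball, with a Lipschitz inverse. *)
have expand x y : `|x - x0| < d -> `|y - x0| < d -> `|x - y| <= 2 * `|(F x - F y) *m B|.
  move=> xd yd.
  have e : x - y = (G x - G y) + (F x - F y) *m B.
    by rewrite /G mulmxBl; apply/matrixP => i j; rewrite !mxE; ring.
  have := contr x y xd yd; have := ler_normD (G x - G y) ((F x - F y) *m B).
  by rewrite -e; lra.
(* The second condition makes the image of [U] an explicit open set. For [y] in that set, the map
   [T] below sends the closed ball of radius d/2 into itself, since 1/2 * d/2 + d/4 = d/2. *)
pose U := [set x | `|x - x0| < d / 2 /\ `|(F x - F x0) *m B| < d / 4].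
have cF : continuous F by move=> x; exact: differentiable_continuous.
have cFB : continuous (fun x => (F x - F x0) *m B).
  move=> x; apply: (@continuous_comp _ _ _ (fun x => F x - F x0) (fun v : E => v *m B)).
    exact: (sub_continuous cF).
  exact: mulmxr_continuous.
have idc : continuous (fun x : E => x) by move=> ?; exact: cvg_id.
have oU : open U.
  apply: openI.
    apply: (@open_comp _ _ (fun x : E => `|x - x0|) [set r : R | r < d / 2]); last exact: open_lt.
    by move=> x _; exact: (norm_comp_continuous (sub_continuous idc)).
  apply: (@open_comp _ _ (fun x : E => `|(F x - F x0) *m B|) [set r : R | r < d / 4]); last exact: open_lt.
  by move=> x _; exact: (norm_comp_continuous cFB).
have Ud x : U x -> `|x - x0| < d by move=> [xd _]; lra.
have imF : F @` U = [set y | `|(y - F x0) *m B| < d / 4].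
  apply/seteqP; split=> [_ [x [_ Ux] <-]//|y /= yd].
  pose C := [set x : E | `|x - x0| <= d / 2].
  have Cd x : C x -> `|x - x0| < d by rewrite /C /=; lra.
  pose T x := G x + y *m B.
  have x0d : `|x0 - x0| < d by rewrite subrr normr0.
  have Tb x : C x -> `|T x - x0| < d / 2.
    move=> Cx; have -> : T x - x0 = (G x - G x0) + (y - F x0) *m B.
      by rewrite /T /G mulmxBl; apply/matrixP => i j; rewrite !mxE; ring.
    apply: le_lt_trans (ler_normD _ _) _.
    have := contr x x0 (Cd x Cx) x0d.
    by move: Cx yd; rewrite /C /=; lra.
  have TC : set_fun C C T by move=> x /Tb /ltW.
  pose Tf : {fun C >-> C} := HB.pack T (isFun.Build _ _ _ _ _ TC).
  have cT : is_contraction Tf.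
    have h0 : 0 <= 2^-1 :> R by [].
    exists (NngNum h0); split => /=; first by rewrite invf_lt1// ltr1n.
    move=> [a b] [/= Ca Cb]; rewrite /T opprD addrACA subrr addr0.
    by apply: contr; exact: Cd.
  have [||x Cx Tx] := banach_fixed_point cT.
  - rewrite /C; apply: (@preimage_closed _ _ (fun x : E => `|x - x0|) [set r | r <= d / 2]); last exact: closed_le.
    by move=> x _; exact: (norm_comp_continuous (sub_continuous idc)).
  - by exists x0; rewrite /C /= subrr normr0 divr_ge0// ltW.
  - have yE : y = F x.
      have : (F x - y) *m B = 0.
        by move: Tx; rewrite /= /T /G mulmxBl => /eqP; rewrite -subr_eq0 => /eqP <-;
          apply/matrixP => i j; rewrite !mxE; ring.
      move=> /(congr1 (mulmx^~ ('J F x0))); rewrite mulmxKV// mul0mx => /eqP.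
      by rewrite subr_eq0 => /eqP.
    by exists x => //; split; [rewrite Tx; exact: Tb|rewrite -yE].
have oV : open (F @` U).
  rewrite imF; apply: (@open_comp _ _ (fun y : E => `|(y - F x0) *m B|) [set r : R | r < d / 4]); last exact: open_lt.
  move=> y _; apply: norm_comp_continuous.
  exact: (comp_continuous (sub_continuous idc) (@mulmxr_continuous _ _ _ B)).
have Ux0 : U x0 by rewrite /U /= !subrr mul0mx normr0; split; rewrite divr_gt0.
pose H y := xget x0 [set x | U x /\ F x = y].
have HP y : (F @` U) y -> U (H y) /\ F (H y) = y.
  by move=> [x Ux Fxy]; rewrite /H; case: xgetP => [x' _ []//|/(_ x)[]].
have HF x : U x -> H (F x) = x.
  move=> Ux; have [UH FH] : U (H (F x)) /\ F (H (F x)) = F x by apply: HP; exists x.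
  have := expand _ _ (Ud _ UH) (Ud _ Ux).
  by rewrite FH subrr mul0mx normr0 mulr0 normr_le0 subr_eq0 => /eqP.
have [L L0 HL] : exists2 L : R, 0 < L & forall y y', (F @` U) y -> (F @` U) y' ->
    `|H y' - H y| <= L * `|y' - y|.
  exists (2 * (k%:R * `|B|) + 1); first by rewrite ltr_wpDl// mulr_ge0// mulr_ge0.
  move=> y y' /HP[Uy Fy] /HP[Uy' Fy'].
  have := expand _ _ (Ud _ Uy') (Ud _ Uy); rewrite Fy Fy'.
  have := mulmx_norm_le (y' - y) B.
  have : 0 <= `|y' - y| by [].
  by rewrite mulrDl mul1r -!mulrA; lra.
have cH y : (F @` U) y -> {for y, continuous H}.
  move=> Vy; rewrite /prop_for /continuous_at.
  apply/(@cvgrPdist_lt _ _ _ (nbhs y) (nbhs_filter y)) => e e0.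
  have [d1 d10 d1e] : exists2 d1, 0 < d1 & L * d1 = e.
    by exists (e / L); [rewrite divr_gt0|rewrite mulrC divfK// gt_eqF].
  have idy : {for y, continuous (fun z : E => z)} by exact: cvg_id.
  have /(_ _ d10) nb := (@cvgrPdist_lt _ _ _ (nbhs y) (nbhs_filter y) _ _).1 idy.
  have nV : \forall z \near y, (F @` U) z by exact: open_nbhs_nbhs.
  apply: filterS2 nb nV => y' yy' Vy'.
  rewrite distrC; apply: le_lt_trans (HL _ _ Vy Vy') _.
  by rewrite -d1e ltr_pM2l// distrC.
have dH y : (F @` U) y -> differentiable H y /\
    forall v, 'd H y v = v *m invmx ('J F (H y)).
  move=> Vy; have [UHy FHy] := HP _ Vy.
  have [uJ _] := dgood _ (Ud _ UHy).
  pose M := invmx ('J F (H y)).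
  have : differentiable H y /\ 'd H y = mulmxr M :> (E -> E).
    apply: (@diff_eps R E E); first exact: (@mulmxr_continuous R k k M).
    move=> e e0.
    pose e1 := e / (L * (k%:R * `|M| + 1)).
    have kM : 0 < k%:R * `|M| + 1 by rewrite ltr_wpDl// mulr_ge0.
    have e10 : 0 < e1 by rewrite divr_gt0// mulr_gt0.
    have Fo := diff_epsE (dF (H y)) e10.
    have cHy : {for 0 + y, continuous H} by rewrite add0r; exact: cH.
    have cadd : {for (0 : E), continuous (fun h : E => h + y)}.
      exact: (cvgD (@cvg_id _ (nbhs (0 : E))) (cvg_cst y)).
    have c1 := continuous_comp cadd cHy.
    have cH0 := cvgB c1 (cvg_cst (H y)).
    rewrite /= add0r subrr in cH0.
    have Fo' : \forall h \near (0 : E), `|F (H (h + y) - H y + H y) -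
        (F (H y) + 'd F (H y) (H (h + y) - H y))| <= e1 * `|H (h + y) - H y|.
      exact: (cH0 _ _ _ Fo).
    have nV : \forall h \near (0 : E), (F @` U) (h + y).
      have : \forall z \near y, (F @` U) z by exact: open_nbhs_nbhs.
      by rewrite (near_shift 0 y) subr0.
    apply: (@filterS2 _ (nbhs (0 : E)) (nbhs_filter (0 : E)) _ _ _ _ Fo' nV) => h; rewrite /= => Fh Vh.
    have [Uh FHh] := HP _ Vh.
    move: Fh; rewrite subrK FHh FHy -deriveE// deriveEjacobian//.
    set w := H (h + y) - H y => Fh.
    (* The remainder of [H] at [y] is the remainder of [F] at [H y], multiplied by [- M]; the
       Lipschitz bound on [H] compares [w] with [h]. *)
    have -> : H (h + y) - (H y + h *m M) = - ((h + y - (y + w *m 'J F (H y))) *m M).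
      have -> : h + y - (y + w *m 'J F (H y)) = h - w *m 'J F (H y).
        by apply/matrixP => i j; rewrite !mxE; ring.
      rewrite mulmxBl mulmxK// /w.
      by apply/matrixP => i j; rewrite !mxE; ring.
    rewrite normrN; apply: le_trans (mulmx_norm_le _ _) _.
    have wL : `|w| <= L * `|h|.
      by have := HL _ _ Vy Vh; rewrite addrK.
    apply: (@le_trans _ _ ((k%:R * `|M| + 1) * (e1 * (L * `|h|)))).
      apply: ler_pM; rewrite ?mulr_ge0//; first by rewrite lerDl.
      by apply: le_trans Fh _; rewrite ler_wpM2l// ltW.
    rewrite le_eqVlt; apply/orP; left; apply/eqP.
    rewrite /e1; field; by rewrite !gt_eqF.
  by move=> [dHy e]; split => // v; rewrite e.
(* The derivative of [H] is a smooth function of [H] itself, so each order of differentiability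
   yields the next. *)
exists U, H; split => //; elim=> [|j ih]; first exact: cH.
split=> [y /dH[]//|v].
have h2 : Ck j U (fun x => v *m invmx ('J F x)).
  apply: (Ck_mulmx oU); first exact: smooth_on_cst.
  apply: (Ck_invmx oU); last by apply: Ck_sub (smooth_jacobian j).
  by move=> x Ux; have [] := dgood _ (Ud _ Ux).
have h3 := Ck_comp_mx oV oU (fun y Vy => (HP y Vy).1) ih h2.
apply: eq_Ck h3 => // y Vy; have [dHy dHv] := dH _ Vy.
by rewrite deriveE.
Qed.

End InverseFunction.

(** * Regular level sets *)

Section SubsetTopology.
Variables (E : topologicalType) (A : set E).
Local Notation T := (set_type A).

Lemma val_continuous : continuous (set_val : T -> E).
Proof. exact: initial_continuous. Qed.

Lemma to_subset_continuousP (X : topologicalType) (g : X -> T) x :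
  {for x, continuous (fun y => set_val (g y))} -> {for x, continuous g}.
Proof.
move=> cg B [B' [[C oC CE] B'gx B'B]].
have nC : nbhs (set_val (g x)) C.
  by apply: open_nbhs_nbhs; split=> //; move: B'gx; rewrite -CE.
by apply: (@filterS _ (nbhs x) (nbhs_filter x) _ _ _ (cg _ nC)) => y Cy; apply: B'B; rewrite -CE.
Qed.

Lemma subset_hausdorff : hausdorff_space E -> hausdorff_space T.
Proof.
move=> hE p q pq; apply: val_inj; apply: hE => B C nB nC.
have [r [Br Cr]] := pq _ _ (val_continuous nB) (val_continuous nC).
by exists (set_val r).
Qed.

Lemma subset_second_countable : @second_countable E -> @second_countable T.
Proof.
move=> [B cB [oB bB]]; exists [set set_val @^-1` b | b in B].
  exact: sub_countable (card_image_le _ _) cB.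
split=> [_ [b Bb <-]|x V].
  by apply: open_comp (oB _ Bb) => y _; exact: val_continuous.
move=> [V' [[C oC <-] Cx] V'V].
have nC : nbhs (set_val x) C by exact: open_nbhs_nbhs.
have [b [Bb bx] bC] := bB _ _ nC.
exists (set_val @^-1` b); first by split=> //; exists b.
by move=> y yb; apply: V'V; exact: bC.
Qed.

Lemma subset_compact : compact A -> compact [set: T].
Proof.
move=> cA F PF _.
have PF' : ProperFilter (set_val @ F) by exact: fmap_proper_filter.
have [x [Ax clx]] := cA (set_val @ F) PF' (filterS (fun (t : T) _ => set_valP t) filterT).
exists (exist _ x (mem_set Ax)); split=> // B C FB [C' [[D oD <-] Dx] C'C].
have nD : nbhs x D by exact: open_nbhs_nbhs.
have FB' : (set_val @ F) (set_val @` B) by apply: (@filterS T F _ B) FB => t Bt; exists t.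
have [_ [[t Bt <-] Dt]] := clx _ _ FB' nD.
by exists t; split=> //; exact: C'C.
Qed.

End SubsetTopology.

Section LevelSet.
Variables (R : realType) (m : nat).
Local Notation E := 'rV[R]_(m + 2).
Variable Phi : E -> 'rV[R]_2.
Hypothesis smoothPhi : smooth_on setT Phi.
Local Notation Z := [set x : E | Phi x = 0].
Hypothesis regularPhi : forall x, Z x -> \rank ('J Phi x) = 2%N.
Local Notation T := (set_type Z).

Let dPhi x : differentiable Phi x.
Proof. by have [+ _] := smoothPhi 1%N; apply. Qed.

(* The carrier sits in a Euclidean space; the admissible charts are the
   restrictions of linear maps that have a smooth local inverse. *)
Definition linear_chart (a : chart R m T) (C : 'M[R]_(m + 2, m)) (H : 'rV[R]_m -> E) :=
  [/\ smooth_on (cmap a @` cdom a) H,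
      forall w, (cmap a @` cdom a) w -> set_val (cinv a w) = H w &
      forall p, cmap a p = set_val p *m C].

Definition linear_atlas : set (chart R m T) :=
  [set a | exists C H, linear_chart a C H].

Let complement x : Z x -> exists C : 'M[R]_(m + 2, m),
  row_mx C ('J Phi x) \in unitmx.
Proof.
move=> Zx; set B := 'J Phi x.
have rk : \rank (kermx B) = m by rewrite mxrank_ker regularPhi// addnK.
pose K : 'M[R]_(m, m + 2) := castmx (rk, erefl) (row_base (kermx B)).
have KB : (K :=: kermx B)%MS.
  by apply: eqmx_trans (eqmx_cast _ _) (eq_row_base _).
have KB0 : K *m B = 0 by apply/sub_kermxP; rewrite KB.
have Kfree : row_free K by rewrite /row_free KB rk.
exists K^T; rewrite -row_free_unit -kermx_eq0; apply/rowV0P => v.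
move=> /sub_kermxP; rewrite mul_mx_row -[X in _ = X -> _]row_mx0 => /eq_row_mx[vK vB].
have /submxP[w vE] : (v <= K)%MS by rewrite KB; apply/sub_kermxP.
have : w *m K *m (w *m K)^T = 0 by rewrite trmx_mul mulmxA -vE vK mul0mx.
move=> /matrixP /(_ 0 0); rewrite -vE !mxE => /eqP.
rewrite psumr_eq0 => [|i _]; last by rewrite mxE -expr2 sqr_ge0.
move=> /allP h; apply/rowP => i; rewrite mxE.
by have := h i (mem_index_enum i); rewrite /= mxE mulf_eq0 => /orP[] /eqP.
Qed.

Let chart_exists (p : T) : exists2 a, linear_atlas a & cdom a p.
Proof.
set x := set_val p; have Zx : Z x := set_valP p.
have [C uC] := complement Zx.
(* In the coordinates given by [F] the level set is the linear slice where the last two coordinates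
   vanish, and the chart is the linear map [C]. *)
pose F (y : E) : E := row_mx (y *m C) (Phi y).
have smF : smooth_on setT F.
  move=> j; apply: Ck_mxE => [|i l]; first exact: openT.
  case: (split_ordP l) => l' ->.
    have : Ck j setT (fun y : E => (y *m C) i l').
      apply: Ck_coord; first exact: openT.
      by apply: Ck_mulmxr; [exact: openT|exact: smooth_on_id].
    by apply: eq_Ck => [|y _]; [exact: openT|rewrite row_mxEl].
  have : Ck j setT (fun y : E => Phi y i l').
    by apply: Ck_coord; [exact: openT|exact: smoothPhi].
  by apply: eq_Ck => [|y _]; [exact: openT|rewrite row_mxEr].
have JF : 'J F x = row_mx C ('J Phi x).
  apply/matrixP => i l; rewrite jacobianE//.
  have dF : differentiable F x by have [+ _] := smF 1%N; apply.
  rewrite derive_mx; last exact: diff_derivable.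
  rewrite mxE; case: (split_ordP l) => l' ->.
    have -> : (fun t => F t 0 (lshift 2 l')) = (fun y : E => (y *m C) 0 l').
      by apply/funext => y; rewrite row_mxEl.
    rewrite row_mxEl.
    have h : 'D_('e_i) (fun y : E => y *m C) x 0 l' = C i l'.
      rewrite deriveE ?diff_mulmxr; last exact: differentiable_mulmxr.
      by have /matrixP/(_ 0 l') := rowE i C; rewrite mxE.
    rewrite -h derive_mx ?mxE//; apply: diff_derivable; exact: differentiable_mulmxr.
  have -> : (fun t => F t 0 (rshift m l')) = (fun y : E => Phi y 0 l').
    by apply/funext => y; rewrite row_mxEr.
  rewrite row_mxEr.
  have h : 'D_('e_i) Phi x 0 l' = 'J Phi x i l'.
    rewrite (deriveEjacobian _ (dPhi x)).
    by have /matrixP/(_ 0 l') := rowE i ('J Phi x); rewrite mxE.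
  by rewrite -h derive_mx ?mxE//; exact: diff_derivable.
have uF : 'J F x \in unitmx by rewrite JF.
have [U [H [oU Ux oV HF sH]]] := inverse_function smF uF.
pose dom : set T := [set p | U (set_val p)].
pose map (p : T) : 'rV[R]_m := set_val p *m C.
pose emb (w : 'rV[R]_m) : E := row_mx w 0.
(* The value [p] only makes [inv] total: over the image of the chart the first branch applies. *)
pose inv w : T := if pselect (Z (H (emb w))) is left zw
  then exist _ (H (emb w)) (mem_set zw) else p.
have FZ y : Z y -> F y = emb (y *m C) by rewrite /F => ->.
have img : map @` dom = [set w | (F @` U) (emb w)].
  apply/seteqP; split=> [_ [q Uq <-]|w [y Uy /eq_row_mx[yw Phiy]]] /=.
    by exists (set_val q) => //; rewrite FZ//; exact: (set_valP q).
  by exists (exist _ y (mem_set (Phiy : Z y))).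
have invE w : (map @` dom) w -> set_val (inv w) = H (emb w).
  move=> [q Uq <-]; rewrite /map -FZ; last exact: (set_valP q).
  rewrite HF// /inv -FZ; last exact: (set_valP q).
  case: pselect => [z|]; first exact: HF.
  by rewrite HF//; case; exact: (set_valP q).
have semb : smooth_on setT emb.
  move=> j; apply: Ck_mxE => [|i l]; first exact: openT.
  case: (split_ordP l) => l' ->.
    have : Ck j setT (fun w : 'rV[R]_m => w i l').
      by apply: Ck_coord; [exact: openT|exact: smooth_on_id].
    by apply: eq_Ck => [|y _]; [exact: openT|rewrite row_mxEl].
  have : Ck j setT (fun w : 'rV[R]_m => 0 : R) by exact: smooth_on_cst.
  by apply: eq_Ck => [|y _]; [exact: openT|rewrite row_mxEr mxE].
have cemb : continuous emb by move=> w; exact: (semb 0%N).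
have odom : open dom.
  by apply: (@open_comp _ _ (set_val : T -> E)) => // q _; exact: val_continuous.
have oimg : open (map @` dom).
  by rewrite img; apply: (@open_comp _ _ emb) => // q _; exact: cemb.
have sHe : smooth_on (map @` dom) (fun w => H (emb w)).
  move=> j; apply: (@Ck_comp_mx _ _ _ oimg _ _ _ j (F @` U)) => //.
  - by move=> w; rewrite img.
  - by apply: Ck_sub (semb j).
have cmap' q : dom q -> {for q, continuous map}.
  move=> _; exact: (continuous_comp (@val_continuous _ _ q) (@mulmxr_continuous _ _ _ C _)).
have cinv' w : (map @` dom) w -> {for w, continuous inv}.
  move=> mw; apply: to_subset_continuousP.
  have : Ck 0 (map @` dom) (fun w => set_val (inv w)).
    by apply: eq_Ck (sHe 0%N) => // z /invE.
  exact.
have mapK q : dom q -> inv (map q) = q.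
  move=> Uq; apply: val_inj; have e : set_val (inv (map q)) = set_val q; last exact: e.
  rewrite invE; last by exists q.
  by rewrite /map -FZ ?HF//; exact: (set_valP q).
exists (@Chart R m T dom map inv odom oimg cmap' cinv' mapK) => //.
by exists C, (fun w => H (emb w)).
Qed.

Let charts_smooth a b : linear_atlas a -> linear_atlas b ->
  smooth_on (cmap a @` (cdom a `&` cdom b)) (cmap b \o cinv a).
Proof.
move=> [C [H [sH HE mE]]] [C' [H' [sH' HE' mE']]] k.
have h : Ck k (cmap a @` cdom a) (fun w => H w *m C').
  by apply: Ck_mulmxr (sH k); exact: cimg_open.
have h' : Ck k (cmap a @` cdom a) (cmap b \o cinv a).
  by apply: eq_Ck h => [|w aw]; [exact: cimg_open|rewrite /= mE' HE].
by apply: Ck_sub h' => _ [q [aq _] <-]; exists q.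
Qed.

Definition level_manifold : manifold R m :=
  @Manifold R m T (subset_hausdorff (@manifold_hausdorff _ _ (euclidean R (m + 2))))
    (@subset_second_countable _ Z (@manifold_second_countable _ _ (euclidean R (m + 2))))
    linear_atlas chart_exists charts_smooth.

Lemma level_closed : compact Z -> closed_manifold level_manifold.
Proof. exact: subset_compact. Qed.

(** The rows of the Jacobian of [H] form a basis of the tangent space, which is the kernel of the
    Jacobian of [Phi]. Hence that Jacobian and [C] are inverse to each other between coordinate
    vectors and tangent vectors. *)
Lemma jacobian_inverse a C H p : linear_chart a C H -> cdom a p ->
  [/\ set_val p = H (cmap a p), 'J H (cmap a p) *m C = 1%:M,
      'J H (cmap a p) *m 'J Phi (set_val p) = 0 &
      forall v : E, v *m 'J Phi (set_val p) = 0 -> v *m C *m 'J H (cmap a p) = v].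
Proof.
move=> [sH HE mE] ap; set w := cmap a p.
have imw : (cmap a @` cdom a) w by exists p.
have Hw : set_val p = H w by rewrite -HE// cmapK.
have dH : differentiable H w by have [+ _] := sH 1%N; apply.
have near_img : \forall z \near w, (cmap a @` cdom a) z.
  by apply: open_nbhs_nbhs; split=> //; exact: cimg_open.
have LC : 'J H w *m C = 1%:M.
  apply/row_matrixP => i; rewrite !rowE mulmxA mulmx1 -(deriveEjacobian _ dH).
  rewrite deriveE// -(diff_mulmxr C (H w)).
  have -> : 'd (mulmx^~ C) (H w) ('d H w 'e_i) = 'd ((mulmx^~ C) \o H) w 'e_i.
    exact: (esym (congr1 (fun F : 'rV[R]_m -> 'rV[R]_m => F 'e_i)
      (diff_comp dH (differentiable_mulmxr C (H w))))).
  rewrite -deriveE; last exact: (differentiable_comp dH (differentiable_mulmxr C (H w))).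
  rewrite (_ : 'D_('e_i) _ w = 'D_('e_i) id w); first exact: derive_id.
  apply: near_eq_derive; apply: filterS near_img => z imz /=.
  by rewrite -HE// -mE; case: imz => q aq <-; rewrite cmapK.
have LB : 'J H w *m 'J Phi (set_val p) = 0.
  apply/row_matrixP => i; rewrite !rowE mulmxA mulmx0 -(deriveEjacobian _ dH).
  rewrite Hw -(deriveEjacobian _ (dPhi _)) [LHS]deriveE// deriveE//.
  have -> : 'd Phi (H w) ('d H w 'e_i) = 'd (Phi \o H) w 'e_i.
    exact: (esym (congr1 (fun F : 'rV[R]_m -> 'rV[R]_2 => F 'e_i) (diff_comp dH (dPhi (H w))))).
  rewrite -deriveE; last exact: (differentiable_comp dH (dPhi (H w))).
  rewrite (_ : 'D_('e_i) _ w = 'D_('e_i) (cst 0) w); first exact: derive_cst.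
  apply: near_eq_derive; apply: filterS near_img => z imz /=.
  by rewrite -HE//; exact: (set_valP (cinv a z)).
split=> // v vB.
have Lfree : row_free ('J H w).
  by apply/row_freeP; exists C.
have Lker : ('J H w :=: kermx ('J Phi (set_val p)))%MS.
  have LK : ('J H w <= kermx ('J Phi (set_val p)))%MS by exact/sub_kermxP.
  apply/eqmxP; rewrite -(geq_leqif (mxrank_leqif_eq LK)).
  rewrite mxrank_ker regularPhi ?addnK//; last exact: (set_valP p).
  by move: Lfree; rewrite /row_free => /eqP ->.
have /submxP[u ->] : (v <= 'J H w)%MS by rewrite Lker; apply/sub_kermxP.
by rewrite -(mulmxA u) LC mulmx1.
Qed.

End LevelSet.

Section EuclideanACS.
Variables (R : realType) (k : nat) (A : 'rV[R]_k -> 'M[R]_k).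
Hypothesis sA : smooth_on setT A.
Hypothesis A2 : forall x, A x *m A x = - 1%:M.
Local Notation N := (euclidean R k).

Lemma euclidean_chart (p : N) (a : chart_at p) : chart_of a = id_chart R k.
Proof. exact: chart_atlas a. Qed.

Let coordsA (p : N) (v : tangent p) (b : chart_at p) := v b *m A p.

Lemma euclidean_coords (p : N) (v : tangent p) (a b : chart_at p) : v a = v b.
Proof.
have /asboolP vE := coordsP v; rewrite (vE b a) !euclidean_chart /=.
have -> : 'd (fun y : 'rV[R]_k => y) p (v b) = 'D_(v b) id p.
  by rewrite deriveE//; exact: ex_diff.
exact: derive_id.
Qed.

Let coordsA_tangent (p : N) (v : tangent p) : is_tangent (coordsA v).
Proof.
apply/asboolP => a b; rewrite /coordsA (euclidean_coords v a b).
rewrite !euclidean_chart /=.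
have -> : forall u : 'rV[R]_k, 'd (fun y : 'rV[R]_k => y) p u = 'D_u id p.
  by move=> u; rewrite deriveE//; exact: ex_diff.
exact: esym (derive_id _ _).
Qed.

Let actA (p : N) (v : tangent p) : tangent p := Tangent (coordsA_tangent v).

Let actA_linear p : linear (@actA p).
Proof.
move=> c u v; apply: val_inj; apply/funext => b.
rewrite -[LHS]/((c *: u b + v b) *m A p) -[RHS]/(c *: (u b *m A p) + v b *m A p).
by rewrite mulmxDl scalemxAl.
Qed.

HB.instance Definition _ p := GRing.isLinear.Build R _ _ _ (@actA p) (@actA_linear p).

Definition euclidean_acs : almost_complex N.
Proof.
refine (@AlmostComplex R k N (fun p => @actA p) _ _).
- move=> p v; apply: val_inj; apply/funext => b.
  rewrite -[LHS]/(v b *m A p *m A p) -[RHS]/(- v b).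
  by rewrite -mulmxA A2 mulmxN mulmx1.
- move=> a aN; exists A; split=> [j|p c v ca].
    by apply: Ck_sub (sA j).
  by rewrite -ca euclidean_chart.
Defined.

Lemma euclidean_acsE (p : N) (v : tangent p) (b : chart_at p) :
  euclidean_acs p v b = v b *m A p.
Proof. by []. Qed.

End EuclideanACS.

Section LevelACS.
Variables (R : realType) (m : nat).
Local Notation E := 'rV[R]_(m + 2).
Variable Phi : E -> 'rV[R]_2.
Hypothesis smoothPhi : smooth_on setT Phi.
Local Notation Z := [set x : E | Phi x = 0].
Hypothesis regularPhi : forall x, Z x -> \rank ('J Phi x) = 2%N.
Variable A : E -> 'M[R]_(m + 2).
Hypothesis sA : smooth_on setT A.
Hypothesis A2 : forall x, A x *m A x = - 1%:M.
Hypothesis A_invariant : forall x (v : E), Z x -> v *m 'J Phi x = 0 ->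
  v *m A x *m 'J Phi x = 0.
Local Notation M := (level_manifold smoothPhi regularPhi).

(** The atlas only asserts that [C] and [H] exist, whereas the matrix of the structure in a chart
    requires a definite choice. *)
Let Cof (a : chart R m (set_type Z)) : 'M[R]_(m + 2, m) :=
  xget 0 [set C | exists H, linear_chart a C H].

Let Hof (a : chart R m (set_type Z)) : 'rV[R]_m -> E :=
  xget (fun=> 0) [set H | linear_chart a (Cof a) H].

Let CHP a : atlas M a -> linear_chart a (Cof a) (Hof a).
Proof.
move=> aM; have : exists H, linear_chart a (Cof a) H.
  have [C CH] : exists C, exists H, linear_chart a C H by [].
  by rewrite {1}/Cof; case: xgetP => [C' _ //|/(_ C)].
by move=> [H CH]; rewrite /Hof; case: xgetP => [H' _ //|/(_ H)].
Qed.

Let L a w := 'J (Hof a) w.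

Let chartP (p : M) (a : chart_at p) :=
  jacobian_inverse smoothPhi regularPhi (CHP (chart_atlas a)) (chart_dom a).

Let diffH (p : M) (a : chart_at p) : differentiable (Hof a) (cmap a p).
Proof.
have [sH _ _] := CHP (chart_atlas a).
have [+ _] := sH 1%N; apply; exists p => //; exact: chart_dom.
Qed.

Let tangentE (p : M) (v : tangent p) (a b : chart_at p) :
  v b = v a *m L a (cmap a p) *m Cof b.
Proof.
have /asboolP vE := coordsP v; rewrite (vE a b).
have [_ HE _] := CHP (chart_atlas a); have [_ _ mb] := CHP (chart_atlas b).
have near_img : \forall z \near cmap a p, (cmap a @` cdom a) z.
  apply: open_nbhs_nbhs; split; first exact: cimg_open.
  by exists p => //; exact: chart_dom.
rewrite -(deriveE (v a) (transition_diff a b)).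
have -> : 'D_(v a) (cmap b \o cinv a) (cmap a p) =
    'D_(v a) ((mulmx^~ (Cof b)) \o Hof a) (cmap a p).
  by apply: near_eq_derive; apply: filterS near_img => z imz /=; rewrite mb HE.
rewrite deriveE; last exact: (differentiable_comp (diffH a) (differentiable_mulmxr _ _)).
rewrite -(deriveEjacobian _ (diffH a)) deriveE; last exact: diffH.
rewrite -[RHS](diff_mulmxr (Cof b) (Hof a (cmap a p))).
exact: (congr1 (fun F : 'rV[R]_m -> 'rV[R]_m => F (v a))
  (diff_comp (diffH a) (differentiable_mulmxr (Cof b) (Hof a (cmap a p))))).
Qed.

Let mat a w := L a w *m A (Hof a w) *m Cof a.

Let coordsJ (p : M) (v : tangent p) (b : chart_at p) := v b *m mat b (cmap b p).

(** Both sides are the vector of the ambient space that [v] represents. *)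
Let liftE (p : M) (v : tangent p) (a b : chart_at p) :
  v a *m L a (cmap a p) = v b *m L b (cmap b p).
Proof.
have [_ _ LB _] := chartP a; have [_ _ _ CL] := chartP b.
by rewrite (tangentE v a b) -mulmxA mulmxA CL// -mulmxA LB mulmx0.
Qed.

(** [A] preserves tangent vectors, so passing to coordinates and lifting back changes nothing. *)
Let actE (p : M) (v : tangent p) (a : chart_at p) :
  v a *m L a (cmap a p) *m A (set_val p) *m Cof a *m L a (cmap a p) =
  v a *m L a (cmap a p) *m A (set_val p).
Proof.
have [_ _ LB CL] := chartP a; rewrite CL//; apply: A_invariant.
  exact: (set_valP p).
by rewrite -mulmxA LB mulmx0.
Qed.

Let coordsJE (p : M) (v : tangent p) (b : chart_at p) :
  coordsJ v b = v b *m L b (cmap b p) *m A (set_val p) *m Cof b.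
Proof. by have [-> _ _ _] := chartP b; rewrite /coordsJ /mat !mulmxA. Qed.

Let coordsJ_tangent (p : M) (v : tangent p) : is_tangent (coordsJ v).
Proof.
apply/asboolP => a b.
have [w wa] : exists w : tangent p, w a = coordsJ v a.
  have [g _ gK] := coords_bij a; exists (g (coordsJ v a)); exact: gK.
have /asboolP wE := coordsP w.
rewrite -wa -wE (tangentE w a b) wa !coordsJE actE.
by rewrite (liftE v b a).
Qed.

Let actJ (p : M) (v : tangent p) : tangent p := Tangent (coordsJ_tangent v).

Let actJ_linear p : linear (@actJ p).
Proof.
move=> c u v; apply: val_inj; apply/funext => b.
rewrite -[LHS]/((c *: u b + v b) *m mat b (cmap b p)).
rewrite -[RHS]/(c *: (u b *m mat b (cmap b p)) + v b *m mat b (cmap b p)).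
by rewrite mulmxDl scalemxAl.
Qed.

HB.instance Definition _ p := GRing.isLinear.Build R _ _ _ (@actJ p) (@actJ_linear p).

Let actJ_sq (p : M) (v : tangent p) : actJ (actJ v) = - v.
Proof.
apply: val_inj; apply/funext => b.
rewrite -[LHS]/(coordsJ (actJ v) b) -[RHS]/(- v b) coordsJE.
rewrite -[actJ v b]/(coordsJ v b) coordsJE actE.
rewrite -(mulmxA _ (A _) (A _)) A2 mulmxN mulmx1 mulNmx.
by have [_ LC _ _] := chartP b; rewrite -mulmxA LC mulmx1.
Qed.

Let mat_smooth a : atlas M a -> smooth_on (cmap a @` cdom a) (mat a).
Proof.
move=> aM j; have [sH _ _] := CHP aM; have oI := @cimg_open _ _ _ a.
apply: (Ck_mulmx oI); last exact: smooth_on_cst.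
apply: (Ck_mulmx oI); last first.
  by apply: (Ck_comp_mx oI openT (f := Hof a)) => //; exact: sH.
apply: (Ck_mxE oI) => i l.
have : Ck j (cmap a @` cdom a) (fun w => 'D_('e_i) (Hof a) w 0 l).
  by apply: (Ck_coord oI); have [_] := sH j.+1; apply.
apply: (eq_Ck oI) => w aw.
have dH : differentiable (Hof a) w by have [+ _] := sH 1%N; apply.
rewrite (deriveEjacobian _ dH).
by have /matrixP/(_ 0 l) := rowE i ('J (Hof a) w); rewrite mxE.
Qed.

Definition level_acs : almost_complex M.
Proof.
refine (@AlmostComplex R m M (fun p => @actJ p) actJ_sq _).
move=> a aM; exists (mat a); split; first exact: mat_smooth.
by move=> p c v <-.
Defined.

Let val_smooth : smooth_map (set_val : M -> euclidean R (m + 2)).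
Proof.
split; first exact: val_continuous.
move=> a b aM -> j.
have [sH HE _] := CHP aM; have oI := @cimg_open _ _ _ a.
apply: (@Ck_sub _ _ (cmap a @` cdom a)) => [_ [p [ap _] <-]|]; first by exists p.
by apply: (eq_Ck oI _ (sH j)) => w aw; rewrite /= HE.
Qed.

Definition level_inclusion : smoothMap M (euclidean R (m + 2)) :=
  SmoothMap val_smooth.

Let tangent_inclusionE (p : M) (v : tangent p) (a : chart_at p)
    (b : chart_at (level_inclusion p)) :
  tangent_map level_inclusion v b = v a *m L a (cmap a p).
Proof.
rewrite (tangent_mapE _ a) euclidean_chart /=.
have [sH HE _] := CHP (chart_atlas a).
have near_img : \forall z \near cmap a p, (cmap a @` cdom a) z.
  apply: open_nbhs_nbhs; split; first exact: cimg_open.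
  by exists p => //; exact: chart_dom.
rewrite -(deriveEjacobian _ (diffH a)) -deriveE.
  by apply: near_eq_derive; apply: filterS near_img => z imz /=; rewrite HE.
have e : \forall z \near cmap a p, Hof a z = ((fun y : E => y) \o set_val \o cinv a) z.
  by apply: filterS near_img => z imz /=; rewrite HE.
exact: (eq_near_differentiable e (diffH a)).
Qed.

Lemma level_embedding :
  pseudo_holomorphic_embedding level_acs (euclidean_acs sA A2) level_inclusion.
Proof.
split; first split.
- by move=> p q pq; exact: val_inj.
- by move=> U [V oV VU]; exists V.
- move=> p v w vw.
  have [g gK _] := coords_bij (some_chart p); apply: (can_inj gK).
  have [a0 _] := chart_at_nonempty (level_inclusion p).
  have := congr1 (fun t : tangent (level_inclusion p) => t a0 *m Cof (some_chart p)) vw.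
  rewrite !(tangent_inclusionE _ (some_chart p)) -!mulmxA.
  by have [_ -> _ _] := chartP (some_chart p); rewrite !mulmx1.
- move=> p v; apply: val_inj; apply/funext => b.
  rewrite -[LHS]/(tangent_map level_inclusion (level_acs p v) b).
  rewrite -[RHS]/(euclidean_acs sA A2 (level_inclusion p) (tangent_map level_inclusion v) b).
  rewrite euclidean_acsE !(tangent_inclusionE _ (some_chart p)).
  by rewrite -[level_acs p v _]/(coordsJ v _) coordsJE actE.
Qed.

End LevelACS.

(** * Extension of the almost-complex structure *)

Section SmoothStep.
Variable R : realType.
Implicit Types (p : {poly R}) (x : R).

(* The functions p(1/x) exp(-1/x), extended by 0 to x <= 0, are closed under
   differentiation. *)
Let bump_exp p x : R := if 0 < x then p.[x^-1] * expR (- x^-1) else 0.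

(** A quadratic bound gives derivative 0 at the origin. It follows from t^(i+2) <= (i+2)! exp t at t
    = 1/x, applied to each monomial; hence the factorials. *)
Let bump_exp_bound p : exists2 C : R, 0 <= C & forall x, `|bump_exp p x| <= C * x ^+ 2.
Proof.
exists (\sum_(i < size p) `|p`_i| * i.+2`!%:R) => [|x].
  by apply: sumr_ge0 => i _; rewrite mulr_ge0.
have C0 : 0 <= \sum_(i < size p) `|p`_i| * i.+2`!%:R :> R.
  by apply: sumr_ge0 => i _; rewrite mulr_ge0.
rewrite /bump_exp; case: ifP => x0; last by rewrite normr0 mulr_ge0// sqr_ge0.
have t0 : 0 < x^-1 by rewrite invr_gt0.
rewrite normrM (ger0_norm (expR_ge0 _)) expRN ler_pdivrMr ?expR_gt0//.
rewrite -(ler_pM2r (exprn_gt0 2 t0)).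
set C := \sum_(i < _) _ in C0 *.
have -> : C * x ^+ 2 * expR x^-1 * x^-1 ^+ 2 = C * expR x^-1.
  by field; rewrite gt_eqF.
rewrite horner_coef -[X in _ * X](ger0_norm (exprn_ge0 2 (ltW t0))) -normrM mulr_suml.
apply: le_trans (ler_norm_sum _ _ _) _; rewrite mulr_suml; apply: ler_sum => i _.
rewrite -[X in `|X|]mulrA normrM -[leRHS]mulrA ler_wpM2l// -exprD ger0_norm ?exprn_ge0 ?(ltW t0)// addn2.
have := @expR_ge1Dxn R x^-1 i.+1 (ltW t0).
have f0 : (0 : R) < i.+2`!%:R by rewrite ltr0n fact_gt0.
move=> h; rewrite -ler_pdivrMl//; apply: le_trans h; rewrite mulrC.
by rewrite lerDr.
Qed.

Let bump_exp_diff p x :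
  differentiable (bump_exp p) x /\ 'D_1 (bump_exp p) x = bump_exp ('X^2 * (p - p^`())) x.
Proof.
have [x0|x0|->] := ltgtP x 0.
- have e : \forall y \near x, cst 0 y = bump_exp p y.
    have : \forall y \near x, y < 0 by exact: lt_nbhsl.
    by apply: filterS => y y0; rewrite /bump_exp ltNge (ltW y0).
  split; first exact: (eq_near_differentiable e (differentiable_cst _ _)).
  rewrite -(eq_near_diff (1 : R) e) derive_cst /bump_exp ltNge (ltW x0) //.
- pose g (y : R) := p.[y^-1] * expR (- y^-1).
  have e : \forall y \near x, g y = bump_exp p y.
    have : \forall y \near x, 0 < y by exact: lt_nbhsr.
    by apply: filterS => y y0; rewrite /bump_exp y0.
  have xn0 : x != 0 by rewrite gt_eqF.
  have dV : is_derive x (1 : R) (fun y : R => y^-1) (- x ^- 2).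
    have := @is_deriveV R id x 1 1 xn0 (is_derive_id _ _).
    by rewrite /= -[_ *: _]/(_ * _) mulr1.
  have dp : is_derive x (1 : R) (fun y => p.[y^-1]) (p^`().[x^-1] * - x ^- 2).
    exact: (@is_derive1_comp R (horner p) (fun y => y^-1) x _ _ (is_derive_poly p x^-1) dV).
  have dN : is_derive x (1 : R) (fun y : R => - y^-1) (x ^- 2).
    by rewrite -[x ^- 2]opprK; exact: (is_deriveN dV).
  have dE : is_derive x (1 : R) (fun y => expR (- y^-1)) (expR (- x^-1) * x ^- 2).
    exact: (@is_derive1_comp R (@expR R) (fun y => - y^-1) x _ _ (is_derive_expR _) dN).
  have dg : is_derive x (1 : R) g (p.[x^-1] *: (expR (- x^-1) * x ^- 2) +
      expR (- x^-1) *: (p^`().[x^-1] * - x ^- 2)).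
    exact: (is_deriveM dp dE).
  have dgx : differentiable g x by apply/derivable1_diffP; have [] := dg.
  split; first exact: (eq_near_differentiable e dgx).
  rewrite -(eq_near_diff (1 : R) e) (@derive_val _ _ _ _ _ _ _ dg) /bump_exp x0.
  rewrite !hornerE -![_ *: _]/(_ * _) exprVn; ring.
- have [C C0 fC] := bump_exp_bound p.
  pose L : {linear R -> R} := \0.
  have cL : continuous L by move=> y; exact: cvg_cst.
  have [|d0 e0] := @diff_eps R R R (bump_exp p) 0 L cL.
    move=> e e0.
    have e1 : 0 < e / (C + 1) by rewrite divr_gt0// ltr_wpDl.
    have : \forall h \near (0 : R), `|h| < e / (C + 1) by exact: nbhs0_lt.
    apply: filterS => h he; rewrite addr0 /L /= addr0 {2}/bump_exp ltxx subr0.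
    apply: le_trans (fC h) _; rewrite -(real_normK (num_real h)) expr2 mulrA ler_wpM2r//.
    apply: (@le_trans _ _ (C * (e / (C + 1)))); first by rewrite ler_wpM2l// ltW.
    by rewrite mulrCA ler_piMr ?ltW// ltr_pdivrMr ?ltr_wpDl// mul1r ltrDl.
  split=> //; rewrite deriveE//.
  by rewrite (congr1 (fun F : R -> R => F 1) e0) /bump_exp ltxx.
Qed.

Let flat_smooth p : smooth_on setT (bump_exp p).
Proof.
move=> k; elim: k p => [|k ih] p.
  by move=> x _; exact: differentiable_continuous (bump_exp_diff p x).1.
split=> [x _|v]; first exact: (bump_exp_diff p x).1.
have : Ck k setT (fun x => v * bump_exp ('X^2 * (p - p^`())) x).
  by apply: (Ck_mul openT); [exact: smooth_on_cst|exact: ih].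
apply: (eq_Ck openT) => x _; have [dfx <-] := bump_exp_diff p x.
rewrite [in LHS]deriveE// [RHS]deriveE//.
by have := linearZ_LR ('d (bump_exp p) x) v (1 : R); rewrite -[v *: _]/(v * 1) mulr1.
Qed.

Definition bump0 x := bump_exp 1 x.

Lemma bump0_gt0 x : (0 < bump0 x) = (0 < x).
Proof.
rewrite /bump0 /bump_exp; case: ifP => // _.
by rewrite hornerC mul1r expR_gt0.
Qed.

Lemma bump0_ge0 x : 0 <= bump0 x.
Proof.
by rewrite /bump0 /bump_exp; case: ifP => // _; rewrite hornerC mul1r expR_ge0.
Qed.

Lemma bump0_eq0 x : x <= 0 -> bump0 x = 0.
Proof. by rewrite /bump0 /bump_exp leNgt => /negbTE ->. Qed.

Lemma bump0_le x y : x <= y -> bump0 x <= bump0 y.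
Proof.
have [x0 _|x0 xy] := leP x 0; first by rewrite bump0_eq0// bump0_ge0.
have y0 := lt_le_trans x0 xy; rewrite /bump0 /bump_exp x0 y0 !hornerC !mul1r.
by rewrite ler_expR lerN2 lef_pV2.
Qed.

Definition step x := bump0 x / (bump0 x + bump0 (1 - x)).

Let den_gt0 x : 0 < bump0 x + bump0 (1 - x).
Proof.
have [x0|x0] := ltP 0 x; first by rewrite ltr_pwDl ?bump0_gt0 ?bump0_ge0.
by rewrite ltr_wpDl ?bump0_ge0// bump0_gt0; lra.
Qed.

Lemma step_smooth : smooth_on setT step.
Proof.
move=> k; apply: (Ck_mul openT); first exact: flat_smooth.
apply: (Ck_inv openT) => [x _|]; first by rewrite gt_eqF.
apply: (Ck_add openT); first exact: flat_smooth.
apply: (Ck_comp_R openT openT (f := fun x => 1 - x)) => //; last exact: flat_smooth.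
apply: (Ck_add openT); first exact: smooth_on_cst.
by apply: (Ck_opp openT); exact: smooth_on_id.
Qed.

Lemma step_ge0 x : 0 <= step x.
Proof. by rewrite divr_ge0 ?bump0_ge0// ltW. Qed.

Lemma step_le1 x : step x <= 1.
Proof. by rewrite ler_pdivrMr// mul1r lerDl bump0_ge0. Qed.

Lemma step0 x : x <= 0 -> step x = 0.
Proof. by move=> x0; rewrite /step bump0_eq0// mul0r. Qed.

Lemma step1 x : 1 <= x -> step x = 1.
Proof.
move=> x1; rewrite /step (bump0_eq0 (x := 1 - x)); last by lra.
by rewrite addr0 divff// gt_eqF// bump0_gt0; lra.
Qed.

Lemma step_le x y : x <= y -> step x <= step y.
Proof.
move=> xy; rewrite ler_pdivlMr// mulrAC ler_pdivrMr// mulrC.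
have h1 := bump0_le xy; have h2 : bump0 (1 - y) <= bump0 (1 - x).
  by apply: bump0_le; lra.
have := ler_pM (bump0_ge0 x) (bump0_ge0 (1 - y)) h1 h2; lra.
Qed.

(** The numerator of the derivative is f' b + a e', with all four factors positive inside the
    interval. This is what makes the interpolated profile regular in its transition zones. *)
Lemma step_derive_neq0 x : 0 < x -> x < 1 -> 'D_1 step x != 0.
Proof.
move=> x0 x1; have xn0 : x != 0 by rewrite gt_eqF.
have de (y : R) : 0 < y -> is_derive y (1 : R) bump0 (bump_exp 'X^2 y) /\ 0 < bump_exp 'X^2 y.
  move=> y0; have [dy ey] := bump_exp_diff 1 y.
  split; last first.
    by rewrite /bump_exp y0 hornerXn mulr_gt0 ?expR_gt0// exprn_gt0// invr_gt0.
  apply: DeriveDef; first exact: diff_derivable.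
  by rewrite ey (_ : 1^`() = 0) ?subr0 ?mulr1//; exact: derivC.
have [d1 p1] := de x x0; have [] := de (1 - x); first by lra.
set e' := bump_exp _ _; set f' := bump_exp _ _ in d1 p1 *; move=> d2 p2.
have dN : is_derive x (1 : R) (fun y : R => 1 - y) (- 1).
  have := is_deriveB (is_derive_cst (1 : R) x (1 : R)) (is_derive_id x (1 : R)).
  by rewrite sub0r.
have d3 := @is_derive1_comp R bump0 (fun y => 1 - y) x _ _ d2 dN.
have d4 := is_deriveD d1 d3.
have d5 := @is_deriveV R _ x _ 1 (lt0r_neq0 (den_gt0 x)) d4.
have d6 := is_deriveM d1 d5.
have -> : 'D_1 step x = _ := @derive_val _ _ _ _ _ _ _ d6.
rewrite /= !fctE /= -![_ *: _]/(_ * _).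
have b1 : 0 < bump0 x by rewrite bump0_gt0.
have b2 : 0 < bump0 (1 - x) by rewrite bump0_gt0; lra.
set a := bump0 x in b1 *; set b := bump0 (1 - x) in b2 *.
have ab : a + b != 0 by rewrite gt_eqF// addr_gt0.
rewrite (_ : _ + _ = (f' * b + a * e') / (a + b) ^+ 2); last by field.
by rewrite gt_eqF// divr_gt0// ?exprn_gt0// ?addr_gt0// mulr_gt0.
Qed.

End SmoothStep.

(** * Projections onto planes and rotations between nearby planes *)

Section PlaneTransport.
Variables (R : realType) (k : nat).
Implicit Types M : 'M[R]_(k, 2).

Definition gram M := \det (M^T *m M).

(* [gram M] times the orthogonal projection onto the column space of M. *)
Definition gproj M := M *m \adj (M^T *m M) *m M^T.

(* For M and M' close to each other, conjugation by this matrix carries the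
   projection onto the columns of M' to the projection onto those of M. *)
Definition transport M M' :=
  gproj M *m gproj M' + ((gram M)%:M - gproj M) *m ((gram M')%:M - gproj M').

Lemma gproj_idem M : gproj M *m gproj M = gram M *: gproj M.
Proof.
rewrite /gproj -!mulmxA (mulmxA M^T M) (mulmxA (M^T *m M)) mul_mx_adj.
by rewrite mul_scalar_mx -!scalemxAr.
Qed.

Lemma gproj_ker M (v : 'rV[R]_k) : gram M != 0 ->
  v *m M = 0 <-> v *m gproj M = 0.
Proof.
move=> g0; split=> [vM|vP]; first by rewrite /gproj !mulmxA vM !mul0mx.
have : v *m gproj M *m M = gram M *: (v *m M).
  by rewrite /gproj -!mulmxA mul_adj_mx mul_mx_scalar scalemxAr.
by rewrite vP mul0mx => /esym/eqP; rewrite scaler_eq0 (negbTE g0) => /eqP.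
Qed.

(** Both products reduce to multiples of [gproj M *m gproj M']. The Gram determinants are kept as
    factors instead of being divided out, so that all these matrices are polynomial in the entries
    of [M] and [M'], hence smooth. *)
Lemma transport_gproj M M' :
  gram M' *: (gproj M *m transport M M') = gram M *: (transport M M' *m gproj M').
Proof.
have e1 : gproj M *m transport M M' = gram M *: (gproj M *m gproj M').
  rewrite /transport mulmxDr (mulmxA _ (gproj M)) (mulmxA _ (_ - _) (_ - _)).
  have -> : gproj M *m ((gram M)%:M - gproj M) = 0.
    by rewrite mulmxBr gproj_idem mul_mx_scalar subrr.
  by rewrite mul0mx addr0 gproj_idem -[LHS]scalemxAl.
have e2 : transport M M' *m gproj M' = gram M' *: (gproj M *m gproj M').
  rewrite /transport mulmxDl -(mulmxA _ (gproj M')) -(mulmxA (_ - _) (_ - _)).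
  have -> : ((gram M')%:M - gproj M') *m gproj M' = 0.
    by rewrite mulmxBl gproj_idem mul_scalar_mx subrr.
  by rewrite mulmx0 addr0 gproj_idem -[LHS]scalemxAr.
by rewrite e1 e2 !scalerA mulrC.
Qed.

(** This gives invertibility on the diagonal, which a compactness argument extends to nearby pairs
    of frames. *)
Lemma transport_diag M : transport M M = (gram M ^+ 2)%:M.
Proof.
rewrite /transport mulmxBr !mulmxBl gproj_idem !mul_mx_scalar !mul_scalar_mx.
by rewrite subrr subr0 addrC subrK scale_scalar_mx.
Qed.

Variables (V : normedModType R) (U : set V).
Hypothesis oU : open U.

Lemma Ck_adj n j (f : V -> 'M[R]_n) : Ck j U f -> Ck j U (fun x => \adj (f x)).
Proof.
move=> fk; apply: (Ck_mxE oU) => a b.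
apply: (@eq_Ck _ _ _ oU _ _ (fun x => cofactor (f x) b a)) => [x _|]; first by rewrite mxE.
apply: (Ck_mul oU); first exact: smooth_on_cst.
apply: (Ck_det oU); apply: (Ck_mxE oU) => i l.
by apply: (@eq_Ck _ _ _ oU _ _ (fun x => f x (lift b i) (lift a l))) => [x _|];
  [rewrite !mxE|exact: (Ck_coord oU)].
Qed.

Lemma Ck_gram j (f : V -> 'M[R]_(k, 2)) : Ck j U f -> Ck j U (fun x => gram (f x)).
Proof. by move=> fj; apply: (Ck_det oU); apply: (Ck_mulmx oU) => //; exact: (Ck_tr oU). Qed.

Lemma Ck_gproj j (f : V -> 'M[R]_(k, 2)) : Ck j U f -> Ck j U (fun x => gproj (f x)).
Proof.
move=> fj; have fT := Ck_tr oU fj; apply: (Ck_mulmx oU) => //; apply: (Ck_mulmx oU) => //.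
by apply: Ck_adj; exact: (Ck_mulmx oU).
Qed.

Lemma Ck_scalar_mx n j (c : V -> R) : Ck j U c -> Ck j U (fun x => (c x)%:M : 'M[R]_n).
Proof.
move=> cj; apply: (Ck_mxE oU) => a b.
apply: (@eq_Ck _ _ _ oU _ _ (fun x => c x * (a == b)%:R)) => [x _|].
  by rewrite mxE mulr_natr.
by apply: (Ck_mul oU) => //; exact: smooth_on_cst.
Qed.

Lemma Ck_addmx m n j (f g : V -> 'M[R]_(m, n)) :
  Ck j U f -> Ck j U g -> Ck j U (fun x => f x + g x).
Proof. exact: (Ck_add oU). Qed.

Lemma Ck_oppmx m n j (f : V -> 'M[R]_(m, n)) :
  Ck j U f -> Ck j U (fun x => - f x).
Proof.
move=> fj; apply: (Ck_mxE oU) => a b.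
apply: (@eq_Ck _ _ _ oU _ _ (fun x => - f x a b)) => [x _|]; first by rewrite [RHS]mxE.
exact/(Ck_opp oU)/(Ck_coord oU).
Qed.

Lemma Ck_scalemx m n j (c : V -> R) (f : V -> 'M[R]_(m, n)) :
  Ck j U c -> Ck j U f -> Ck j U (fun x => c x *: f x).
Proof.
move=> cj fj; apply: (Ck_mxE oU) => a b.
apply: (@eq_Ck _ _ _ oU _ _ (fun x => c x * f x a b)) => [x _|]; first by rewrite [RHS]mxE.
by apply: (Ck_mul oU) => //; exact: (Ck_coord oU).
Qed.

Lemma Ck_transport j (f g : V -> 'M[R]_(k, 2)) : Ck j U f -> Ck j U g ->
  Ck j U (fun x => transport (f x) (g x)).
Proof.
move=> fj gj; have [hf hg] := (Ck_gproj fj, Ck_gproj gj).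
apply: Ck_addmx; first exact: (Ck_mulmx oU).
by apply: (Ck_mulmx oU); apply: Ck_addmx; [|exact: Ck_oppmx| |exact: Ck_oppmx];
  apply: Ck_scalar_mx; exact: Ck_gram.
Qed.

End PlaneTransport.

Section ExtendJ.
Variables (R : realType) (k : nat).
Local Notation E := 'rV[R]_k.

Definition sqn (x : E) : R := \sum_i x 0 i ^+ 2.

Lemma sqn_smooth : smooth_on setT sqn.
Proof.
move=> j; apply: (Ck_sum openT) => i _; apply: (Ck_exp openT).
by apply: (Ck_coord openT); exact: smooth_on_id.
Qed.

Lemma sqn_compact (c : R) (A : set E) : closed A ->
  (forall x, A x -> sqn x <= c) -> compact A.
Proof.
move=> cA Ac; apply: bounded_closed_compact => //.
exists (c + 1); split; first exact: num_real.
move=> b bc x /Ac xc; apply: mx_norm_le => [|i j].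
  have : 0 <= sqn x by apply: sumr_ge0 => i _; exact: sqr_ge0.
  by lra.
have : x i j ^+ 2 <= sqn x.
  rewrite (ord1 i) /sqn (bigD1 j)//= lerDl.
  by apply: sumr_ge0 => l _; exact: sqr_ge0.
rewrite -(real_normK (num_real (x i j))); have := normr_ge0 (x i j).
by nra.
Qed.

Variables (B0 Psi : E -> 'M[R]_(k, 2)) (N : E -> R) (J0 : 'M[R]_k) (r : R).
Hypotheses (sB0 : smooth_on setT B0) (sPsi : smooth_on setT Psi).
Hypotheses (sN : smooth_on setT N) (N0 : forall x, 0 <= N x).
Hypotheses (r0 : 0 <= r) (Nr : forall x, N x = 0 -> sqn x <= r).
Hypothesis J2 : J0 *m J0 = - 1%:M.

Definition frame_path (s : R) x := (1 - s) *: B0 x + s *: Psi x.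

Hypothesis Bgram : forall x s, N x = 0 -> 0 <= s <= 1 -> gram (frame_path s x) != 0.
Hypothesis Pgram : forall x, gram (Psi x) != 0.
Hypothesis JPsi : forall x, J0 *m gproj (Psi x) = gproj (Psi x) *m J0.

Let frame_path1 x : frame_path 1 x = Psi x.
Proof. by rewrite /frame_path subrr scale0r add0r scale1r. Qed.

Let Ck_frame (V : normedModType R) (U : set V) (oU : open U) j (s : V -> R) (g : V -> E) :
  Ck j U s -> Ck j U (fun x => B0 (g x)) -> Ck j U (fun x => Psi (g x)) ->
  Ck j U (fun x => frame_path (s x) (g x)).
Proof.
move=> sj bj pj; apply: (Ck_addmx oU); apply: (Ck_scalemx oU) => //.
by apply: (Ck_add oU); [exact: smooth_on_cst|exact: (Ck_opp oU)].
Qed.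

Let ball_closed c : closed [set x : E | sqn x <= c].
Proof.
apply: (@preimage_closed _ _ sqn [set y | y <= c]); last exact: closed_le.
by move=> x _; exact: (sqn_smooth 0%N).
Qed.

Let I01 : set R := `[0, 1].

(** The function N + gram^2 is positive on a compact set, hence has a positive minimum there; where
    [N] is at most half of it, the Gram determinant cannot vanish. *)
Let good_nbhs : exists2 c : R, 0 < c & forall x s, sqn x <= r + 1 -> N x <= c ->
  0 <= s <= 1 -> gram (frame_path s x) != 0.
Proof.
pose f (z : E * R) := N z.1 + gram (frame_path z.2 z.1) ^+ 2.
have cf : continuous f.
  suff h : Ck 0 setT f by move=> z; exact: h.
  have c1 g : smooth_on setT g -> Ck 0 setT (fun z : E * R => g z.1 : 'M[R]_(k, 2)).
    by move=> gs z _; apply: (@continuous_comp _ _ _ fst g); [exact: cvg_fst|exact: (gs 0%N)].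
  apply: (Ck_add openT).
    by move=> z _; apply: (@continuous_comp _ _ _ fst N); [exact: cvg_fst|exact: (sN 0%N)].
  apply: (Ck_exp openT); apply: (Ck_gram openT); apply: (Ck_frame openT); try exact: c1.
  by move=> z _; exact: cvg_snd.
pose D := [set x : E | sqn x <= r + 1] `*` I01.
have cD : compact D.
  apply: compact_setX; last exact: segment_compact.
  exact: (@sqn_compact (r + 1)).
have D0 : D !=set0.
  exists (0, 0); split => /=; last by rewrite /I01 /= in_itv /= lexx ler01.
  rewrite /sqn big1 ?addr_ge0// => i _; by rewrite mxE expr0n.
have [[x s]] := compact_EVT_min D0 cD (continuous_subspaceT cf).
rewrite inE => -[/= xD sD] min.
have f0 : 0 < f (x, s).
  rewrite /f /= lt_def addr_ge0 ?sqr_ge0// andbT.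
  apply/eqP => h; have Nx : N x = 0.
    by apply/eqP; rewrite eq_le N0 andbT -h lerDl sqr_ge0.
  move: h; rewrite Nx add0r => /eqP; rewrite sqrf_eq0; apply/negP/Bgram => //.
exists (f (x, s) / 2); first by rewrite divr_gt0.
move=> y t yr Ny ty; apply/eqP => g0.
have := min (y, t); rewrite inE => /(_ _)/wrap[].
  by split => //=; rewrite /I01 /= in_itv.
by rewrite {2}/f /= g0 expr0n addr0; lra.
Qed.

(** The same argument for (s - t)^2 + det^2, which is positive because the transport from a frame to
    itself is a nonzero scalar. A step whose square is below the minimum is then harmless. *)
Let steps c : 0 < c -> (forall x s, sqn x <= r + 1 -> N x <= c ->
    0 <= s <= 1 -> gram (frame_path s x) != 0) ->
  exists n : nat, forall x s t, sqn x <= r + 1 -> N x <= c ->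
    0 <= s <= 1 -> 0 <= t <= 1 -> `|s - t| <= n.+1%:R^-1 ->
    transport (frame_path s x) (frame_path t x) \in unitmx.
Proof.
move=> c0 cgood.
pose d (z : E * R * R) := \det (transport (frame_path z.1.2 z.1.1) (frame_path z.2 z.1.1)).
pose f (z : E * R * R) := (z.1.2 - z.2) ^+ 2 + d z ^+ 2.
have cx : Ck 0 setT (fun z : E * R * R => z.1.1).
  by move=> z _; apply: (@continuous_comp _ _ _ fst fst); exact: cvg_fst.
have cs : Ck 0 setT (fun z : E * R * R => z.1.2).
  by move=> z _; apply: (@continuous_comp _ _ _ fst snd); [exact: cvg_fst|exact: cvg_snd].
have ct : Ck 0 setT (fun z : E * R * R => z.2) by move=> z _; exact: cvg_snd.
have cf : continuous f.
  suff h : Ck 0 setT f by move=> z; exact: h.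
  have c1 g : smooth_on setT g -> Ck 0 setT (fun z : E * R * R => g z.1.1 : 'M[R]_(k, 2)).
    move=> gs z _; apply: (@continuous_comp _ _ _ (fun z : E * R * R => z.1.1) g).
      exact: cx.
    exact: (gs 0%N).
  apply: (Ck_add openT); apply: (Ck_exp openT).
    by apply: (Ck_add openT) => //; exact: (Ck_opp openT).
  by apply: (Ck_det openT); apply: (Ck_transport openT); apply: (Ck_frame openT) => //; exact: c1.
pose K := [set x : E | sqn x <= r + 1] `&` [set x | N x <= c].
have cK : compact K.
  apply: (@sqn_compact (r + 1)); last by move=> x [].
  apply: closedI; first exact: ball_closed.
  apply: (@preimage_closed _ _ N [set y | y <= c]); last exact: closed_le.
  by move=> x _; exact: (sN 0%N).
pose D := K `*` I01 `*` I01.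
have cD : compact D.
  apply: compact_setX; last exact: segment_compact.
  by apply: compact_setX => //; exact: segment_compact.
have [D0|/set0P nD0] := eqVneq D set0.
  exists 0%N => x s t xr xc s01 t01 _; exfalso.
  have : D (x, s, t) by split; first split; rewrite /I01 /= ?in_itv.
  by rewrite D0.
have [[[x s] t]] := compact_EVT_min nD0 cD (continuous_subspaceT cf).
rewrite inE => -[[/= [xr xc] sD] /= tD] min.
have f0 : 0 < f (x, s, t).
  rewrite /f /= lt_def addr_ge0 ?sqr_ge0// andbT.
  rewrite paddr_eq0 ?sqr_ge0// !sqrf_eq0 subr_eq0; apply/negP => /andP[/eqP st].
  rewrite /d /= -st transport_diag det_scalar expf_eq0 => /andP[_].
  rewrite sqrf_eq0; apply/negP/cgood => //.
have [n nf] : exists n : nat, n.+1%:R^-1 ^+ 2 < f (x, s, t).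
  have [//|n] := @ltr_add_invr R 0 (f (x, s, t)) _; rewrite add0r => nf.
  exists n; apply: le_lt_trans nf.
  by rewrite expr2 ler_piMr ?invr_ge0// invf_le1// ler1n.
exists n => y a b yr yc a01 b01 ab; rewrite unitmxE unitfE; apply/eqP => d0.
have := min (y, a, b); rewrite inE => /(_ _)/wrap[].
  by split; first split; rewrite /I01 /= ?in_itv.
rewrite {2}/f /= /d /= d0 expr0n addr0 => h.
have h2 : (a - b) ^+ 2 <= n.+1%:R^-1 ^+ 2.
  by rewrite -(real_normK (num_real _)) lerXn2r ?nnegrE ?invr_ge0.
by have := le_lt_trans (le_trans h h2) nf; rewrite ltxx.
Qed.

Theorem extend_J : exists A : E -> 'M[R]_k,
  [/\ smooth_on setT A, forall x, A x *m A x = - 1%:M &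
      forall x (v : E), N x = 0 -> v *m B0 x = 0 -> v *m A x *m B0 x = 0].
Proof.
have [c c0 cgood] := good_nbhs; have [n nsteps] := steps c0 cgood.
(* A cut-off equal to 1 on the zero set of [N], and to 0 outside the region where frames and
   transports are controlled. Where it vanishes all the frames below coincide with [Psi x], and the
   transports are scalars. *)
pose al x := step (1 - N x / c) * step (r + 1 - sqn x).
have al01 x : 0 <= al x <= 1.
  by rewrite /al mulr_ge0 ?step_ge0//= mulr_ile1 ?step_ge0// step_le1.
have sal : smooth_on setT al.
  have h (g : E -> R) : smooth_on setT g -> smooth_on setT (fun x => step (g x)).
    move=> gs j; apply: (Ck_comp_R openT openT) => //; exact: step_smooth.
  move=> j; apply: (Ck_mul openT); apply: h => {}j; apply: (Ck_add openT);
    try exact: smooth_on_cst; apply: (Ck_opp openT); last exact: sqn_smooth.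
  by apply: (Ck_mul openT); [exact: sN|exact: smooth_on_cst].
have alZ x : N x = 0 -> al x = 1.
  move=> Nx; rewrite /al Nx mul0r subr0 (step1 (lexx 1)) mul1r step1//.
  by have := Nr Nx; lra.
have alK x : al x != 0 -> sqn x <= r + 1 /\ N x <= c.
  rewrite /al mulf_eq0 negb_or => /andP[h1 h2]; split.
    by rewrite leNgt; apply/negP => h; move: h2; rewrite step0 ?eqxx//; lra.
  rewrite leNgt; apply/negP => h; move: h1; rewrite step0 ?eqxx//.
  have h3 : 1 < N x / c by rewrite ltr_pdivlMr ?mul1r.
  by lra.
(* The frames start at [Psi] for i = 0 and reach, after [n.+1] steps, the parameter [1 - al x],
   which is [B0] on the zero set of [N]. *)
pose t i x := 1 - al x * (i%:R / n.+1%:R).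
have t01 i x : (i <= n.+1)%N -> 0 <= t i x <= 1.
  move=> ni; have q0 : 0 <= i%:R / n.+1%:R :> R by rewrite divr_ge0.
  have q1 : i%:R / n.+1%:R <= 1 :> R by rewrite ler_pdivrMr ?ltr0n// mul1r ler_nat.
  have /andP[a0 a1] := al01 x; rewrite /t.
  have := mulr_ge0 a0 q0; have := mulr_ile1 a0 q0 a1 q1.
  by rewrite subr_ge0 gerBl => -> ->.
have st i : smooth_on setT (t i).
  move=> j; apply: (Ck_add openT); first exact: smooth_on_cst.
  by apply: (Ck_opp openT); apply: (Ck_mul openT) => //; exact: smooth_on_cst.
pose fr i x := frame_path (t i x) x.
have sfr i : smooth_on setT (fr i).
  move=> j; apply: (Ck_frame openT); [exact: st|exact: sB0|exact: sPsi].
pose T i x := transport (fr i x) (fr i.+1 x).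
have sT i : smooth_on setT (T i) by move=> j; apply: (Ck_transport openT); exact: sfr.
have gfr i x : (i <= n.+1)%N -> gram (fr i x) != 0.
  move=> ni; have [al0|] := eqVneq (al x) 0.
    by rewrite /fr /t al0 mul0r subr0 frame_path1.
  by move=> /alK[xr xc]; apply: cgood => //; exact: t01.
have uT i x : (i <= n)%N -> T i x \in unitmx.
  move=> ni; have [al0|] := eqVneq (al x) 0.
    rewrite /T /fr /t al0 !mul0r subr0 !frame_path1 transport_diag unitmxE det_scalar.
    by rewrite unitfE expf_neq0// sqrf_eq0.
  move=> /alK[xr xc]; apply: nsteps => //; [by apply: t01; exact: leqW|exact: t01|].
  have /andP[a0 a1] := al01 x.
  rewrite /t (_ : _ - _ = al x * n.+1%:R^-1).
    by rewrite normrM (ger0_norm a0) ger0_norm ?invr_ge0// ler_piMl ?invr_ge0.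
  by rewrite -[i.+1]addn1 natrD; set w := n.+1%:R^-1; ring.
pose A := fix A i x := if i is i'.+1 then A i' x *m T i' x else 1%:M.
have sA i : smooth_on setT (A i).
  elim: i => [|i ih] j; first exact: smooth_on_cst.
  by apply: (Ck_mulmx openT); [exact: ih|exact: sT].
have uA i x : (i <= n.+1)%N -> A i x \in unitmx.
  elim: i => [|i ih] ni; first exact: unitmx1.
  by rewrite /= unitmx_mul ih ?uT// ltnW.
(* The product of the transports conjugates one projection into the other only up to a nonzero
   scalar; this suffices, since the projections serve to describe kernels. *)
have PA i x : (i <= n.+1)%N -> exists2 l : R, l != 0 &
    gproj (fr 0 x) *m A i x = l *: (A i x *m gproj (fr i x)).
  elim: i => [|i ih] ni; first by exists 1; rewrite ?oner_eq0//= scale1r mulmx1 mul1mx.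
  have [l l0 e] := ih (ltnW ni).
  exists (l * (gram (fr i x) / gram (fr i.+1 x))).
    by rewrite !mulf_neq0 ?invr_eq0 ?gfr// ltnW.
  rewrite /= mulmxA e -scalemxAl -mulmxA -scalerA; congr (_ *: _).
  rewrite -(mulmxA (A i x) (T i x)) [RHS]scalemxAr; congr (_ *m _).
  have := transport_gproj (fr i x) (fr i.+1 x); rewrite -/(T i x).
  move=> /(congr1 (fun M => (gram (fr i.+1 x))^-1 *: M)).
  by rewrite !scalerA mulVf ?gfr// scale1r mulrC.
pose Jh x := invmx (A n.+1 x) *m J0 *m A n.+1 x.
exists Jh; split=> [j|x|x v Nx vB].
- apply: (Ck_mulmx openT) => //; last exact: sA.
  apply: (Ck_mulmx openT); last exact: smooth_on_cst.
  by apply: (Ck_invmx openT) => [x _|]; [exact: uA|exact: sA].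
- rewrite /Jh; move: (A n.+1 x) (uA n.+1 x (leqnn _)) => An uAn.
  by rewrite !mulmxA mulmxK// -(mulmxA _ J0 J0) J2 mulmxN mulmx1 mulNmx mulVmx.
- have frE : fr n.+1 x = B0 x.
    by rewrite /fr /t alZ// mul1r divff ?pnatr_eq0// subrr /frame_path subr0 scale0r addr0 scale1r.
  have fr0E : fr 0%N x = Psi x by rewrite /fr /t mul0r mulr0 subr0 frame_path1.
  have gB : gram (B0 x) != 0 by rewrite -frE gfr.
  apply/(gproj_ker _ gB); move/(gproj_ker _ gB) : vB => vP.
  have [l l0 e] := PA n.+1 x (leqnn _).
  move: e; rewrite frE fr0E /Jh; move: (A n.+1 x) (uA n.+1 x (leqnn _)) => An uAn e.
  have PsiE : gproj (Psi x) = l *: (An *m gproj (B0 x) *m invmx An).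
    by rewrite scalemxAl -e mulmxK.
  apply: (scalerI l0); rewrite scaler0 scalemxAr.
  have -> : l *: gproj (B0 x) = invmx An *m gproj (Psi x) *m An.
    by rewrite PsiE -scalemxAr -scalemxAl !mulmxA mulVmx// mul1mx mulmxKV.
  have := JPsi x; move: (gproj (Psi x)) (gproj (B0 x)) PsiE vP => P Q PsiE vP JP.
  rewrite !mulmxA mulmxK// -(mulmxA _ J0 P) JP PsiE !mulmxA -scalemxAr -!scalemxAl.
  by rewrite !mulmxA mulmxKV// vP !mul0mx scaler0.
Qed.

End ExtendJ.

(** * Paths and functors on paths *)

Section Continuity.
Variables (R : realType) (T : topologicalType).
Implicit Types f g : T -> R.

Lemma contD f g : continuous f -> continuous g -> continuous (fun t => f t + g t).
Proof. by move=> cf cg t; exact: (cvgD (cf t) (cg t)). Qed.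

Lemma contN f : continuous f -> continuous (fun t => - f t).
Proof. by move=> cf t; exact: (cvgN (cf t)). Qed.

Lemma contM f g : continuous f -> continuous g -> continuous (fun t => f t * g t).
Proof. by move=> cf cg t; exact: (cvgM (cf t) (cg t)). Qed.

Lemma contX f n : continuous f -> continuous (fun t => f t ^+ n).
Proof.
move=> cf; elim: n => [|n ih]; first by move=> t; exact: cvg_cst.
rewrite (_ : (fun t => _) = fun t => f t * f t ^+ n); first exact: contM.
by apply/funext => t; rewrite exprS.
Qed.

Lemma contmax f g : continuous f -> continuous g ->
  continuous (fun t => Num.max (f t) (g t)).
Proof. by move=> cf cg t; exact: (@continuous_max _ _ f g t (cf t) (cg t)). Qed.

Lemma contmin f g : continuous f -> continuous g ->
  continuous (fun t => Num.min (f t) (g t)).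
Proof. by move=> cf cg t; exact: (@continuous_min _ _ f g t (cf t) (cg t)). Qed.

Lemma contcst (U : topologicalType) (c : U) : continuous (fun _ : T => c).
Proof. by move=> t; exact: cvg_cst. Qed.

Lemma contid : continuous (fun t : T => t).
Proof. by move=> t; exact: cvg_id. Qed.

Lemma contfst (U V : topologicalType) (f : T -> U * V) :
  continuous f -> continuous (fun t => (f t).1).
Proof. by move=> cf t; apply: (continuous_comp (cf t)); exact: cvg_fst. Qed.

Lemma contsnd (U V : topologicalType) (f : T -> U * V) :
  continuous f -> continuous (fun t => (f t).2).
Proof. by move=> cf t; apply: (continuous_comp (cf t)); exact: cvg_snd. Qed.

Lemma contpair (U V : topologicalType) (f : T -> U) (g : T -> V) :
  continuous f -> continuous g -> continuous (fun t => (f t, g t)).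
Proof. by move=> cf cg t; exact: (cvg_pair (cf t) (cg t)). Qed.

Lemma contcomp (U V : topologicalType) (f : T -> U) (g : U -> V) :
  continuous g -> continuous f -> continuous (fun t => g (f t)).
Proof. by move=> cg cf t; apply: (continuous_comp (cf t)); exact: cg. Qed.

End Continuity.

Ltac cont := repeat lazymatch goal with
  | |- continuous (fun _ => ?c) => exact: contcst
  | |- continuous (fun t => t) => exact: contid
  | |- continuous (fun t => fst t) => exact: (contfst (@contid _))
  | |- continuous (fun t => snd t) => exact: (contsnd (@contid _))
  | |- continuous (fun _ => Order.max _ _) => apply: contmax
  | |- continuous (fun _ => Order.min _ _) => apply: contmin
  | |- continuous (fun _ => (_ + _)%R) => apply: contD
  | |- continuous (fun _ => (- _)%R) => apply: contN
  | |- continuous (fun _ => (_ * _)%R) => apply: contM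
  | |- continuous (fun _ => (_ ^+ _)%R) => apply: contX
  | |- continuous (fun _ => fst _) => apply: contfst
  | |- continuous (fun _ => snd _) => apply: contsnd
  | |- continuous (fun _ => (_, _)) => apply: contpair
  | |- continuous id => exact: contid
  | H : continuous ?f |- continuous ?f => exact: H
  | H : forall _, continuous _ |- continuous _ => exact: H
  | H : continuous ?g |- continuous (fun t => ?g (@?f t)) => apply: (contcomp H)
  | |- continuous (_ \o _) => rewrite /comp
  | |- continuous ?f => lazymatch f with
    | @fst _ _ => exact: (contfst (@contid _))
    | @snd _ _ => exact: (contsnd (@contid _))
    | @GRing.opp _ => exact: (contN (@contid _))
    | @GRing.mul _ ?c => exact: (contM (@contcst _ _ c) (@contid _))
    | @GRing.add _ ?c => exact: (contD (@contcst _ _ c) (@contid _))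
    | @Order.max _ _ ?c => exact: (contmax (@contcst _ _ c) (@contid _))
    | @Order.min _ _ ?c => exact: (contmin (@contcst _ _ c) (@contid _))
    | @pair _ _ ?c => exact: (contpair (@contcst _ _ c) (@contid _))
    end
  end.

Ltac grp := rewrite ?(invgM, invgK, invg1, mul1g, mulg1, mulgA, mulgK, mulgVK, mulgV, mulVg)//.

Section Clamp.
Variable R : realType.

Definition cl (t : R) := Num.max 0 (Num.min t 1).

Lemma cl_itv t : 0 <= cl t <= 1.
Proof. by rewrite le_max lexx ge_max ler01 ge_min lexx orbT. Qed.

Lemma clK t : 0 <= t <= 1 -> cl t = t.
Proof. by rewrite /cl => /andP[t0 t1]; rewrite min_l// max_r. Qed.

Lemma cl_le0 t : t <= 0 -> cl t = 0.
Proof. by move=> t0; rewrite /cl max_l// ge_min t0. Qed.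

Lemma cl_ge1 t : 1 <= t -> cl t = 1.
Proof. by move=> t1; rewrite /cl min_r// max_r. Qed.

Lemma cl0 : cl 0 = 0. Proof. by rewrite cl_le0. Qed.

Lemma cl1 : cl 1 = 1. Proof. by rewrite cl_ge1. Qed.

Lemma clcl t : cl (cl t) = cl t. Proof. exact/clK/cl_itv. Qed.

Lemma cl_cont : continuous cl. Proof. by rewrite /cl; cont. Qed.

End Clamp.

Section Paths.
Variables (R : realType) (X : topologicalType) (A : set X).
Implicit Types g h k : R -> X.

Definition path_in g := continuous g /\ forall t, A (g t).

(** Paths and homotopies are maps of the whole line and plane with values in [A], so that no
    restriction to intervals is needed; only their values over the unit interval and square are
    compared. *)
Definition hot g h := exists H : R * R -> X, [/\ continuous H, forall z, A (H z),
  forall t, 0 <= t <= 1 -> H (0, t) = g t /\ H (1, t) = h t &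
  forall s, 0 <= s <= 1 -> H (s, 0) = g 0 /\ H (s, 1) = g 1].

Lemma path_comp g (phi : R -> R) : path_in g -> continuous phi -> path_in (g \o phi).
Proof. by move=> [cg Ag] cphi; split=> [|t]; [cont|exact: Ag]. Qed.

Lemma path_cst x : A x -> path_in (fun _ : R => x).
Proof. by move=> Ax; split=> // ; exact: contcst. Qed.

Lemma hot_ends g h : hot g h -> g 0 = h 0 /\ g 1 = h 1.
Proof.
move=> [H [_ _ H1 H2]].
have i0 : 0 <= (0 : R) <= 1 by apply/andP; lra.
have i1 : 0 <= (1 : R) <= 1 by apply/andP; lra.
by split; [rewrite -(H2 1 i1).1 (H1 0 i0).2|rewrite -(H2 1 i1).2 (H1 1 i1).2].
Qed.

(** The plane is convex: [F] carries over the straight-line homotopy between the curves [a] and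
    [b]. *)
Lemma hot_square (F : R * R -> X) (a b : R -> R * R) : continuous F -> (forall z, A (F z)) ->
  continuous a -> continuous b -> a 0 = b 0 -> a 1 = b 1 -> hot (F \o a) (F \o b).
Proof.
move=> cF AF ca cb ab0 ab1.
exists (fun z => F ((1 - z.1) * (a z.2).1 + z.1 * (b z.2).1,
                    (1 - z.1) * (a z.2).2 + z.1 * (b z.2).2)).
split=> [|z|t _|s _]; [|exact: AF| |].
- by apply: (contcomp cF); cont.
- by split; congr F; rewrite [RHS]surjective_pairing; congr pair; rewrite /=; ring.
- by rewrite /= -ab0 -ab1; split; congr F; rewrite [RHS]surjective_pairing; congr pair; rewrite /=; ring.
Qed.

Lemma hot_reparam g (phi psi : R -> R) : path_in g -> continuous phi -> continuous psi ->
  phi 0 = psi 0 -> phi 1 = psi 1 -> hot (g \o phi) (g \o psi).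
Proof.
move=> [cg Ag] cphi cpsi e0 e1.
apply: (@hot_square (fun z => g z.1) (fun t => (phi t, 0)) (fun t => (psi t, 0))) => //=;
  rewrite ?e0 ?e1//; cont.
Qed.

Lemma hot_eq g h : path_in g -> (forall t, 0 <= t <= 1 -> g t = h t) -> hot g h.
Proof.
move=> [cg Ag] gh; exists (fun z => g z.2); split=> [|//|t t01|//]; first by cont.
by rewrite gh.
Qed.

Lemma hot_refl g : path_in g -> hot g g.
Proof. by move=> pg; exact: hot_eq. Qed.

Lemma hot_sym g h : hot g h -> hot h g.
Proof.
move=> gh; have [e0 e1] := hot_ends gh; move: gh => [H [cH AH H1 H2]].
exists (fun z => H (1 - z.1, z.2)); split=> [|//|t t01|s /andP[s0 s1]].
- by apply: (contcomp cH); cont.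
- by rewrite /= subr0 subrr; have [-> ->] := H1 t t01.
- by rewrite /= -e0 -e1; apply: H2; apply/andP; lra.
Qed.

Lemma hot_trans g h k : hot g h -> hot h k -> hot g k.
Proof.
move=> gh; have [e0 e1] := hot_ends gh.
move: gh => [H [cH AH H1 H2]] [K [cK AK K1 K2]].
have ccl := @cl_cont R.
exists (fun z => if z.1 <= 2^-1 then H (cl (2 * z.1), cl z.2) else K (cl (2 * z.1 - 1), cl z.2)).
split=> [|z|t t01|s s01].
- apply: (@pasting R X _ (fun z => z.1) (fun z => H (cl (2 * z.1), cl z.2))
    (fun z => K (cl (2 * z.1 - 1), cl z.2))); first by cont.
  + by apply: (contcomp cH); cont.
  + by apply: (contcomp cK); cont.
  + move=> z ->; rewrite mulfV ?pnatr_eq0// subrr cl0 cl1.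
    by rewrite (H1 _ (cl_itv _)).2 (K1 _ (cl_itv _)).1.
- by case: ifP => _; [exact: AH|exact: AK].
- rewrite /= invr_ge0 ler0n mulr0 cl0 (clK t01) (H1 t t01).1; split=> //.
  rewrite ifF; last by apply/negbTE; rewrite -ltNge; lra.
  by rewrite (_ : 2 * 1 - 1 = 1) ?cl1 ?(K1 t t01).2//; lra.
- rewrite /= cl0 cl1; case: ifP => _; first exact/H2/cl_itv.
  by rewrite e0 e1; exact/K2/cl_itv.
Qed.

Definition cat g h (t : R) := if t <= 2^-1 then g (cl (2 * t)) else h (cl (2 * t - 1)).

Definition rev g (t : R) := g (1 - t).

Lemma cat0 g h : cat g h 0 = g 0.
Proof. by rewrite /cat invr_ge0 ler0n mulr0 cl0. Qed.

Lemma cat1 g h : cat g h 1 = h 1.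
Proof.
rewrite /cat ifF; last by apply/negbTE; rewrite -ltNge; lra.
by rewrite (_ : 2 * 1 - 1 = 1) ?cl1//; lra.
Qed.

Lemma rev0 g : rev g 0 = g 1. Proof. by rewrite /rev subr0. Qed.

Lemma rev1 g : rev g 1 = g 0. Proof. by rewrite /rev subrr. Qed.

Lemma path_rev g : path_in g -> path_in (rev g).
Proof. by move=> pg; apply: (path_comp (phi := fun t => 1 - t) pg); cont. Qed.

Lemma path_cat g h : path_in g -> path_in h -> g 1 = h 0 -> path_in (cat g h).
Proof.
move=> [cg Ag] [ch Ah] gh; have ccl := @cl_cont R; split=> [|t].
  apply: (@pasting R X _ id (fun t => g (cl (2 * t))) (fun t => h (cl (2 * t - 1)))); cont.
  by move=> t ->; rewrite mulfV ?pnatr_eq0// subrr cl0 cl1.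
by rewrite /cat; case: ifP.
Qed.

Lemma hot_cat g g' h h' : hot g g' -> hot h h' -> g 1 = h 0 -> hot (cat g h) (cat g' h').
Proof.
move=> [H [cH AH H1 H2]] [K [cK AK K1 K2]] gh; have ccl := @cl_cont R.
exists (fun z => if z.2 <= 2^-1 then H (cl z.1, cl (2 * z.2)) else K (cl z.1, cl (2 * z.2 - 1))).
split=> [|z|t t01|s s01].
- apply: (@pasting R X _ (fun z => z.2) (fun z => H (cl z.1, cl (2 * z.2)))
    (fun z => K (cl z.1, cl (2 * z.2 - 1)))); first by cont.
  + by apply: (contcomp cH); cont.
  + by apply: (contcomp cK); cont.
  + move=> z ->; rewrite mulfV ?pnatr_eq0// subrr cl0 cl1.
    by rewrite (H2 _ (cl_itv _)).2 (K2 _ (cl_itv _)).1.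
- by case: ifP => _; [exact: AH|exact: AK].
- rewrite /= /cat cl0 cl1; case: ifP => _; first exact/H1/cl_itv.
  exact/K1/cl_itv.
- rewrite /= invr_ge0 ler0n mulr0 cl0 (clK s01) (H2 s s01).1 cat0 cat1; split=> //.
  rewrite ifF; last by apply/negbTE; rewrite -ltNge; lra.
  by rewrite (_ : 2 * 1 - 1 = 1) ?cl1 ?(K2 s s01).2//; lra.
Qed.

(** Both concatenations are reparametrizations of a single path [e], so [hot_reparam] applies. *)
Lemma catA g h k : path_in g -> path_in h -> path_in k -> g 1 = h 0 -> h 1 = k 0 ->
  hot (cat (cat g h) k) (cat g (cat h k)).
Proof.
move=> [cg Ag] [ch Ah] [ck Ak] gh hk; have ccl := @cl_cont R.
pose e t := if t <= 2^-1 then g (cl (2 * t)) else cat h k (2 * t - 1).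
have pe : path_in e.
  split=> [|t]; last by rewrite /e /cat; case: ifP => // _; case: ifP.
  apply: (@pasting R X _ id (fun t => g (cl (2 * t))) (fun t => cat h k (2 * t - 1))).
  - by cont.
  - by cont.
  - apply: (contcomp (path_cat (conj ch Ah) (conj ck Ak) hk).1); cont.
  - by move=> t ->; rewrite mulfV ?pnatr_eq0// subrr cat0 cl1.
(* As [t] runs through the first quarter, the second quarter and the second half, [phi] runs through
   [0, 1/2], [1/2, 3/4] and [3/4, 1], where [e] follows [g], [h] and [k]. *)
pose phi t : R := 2^-1 * cl (2 * cl (2 * t)) + 4^-1 * cl (2 * cl (2 * t) - 1) + 4^-1 * cl (2 * t - 1).
pose psi t : R := cl t.
have -> : cat (cat g h) k = e \o phi.
  apply/funext => t; rewrite /cat /e /phi /=.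
  have [t1|t1] := leP t 2^-1.
    rewrite (cl_le0 (t := 2 * t - 1)); last by lra.
    set u := cl (2 * t); have /andP[u0 u1] : 0 <= u <= 1 by exact: cl_itv.
    have [u2|u2] := leP u 2^-1.
      rewrite (cl_le0 (t := 2 * u - 1)); last by lra.
      rewrite (clK (t := 2 * u)); last by apply/andP; lra.
      rewrite ifT; last by lra.
      by congr (g _); rewrite clK; [lra|apply/andP; lra].
    rewrite (cl_ge1 (t := 2 * u)); last by lra.
    rewrite (clK (t := 2 * u - 1)); last by apply/andP; lra.
    rewrite ifF; last by apply/negbTE; rewrite -ltNge; lra.
    rewrite /cat ifT; last by lra.
    by congr (h _); rewrite clK; [lra|apply/andP; lra].
  rewrite (cl_ge1 (t := 2 * t)); last by lra.
  rewrite (cl_ge1 (t := 2 * 1)); last by lra.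
  rewrite (cl_ge1 (t := 2 * 1 - 1)); last by lra.
  have [t2|t2] := leP 1 t.
    rewrite (cl_ge1 (t := 2 * t - 1)); last by lra.
    rewrite ifF; last by apply/negbTE; rewrite -ltNge; lra.
    rewrite /cat ifF; last by apply/negbTE; rewrite -ltNge; lra.
    by congr (k _); rewrite cl_ge1//; lra.
  rewrite (clK (t := 2 * t - 1)); last by apply/andP; lra.
  rewrite ifF; last by apply/negbTE; rewrite -ltNge; lra.
  rewrite /cat ifF; last by apply/negbTE; rewrite -ltNge; lra.
  by congr (k _); rewrite clK; [lra|apply/andP; lra].
have -> : cat g (cat h k) = e \o psi.
  apply/funext => t; rewrite /cat /e /psi /=.
  have [t1|t1] := leP t 2^-1.
    rewrite ifT; last by rewrite /cl; case: (leP t 1) => ?; rewrite ge_max; apply/andP; lra.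
    congr (g _); have [t0|t0] := leP t 0; first by rewrite !cl_le0//; lra.
    by rewrite [cl t]clK//; apply/andP; lra.
  have [t2|t2] := leP 1 t.
    rewrite [cl t]cl_ge1// (cl_ge1 (t := 2 * t - 1)); last by lra.
    have h12 : ((1 : R) <= 2^-1) = false by apply/negbTE; rewrite -ltNge; lra.
    have e1 : 2 * 1 - 1 = 1 :> R by lra.
    by rewrite h12 e1 cl1 -[in RHS]e1 -{1}[k 1](cat1 h) e1.
  rewrite [cl t]clK ?[cl (2 * t - 1)]clK; try by apply/andP; lra.
  by rewrite (leNgt t) t1.
apply: hot_reparam => //; rewrite /phi /psi; cont.
  by rewrite !(mulr0, cl0) sub0r !cl_le0//; lra.
by rewrite cl1 !cl_ge1//; lra.
Qed.

Lemma cat_rev g : path_in g -> hot (cat g (rev g)) (fun _ => g 0).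
Proof.
move=> pg; have ccl := @cl_cont R.
have -> : cat g (rev g) = g \o (fun t => cl (2 * t) - cl (2 * t - 1)).
  apply/funext => t; rewrite /cat /rev /=; have [t1|t1] := leP t 2^-1.
    by rewrite (cl_le0 (t := 2 * t - 1)) ?subr0//; lra.
  by rewrite (cl_ge1 (t := 2 * t))//; lra.
apply: (@hot_reparam g _ (fun _ => 0) pg) => //; cont.
  by rewrite mulr0 sub0r !cl_le0 ?subrr//; lra.
by rewrite !cl_ge1 ?subrr//; lra.
Qed.

Lemma cat_cst g x : path_in g -> g 1 = x -> hot (cat g (fun _ => x)) g.
Proof.
move=> pg gx; have ccl := @cl_cont R.
have -> : cat g (fun _ => x) = g \o (fun t => cl (2 * t)).
  apply/funext => t; rewrite /cat /=; have [t1|t1] := leP t 2^-1; first by [].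
  by rewrite (cl_ge1 (t := 2 * t)) ?gx//; lra.
apply: (@hot_reparam g _ id pg) => //; cont; first by rewrite mulr0 cl0.
by rewrite cl_ge1//; lra.
Qed.

Lemma cst_cat g x : path_in g -> g 0 = x -> hot (cat (fun _ => x) g) g.
Proof.
move=> pg gx; have ccl := @cl_cont R.
have -> : cat (fun _ => x) g = g \o (fun t => cl (2 * t - 1)).
  apply/funext => t; rewrite /cat /=; have [t1|t1] := leP t 2^-1; last by [].
  by rewrite (cl_le0 (t := 2 * t - 1)) ?gx//; lra.
apply: (@hot_reparam g _ id pg) => //; cont; first by rewrite cl_le0//; lra.
by rewrite cl_ge1//; lra.
Qed.

End Paths.

(** * Local-to-global arguments on an interval *)

Section Cousin.
Variable R : realType.

(** A supremum argument: locality at the supremum of the reachable points, combined with gluing,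
    pushes it to [b]. This replaces subdivisions by Lebesgue numbers. *)
Lemma cousin (Q : R -> R -> Prop) a b : a <= b ->
  (forall x y z, a <= x -> x <= y -> y <= z -> z <= b -> Q x y -> Q y z -> Q x z) ->
  (forall t, a <= t <= b -> exists2 d, 0 < d & forall x y, a <= x -> x <= y -> y <= b ->
     t - d < x -> y < t + d -> Q x y) -> Q a b.
Proof.
move=> ab glue loc; pose S := [set t | a <= t <= b /\ Q a t].
have Sa : S a.
  have aab : a <= a <= b by rewrite lexx.
  by split=> //; have [d d0 h] := loc a aab; apply: h => //; lra.
have ubS : has_ubound S by exists b => t [/andP[]].
have hs : has_sup S by split=> //; exists a.
have as_ : a <= sup S by exact: (ub_le_sup ubS).
have sb : sup S <= b by apply: ge_sup; [exists a|move=> t [/andP[]]].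
have asb : a <= sup S <= b by rewrite as_ sb.
have [d d0 h] := loc _ asb.
have [t [/andP[at_ tb] Qat] st] := sup_adherent d0 hs.
have ts : t <= sup S by apply: (ub_le_sup ubS); split=> //; apply/andP.
pose s := Num.min b (sup S + d / 2).
have sle : sup S <= s by rewrite /s le_min sb /=; lra.
have sb' : s <= b by rewrite /s ge_min lexx.
have Qas : Q a s.
  apply: (glue a t s) => //; first by exact: le_trans ts sle.
  apply: h => //; first exact: le_trans ts sle.
  by rewrite /s gt_min; apply/orP; right; lra.
have : s <= sup S by apply: (ub_le_sup ubS); split=> //; apply/andP; lra.
rewrite /s ge_min => /orP[bs|]; last by lra.
by have -> : b = s by apply/le_anti; rewrite sb' andbT; apply: le_trans sle.
Qed.

Lemma near_interval (T : topologicalType) (f : R -> T) t (U : set T) :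
  continuous f -> nbhs (f t) U ->
  exists2 d, 0 < d & forall x, t - d < x -> x < t + d -> U (f x).
Proof.
move=> cf /cf; rewrite nbhs_simpl /= => /nbhs_ballP[d /= d0 h]; exists d => // x x1 x2.
by apply: h; rewrite /ball /= ltr_norml; apply/andP; lra.
Qed.

Definition clab (a b t : R) := Num.max a (Num.min t b).

Lemma clab_itv a b t : a <= b -> a <= clab a b t <= b.
Proof. by move=> ab; rewrite le_max lexx ge_max ab ge_min lexx orbT. Qed.

Lemma clabK a b t : a <= t <= b -> clab a b t = t.
Proof. by rewrite /clab => /andP[h1 h2]; rewrite min_l// max_r. Qed.

Definition aff (a b t : R) := a + t * (b - a).

Lemma aff0 a b : aff a b 0 = a. Proof. by rewrite /aff mul0r addr0. Qed.

Lemma aff1 a b : aff a b 1 = b. Proof. by rewrite /aff mul1r addrC subrK. Qed.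

Lemma aff_cont a b : continuous (aff a b). Proof. by rewrite /aff; cont. Qed.

Lemma clab_cont a b : continuous (clab a b). Proof. by rewrite /clab; cont. Qed.

End Cousin.

Section Functor.
Variables (R : realType) (X : topologicalType) (A : set X) (K : groupType).
Implicit Types g h : R -> X.

(* A functor from the fundamental groupoid of A to K; functor_square is homotopy invariance. *)
Record functor (kap : (R -> X) -> R -> R -> K) : Prop := Functor {
  functor_mul : forall g, path_in A g -> forall a b c, (kap g a b * kap g b c)%g = kap g a c;
  functor_comp : forall g phi, path_in A g -> continuous phi -> forall a b,
    kap (g \o phi) a b = kap g (phi a) (phi b);
  functor_square : forall H : R * R -> X, continuous H -> (forall z, A (H z)) ->
    forall s1 s2 t1 t2, (kap (fun t => H (s1, t)) t1 t2 * kap (fun s => H (s, t2)) s1 s2)%g =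
      (kap (fun s => H (s, t1)) s1 s2 * kap (fun t => H (s2, t)) t1 t2)%g }.

Variables (kap : (R -> X) -> R -> R -> K) (fk : functor kap).

Lemma kap_id g a : path_in A g -> kap g a a = 1%g.
Proof.
by move=> pg; have := functor_mul fk pg a a a => /(congr1 (fun k => (kap g a a)^-1 * k)%g); rewrite mulKg mulVg.
Qed.

Lemma kap_inv g a b : path_in A g -> kap g b a = (kap g a b)^-1%g.
Proof.
by move=> pg; apply/esym/mulg1_eq; rewrite (functor_mul fk pg) kap_id.
Qed.

Lemma kap_cst x a b : A x -> kap (fun _ => x) a b = 1%g.
Proof.
move=> Ax; have pc : path_in A (fun _ : R => x) by exact: path_cst.
have := functor_comp fk pc (@contcst R R 0) a b.
by rewrite (kap_id _ pc).
Qed.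

Lemma kap_aff g a b : path_in A g -> kap g a b = kap (g \o aff a b) 0 1.
Proof. by move=> pg; rewrite (functor_comp fk pg (@aff_cont _ a b)) aff0 aff1. Qed.

Lemma kap_ext g h a b : path_in A g -> path_in A h -> a <= b ->
  (forall t, a <= t <= b -> g t = h t) -> kap g a b = kap h a b.
Proof.
move=> pg ph ab gh; have cc := @clab_cont R a b.
have e1 : clab a b a = a by rewrite clabK// lexx.
have e2 : clab a b b = b by rewrite clabK// lexx ab.
have E f : path_in A f -> kap f a b = kap (f \o clab a b) a b.
  by move=> pf; rewrite (functor_comp fk pf cc) e1 e2.
rewrite (E g)// (E h)//; by congr (kap _ _ _); apply/funext => t /=; apply/gh/clab_itv.
Qed.

Lemma kap_homotopy (F : R -> X -> X) g a b :
  (forall z : R * R, A (F z.1 (g z.2))) -> continuous (fun z : R * R => F z.1 (g z.2)) ->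
  kap (F 1 \o g) a b = ((kap (F^~ (g a)) 0 1)^-1 * kap (F 0 \o g) a b * kap (F^~ (g b)) 0 1)%g.
Proof.
move=> AF cF; have := functor_square fk cF AF 0 1 a b => /= e.
by rewrite -mulgA e mulKg.
Qed.

Lemma kap_square (H : R * R -> X) a b : continuous H -> (forall z, A (H z)) ->
  kap (fun t => H (1, t)) a b =
  ((kap (fun s => H (s, a)) 0 1)^-1 * kap (fun t => H (0, t)) a b * kap (fun s => H (s, b)) 0 1)%g.
Proof.
move=> cH AH; have := functor_square fk cH AH 0 1 a b => /= e.
by rewrite -mulgA e mulKg.
Qed.

(** Homotopy invariance is applied to a sheared square with the diagonal as one edge and a constant
    path as another. *)
Lemma kap_diag (H : R * R -> X) a b : continuous H -> (forall z, A (H z)) ->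
  kap (fun t => H (t, t)) a b = (kap (fun t => H (a, t)) a b * kap (fun s => H (s, b)) a b)%g.
Proof.
move=> cH AH.
have cH' : continuous (fun z : R * R => H (a + z.1 * (z.2 - a), z.2)).
  by apply: (contcomp cH); cont.
have := functor_square fk cH' (fun z => AH _) 0 1 a b.
rewrite /= !subrr (_ : (fun s : R => H (a + s * 0, a)) = fun _ => H (a, a)); last first.
  by apply/funext => s; rewrite mulr0 addr0.
rewrite kap_cst// mul1g (_ : (fun t : R => H (a + 1 * (t - a), t)) = fun t => H (t, t)); last first.
  by apply/funext => t; rewrite mul1r addrC subrK.
move=> <-; congr (_ * _)%g.
  by congr (kap _ _ _); apply/funext => t; rewrite mul0r addr0.
have pH : path_in A (fun s => H (s, b)) by split=> [|s]; [apply: (contcomp cH); cont|].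
by rewrite [RHS]kap_aff.
Qed.

Lemma kap_hot g h : hot A g h -> path_in A g -> path_in A h -> kap g 0 1 = kap h 0 1.
Proof.
move=> [H [cH AH H1 H2]] pg ph; have ccl := @cl_cont R.
have cH' : continuous (fun z : R * R => H (cl z.1, cl z.2)) by apply: (contcomp cH); cont.
have := @kap_square (fun z : R * R => H (cl z.1, cl z.2)) 0 1 cH' (fun z => AH _).
have AH' x : A (H x) by [].
rewrite /= !cl0 !cl1.
have -> : (fun s : R => H (cl s, 0)) = fun _ => g 0.
  by apply/funext => s; have [] := H2 _ (cl_itv s).
have -> : (fun s : R => H (cl s, 1)) = fun _ => g 1.
  by apply/funext => s; have [] := H2 _ (cl_itv s).
have Ag t : A (g t) by case: pg.
rewrite !kap_cst// invg1 mul1g mulg1 => e.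
have pH s : path_in A (fun t => H (s, cl t)) by split=> [|//]; apply: (contcomp cH); cont.
transitivity (kap (fun t => H (0, cl t)) 0 1).
  by apply: kap_ext => // t t01; rewrite (clK t01) (H1 t t01).1.
by rewrite -e; apply: kap_ext => // t t01; rewrite (clK t01) (H1 t t01).2.
Qed.

Lemma kap_cat g h : path_in A g -> path_in A h -> g 1 = h 0 ->
  kap (cat g h) 0 1 = (kap g 0 1 * kap h 0 1)%g.
Proof.
move=> pg ph gh; have pc := path_cat pg ph gh; have ccl := @cl_cont R.
rewrite -(functor_mul fk pc 0 2^-1 1); congr (_ * _)%g.
  transitivity (kap (g \o (fun t => 2 * t)) 0 2^-1); last first.
    by rewrite (functor_comp fk)//; [rewrite mulr0 mulfV ?pnatr_eq0|cont].
  apply: kap_ext => //; [by apply: path_comp => //; cont|].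
  by move=> t /andP[t0 t1]; rewrite /cat t1 /= clK//; apply/andP; lra.
transitivity (kap (h \o (fun t => 2 * t - 1)) 2^-1 1); last first.
  rewrite (functor_comp fk)//; last by cont.
  by congr (kap _ _ _); lra.
apply: kap_ext => //; [by apply: path_comp => //; cont|by lra|].
move=> t /andP[t0 t1]; rewrite /cat /=; case: ifP => t2; last first.
  by rewrite clK//; apply/andP; lra.
have -> : t = 2^-1 by apply/le_anti; rewrite t2 t0.
by rewrite mulfV ?pnatr_eq0// subrr cl1.
Qed.

Lemma kap_rev g : path_in A g -> kap (rev g) 0 1 = (kap g 0 1)^-1%g.
Proof.
move=> pg; rewrite -kap_inv//.
have -> : rev g = g \o (fun t => 1 - t) by [].
by rewrite (functor_comp fk)//; [rewrite subr0 subrr|cont].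
Qed.

(** The functor is a coboundary on [U]. Such sets play the role of the simply connected pieces in
    van Kampen's theorem. *)
Definition flat (U : set X) := exists d : X -> K,
  forall g, path_in U g -> kap g 0 1 = ((d (g 0%R))^-1 * d (g 1%R))%g.

End Functor.

(** A path is a finite product of pieces lying in small neighbourhoods. Two functors occur so that
    one can be compared with the other. *)
Lemma path_local (R : realType) (X : topologicalType) (A : set X) (K L : groupType)
  (kap : (R -> X) -> R -> R -> K) (lam : (R -> X) -> R -> R -> L) (Q : X -> X -> K -> L -> Prop) :
  functor A kap -> functor A lam ->
  (forall x y z k l k' l', Q x y k l -> Q y z k' l' -> Q x z (k * k')%g (l * l')%g) ->
  (forall x, A x -> exists2 U, nbhs x U &
     forall g, path_in (A `&` U) g -> Q (g 0) (g 1) (kap g 0 1) (lam g 0 1)) ->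
  forall g, path_in A g -> Q (g 0) (g 1) (kap g 0 1) (lam g 0 1).
Proof.
move=> fk fl glue loc g pg.
apply: (@cousin R (fun a b => Q (g a) (g b) (kap g a b) (lam g a b))) => // [x y z _ _ _ _|t _].
  by rewrite -(functor_mul fk pg x y z) -(functor_mul fl pg x y z); exact: glue.
have [U nU h] := loc (g t) (pg.2 t).
have [d d0 hd] := near_interval pg.1 nU; exists d => // x y _ xy _ tx ty.
pose phi := clab x y \o aff x y.
have phi0 : phi 0 = x by rewrite /phi /= aff0 clabK// lexx.
have phi1 : phi 1 = y by rewrite /phi /= aff1 clabK// lexx xy.
have cphi : continuous phi by apply: contcomp; [exact: clab_cont|exact: aff_cont].
have p' : path_in (A `&` U) (g \o phi).
  split=> [|s]; first by apply: contcomp => //; case: pg.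
  split; first by case: pg => _; exact.
  have /andP[h1 h2] := clab_itv (aff x y s) xy.
  by apply: hd; [exact: lt_le_trans h1|exact: le_lt_trans ty].
by have := h _ p'; rewrite (functor_comp fk)// (functor_comp fl)//= phi0 phi1.
Qed.

Lemma functor_sub (R : realType) (X : topologicalType) (A B : set X) (K : groupType)
  (kap : (R -> X) -> R -> R -> K) : A `<=` B -> functor B kap -> functor A kap.
Proof.
move=> AB fk; have pAB g : path_in A g -> path_in B g by case=> cg Ag; split=> // t; exact: AB.
split=> [g /pAB pg|g phi /pAB pg|H cH AH]; [exact: (functor_mul fk)|exact: (functor_comp fk)|].
by apply: (functor_square fk) => // z; exact: AB.
Qed.

Lemma functor_pull (R : realType) (X Y : topologicalType) (A : set X) (B : set Y) (K : groupType)
  (kap : (R -> Y) -> R -> R -> K) (f : X -> Y) : continuous f -> (forall x, A x -> B (f x)) ->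
  functor B kap -> functor A (fun g => kap (f \o g)).
Proof.
move=> cf AB fk.
have pAB g : path_in A g -> path_in B (f \o g).
  by case=> cg Ag; split=> [|t]; [exact: contcomp|exact: AB].
split=> [g /pAB pg|g phi /pAB pg cphi a b|H cH AH s1 s2 t1 t2].
- exact: (functor_mul fk).
- by rewrite -(functor_comp fk pg).
- have := @functor_square _ _ _ _ _ fk (f \o H); apply => //; first exact: contcomp.
  by move=> z; exact: AB.
Qed.

(** * Holonomy of an Alexander-Spanier cocycle *)

Section Holonomy.
Variables (R : realType) (X : topologicalType) (A : set X) (K : groupType).
Variable c : X -> X -> K.
Implicit Types g h : R -> X.

Definition potential_on (U : set X) (p : X -> K) :=
  forall x y, U x -> U y -> c x y = ((p x)^-1 * p y)%g.

(* An Alexander-Spanier 1-cocycle, near the diagonal of A. *)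
Definition local_cocycle := forall x, A x ->
  exists2 U, nbhs x U & exists p, potential_on (A `&` U) p.

(** The potential depends on the parameter rather than on the point of [X], since a path may return
    to a point with another value. *)
Definition path_lift g a b (p : R -> K) := forall t, a <= t <= b ->
  exists2 d, 0 < d & forall s s', a <= s <= b -> a <= s' <= b ->
    t - d < s < t + d -> t - d < s' < t + d -> c (g s) (g s') = ((p s)^-1 * p s')%g.

Hypothesis locc : local_cocycle.

Lemma lift_uniq g a b p q : a <= b -> path_lift g a b p -> path_lift g a b q ->
  ((p a)^-1 * p b)%g = ((q a)^-1 * q b)%g.
Proof.
move=> ab Lp Lq.
apply: (@cousin R (fun x y => ((p x)^-1 * p y)%g = ((q x)^-1 * q y)%g) a b ab).
  move=> x y z _ _ _ _ e1 e2.
  by have := congr2 (fun k l : K => (k * l)%g) e1 e2; rewrite !mulgA !mulgK.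
move=> t tab; have [d d0 h] := Lp t tab; have [e e0 k] := Lq t tab.
exists (Num.min d e); first by rewrite lt_min d0.
move=> x y ax xy yb; rewrite -ltrBDl => t1; rewrite -ltrBlDl lt_min => /andP[t2 t3].
have /andP[t4 t5] : (t - x < d) && (t - x < e) by rewrite -lt_min; lra.
by rewrite -h -?k//; apply/andP; lra.
Qed.

Lemma lift_cat g a b b' p q : path_in A g -> a <= b -> b <= b' ->
  path_lift g a b p -> path_lift g b b' q -> exists r, path_lift g a b' r.
Proof.
move=> pg ab bb Lp Lq.
(* The second lift is multiplied on the left by a constant, to agree with the first one at [b];
   around [b] both are compared with the potential [r]. *)
exists (fun t => if t <= b then p t else p b * (q b)^-1 * q t)%g => t /andP[t1 t2].
have [tb|bt] := ltP t b.
  have [|d d0 h] := Lp t; first by apply/andP; lra.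
  exists (Num.min d (b - t)); first by rewrite lt_min d0; lra.
  move=> s s' /andP[s1 s2] /andP[s3 s4] /andP[]; rewrite ltrBlDl -ltrBlDr lt_min => /andP[h1 h2].
  rewrite -ltrBlDl lt_min => /andP[h3 h4] /andP[]; rewrite ltrBlDl -ltrBlDr lt_min => /andP[h5 h6].
  rewrite -ltrBlDl lt_min => /andP[h7 h8].
  by rewrite !ifT ?h//; try lra; apply/andP; lra.
have [tb|bt'] := ltP b t.
  have [|d d0 h] := Lq t; first by apply/andP; lra.
  exists (Num.min d (t - b)); first by rewrite lt_min d0; lra.
  move=> s s' /andP[s1 s2] /andP[s3 s4] /andP[]; rewrite ltrBlDl -ltrBlDr lt_min => /andP[h1 h2].
  rewrite -ltrBlDl lt_min => /andP[h3 h4] /andP[]; rewrite ltrBlDl -ltrBlDr lt_min => /andP[h5 h6].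
  rewrite -ltrBlDl lt_min => /andP[h7 h8].
  rewrite !ifF; try by apply/negbTE; rewrite -ltNge; lra.
  by rewrite h; [grp; rewrite -!mulgA mulKg ?mulVKg|..]; try (apply/andP; lra).
have tb : t = b by apply/le_anti; rewrite bt bt'.
rewrite {}tb in t1 t2 bt bt' *.
have [|d d0 h] := Lp b; first by apply/andP; lra.
have [|e e0 k] := Lq b; first by apply/andP; lra.
have [U nU [r hr]] := locc (pg.2 b).
have [f f0 l] := near_interval pg.1 nU.
pose m := Num.min d (Num.min e f).
have m0 : 0 < m by rewrite !lt_min d0 e0.
have md : m <= d by rewrite ge_min lexx.
have me : m <= e by rewrite !ge_min lexx orbT.
have mf : m <= f by rewrite !ge_min lexx !orbT.
have Ug s : b - m < s < b + m -> (A `&` U) (g s).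
  by move=> /andP[s1 s2]; split; [case: pg|apply: l; lra].
have pP s : a <= s <= b' -> s <= b -> b - m < s < b + m -> p s = (p b * (r (g b))^-1 * r (g s))%g.
  move=> /andP[s1 s2] s3 sm; have /andP[s4 s5] := sm.
  have := h b s; rewrite hr; [|by apply: Ug; apply/andP; lra|exact: Ug].
  move=> e1; rewrite -mulgA e1 ?mulVKg//; apply/andP; lra.
have qP s : a <= s <= b' -> b <= s -> b - m < s < b + m ->
    (p b * (q b)^-1 * q s = p b * (r (g b))^-1 * r (g s))%g.
  move=> /andP[s1 s2] s3 sm; have /andP[s4 s5] := sm.
  have := k b s; rewrite hr; [|by apply: Ug; apply/andP; lra|exact: Ug].
  move=> e1; rewrite -!mulgA e1//; apply/andP; lra.
have rP s : a <= s <= b' -> b - m < s < b + m ->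
    (if s <= b then p s else p b * (q b)^-1 * q s)%g = (p b * (r (g b))^-1 * r (g s))%g.
  by move=> s1 s2; case: leP => s3; [apply: pP|apply: qP => //; exact: ltW].
exists m => // s s' s1 s2 s3 s4; rewrite !rP//= hr; try exact: Ug.
by rewrite !invgM !invgK -!mulgA mulKg mulVKg.
Qed.

Lemma lift_exists g a b : path_in A g -> a <= b -> exists p, path_lift g a b p.
Proof.
move=> pg ab; apply: (@cousin R (fun x y => exists p, path_lift g x y p) a b ab).
  by move=> x y z _ xy yz _ [p Lp] [q Lq]; exact: lift_cat Lp Lq.
move=> t _; have [U nU [r hr]] := locc (pg.2 t).
have [d d0 h] := near_interval pg.1 nU; exists d => // x y _ xy _ t1 t2.
exists (fun s => r (g s)) => u _; exists 1 => // s s' /andP[s1 s2] /andP[s3 s4] _ _.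
by apply: hr; split; try (by case: pg); apply: h; lra.
Qed.

Definition hol g a b : K :=
  let h := g \o aff a b in
  let p := xget (fun _ => 1%g) [set p | path_lift h 0 1 p] in ((p 0%R)^-1 * p 1%R)%g.

Lemma lift_comp g (phi : R -> R) a b a' b' p : continuous phi ->
  (forall t, a' <= t <= b' -> a <= phi t <= b) -> path_lift g a b p -> path_lift (g \o phi) a' b' (p \o phi).
Proof.
move=> cphi ph L t tab; have [d d0 h] := L _ (ph t tab).
have [e e0 k] := @near_interval R R phi t _ cphi (nbhsx_ballx (phi t) d d0).
exists e => // s s' s1 s2 /andP[s3 s4] /andP[s5 s6] /=.
have B u : t - e < u -> u < t + e -> phi t - d < phi u < phi t + d.
  by move=> u1 u2; have := k u u1 u2; rewrite /ball /= ltr_norml => /andP[? ?]; apply/andP; lra.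
by apply: h; [exact: ph|exact: ph|exact: B|exact: B].
Qed.

Lemma hol_lift g lo hi a b p : lo <= a <= hi -> lo <= b <= hi ->
  path_lift g lo hi p -> hol g a b = ((p a)^-1 * p b)%g.
Proof.
move=> /andP[a1 a2] /andP[b1 b2] L.
have L' : path_lift (g \o aff a b) 0 1 (p \o aff a b).
  apply: lift_comp L; first exact: aff_cont.
  move=> t /andP[t0 t1]; rewrite /aff; apply/andP; nra.
rewrite /hol; case: xgetP => [q _ Lq|/(_ _ L')//].
by rewrite (lift_uniq ler01 Lq L') /= aff0 aff1.
Qed.

(** Although [p] is a potential only near each point, [p \o g] is a lift of the whole path. *)
Lemma hol_flat (U : set X) p : U `<=` A ->
  (forall x, U x -> exists2 V, nbhs x V & potential_on (U `&` V) p) ->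
  forall g, path_in U g -> forall a b, hol g a b = ((p (g a))^-1 * p (g b))%g.
Proof.
move=> UA h g [cg Ug] a b.
apply: (@hol_lift g (Num.min a b) (Num.max a b) a b (p \o g)).
- by rewrite ge_min le_max lexx.
- by rewrite ge_min le_max lexx !orbT.
move=> t _; have [V nV pV] := h _ (Ug t).
have [d d0 k] := near_interval cg nV; exists d => // s s' _ _ /andP[s1 s2] /andP[s3 s4].
by apply: pV; split=> //; exact: k.
Qed.

Lemma image_bounded (phi : R -> R) a b : a <= b -> continuous phi ->
  exists lo hi, forall t, a <= t <= b -> lo <= phi t <= hi.
Proof.
move=> ab cphi.
have [m _ hm] := EVT_min ab (continuous_subspaceT cphi).
have [M _ hM] := EVT_max ab (continuous_subspaceT cphi).
by exists (phi m), (phi M) => t tab; rewrite hm ?hM// in_itv.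
Qed.

Lemma hol_mul g : path_in A g -> forall a b e, (hol g a b * hol g b e)%g = hol g a e.
Proof.
move=> pg a b e.
pose lo := Num.min a (Num.min b e); pose hi := Num.max a (Num.max b e).
have ai : lo <= a <= hi by rewrite ge_min le_max lexx.
have bi : lo <= b <= hi by rewrite !ge_min !le_max lexx !orbT.
have ei : lo <= e <= hi by rewrite !ge_min !le_max lexx !orbT.
have [|p L] := @lift_exists g lo hi pg; first by case/andP: ai; exact: le_trans.
by rewrite !(hol_lift _ _ L)//; grp.
Qed.

Lemma hol_comp g phi : path_in A g -> continuous phi -> forall a b,
  hol (g \o phi) a b = hol g (phi a) (phi b).
Proof.
move=> pg cphi a b.
have mM : Num.min a b <= Num.max a b by rewrite ge_min le_max lexx.
have ai : Num.min a b <= a <= Num.max a b by rewrite ge_min le_max lexx.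
have bi : Num.min a b <= b <= Num.max a b by rewrite ge_min le_max lexx !orbT.
have [lo [hi h]] := image_bounded mM cphi.
have [|p L] := @lift_exists g lo hi pg; first by case/andP: (h _ ai); exact: le_trans.
have L' := lift_comp cphi h L.
by rewrite (hol_lift ai bi L') (hol_lift (h _ ai) (h _ bi) L).
Qed.

(** For each [s], Cousin's lemma along [t] gives a strip of positive width on which the relation
    holds; a second application along [s] glues the strips. *)
Lemma hol_square01 (H : R * R -> X) : continuous H -> (forall z, A (H z)) ->
  (hol (fun t => H (0, t)) 0 1 * hol (fun s => H (s, 1%R)) 0 1)%g =
  (hol (fun s => H (s, 0)) 0 1 * hol (fun t => H (1%R, t)) 0 1)%g.
Proof.
move=> cH AH.
pose Q s1 s2 t1 t2 := (hol (fun t => H (s1, t)) t1 t2 * hol (fun s => H (s, t2)) s1 s2)%g =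
  (hol (fun s => H (s, t1)) s1 s2 * hol (fun t => H (s2, t)) t1 t2)%g.
have pr s : path_in A (fun t => H (s, t)) by split=> [|//]; apply: (contcomp cH); cont.
have pc t : path_in A (fun s => H (s, t)) by split=> [|//]; apply: (contcomp cH); cont.
have Qt s1 s2 t1 t2 t3 : Q s1 s2 t1 t2 -> Q s1 s2 t2 t3 -> Q s1 s2 t1 t3.
  rewrite /Q => e1 e2; rewrite -(hol_mul (pr s1) t1 t2 t3) -(hol_mul (pr s2) t1 t2 t3).
  by rewrite -mulgA e2 mulgA e1 -mulgA.
have Qs s1 s2 s3 t1 t2 : Q s1 s2 t1 t2 -> Q s2 s3 t1 t2 -> Q s1 s3 t1 t2.
  rewrite /Q => e1 e2; rewrite -(hol_mul (pc t1) s1 s2 s3) -(hol_mul (pc t2) s1 s2 s3).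
  by rewrite mulgA e1 -mulgA e2 -[RHS]mulgA.
have h01 : (0 : R) <= 1 by [].
have strip s : exists2 d, 0 < d & forall s1 s2, s - d < s1 < s + d -> s - d < s2 < s + d -> Q s1 s2 0 1.
  apply: (@cousin R (fun t1 t2 => exists2 d, 0 < d & forall s1 s2, s - d < s1 < s + d ->
    s - d < s2 < s + d -> Q s1 s2 t1 t2) 0 1 h01).
    move=> x y z _ _ _ _ [d d0 hd] [e e0 he]; exists (Num.min d e); first by rewrite lt_min d0.
    have md : Num.min d e <= d by rewrite ge_min lexx.
    have me : Num.min d e <= e by rewrite ge_min lexx orbT.
    move=> s1 s2 /andP[h1 h2] /andP[h3 h4]; apply: (Qt _ _ _ y).
      by apply: hd; apply/andP; lra.
    by apply: he; apply/andP; lra.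
  move=> t _; have [U nU [r hr]] := locc (AH (s, t)).
  have /nbhs_ballP[d /= d0 hd] := cH (s, t) U nU; exists d => // x y _ xy _ x1 y1.
  exists d => // s1 s2 /andP[h1 h2] /andP[h3 h4].
  have B u v : s - d < u < s + d -> t - d < v < t + d -> (A `&` U) (H (u, v)).
    move=> /andP[u1 u2] /andP[v1 v2]; split=> //; apply: hd.
    by split; rewrite /ball /= ltr_norml; apply/andP; lra.
  have hz g a b : (forall t, Num.min a b <= t <= Num.max a b -> (A `&` U) (g t)) ->
      hol g a b = ((r (g a))^-1 * r (g b))%g.
    move=> h; apply: (@hol_lift g (Num.min a b) (Num.max a b) a b (r \o g)).
    - by rewrite ge_min le_max lexx.
    - by rewrite ge_min le_max lexx !orbT.
    by move=> u _; exists 1 => // v w v1 w1 _ _; apply: hr; exact: h.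
  have mm (a b e lo hi : R) : lo < a < hi -> lo < b < hi -> Num.min a b <= e <= Num.max a b -> lo < e < hi.
    move=> /andP[a1 a2] /andP[b1 b2] /andP[e1 e2]; apply/andP; split.
      by apply: (lt_le_trans _ e1); rewrite lt_min a1.
    by apply: (le_lt_trans e2); rewrite gt_max a2.
  have i1 : s - d < s1 < s + d by rewrite h1.
  have i2 : s - d < s2 < s + d by rewrite h3.
  have j1 : t - d < x < t + d by apply/andP; lra.
  have j2 : t - d < y < t + d by apply/andP; lra.
  rewrite /Q !hz; first by grp.
  - by move=> u ui; apply: B => //; exact: mm ui.
  - by move=> u ui; apply: B => //; exact: mm ui.
  - by move=> u ui; apply: B => //; exact: mm ui.
  - by move=> u ui; apply: B => //; exact: mm ui.
apply: (@cousin R (fun s1 s2 => Q s1 s2 0 1) 0 1 h01) => [x y z _ _ _ _|s _]; first exact: Qs.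
by have [d d0 h] := strip s; exists d => // x y _ xy _ x1 y1; apply: h; apply/andP; lra.
Qed.

Lemma hol_functor : functor A hol.
Proof.
split=> [|g phi pg cphi a b|H cH AH s1 s2 t1 t2]; [exact: hol_mul|exact: hol_comp|].
have cH' : continuous (fun z : R * R => H (aff s1 s2 z.1, aff t1 t2 z.2)).
  by rewrite /aff; apply: (contcomp cH); cont.
have := hol_square01 cH' (fun z => AH _).
have pr s : path_in A (fun t => H (s, t)) by split=> [|//]; apply: (contcomp cH); cont.
have pc t : path_in A (fun s => H (s, t)) by split=> [|//]; apply: (contcomp cH); cont.
rewrite /= !aff0 !aff1 => e.
have Er s : hol (fun t => H (s, t)) t1 t2 = hol (fun t => H (s, aff t1 t2 t)) 0 1.
  by have := hol_comp (pr s) (@aff_cont _ t1 t2) 0 1; rewrite aff0 aff1 => <-.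
have Ec t : hol (fun s => H (s, t)) s1 s2 = hol (fun s => H (aff s1 s2 s, t)) 0 1.
  by have := hol_comp (pc t) (@aff_cont _ s1 s2) 0 1; rewrite aff0 aff1 => <-.
by rewrite !Er !Ec.
Qed.

End Holonomy.

(** * The universal functor, with values in the fundamental group *)

Section Universal.
Variables (R : realType) (X : topologicalType) (A : set X) (x : set_type A).
Local Open Scope quotient_scope.
Local Notation T := (set_type A).
Local Notation I := (unit_itv R).
Local Notation G := (pi1 R x).
Local Notation x0 := (set_val x).
Implicit Types (g h : R -> X) (p q : loop R x).

Definition is_loop g := [/\ path_in A g, g 0 = x0 & g 1 = x0].

Definition loop_ext p (t : R) : X := set_val (p (clamp t)).

Lemma path_loop_ext p : is_loop (loop_ext p).
Proof.
split=> [||]; [|by rewrite /loop_ext -/zero path_zero|by rewrite /loop_ext -/one path_one].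
split=> [|t]; last exact: set_valP.
apply: (contcomp (@val_continuous X A)); apply: clamp_comp; last exact: cts_fun.
exact: contid.
Qed.

Let lift_fun g (Ag : forall t, A (g t)) (t : I) : T := exist _ (g (uval t)) (mem_set (Ag (uval t))).

Let lift_cont g (Ag : forall t, A (g t)) : continuous g -> continuous (lift_fun Ag).
Proof.
move=> cg t; apply: to_subset_continuousP.
by move: t; change (continuous (fun t : I => g (uval t))); apply: contcomp => //; exact: uval_continuous.
Qed.

Lemma loop_of_path g : is_loop g -> exists p : loop R x, forall t, 0 <= t <= 1 -> loop_ext p t = g t.
Proof.
move=> [[cg Ag] g0 g1].
have l0 : lift_fun Ag zero = x by apply: val_inj; rewrite /= uval_zero g0.
have l1 : lift_fun Ag one = x by apply: val_inj; rewrite /= uval_one g1.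
exists (mk_path (@lift_cont g Ag cg) l0 l1 : loop R x) => t t01.
by rewrite /loop_ext /= /lift_fun /mk_path /= clampK.
Qed.

Definition loop_of g : loop R x :=
  if pselect (is_loop g) is left lg then projT1 (cid (loop_of_path lg)) else const_loop R x.

Lemma loop_ofE g t : is_loop g -> 0 <= t <= 1 -> loop_ext (loop_of g) t = g t.
Proof.
move=> lg t01; rewrite /loop_of; case: pselect => // lg'.
by case: cid => /= p h; exact: h.
Qed.

Lemma loop_of_hot g : is_loop g -> hot A (loop_ext (loop_of g)) g.
Proof.
move=> lg; apply: hot_eq; first by case: (path_loop_ext (loop_of g)).
by move=> t t01; rewrite loop_ofE.
Qed.

Lemma loop_homotopicP p q : loop_homotopic p q <-> hot A (loop_ext p) (loop_ext q).
Proof.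
have i0 : 0 <= (0 : R) <= 1 by apply/andP; lra.
have i1 : 0 <= (1 : R) <= 1 by apply/andP; lra.
split=> [[H [cH H0 H1 Hx]]|[H [cH AH H0 H1]]].
  exists (fun z => set_val (H (clamp z.2, clamp z.1))).
  have cc := @clamp_continuous R; split=> [|z|t t01|s s01].
  - by apply: (contcomp (@val_continuous X A)); apply: (contcomp cH); cont.
  - exact: set_valP.
  - by rewrite /= -/zero -/one H0 H1.
  - rewrite /= -/zero -/one (Hx _).1 (Hx _).2 /loop_ext -/zero -/one.
    by rewrite path_zero path_one.
exists (fun z => exist _ (H (uval z.2, uval z.1)) (mem_set (AH _))); split=> [z|t|t|s].
- apply: to_subset_continuousP; move: z.
  change (continuous (fun z : I * I => H (uval z.2, uval z.1))).
  by have cu := @uval_continuous R; apply: (contcomp cH); cont.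
- apply: val_inj; rewrite /= uval_zero (H0 _ (uval_itv t)).1.
  by rewrite /loop_ext uvalK.
- apply: val_inj; rewrite /= uval_one (H0 _ (uval_itv t)).2.
  by rewrite /loop_ext uvalK.
- split; apply: val_inj; rewrite /= ?uval_zero ?uval_one.
    by rewrite (H1 _ (uval_itv s)).1 /loop_ext -/zero path_zero.
  by rewrite (H1 _ (uval_itv s)).2 /loop_ext -/one path_one.
Qed.

Lemma pi1_eqP p q : \pi_G p = \pi_G q <-> hot A (loop_ext p) (loop_ext q).
Proof.
rewrite -loop_homotopicP; split=> [|pq].
  by move=> /(@eqmodP _ (loop_equiv R x)) /asboolP.
by apply/(@eqmodP _ (loop_equiv R x))/asboolP.
Qed.

Lemma loop_ext_concat p q : hot A (loop_ext (concat p q)) (cat (loop_ext p) (loop_ext q)).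
Proof.
apply: hot_eq; first by case: (path_loop_ext (concat p q)).
move=> t /andP[t0 t1]; rewrite /loop_ext concatE /cat clampK ?t0//.
case: ifP => th; congr (set_val (_ _)); apply: uval_inj; rewrite !clampE -/(cl _) -/(cl _) ?clcl//.
Qed.

Lemma pi1_mulE p q : (\pi_G p * \pi_G q)%g = \pi_G (concat p q).
Proof.
have rp r : hot A (loop_ext (repr (\pi_G r))) (loop_ext r) by apply/pi1_eqP; rewrite reprK.
apply/pi1_eqP; apply: hot_trans (loop_ext_concat _ _) _.
apply: hot_trans (hot_sym (loop_ext_concat _ _)).
apply: hot_cat => //.
by have [_ _ ->] := path_loop_ext (repr (\pi_G p)); have [_ -> _] := path_loop_ext (repr (\pi_G q)).
Qed.

Definition cls g : G := \pi_G (loop_of g).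

Lemma cls_hot g h : is_loop g -> is_loop h -> hot A g h -> cls g = cls h.
Proof.
move=> lg lh gh; apply/pi1_eqP.
exact: hot_trans (loop_of_hot lg) (hot_trans gh (hot_sym (loop_of_hot lh))).
Qed.

Lemma is_loop_cat g h : is_loop g -> is_loop h -> is_loop (cat g h).
Proof.
by move=> [pg g0 g1] [ph h0 h1]; split; rewrite ?cat0 ?cat1//; apply: path_cat; rewrite // h0.
Qed.

Lemma cls_cat g h : is_loop g -> is_loop h -> cls (cat g h) = (cls g * cls h)%g.
Proof.
move=> lg lh; rewrite /cls pi1_mulE; apply/pi1_eqP.
apply: hot_trans (loop_of_hot (is_loop_cat lg lh)) _.
apply: hot_trans (hot_sym (loop_ext_concat _ _)).
apply/hot_sym/hot_cat; [exact: loop_of_hot|exact: loop_of_hot|].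
have [_ _ ->] := path_loop_ext (loop_of g).
by have [_ -> _] := path_loop_ext (loop_of h).
Qed.

Lemma cls_surj (k : G) : exists2 g, is_loop g & k = cls g.
Proof.
exists (loop_ext (repr k)); first exact: path_loop_ext.
rewrite -[LHS]reprK; apply/pi1_eqP; apply/hot_sym/loop_of_hot.
exact: path_loop_ext.
Qed.

Hypothesis path_conn : forall w, A w -> exists g, [/\ path_in A g, g 0 = x0 & g 1 = w].

Let Ax : A x0. Proof. exact: set_valP. Qed.

Lemma base_paths : exists mu : X -> R -> X, mu x0 = (fun _ => x0) /\
  forall w, A w -> [/\ path_in A (mu w), mu w 0 = x0 & mu w 1 = w].
Proof.
have [mu hmu] : {mu : X -> R -> X & forall w, A w -> [/\ path_in A (mu w), mu w 0 = x0 & mu w 1 = w]}.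
  apply: (@choice _ _ (fun w g => A w -> [/\ path_in A g, g 0 = x0 & g 1 = w])) => w.
  have [/path_conn/cid[g h]|nA] := pselect (A w); first by exists g.
  by exists (fun _ => x0).
exists (fun w => if `[< w = x0 >] then (fun _ => x0) else mu w); split.
  by case: asboolP.
move=> w Aw; case: asboolP => [wx|_]; last exact: hmu.
by split=> //; exact: path_cst.
Qed.

Section Mu.
Variable mu : X -> R -> X.
Hypothesis mu_path : forall w, A w -> path_in A (mu w).
Hypothesis mu_0 : forall w, A w -> mu w 0 = x0.
Hypothesis mu_1 : forall w, A w -> mu w 1 = w.

Let closing g := cat (cat (mu (g 0)) g) (rev (mu (g 1))).

Let closing_loop g : path_in A g -> is_loop (closing g).
Proof.
move=> pg; have Ag t : A (g t) by case: pg.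
split; rewrite /closing ?cat0 ?cat1 ?rev1 ?mu_0//.
apply: path_cat; [apply: path_cat => //|apply: path_rev|]; rewrite ?cat1 ?rev0 ?mu_1//; exact: mu_path.
Qed.

Definition ucls g := cls (closing g).

Lemma ucls_hot g h : path_in A g -> path_in A h -> hot A g h -> ucls g = ucls h.
Proof.
move=> pg ph gh; apply: cls_hot; [exact: closing_loop|exact: closing_loop|].
have [e0 e1] := hot_ends gh; rewrite /closing -e0 -e1.
have Ag t : A (g t) by case: pg.
apply: hot_cat; last by rewrite cat1 rev0 mu_1.
  by apply: hot_cat => //; [apply/hot_refl/mu_path|rewrite mu_1].
exact/hot_refl/path_rev/mu_path.
Qed.

Lemma ucls_cat g h : path_in A g -> path_in A h -> g 1 = h 0 ->
  ucls (cat g h) = (ucls g * ucls h)%g.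
Proof.
move=> pg ph gh; rewrite /ucls -cls_cat; try exact: closing_loop.
have Ag t : A (g t) by case: pg.
have Ah t : A (h t) by case: ph.
have pgh := path_cat pg ph gh.
apply: cls_hot; [exact: closing_loop|apply: is_loop_cat; exact: closing_loop|].
rewrite /closing cat0 cat1 -gh.
set m := mu (g 0); set n := mu (g 1); set l := mu (h 1).
have [pm m1] : path_in A m /\ m 1 = g 0 by split; [exact: mu_path|exact: mu_1].
have [pn n1] : path_in A n /\ n 1 = g 1 by split; [exact: mu_path|exact: mu_1].
have [pl l1] : path_in A l /\ l 1 = h 1 by split; [exact: mu_path|exact: mu_1].
have n0l0 : n 0 = l 0 by rewrite /n /l !mu_0.
have prn := path_rev pn; have prl := path_rev pl.
have pmg : path_in A (cat m g) by apply: path_cat.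
have phl : path_in A (cat h (rev l)) by apply: path_cat => //; rewrite rev0.
have pnh : path_in A (cat n h) by apply: path_cat => //; rewrite n1 gh.
have pnhl : path_in A (cat (cat n h) (rev l)) by apply: path_cat => //; rewrite cat1 rev0.
apply: hot_sym.
apply: hot_trans (catA pmg prn pnhl _ _) _; rewrite ?cat1 ?cat0 ?rev0 ?rev1//.
apply: hot_trans (_ : hot A _ (cat (cat m g) (cat h (rev l)))) _.
  apply: hot_cat; [exact: hot_refl| |by rewrite cat1 cat0 rev0 n1].
  apply: hot_trans (_ : hot A _ (cat (rev n) (cat n (cat h (rev l))))) _.
    apply: hot_cat; [exact: hot_refl| |by rewrite rev1 !cat0].
    by apply: catA; rewrite ?rev0 ?n1.
  apply: hot_trans (hot_sym (catA prn pn phl _ _)) _; rewrite ?rev1 ?cat0 ?n1 ?gh//.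
  apply: hot_trans (_ : hot A _ (cat (fun _ => h 0) (cat h (rev l)))) _.
    apply: hot_cat; [|exact: hot_refl|by rewrite cat1 cat0 n1 gh].
    have := cat_rev prn; rewrite rev0 n1 gh.
    by rewrite (_ : rev (rev n) = n)//; apply/funext => t; rewrite /rev subKr.
  by apply: cst_cat => //; rewrite cat0.
apply: hot_trans (hot_sym (catA pmg ph prl _ _)) _; rewrite ?cat1 ?rev0 ?gh//.
apply: hot_cat; [|exact: hot_refl|by rewrite cat1 rev0].
by apply: catA => //; rewrite m1.
Qed.

Definition uni g a b := ucls (g \o aff a b).

Lemma uni_functor : functor A uni.
Proof.
have pa g a b : path_in A g -> path_in A (g \o aff a b) by move=> pg; apply: path_comp => //; exact: aff_cont.
split=> [g pg a b c|g phi pg cphi a b|H cH AH s1 s2 t1 t2]; rewrite /uni.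
- rewrite -ucls_cat /= ?aff0 ?aff1//; try exact: pa.
  apply: ucls_hot; [by apply: path_cat; rewrite /= ?aff0 ?aff1//; exact: pa|exact: pa|].
  have ccl := @cl_cont R.
  have -> : cat (g \o aff a b) (g \o aff b c) =
      g \o (fun t => a + cl (2 * t) * (b - a) + cl (2 * t - 1) * (c - b)).
    apply/funext => t; rewrite /cat /aff /=; case: ifP => h.
      by rewrite (cl_le0 (t := 2 * t - 1)) ?mul0r ?addr0//; lra.
    rewrite (cl_ge1 (t := 2 * t)); last by move: h => /negbT; rewrite -ltNge; lra.
    by congr (g _); ring.
  apply: hot_reparam => //; [cont|exact: aff_cont| |].
    by rewrite aff0 !cl_le0 ?mul0r ?addr0//; lra.
  by rewrite aff1 !cl_ge1; lra.
- have pgp : path_in A (g \o phi) by exact: path_comp.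
  apply: ucls_hot; [exact: pa|exact: pa|].
  apply: (hot_reparam (phi := phi \o aff a b)) => //=; rewrite ?aff0 ?aff1//; last exact: aff_cont.
  by apply: contcomp => //; exact: aff_cont.
- have pr s : path_in A (fun t => H (s, t)) by split=> [|//]; apply: (contcomp cH); cont.
  have pc t : path_in A (fun s => H (s, t)) by split=> [|//]; apply: (contcomp cH); cont.
  have pra s a b := pa _ a b (pr s); have pca s a b := pa _ a b (pc s).
  rewrite -!ucls_cat /= ?aff0 ?aff1//.
  apply: ucls_hot; try by apply: path_cat; rewrite /= ?aff0 ?aff1.
  have ccl := @cl_cont R.
  have -> : cat ((fun t => H (s1, t)) \o aff t1 t2) ((fun s => H (s, t2)) \o aff s1 s2) =
      H \o (fun t => (aff s1 s2 (cl (2 * t - 1)), aff t1 t2 (cl (2 * t)))).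
    apply/funext => t; rewrite /cat /=; case: ifP => h.
      by rewrite (cl_le0 (t := 2 * t - 1)) ?aff0//; lra.
    by rewrite (cl_ge1 (t := 2 * t)) ?aff1//; move: h => /negbT; rewrite -ltNge; lra.
  have -> : cat ((fun s => H (s, t1)) \o aff s1 s2) ((fun t => H (s2, t)) \o aff t1 t2) =
      H \o (fun t => (aff s1 s2 (cl (2 * t)), aff t1 t2 (cl (2 * t - 1)))).
    apply/funext => t; rewrite /cat /=; case: ifP => h.
      by rewrite (cl_le0 (t := 2 * t - 1)) ?aff0//; lra.
    by rewrite (cl_ge1 (t := 2 * t)) ?aff1//; move: h => /negbT; rewrite -ltNge; lra.
  apply: hot_square => //; rewrite /aff; [cont|cont| |].
    by rewrite !cl_le0//; lra.
  by rewrite !cl_ge1//; lra.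
Qed.

End Mu.

(** The functor sends a path to the class of the loop obtained by closing it with chosen paths from
    the base point. The path chosen for the base point itself is constant, so a loop there is sent
    to its own class. The cochain [f] is the value of [hl] on the chosen paths. *)
Theorem universal_functor : exists kap : (R -> X) -> R -> R -> G, [/\ functor A kap,
  forall k : G, exists2 g, is_loop g & k = kap g 0 1 &
  forall (K : groupType) (hl : (R -> X) -> R -> R -> K), functor A hl ->
    exists (phi : {multiplicative G -> K}) (f : X -> K), forall g, path_in A g ->
      phi (kap g 0 1) = (f (g 0%R) * hl g 0%R 1%R * (f (g 1%R))^-1)%g].
Proof.
have [mu [mux mup]] := base_paths.
have mu_path w (Aw : A w) : path_in A (mu w) by have [] := mup w Aw.
have mu_0 w (Aw : A w) : mu w 0 = x0 by have [] := mup w Aw.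
have mu_1 w (Aw : A w) : mu w 1 = w by have [] := mup w Aw.
have affid g : g \o aff 0 1 = g by apply/funext => t; rewrite /= /aff subr0 mulr1 add0r.
exists (uni mu); split=> [|k|K hl fh]; first exact: uni_functor.
  have [g lg ->] := cls_surj k; exists g => //.
  have [pg g0 g1] := lg.
  rewrite /uni affid /ucls g0 g1 mux; apply: cls_hot => //.
    split; rewrite ?cat0 ?cat1//.
    by apply: path_cat; [apply: path_cat => //; exact: path_cst|exact: path_cst|rewrite cat1].
  apply: hot_sym; apply: hot_trans (cst_cat pg g0).
  have pc : path_in A (cat (fun _ => x0) g) by apply: path_cat => //; exact: path_cst.
  by apply: (cat_cst pc); rewrite cat1.
pose phi (k : G) := hl (loop_ext (repr k)) 0 1.
have phiE g : is_loop g -> phi (cls g) = hl g 0 1.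
  move=> lg; have [pg _ _] := lg; apply: (kap_hot fh) => //; last by case: (path_loop_ext (repr (cls g))).
  apply: hot_trans (loop_of_hot lg).
  by apply/pi1_eqP; rewrite reprK.
have phiM : {morph phi : k l / (k * l)%g >-> (k * l)%g}.
  move=> k l; have [g lg ->] := cls_surj k; have [h lh ->] := cls_surj l.
  rewrite -cls_cat// !phiE//; last exact: is_loop_cat.
  by case: lg lh => [pg _ g1] [ph h0 _]; apply: (kap_cat fh) => //; rewrite g1.
pose Phi : {multiplicative G -> K} := HB.pack phi (isMultiplicative.Build G K phi phiM).
have PhiE g : is_loop g -> Phi (cls g) = hl g 0 1 by exact: phiE.
exists Phi, (fun w => hl (mu w) 0 1) => g pg.
have Ag t : A (g t) by case: pg.
rewrite /uni affid /ucls PhiE; last first.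
  split; rewrite ?cat0 ?cat1 ?rev1 ?mu_0//.
  apply: path_cat; [apply: path_cat => //|apply: path_rev|]; rewrite ?cat1 ?rev0 ?mu_1//; exact: mu_path.
rewrite (kap_cat fh) ?cat1 ?rev0 ?mu_1//; [|apply: path_cat => //|apply: path_rev]; rewrite ?mu_1//; try exact: mu_path.
rewrite (kap_cat fh) ?mu_1//; last exact: mu_path.
by rewrite (kap_rev fh)//; exact: mu_path.
Qed.

End Universal.

(** * Collapsing, pushing and products *)

Section MoreContinuity.
Variables (R : realType) (T : topologicalType).

Lemma cont_row k (f : T -> 'rV[R]_k) :
  (forall j, continuous (fun t => f t 0 j)) -> continuous f.
Proof.
move=> cf t; apply/cvg_ballP => e e0.
have h : \forall u \near t, forall j, ball (f t 0 j) e (f u 0 j).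
  by apply: (@filter_forall _ _ _ (nbhs t) (nbhs_filter t)) => j; apply: (cf j t); exact: nbhsx_ballx.
apply: (@filterS _ (nbhs t) (nbhs_filter t)) h => u hu; split=> // i j.
by rewrite !ord1; exact: hu.
Qed.

Lemma cont_entry k (f : T -> 'rV[R]_k) j : continuous f -> continuous (fun t => f t 0 j).
Proof. by move=> cf; apply: (contcomp (@coord_continuous R 1 k 0 j)). Qed.

Lemma cont_sum (I : finType) (P : pred I) (f : I -> T -> R) :
  (forall i, continuous (f i)) -> continuous (fun t => \sum_(i | P i) f i t).
Proof.
move=> cf; rewrite (_ : (fun t => _) = fun t => \sum_(i <- [seq i <- index_enum I | P i]) f i t); last first.
  by apply/funext => t; rewrite big_filter.
elim: [seq i <- index_enum I | P i] => [|i s ih].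
  by rewrite (_ : (fun t => _) = fun => 0); [exact: contcst|apply/funext => t; rewrite big_nil].
rewrite (_ : (fun t => _) = fun t => f i t + \sum_(i <- s) f i t); first exact: contD.
by apply/funext => t; rewrite big_cons.
Qed.

Lemma contV (f : T -> R) : (forall t, f t != 0) -> continuous f -> continuous (fun t => (f t)^-1).
Proof. by move=> f0 cf t; exact: (cvgV (f0 t) (cf t)). Qed.

Lemma contsqrt (f : T -> R) : continuous f -> continuous (fun t => Num.sqrt (f t)).
Proof. by move=> cf t; apply: (continuous_comp (cf t)); exact: sqrt_continuous. Qed.

End MoreContinuity.

Section Conn.
Variables (R : realType) (X : topologicalType).
Implicit Types (A B : set X) (x y z : X).

Definition conn A x y := exists g : R -> X, [/\ path_in A g, g 0 = x & g 1 = y].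

Lemma conn_refl A x : A x -> conn A x x.
Proof. by move=> Ax; exists (fun _ => x); split=> //; exact: path_cst. Qed.

Lemma conn_sym A x y : conn A x y -> conn A y x.
Proof.
by move=> [g [pg g0 g1]]; exists (rev g); rewrite rev0 rev1; split=> //; exact: path_rev.
Qed.

Lemma conn_trans A x y z : conn A x y -> conn A y z -> conn A x z.
Proof.
move=> [g [pg g0 g1]] [h [ph h0 h1]]; exists (cat g h); rewrite cat0 cat1; split=> //.
by apply: path_cat; rewrite // g1 h0.
Qed.

Lemma conn_in A x y : conn A x y -> A x /\ A y.
Proof. by move=> [g [[_ Ag] <- <-]]. Qed.

Lemma conn_sub A B x y : A `<=` B -> conn A x y -> conn B x y.
Proof. by move=> AB [g [[cg Ag] g0 g1]]; exists g; split=> //; split=> // t; exact: AB. Qed.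

Lemma conn_curve A (f : R -> X) : continuous f -> (forall t, 0 <= t <= 1 -> A (f t)) -> conn A (f 0) (f 1).
Proof.
move=> cf Af; exists (f \o @cl R); rewrite /= cl0 cl1; split=> //; split=> [|t]; last exact/Af/cl_itv.
by apply: contcomp => //; exact: cl_cont.
Qed.

End Conn.

Lemma conn_map (R : realType) (X Y : topologicalType) (A : set X) (B : set Y) (f : X -> Y) x y :
  continuous f -> (forall w, A w -> B (f w)) -> conn R A x y -> conn R B (f x) (f y).
Proof.
move=> cf AB [g [[cg Ag] g0 g1]]; exists (f \o g); rewrite /= g0 g1; split=> //.
by split=> [|t]; [exact: contcomp|exact: AB].
Qed.

Section Sphere.
Variables (R : realType) (k : nat) (I : pred 'I_k) (j1 j2 : 'I_k).
Hypotheses (I1 : I j1) (I2 : I j2) (j12 : j1 != j2).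
Local Notation E := 'rV[R]_k.

Definition bsq (x : E) : R := \sum_(j | I j) x 0 j ^+ 2.

Definition bunit (x : E) := bsq x = 1.

Lemma bsq_ge0 x : 0 <= bsq x.
Proof. by apply: sumr_ge0 => j _; exact: sqr_ge0. Qed.

Lemma bsq_eq0 x : bsq x = 0 -> forall j, I j -> x 0 j = 0.
Proof.
move=> x0 j Ij; apply/eqP; rewrite -sqrf_eq0; apply/eqP.
by apply: (psumr_eq0P _ x0) => // i _; exact: sqr_ge0.
Qed.

Lemma bsq_neq0 (x : E) j : I j -> x 0 j != 0 -> bsq x != 0.
Proof. by move=> Ij; apply: contra => /eqP/bsq_eq0 ->. Qed.

Lemma bsq_cont : continuous bsq.
Proof. by apply: cont_sum => j; apply: contX; apply: (@cont_entry _ _ _ id); exact: contid. Qed.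

Lemma bsqZ c x : bsq (c *: x) = c ^+ 2 * bsq x.
Proof. by rewrite /bsq mulr_sumr; apply: eq_bigr => j _; rewrite mxE exprMn. Qed.

Lemma bunit_delta j : I j -> bunit ('e_j : E).
Proof.
move=> Ij; rewrite /bunit /bsq (bigD1 j)//= big1 ?addr0 => [|i /andP[_ ij]].
  by rewrite mxE !eqxx expr1n.
by rewrite mxE eqxx /= (negbTE ij) expr0n.
Qed.

(** Segments that avoid 0 in the block lead to ['e_j1], and are then normalized. A vector whose
    block is a multiple of ['e_j1] first makes a detour through ['e_j2]. *)
Lemma sphere_conn (x y : E) : bunit x -> bunit y -> conn R bunit x y.
Proof.
pose N := [set z : E | bsq z != 0].
have Nlin (a b : E) j : I j -> (forall t : R, 0 <= t <= 1 -> (1 - t) * a 0 j + t * b 0 j = 0 -> t = 1) ->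
    bsq b != 0 -> conn R N a b.
  move=> Ij h b0.
  have ha : a = (1 - 0) *: a + (0 : R) *: b by rewrite subr0 scale1r scale0r addr0.
  have hb : b = (1 - 1) *: a + (1 : R) *: b by rewrite subrr scale0r scale1r add0r.
  rewrite [X in conn _ _ X _]ha [X in conn _ _ _ X]hb.
  apply: (@conn_curve R _ N (fun t => (1 - t) *: a + t *: b)).
    apply: cont_row => i; rewrite (_ : (fun t => _) = fun t => (1 - t) * a 0 i + t * b 0 i); first by cont.
    by apply/funext => t; rewrite !mxE.
  move=> t t01; have [e|ne] := eqVneq ((1 - t) * a 0 j + t * b 0 j) 0.
    by rewrite /N /= (h t t01 e) subrr scale0r add0r scale1r.
  by apply: (@bsq_neq0 _ j) => //; rewrite !mxE.
have nd j : I j -> bsq ('e_j : E) != 0 by move=> /bunit_delta ->; exact: oner_neq0.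
have toe1 a : bsq a != 0 -> (exists j, [/\ I j, j != j1 & a 0 j != 0]) -> conn R N a 'e_j1.
  move=> _ [j [Ij jj1 aj]]; apply: (Nlin _ _ j) => //; last exact: nd.
  move=> t _ /eqP; rewrite mxE eqxx /= (negbTE jj1) mulr0 addr0 mulf_eq0 (negbTE aj) orbF subr_eq0.
  by move/eqP.
have e21 : conn R N 'e_j2 'e_j1.
  apply: toe1; first exact: nd.
  by exists j2; split=> //; [rewrite eq_sym|rewrite mxE !eqxx /=; exact: oner_neq0].
have all1 a : bsq a != 0 -> conn R N a 'e_j1.
  move=> a0; have [h|h] := pselect (exists j, [/\ I j, j != j1 & a 0 j != 0]); first exact: toe1.
  apply: conn_trans e21; apply: (Nlin _ _ j1) => //; last exact: nd.
  have a1 : a 0 j1 != 0.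
    apply: contra a0 => /eqP a1; rewrite /bsq big1// => j Ij; have [->|jj] := eqVneq j j1; first by rewrite a1 expr0n.
    by have [->|aj] := eqVneq (a 0 j) 0; [rewrite expr0n|case: h; exists j].
  move=> t _ /eqP; rewrite mxE eqxx /= (negbTE j12) mulr0 addr0 mulf_eq0 (negbTE a1) orbF subr_eq0.
  by move/eqP.
move=> ux uy; have [g [[cg Ng] g0 g1]] : conn R N x y.
  by apply: conn_trans (all1 x _) (conn_sym (all1 y _)); rewrite ?ux ?uy oner_neq0.
have sg t : Num.sqrt (bsq (g t)) != 0.
  by rewrite sqrtr_eq0 -ltNge lt0r bsq_ge0 andbT; exact: Ng.
exists (fun t => (Num.sqrt (bsq (g t)))^-1 *: g t).
rewrite g0 g1 ux uy sqrtr1 invr1 !scale1r; split=> //; split=> [|t].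
  apply: cont_row => j; rewrite (_ : (fun t => _) = fun t => (Num.sqrt (bsq (g t)))^-1 * g t 0 j).
    apply: contM; last exact: cont_entry.
    by apply: contV => //; apply: contsqrt; apply: contcomp => //; exact: bsq_cont.
  by apply/funext => t; rewrite mxE.
by rewrite /bunit bsqZ exprVn sqr_sqrtr ?bsq_ge0// mulVf//; exact: Ng.
Qed.

End Sphere.

Section Collapse.
Variables (R : realType) (k : nat) (I : pred 'I_k) (j1 j2 : 'I_k).
Hypotheses (I1 : I j1) (I2 : I j2) (j12 : j1 != j2).
Local Notation E := 'rV[R]_k.
Local Notation U1 := (@bunit R k I).

Definition bnorm (x : E) : R := Num.sqrt (bsq I x).

(** Only the direction of the block changes. The equations of the level set depend on the block
    through its norm, so they are preserved. *)
Definition act (m a : E) : E := \row_j (if I j then bnorm m * a 0 j else m 0 j).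

Definition collapse (m : E) : E := act m 'e_j1.

Definition bdir (m : E) : E := if bnorm m == 0 then 'e_j1 else (bnorm m)^-1 *: m.

Lemma bnorm_ge0 x : 0 <= bnorm x. Proof. exact: sqrtr_ge0. Qed.

Lemma bnorm_cont : continuous bnorm.
Proof. by apply: contsqrt; exact: bsq_cont. Qed.

Lemma bnorm_eq0 x : bnorm x = 0 -> forall j, I j -> x 0 j = 0.
Proof.
by move/eqP; rewrite sqrtr_eq0 => h; apply: bsq_eq0; apply/le_anti; rewrite h bsq_ge0.
Qed.

Lemma act_cont (T : topologicalType) (f g : T -> E) : continuous f -> continuous g ->
  continuous (fun t => act (f t) (g t)).
Proof.
move=> cf cg; apply: cont_row => j.
rewrite (_ : (fun t => _) = fun t => if I j then bnorm (f t) * g t 0 j else f t 0 j).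
  case: (I j); last exact: cont_entry.
  by apply: contM; [apply: contcomp => //; exact: bnorm_cont|exact: cont_entry].
by apply/funext => t; rewrite mxE.
Qed.

Lemma bdir_unit x : U1 (bdir x).
Proof.
rewrite /bdir; case: eqP => [_|/eqP x0]; first exact: bunit_delta.
rewrite /bunit bsqZ exprVn sqr_sqrtr ?bsq_ge0// mulVf//.
by apply: contra x0 => /eqP h; rewrite /bnorm h sqrtr0.
Qed.

Lemma act_bdir x : act x (bdir x) = x.
Proof.
apply/rowP => j; rewrite mxE; case: ifP => // Ij.
have [x0|x0] := eqVneq (bnorm x) 0; first by rewrite x0 mul0r (bnorm_eq0 x0).
by rewrite /bdir (negbTE x0) mxE mulVKf.
Qed.

Variables (Z : set E) (K : groupType) (kap : (R -> E) -> R -> R -> K).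
Hypothesis fk : functor Z kap.
Hypothesis Zact : forall m a, Z m -> U1 a -> Z (act m a).
Hypothesis Zflat : forall m, Z m -> bnorm m = 0 -> exists2 U, nbhs m U & flat kap (Z `&` U).
Hypothesis Zreach : forall m, Z m -> exists2 m', bnorm m' = 0 & conn R Z m m'.

Let Uid : U1 'e_j1. Proof. exact: bunit_delta. Qed.

(** A path that only turns the block of [m] is homotopic, through a motion of [m] to a point whose
    block is zero, to a path in a fibre reduced to one point. The chosen motions supply the
    potential [D]. *)
Lemma fibre_potential : exists D : E -> E -> K, forall m l, Z m -> path_in U1 l ->
  kap (fun t => act m (l t)) 0 1 = (D m (l 0%R) * (D m (l 1%R))^-1)%g.
Proof.
have [del hd] : {del : E -> R -> E & forall m, Z m ->
    [/\ path_in Z (del m), del m 0 = m & bnorm (del m 1) = 0]}.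
  apply: (@choice _ _ (fun m g => Z m -> [/\ path_in Z g, g 0 = m & bnorm (g 1) = 0])) => m.
  have [Zm|nZ] := pselect (Z m); last by exists (fun _ => m).
  by have [m' m0 [g [pg g0 g1]]] := Zreach Zm; exists g; rewrite g1.
exists (fun m a => kap (fun s => act (del m s) a) 0 1) => m l Zm [cl Ul].
have [[cd Zd] d0 d1] := hd m Zm.
have cH : continuous (fun z : R * R => act (del m z.1) (l z.2)) by apply: act_cont; cont.
have := kap_square fk 0 1 cH (fun z => Zact (Zd _) (Ul _)); rewrite /= d0.
have -> : (fun t => act (del m 1) (l t)) = fun _ => act (del m 1) (l 0).
  apply/funext => t; apply/rowP => j; rewrite !mxE.
  by case: ifP => // _; rewrite d1 !mul0r.
rewrite (kap_cst fk); last exact: Zact.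
set a := kap (fun s => act (del m s) (l 0)) 0 1; set b := kap (fun s => act (del m s) (l 1)) 0 1.
move=> e1; have := congr1 (fun z => a * z * b^-1)%g e1; rewrite mulg1 => ->.
by rewrite !mulgA mulgV mul1g mulgK.
Qed.

(** Where the block is nonzero its direction is continuous, and a path splits into a part with fixed
    direction and a part inside one fibre. At a zero of the block the direction is discontinuous,
    and local flatness is used instead. *)
Theorem collapse_kap : exists e : E -> K, forall g, path_in Z g ->
  kap g 0 1 = (e (g 0%R) * kap (collapse \o g) 0 1 * (e (g 1%R))^-1)%g.
Proof.
have [D hD] := fibre_potential.
pose e m := (D m (bdir m) * (D m 'e_j1)^-1)%g; exists e.
have ccol : continuous collapse.
  by apply: (@act_cont E (fun m => m) (fun _ => 'e_j1)); [exact: contid|exact: contcst].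
have fk' : functor Z (fun g => kap (collapse \o g)).
  by apply: functor_pull fk => // m Zm; exact: Zact.
apply: (@path_local R E Z K K kap (fun g => kap (collapse \o g))
  (fun x y k l => k = (e x * l * (e y)^-1)%g)) => //.
  by move=> x y z k1 l1 k2 l2 -> ->; grp.
move=> m Zm; have [m0|m0] := eqVneq (bnorm m) 0.
- have [U nU [d hd]] := Zflat Zm m0.
  have /nbhs_ballP[r /= r0 hr] := nU.
  exists (ball m r `&` [set x | bnorm x < r]).
    apply: filterI; first exact: nbhsx_ballx.
    have h : nbhs (bnorm m) [set y | y < r] by rewrite m0; exact: lt_nbhsl.
    exact: (bnorm_cont h).
  have inU x a : ball m r x -> bnorm x < r -> U1 a -> U (act x a).
    move=> bx nx Ua; apply: hr; split=> // i j; rewrite !ord1 mxE; case: ifP => Ij; last by case: bx.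
    rewrite (bnorm_eq0 m0 Ij) /ball /= sub0r normrN normrM ger0_norm ?bnorm_ge0//.
    apply: le_lt_trans nx; rewrite ler_piMr ?bnorm_ge0//.
    rewrite -(@ler_pXn2r _ 2)// ?nnegrE// expr1n -normrX ger0_norm ?sqr_ge0//.
    by rewrite -Ua /bsq (bigD1 j)//= lerDl; apply: sumr_ge0 => ? _; exact: sqr_ge0.
  move=> g [cg Zg].
  (* [D] is evaluated along a path of directions from [bdir x] to ['e_j1]. This path stays in the
     fibre over [x], hence in [U], where [kap] has the potential [d]. *)
  have eE x : (Z `&` (ball m r `&` [set x | bnorm x < r])) x -> e x = ((d x)^-1 * d (collapse x))%g.
    move=> [Zx [bx nx]]; have [l [[cl Ul] l0 l1]] := sphere_conn I1 I2 j12 (bdir_unit x) Uid.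
    rewrite /e -l0 -l1 -hD// hd ?l0 ?l1 ?act_bdir//.
    split=> [|t]; first by apply: act_cont; [exact: contcst|].
    by split; [exact: Zact|exact: inU].
  have pU : path_in (Z `&` U) g.
    by split=> // t; have [Zt [bt nt]] := Zg t; split=> //; rewrite -[g t]act_bdir; apply: inU => //; exact: bdir_unit.
  have pU' : path_in (Z `&` U) (collapse \o g).
    split=> [|t]; first exact: contcomp.
    by have [Zt [bt nt]] := Zg t; split; [exact: Zact|exact: inU].
  by rewrite !hd//= !eE//; grp; rewrite -!mulgA mulKg mulVKg mulVKg.
- exists [set x | bnorm x != 0].
    have o : open [set y : R | y != 0] by apply: open_neq.
    have h : nbhs (bnorm m) [set y | y != 0] by apply: open_nbhs_nbhs.
    exact: (bnorm_cont h).
  move=> g [cg Zg].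
  have Zgt t : Z (g t) by have [] := Zg t.
  have cd : continuous (bdir \o g).
    apply: cont_row => j; rewrite (_ : (fun t => _) = fun t => (bnorm (g t))^-1 * g t 0 j).
      apply: contM; last exact: cont_entry.
      apply: contV => [t|]; first by have [] := Zg t.
      by apply: contcomp => //; exact: bnorm_cont.
    by apply/funext => t; rewrite /bdir /=; have [_ /negbTE ->] := Zg t; rewrite mxE.
  have Ud t : U1 (bdir (g t)) by exact: bdir_unit.
  have cH : continuous (fun z : R * R => act (g z.2) (bdir (g z.1))).
    apply: act_cont; first by cont.
    by have := contcomp cd (contfst (@contid (R * R)%type)).
  have -> : kap g 0 1 = kap (fun t => act (g t) (bdir (g t))) 0 1.
    by congr (kap _ _ _); apply/funext => t; rewrite act_bdir.
  rewrite (kap_diag fk 0 1 cH (fun z => Zact (Zgt _) (Ud _))) /=.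
  rewrite (@hD (g 1) (fun s => bdir (g s)))//.
  have [l [[cl Ul] l0 l1]] := sphere_conn I1 I2 j12 (bdir_unit (g 0)) Uid.
  have cH2 : continuous (fun z : R * R => act (g z.2) (l z.1)) by apply: act_cont; cont.
  have := kap_square fk 0 1 cH2 (fun z => Zact (Zgt _) (Ul _)); rewrite /= l0 l1.
  rewrite !hD// l0 l1 => ->.
  by rewrite /e !invgM !invgK; grp; rewrite -?mulgA ?mulKg ?mulVKg.
Qed.

End Collapse.

Section Generation.
Variables (R : realType) (X : topologicalType) (K : groupType) (S : K -> Prop).
Hypothesis SM : forall k l, S k -> S l -> S (k * l)%g.
Variables (W : set X) (kap : (R -> X) -> R -> R -> K).
Hypothesis fk : functor W kap.

(* Up to the 0-cochain e, the functor takes its values in S. *)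
Definition gen_in (A : set X) (e : X -> K) := forall g, path_in A g ->
  S (e (g 0%R) * kap g 0 1 * (e (g 1%R))^-1)%g.

(** The cochain is corrected by the values of [kap] on the tracks of the deformation. *)
Lemma gen_homotopy (A B : set X) (F : R -> X -> X) e : A `<=` W ->
  (forall (T : topologicalType) (f : T -> R) (g : T -> X), continuous f -> continuous g -> (forall t, A (g t)) ->
     continuous (fun t => F (f t) (g t))) ->
  (forall s w, A w -> W (F s w)) -> (forall w, A w -> F 1 w = w) ->
  (forall w, A w -> B (F 0 w)) -> gen_in B e -> exists e', gen_in A e'.
Proof.
move=> AW cF WF F1 BF he; exists (fun w => e (F 0 w) * kap (F^~ w) 0 1)%g => g [cg Ag].
have cH : continuous (fun z : R * R => F z.1 (g z.2)) by apply: cF => //; cont.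
have := @kap_homotopy _ _ _ _ _ fk F g 0 1 (fun z : R * R => WF z.1 _ (Ag z.2)) cH.
have -> : F 1 \o g = g by apply/funext => t; exact: F1.
move=> ->; have pg : path_in B (F 0 \o g).
  split=> [|t]; last exact: BF.
  by apply: (cF _ (fun _ => 0)) => //; exact: contcst.
have := he _ pg; rewrite /= !invgM !mulgA.
by rewrite !mulgK.
Qed.

Lemma flat_homotopy (A B : set X) (F : R -> X -> X) :
  (forall (T : topologicalType) (f : T -> R) (g : T -> X), continuous f -> continuous g -> (forall t, A (g t)) ->
     continuous (fun t => F (f t) (g t))) ->
  (forall s w, A w -> W (F s w)) -> (forall w, A w -> F 1 w = w) ->
  (forall w, A w -> B (F 0 w)) -> flat kap B -> flat kap A.
Proof.
move=> cF WF F1 BF [d hd]; exists (fun w => d (F 0 w) * kap (F^~ w) 0 1)%g => g [cg Ag].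
have cH : continuous (fun z : R * R => F z.1 (g z.2)) by apply: cF => //; cont.
have := @kap_homotopy _ _ _ _ _ fk F g 0 1 (fun z : R * R => WF z.1 _ (Ag z.2)) cH.
have -> : F 1 \o g = g by apply/funext => t; exact: F1.
move=> ->; rewrite (hd (F 0 \o g)); last first.
  split=> [|t]; last exact: BF.
  by apply: (cF _ (fun _ => 0)) => //; exact: contcst.
by rewrite /= invgM !mulgA.
Qed.

Lemma flat_point w : W w -> flat kap [set w].
Proof.
move=> Ww; exists (fun _ => 1%g) => g [_ hg]; rewrite invg1 mulg1.
have -> : g = fun _ => w by apply/funext => t; exact: hg.
exact: (kap_cst fk).
Qed.

(** The generation half of van Kampen's theorem: a flat piece that meets [W'] in a connected set
    adds no generator, because a path in it has the same value as a path of the intersection, up to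
    the potential. *)
Lemma gen_push (W' : set X) (J : Type) (V : J -> set X) e : W' `<=` W ->
  (forall w, W w -> exists2 U, nbhs w U & W `&` U `<=` W' \/ exists j, W `&` U `<=` V j) ->
  (forall j, flat kap (V j)) -> (forall j, exists w, (V j `&` W') w) ->
  (forall j w w', (V j `&` W') w -> (V j `&` W') w' -> conn R (V j `&` W') w w') ->
  (forall i j w, V i w -> V j w -> i = j) ->
  gen_in W' e -> exists e', gen_in W e'.
Proof.
move=> W'W cover Vflat Vne Vconn Vdisj he.
have [d hd] := choice Vflat; have [ws hws] := choice Vne.
(* On a piece [V j] the cochain is continued by the potential [d j], normalized at the point [ws j]
   of the intersection. The disjointness of the pieces makes the choice of [j] unambiguous. *)
pose e' w : K := if `[< W' w >] then e w
  else if pselect (exists j, V j w) is left h then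
    let j := projT1 (cid h) in (e (ws j) * (d j (ws j))^-1 * d j w)%g else 1%g.
have e'W w : W' w -> e' w = e w by move=> Ww; rewrite /e'; case: asboolP.
have e'V j w : V j w -> exists2 a, (V j `&` W') a & e' w = (e a * (d j a)^-1 * d j w)%g.
  move=> Vw; have [Ww|Ww] := pselect (W' w).
    by exists w => //; rewrite e'W// mulgVK.
  exists (ws j) => //; rewrite /e'; case: asboolP => // _.
  case: pselect => [h|[]]; last by exists j.
  by case: cid => i Vi /=; rewrite (Vdisj i j w).
exists e'; have := @path_local R X W K K kap kap
  (fun x y k l => S (e' x * k * (e' y)^-1)%g); apply=> //.
  move=> x y z k l k' l' h1 h2.
  by have := SM h1 h2; rewrite !mulgA mulgVK.
move=> w Ww; have [U nU [UW'|[j UV]]] := cover w Ww; exists U => // g [cg Ug].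
  rewrite !e'W; [apply: he; split=> // t|..]; exact/UW'/Ug.
have pV : path_in (V j) g by split=> // t; exact/UV/Ug.
have [a Va ->] := e'V j (g 0) (pV.2 0); have [b Vb ->] := e'V j (g 1) (pV.2 1).
have [h [[ch Vh] h0 h1]] := Vconn j a b Va Vb.
have ph : path_in W' h by split=> // t; have [] := Vh t.
have ph' : path_in (V j) h by split=> // t; have [] := Vh t.
have := he h ph; rewrite (hd j h ph') (hd j g pV) h0 h1.
by rewrite !invgM !invgK !mulgA !mulgK.
Qed.

End Generation.

Section PlaneConn.
Variable R : realType.

Lemma plane_conn (c1 c2 a b a' b' : R) : 0 < c1 ->
  c1 <= a ^+ 2 + b ^+ 2 <= c2 -> c1 <= a' ^+ 2 + b' ^+ 2 <= c2 ->
  conn R [set z : R * R | c1 <= z.1 ^+ 2 + z.2 ^+ 2 <= c2] (a, b) (a', b').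
Proof.
move=> c10 h h'.
pose row (x y : R) : 'rV[R]_2 := \row_j (if j == 0 then x else y).
have bsqE (z : 'rV[R]_2) : bsq predT z = z 0 0 ^+ 2 + z 0 1 ^+ 2.
  transitivity (\sum_(j < 2) z 0 j ^+ 2); first exact: eq_bigl.
  by rewrite big_ord_recl big_ord1; congr (_ + z 0 _ ^+ 2); exact: val_inj.
pose rad (x y : R) := Num.sqrt (x ^+ 2 + y ^+ 2).
have radp x y : c1 <= x ^+ 2 + y ^+ 2 -> 0 < rad x y by move=> ?; rewrite sqrtr_gt0; lra.
have rad2 x y : rad x y ^+ 2 = x ^+ 2 + y ^+ 2 by rewrite sqr_sqrtr// addr_ge0 ?sqr_ge0.
have unit x y : c1 <= x ^+ 2 + y ^+ 2 -> @bunit R 2 predT (row (x / rad x y) (y / rad x y)).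
  move=> hx; have r0 := radp _ _ hx; rewrite /bunit bsqE !mxE /= !expr_div_n -mulrDl rad2.
  by rewrite divff//; lra.
have /andP[h1 h2] := h; have /andP[h1' h2'] := h'.
have j01 : (0 : 'I_2) != 1 by [].
have [g [[cg Ug] g0 g1]] := sphere_conn (I := predT) isT isT j01 (unit _ _ h1) (unit _ _ h1').
have r0 := radp _ _ h1; have r0' := radp _ _ h1'.
pose rho t := (1 - cl t) * rad a b + cl t * rad a' b'.
exists (fun t => (rho t * g t 0 0, rho t * g t 0 1)); split; last 2 first.
- by rewrite g0 !mxE /= /rho cl0 subr0 mul1r mul0r addr0; congr pair; rewrite mulrCA mulfV ?mulr1// gt_eqF.
- by rewrite g1 !mxE /= /rho cl1 subrr mul1r mul0r add0r; congr pair; rewrite mulrCA mulfV ?mulr1// gt_eqF.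
split=> [|t].
  have ccl := @cl_cont R; have := @cont_entry _ _ _ _ 0 cg; have := @cont_entry _ _ _ _ 1 cg.
  by rewrite /rho => c1' c0'; apply: contpair; apply: contM => //; cont.
have /andP[t0 t1] := cl_itv t; rewrite /= !exprMn -mulrDr.
have := Ug t; rewrite /bunit bsqE => ->; rewrite mulr1.
have m1 : Num.sqrt c1 <= rad a b by rewrite ler_sqrt; lra.
have m2 : rad a b <= Num.sqrt c2 by rewrite ler_sqrt; lra.
have m1' : Num.sqrt c1 <= rad a' b' by rewrite ler_sqrt; lra.
have m2' : rad a' b' <= Num.sqrt c2 by rewrite ler_sqrt; lra.
have s1 : 0 <= Num.sqrt c1 by exact: sqrtr_ge0.
have e1 : Num.sqrt c1 ^+ 2 = c1 by rewrite sqr_sqrtr; lra.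
have e2 : Num.sqrt c2 ^+ 2 = c2 by rewrite sqr_sqrtr; lra.
rewrite -e1 -e2; have l1 : Num.sqrt c1 <= rho t by rewrite /rho; nra.
have l2 : rho t <= Num.sqrt c2 by rewrite /rho; nra.
by apply/andP; split; nra.
Qed.

End PlaneConn.

Section Product.
Variables (R : realType) (X Y : topologicalType) (K : groupType) (S : K -> Prop).
Variables (W : set (X * Y)) (kap : (R -> X * Y) -> R -> R -> K).
Hypothesis fk : functor W kap.
Variables (P : set X) (Q : set Y) (p0 : X) (q0 : Y).
Hypothesis PQW : forall p q, P p -> Q q -> W (p, q).
Hypothesis P0 : P p0.
Hypothesis Q0 : Q q0.
Hypothesis Pconn : forall p, P p -> conn R P p p0.
Hypothesis Qconn : forall q, Q q -> conn R Q q q0.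
Hypothesis flat0 : flat kap [set w : X * Y | w.1 = p0 /\ Q w.2].

(** Motions in the second factor contribute nothing: they can be transported to the slice over [p0],
    where the functor is flat. *)
Lemma gen_product (eP : X -> K) :
  gen_in S (fun g : R -> X => kap (fun t => (g t, q0))) P eP ->
  exists e, gen_in S kap [set w : X * Y | P w.1 /\ Q w.2] e.
Proof.
move=> hP.
have [del hd] : {del : X -> R -> X & forall p, P p -> [/\ path_in P (del p), del p 0 = p & del p 1 = p0]}.
  apply: (@choice _ _ (fun p g => P p -> [/\ path_in P g, g 0 = p & g 1 = p0])) => p.
  by have [/Pconn/cid[g h]|nP] := pselect (P p); [exists g|exists (fun _ => p0)].
have [nu hn] : {nu : Y -> R -> Y & forall q, Q q -> [/\ path_in Q (nu q), nu q 0 = q & nu q 1 = q0]}.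
  apply: (@choice _ _ (fun q g => Q q -> [/\ path_in Q g, g 0 = q & g 1 = q0])) => q.
  by have [/Qconn/cid[g h]|nQ] := pselect (Q q); [exists g|exists (fun _ => q0)].
have [b hb] := flat0.
pose B p q := kap (fun t => (p, nu q t)) 0 1.
pose D p q := kap (fun t => (del p t, q)) 0 1.
have sq (f : R -> X) (g : R -> Y) : path_in P f -> path_in Q g ->
    (kap (fun t => (f 0%R, g t)) 0 1 * kap (fun s => (f s, g 1%R)) 0 1 =
     kap (fun s => (f s, g 0%R)) 0 1 * kap (fun t => (f 1%R, g t)) 0 1)%g.
  move=> [cf Pf] [cg Qg].
  have cH : continuous (fun z : R * R => (f z.1, g z.2)) by cont.
  exact: (functor_square fk cH (fun z => PQW (Pf _) (Qg _))).
have hb0 g : path_in Q g -> kap (fun t => (p0, g t)) 0 1 = ((b (p0, g 0%R))^-1 * b (p0, g 1%R))%g.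
  move=> [cg Qg]; apply: (hb (fun t => (p0, g t))); split=> [|t]; first by cont.
  by split=> //; exact: Qg.
have key p q : P p -> Q q -> (D p q * (b (p0, q))^-1 = B p q * D p q0 * (b (p0, q0))^-1)%g.
  move=> Pp Qq; have [pd d0 d1] := hd p Pp; have [pn n0 n1] := hn q Qq.
  have := sq _ _ pd pn; rewrite d0 d1 n0 n1 -/(B p q) -/(D p q) -/(D p q0) (hb0 _ pn) n0 n1 => ->.
  by rewrite !mulgA mulgK.
have key' p q : P p -> Q q -> (b (p0, q) * (D p q)^-1 = b (p0, q0) * (D p q0)^-1 * (B p q)^-1)%g.
  by move=> Pp Qq; have /(congr1 (fun x => x^-1)%g) := key p q Pp Qq; rewrite !invgM !invgK !mulgA.
exists (fun w => eP w.1 * (B w.1 w.2)^-1)%g => g [cg PQg].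
have pp : path_in P (fun t => (g t).1) by split=> [|t]; [cont|have [] := PQg t].
have pq : path_in Q (fun t => (g t).2) by split=> [|t]; [cont|have [] := PQg t].
have [Pa Qa] := PQg 0; have [Pb Qb] := PQg 1.
have cH : continuous (fun z : R * R => ((g z.2).1, (g z.1).2)) by cont.
have AH z : W ((g z.2).1, (g z.1).2) by apply: PQW; [exact: pp.2|exact: pq.2].
have -> : kap g 0 1 = kap (fun t => ((g t).1, (g t).2)) 0 1.
  by congr (kap _ _ _); apply/funext => t; case: (g t).
rewrite (kap_diag fk 0 1 cH AH) /=.
have [pn n0 n1] := hn _ Qa.
have := sq _ _ pp pn; rewrite n0 n1 -/(B _ _) -/(B _ _) => e1.
have [pd d0 d1] := hd _ Pb.
have := sq _ _ pd pq; rewrite d0 d1 -/(D _ _) -/(D _ _) (hb0 _ pq) => e2.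
have {}e1 : kap (fun t => ((g t).1, (g 0%R).2)) 0 1 =
    (B (g 0%R).1 (g 0%R).2 * kap (fun t => ((g t).1, q0)) 0 1 * (B (g 1%R).1 (g 0%R).2)^-1)%g.
  by rewrite e1 mulgK.
have {}e2 : kap (fun s => ((g 1%R).1, (g s).2)) 0 1 =
    (D (g 1%R).1 (g 0%R).2 * (b (p0, (g 0%R).2))^-1 * (b (p0, (g 1%R).2) * (D (g 1%R).1 (g 1%R).2)^-1))%g.
  by rewrite !mulgA; move: e2; rewrite !mulgA => <-; rewrite mulgK.
rewrite e1 e2 key// key'//.
have := hP _ pp; rewrite !invgM !invgK !mulgA.
by rewrite !(mulgVK, mulgK).
Qed.

End Product.

Section ChartFlat.
Variables (R : realType) (m k : nat) (Z : set 'rV[R]_k) (K : groupType).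
Local Notation E := 'rV[R]_k.
Variables (kap : (R -> E) -> R -> R -> K) (fk : functor Z kap).

Lemma ball_segment (c y : 'rV[R]_m) e l : 0 <= l <= 1 -> ball c e y -> ball c e (c + l *: (y - c)).
Proof.
move=> /andP[l0 l1] [e0 h]; split=> // i j; have := h i j.
rewrite /ball /= !mxE opprD addNKr normrN normrM ger0_norm// distrC => h'.
by apply: le_lt_trans h'; rewrite ler_piMl.
Qed.

(** A coordinate ball is contracted radially to its centre. The factor is clamped by [cl] because
    homotopies are parametrized by the whole line. *)
Lemma chart_flat (a : chart R m (set_type Z)) p : cdom a p ->
  exists2 U, nbhs (set_val p) U & flat kap (Z `&` U).
Proof.
move=> ap; set c := cmap a p.
have [e /= e0 be] : exists2 e : R, 0 < e & forall y, ball c e y -> (cmap a @` cdom a) y.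
  have /nbhs_ballP[e e0 h] : nbhs c (cmap a @` cdom a).
    by apply: open_nbhs_nbhs; split; [exact: cimg_open|exists p].
  by exists e.
have nO : nbhs p [set q | cdom a q /\ ball c e (cmap a q)].
  apply: filterI; first by apply: open_nbhs_nbhs; split=> //; exact: cdom_open.
  exact: (cmap_continuous ap (nbhsx_ballx c e e0)).
move: nO => [V [[C oC CE] Vp hV]].
have Cin q : C (set_val q) -> cdom a q /\ ball c e (cmap a q) by move=> Cq; apply: hV; rewrite -CE.
have Cp : C (set_val p) by move: Vp; rewrite -CE.
exists C; first exact: open_nbhs_nbhs.
pose toZ x : set_type Z := if pselect (Z x) is left h then exist _ x (mem_set h) else p.
have toZE x : Z x -> set_val (toZ x) = x by rewrite /toZ; case: pselect.
have Din x : (Z `&` C) x -> cdom a (toZ x) /\ ball c e (cmap a (toZ x)).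
  by move=> [Zx Cx]; apply: Cin; rewrite toZE.
pose F (s : R) x : E := set_val (cinv a (c + cl s *: (cmap a (toZ x) - c))).
apply: (flat_homotopy fk (F := F)) (flat_point fk (w := set_val p) (set_valP p)).
- move=> T f g cf cg Zg.
  have ct : continuous (fun t => toZ (g t)).
    move=> t; apply: to_subset_continuousP.
    have -> : (fun y => set_val (toZ (g y))) = g.
      by apply/funext => y; rewrite toZE//; have [] := Zg y.
    exact: cg.
  have cm : continuous (fun t => cmap a (toZ (g t))).
    move=> t; have [dt _] := Din _ (Zg t).
    exact: (@continuous_comp _ _ _ (fun t => toZ (g t)) (cmap a) t (ct t) (cmap_continuous dt)).
  have cc : continuous (fun t => c + cl (f t) *: (cmap a (toZ (g t)) - c)).
    apply: cont_row => j; rewrite (_ : (fun t => _) =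
        fun t => c 0 j + cl (f t) * (cmap a (toZ (g t)) 0 j - c 0 j)); last first.
      by apply/funext => t; rewrite !mxE.
    have ccl := @cl_cont R; have cmj := @cont_entry R T m _ j cm.
    by apply: contD; [cont|apply: contM; [cont|apply: contD => //; cont]].
  move=> t; apply: (@continuous_comp _ _ _ (fun t => cinv a (c + cl (f t) *: (cmap a (toZ (g t)) - c))) set_val).
    apply: (@continuous_comp _ _ _ (fun t => c + cl (f t) *: (cmap a (toZ (g t)) - c)) (cinv a) t (cc t)).
    apply: cinv_continuous; apply: be; apply: ball_segment; first exact: cl_itv.
    by have [] := Din _ (Zg t).
  exact: val_continuous.
- by move=> s w _; exact: set_valP.
- move=> w Zw; have [dw _] := Din _ Zw; rewrite /F cl1 scale1r addrC subrK cmapK// toZE//.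
  by case: Zw.
- by move=> w _; rewrite /F /= cl0 scale0r addr0 /c cmapK.
Qed.

End ChartFlat.

(** * The real functions that define the manifold *)

Section Profile.
Variables (R : realType) (N r : nat) (S : 'I_r -> pred nat).
Local Notation st := (@step R).
Local Notation pos i := ((nat_of_ord i).+1%:R : R).

(* The obstacle at (i.+1, 0) is {v^2 < hh u} near u = i.+1, of half-width 1/4. *)
Definition hh (u : R) : R := \sum_(i < N) st (1 - 8 * (u - pos i) ^+ 2) - 2^-1.

(* The graph of phi j passes above the obstacles outside S j, and below the other ones. *)
Definition phi (j : 'I_r) (u : R) : R :=
  3 * \sum_(i < N | ~~ S j i.+1) st (2 - 8 * (u - pos i) ^+ 2).

(** With this width u / LL < 1/2 over every hole, so where psi >= 1 the distance from v to the graph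
    of [phi j] has square above 3/4 there, while a hole satisfies v^2 <= 1/2. *)
Definition LL : R := 2 * N.+1%:R.
(** Large enough for the disc u^2 + v^2 <= rho2 to contain every region psi <= 3, as well as a
    rectangle around all the holes. *)
Definition rho2 : R := 100 * N.+1%:R ^+ 2.
(** A squared elliptic radius, sheared along the graph of [phi j]: 1 <= psi <= 2 is a bent annulus
    and psi <= 3 a bent disc. *)
Definition psi j (u v : R) : R := (u / LL) ^+ 2 + (v - phi j u) ^+ 2.
(** The slices of W are [aa >= 0], a disc with holes, [bb >= 0], the ring, and [om >= 0], the disc
    that fills the ring. *)
Definition aa (u v : R) : R := (v ^+ 2 - hh u) * (rho2 - u ^+ 2 - v ^+ 2).
Definition bb j u v : R := (psi j u v - 1) * (2 - psi j u v).
Definition om j u v : R := 3 - psi j u v.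
(** The centres q_j are 4 apart, so the discs tau <= 4 have disjoint interiors and at most one
    summand of [ff] is nonzero at a time. *)
Definition tau (j : 'I_r) (s t : R) : R := (s - 4 * (nat_of_ord j)%:R) ^+ 2 + t ^+ 2.
(** The steps select [aa] for tau >= 1, [bb] for 1/2 <= tau <= 3/4 and [om] for tau <= 1/4; the
    plateau in the middle leaves room for separating the two transitions. *)
Definition ff (u v s t : R) : R := aa u v +
  \sum_(j < r) (st (4 - 4 * tau j s t) * (bb j u v - aa u v) +
                st (2 - 4 * tau j s t) * (om j u v - bb j u v)).

Lemma NS_ge1 : 1 <= N.+1%:R :> R. Proof. by rewrite ler1n. Qed.

Lemma LL_ge2 : 2 <= LL. Proof. by rewrite /LL; have := NS_ge1; lra. Qed.

Lemma pos_itv (i : 'I_N) : 1 <= pos i <= N%:R.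
Proof. by rewrite ler1n ler_nat ltn_ord. Qed.

Lemma nat_far (m n : nat) (u : R) : m != n -> (u - m%:R) ^+ 2 <= 4^-1 -> 4^-1 <= (u - n%:R) ^+ 2.
Proof.
move=> mn h1.
have h : 1 <= `|m%:R - n%:R : R|.
  move=> {h1}.
  wlog lt : m n mn / (n < m)%N.
    move=> W; move: mn; rewrite neq_ltn => /orP[lt|lt]; last by apply: W => //; rewrite neq_ltn lt orbT.
    by rewrite distrC; apply: W => //; rewrite neq_ltn lt orbT.
  by rewrite -natrB ?(ltnW lt)// normr_nat ler1n subn_gt0.
have h2 : `|u - m%:R| <= 2^-1 by rewrite ler_norml; apply/andP; split; nra.
have h3 : 2^-1 <= `|u - n%:R|.
  have := ler_distD u (m%:R : R) n%:R; rewrite (distrC m%:R u) => h4; lra.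
by rewrite -(real_normK (num_real (u - n%:R))); nra.
Qed.

Lemma hh_far u : (forall i : 'I_N, 8^-1 <= (u - pos i) ^+ 2) -> hh u = - 2^-1.
Proof. by move=> h; rewrite /hh big1 ?add0r// => i _; rewrite step0//; have := h i; lra. Qed.

Lemma hh_near (i : 'I_N) u : (u - pos i) ^+ 2 <= 4^-1 ->
  hh u = st (1 - 8 * (u - pos i) ^+ 2) - 2^-1.
Proof.
move=> ui; rewrite /hh (bigD1 i)//= big1 ?addr0// => j ji; rewrite step0//.
have := @nat_far i.+1 j.+1 u _ ui; rewrite eqSS eq_sym => /(_ ji); lra.
Qed.

Lemma near_or_far u : (exists i : 'I_N, (u - pos i) ^+ 2 < 8^-1) \/
  (forall i : 'I_N, 8^-1 <= (u - pos i) ^+ 2).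
Proof.
have [h|h] := pselect (exists i : 'I_N, (u - pos i) ^+ 2 < 8^-1); first by left.
by right=> i; rewrite leNgt; apply/negP => hi; apply: h; exists i.
Qed.

Lemma hh_le u : hh u <= 2^-1.
Proof.
have [[i ui]|h] := near_or_far u; last by rewrite hh_far//; lra.
rewrite (@hh_near i); last by lra.
by have := step_le1 (1 - 8 * (u - pos i) ^+ 2); lra.
Qed.

Lemma hh_mono u u' : (forall i : 'I_N, 4^-1 <= (u' - pos i) ^+ 2 \/ (u - pos i) ^+ 2 <= (u' - pos i) ^+ 2) ->
  hh u' <= hh u.
Proof.
move=> h; rewrite lerD2r; apply: ler_sum => i _; case: (h i) => hi.
  by rewrite step0 ?step_ge0//; lra.
by apply: step_le; lra.
Qed.

Lemma phi_ge0 j u : 0 <= phi j u.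
Proof. by rewrite mulr_ge0//; apply: sumr_ge0 => i _; exact: step_ge0. Qed.

Lemma phi_far j u : (forall i : 'I_N, ~~ S j i.+1 -> 4^-1 <= (u - pos i) ^+ 2) -> phi j u = 0.
Proof.
by move=> h; rewrite /phi big1 ?mulr0// => i Si; rewrite step0//; have := h i Si; lra.
Qed.

Lemma phi_near j (i : 'I_N) u : (u - pos i) ^+ 2 <= 4^-1 ->
  phi j u = if S j i.+1 then 0 else 3 * st (2 - 8 * (u - pos i) ^+ 2).
Proof.
move=> ui; have far (l : 'I_N) : l != i -> 4^-1 <= (u - pos l) ^+ 2.
  by move=> li; apply: (@nat_far i.+1 l.+1 u _ ui); rewrite eqSS eq_sym.
case: ifP => Si.
  by apply: phi_far => l Sl; apply: far; apply: contra Sl => /eqP ->.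
rewrite /phi (bigD1 i) ?Si//= big1 ?addr0// => l /andP[_ li].
by rewrite step0//; have := far l li; lra.
Qed.

Lemma phi_outside j u : u <= 2^-1 \/ N%:R + 2^-1 <= u -> phi j u = 0.
Proof.
move=> h; apply: phi_far => i _; have /andP[i1 i2] := pos_itv i.
by case: h => h; nra.
Qed.

Lemma hh_outside u : u <= 2^-1 \/ N%:R + 2^-1 <= u -> hh u = - 2^-1.
Proof.
move=> h; apply: hh_far => i; have /andP[i1 i2] := pos_itv i.
by case: h => h; nra.
Qed.

Lemma phi_gt0_near j u : phi j u != 0 -> exists i : 'I_N, ~~ S j i.+1 /\ (u - pos i) ^+ 2 < 4^-1.
Proof.
move=> h; apply: contrapT => h'; move/eqP: h; apply; apply: phi_far => i Si.
by rewrite leNgt; apply/negP => ui; apply: h'; exists i.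
Qed.

Lemma phi_le3 j u : phi j u <= 3.
Proof.
have [->|/phi_gt0_near[i [Si ui]]] := eqVneq (phi j u) 0; first by lra.
rewrite (@phi_near j i); last exact: ltW.
by rewrite (negbTE Si); have := step_le1 (2 - 8 * (u - pos i) ^+ 2); lra.
Qed.

Lemma psi_bounds j u v : psi j u v <= 3 -> u ^+ 2 <= 3 * LL ^+ 2 /\ -2 < v < 5.
Proof.
have L2 := LL_ge2; have p0 := phi_ge0 j u; have p3 := phi_le3 j u.
rewrite /psi => h; have h1 : (u / LL) ^+ 2 <= 3 by have := sqr_ge0 (v - phi j u); lra.
have h2 : (v - phi j u) ^+ 2 <= 3 by have := sqr_ge0 (u / LL); lra.
split; last by apply/andP; split; nra.
move: h1; rewrite expr_div_n ler_pdivrMr//; nra.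
Qed.

Lemma in_disc j u v : psi j u v <= 3 -> u ^+ 2 + v ^+ 2 < rho2.
Proof.
move=> /psi_bounds[h1 /andP[h2 h3]]; have := NS_ge1; rewrite /rho2 /LL in h1 *; nra.
Qed.

(** At a hole of [S j] the function [phi j] vanishes and |u| < LL / 2, so v^2 > 3/4. At another hole
    [phi j] equals 3, and psi <= 2 gives v >= 3 - sqrt 2 > 1. In both cases v^2 exceeds 1/2, the
    bound for [hh]. *)
Lemma ring_off_obstacles j u v : 1 <= psi j u v <= 2 -> hh u < v ^+ 2.
Proof.
move=> /andP[h1 h2]; have [[i ui]|h] := near_or_far u; last first.
  by rewrite hh_far//; have := sqr_ge0 v; lra.
apply: le_lt_trans (hh_le u) _; have ui4 : (u - pos i) ^+ 2 <= 4^-1 by lra.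
have L2 := LL_ge2; move: h1 h2; rewrite /psi (phi_near _ ui4); case: ifP => Si.
  rewrite subr0 => h1 _; suff : (u / LL) ^+ 2 < 4^-1 by lra.
  have /andP[i1 i2] := pos_itv i.
  rewrite expr_div_n ltr_pdivrMr; last by nra.
  have : LL = 2 * (N%:R + 1) by rewrite /LL -(natr1 N).
  have u1 : 0 <= u by nra.
  have u2 : u <= N%:R + 2^-1 by nra.
  by move=> ->; nra.
rewrite step1; last by lra.
move=> _ h2; have := sqr_ge0 (u / LL); nra.
Qed.

Lemma bb_ge0 j u v : (0 <= bb j u v) = (1 <= psi j u v <= 2).
Proof.
apply/idP/andP => [|[h1 h2]]; last by rewrite /bb; nra.
by rewrite /bb => h; split; nra.
Qed.

Lemma bb_aa j u v : 0 <= bb j u v -> 0 < aa u v.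
Proof.
rewrite bb_ge0 => h; apply: mulr_gt0; first by rewrite subr_gt0 (ring_off_obstacles h).
have /andP[_ h2] := h; have := @in_disc j u v; lra.
Qed.

Lemma bb_om j u v : 0 <= bb j u v -> 0 < om j u v.
Proof. by rewrite bb_ge0 /om => /andP[]; lra. Qed.

Lemma obstacle_in_disc u v : v ^+ 2 <= hh u -> u ^+ 2 + v ^+ 2 < rho2.
Proof.
move=> h; have h2 := hh_le u; have N1 := NS_ge1.
have [[i ui]|far] := near_or_far u; last first.
  by move: h; rewrite hh_far//; have := sqr_ge0 v; lra.
have /andP[i1 i2] := pos_itv i; rewrite /rho2; have : N.+1%:R = N%:R + 1 :> R by rewrite -(natr1 N).
move=> ->; have u1 : 0 <= u by nra.
have u2 : u <= N%:R + 1 by nra.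
by nra.
Qed.

Lemma aa_ge0 u v : 0 <= aa u v <-> hh u <= v ^+ 2 /\ u ^+ 2 + v ^+ 2 <= rho2.
Proof.
split=> [|[h1 h2]]; last by apply: mulr_ge0; lra.
rewrite /aa => h; have [vh|hv] := leP (v ^+ 2) (hh u).
  have := obstacle_in_disc vh => d; split; last exact: ltW.
  by rewrite leNgt; apply/negP => lt; nra.
split; first exact: ltW.
by rewrite leNgt; apply/negP => lt; nra.
Qed.

Lemma tau_ge0 j s t : 0 <= tau j s t.
Proof. by rewrite addr_ge0// sqr_ge0. Qed.

Lemma tau_far i j s t : i != j -> tau j s t <= 4 -> 4 <= tau i s t.
Proof.
move=> ij; rewrite /tau.
have h : 1 <= ((nat_of_ord i)%:R - (nat_of_ord j)%:R) ^+ 2 :> R.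
  have : (i : nat) != j by apply: contra ij => /eqP/val_inj ->.
  rewrite neq_ltn => /orP[lt|lt].
    by rewrite -sqrrN opprB -natrB ?(ltnW lt)// -natrX ler1n expn_gt0 subn_gt0 lt.
  by rewrite -natrB ?(ltnW lt)// -natrX ler1n expn_gt0 subn_gt0 lt.
set a := (nat_of_ord i)%:R in h *; set b := (nat_of_ord j)%:R in h *.
have := sqr_ge0 t => t0 h2.
have h3 : (s - 4 * b) ^+ 2 <= 4 by lra.
have h4 : 16 <= ((s - 4 * b) - (s - 4 * a)) ^+ 2 by rewrite (_ : _ - _ = 4 * (a - b)); [rewrite exprMn; lra|ring].
set x := s - 4 * b in h3 h4; set y := s - 4 * a in h4 *.
rewrite leNgt; apply/negP => h5; have y2 : y ^+ 2 < 4 by lra.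
have /andP[x3 x4] : -2 <= x <= 2 by apply/andP; split; nra.
have /andP[y3 y4] : -2 < y < 2 by apply/andP; split; nra.
by nra.
Qed.

Lemma ff_out u v s t : (forall j, 1 <= tau j s t) -> ff u v s t = aa u v.
Proof.
move=> h; rewrite /ff big1 ?addr0// => j _; have := h j => hj.
by rewrite !step0 ?mul0r ?addr0//; lra.
Qed.

Lemma ff_one j u v s t : tau j s t <= 4 -> ff u v s t = aa u v +
  (st (4 - 4 * tau j s t) * (bb j u v - aa u v) + st (2 - 4 * tau j s t) * (om j u v - bb j u v)).
Proof.
move=> tj; rewrite /ff (bigD1 j)//= big1 ?addr0// => i ij.
have := tau_far ij tj => h; rewrite !step0 ?mul0r ?addr0//; lra.
Qed.

Lemma ff_zone1 j u v s t : 2^-1 <= tau j s t <= 4 ->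
  ff u v s t = aa u v + st (4 - 4 * tau j s t) * (bb j u v - aa u v).
Proof.
move=> /andP[h1 h2]; rewrite (@ff_one j)//; rewrite [X in _ + (_ + X)](_ : _ = 0) ?addr0//.
by rewrite step0 ?mul0r//; lra.
Qed.

Lemma ff_zone2 j u v s t : tau j s t <= 3 / 4 ->
  ff u v s t = bb j u v + st (2 - 4 * tau j s t) * (om j u v - bb j u v).
Proof.
move=> h; rewrite (@ff_one j); last by lra.
by rewrite (@step1 _ (4 - 4 * tau j s t)); [ring|lra].
Qed.

Lemma ff_aa j u v s t : 2^-1 <= tau j s t <= 4 -> 0 <= ff u v s t -> 0 <= aa u v.
Proof.
move=> h; rewrite (ff_zone1 _ _ h); set x := 4 - _.
have := step_ge0 x; have := step_le1 x; move=> s1 s0 f0.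
have [//|a0] := leP 0 (aa u v).
have [b0|b0] := leP 0 (bb j u v); first by have := bb_aa b0; lra.
by nra.
Qed.

Lemma ff_om j u v s t : tau j s t <= 3 / 4 -> 0 <= ff u v s t -> 0 <= om j u v.
Proof.
move=> h; rewrite (ff_zone2 _ _ h); set x := 2 - _.
have := step_ge0 x; have := step_le1 x; move=> s1 s0 f0.
have [//|a0] := leP 0 (om j u v).
have [b0|b0] := leP 0 (bb j u v); first by have := bb_om b0; lra.
by nra.
Qed.

Lemma ff_ring j u v s t : tau j s t <= 4 -> 0 <= bb j u v -> 0 <= ff u v s t.
Proof.
move=> h b0; have a0 := bb_aa b0; have o0 := bb_om b0.
have [h1|h1] := leP (tau j s t) (3 / 4).
  rewrite (@ff_zone2 j)//; have := step_ge0 (2 - 4 * tau j s t); have := step_le1 (2 - 4 * tau j s t).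
  by move=> s1 s0; nra.
rewrite (@ff_zone1 j); last by apply/andP; lra.
by have := step_ge0 (4 - 4 * tau j s t); have := step_le1 (4 - 4 * tau j s t); nra.
Qed.

(** If [bb >= 0] the point belongs to the slice for every q near q_j. Otherwise bb < 0 <= aa, and
    the interpolation grows with tau. *)
Lemma ff_push_out j u v s t s' t' : 2^-1 <= tau j s t -> tau j s t <= tau j s' t' -> tau j s' t' <= 4 ->
  0 <= ff u v s t -> 0 <= ff u v s' t'.
Proof.
move=> h1 h2 h3 f0; have h : 2^-1 <= tau j s t <= 4 by apply/andP; lra.
have a0 := ff_aa h f0; have [b0|b0] := leP 0 (bb j u v); first exact: ff_ring b0.
move: f0; rewrite (@ff_zone1 j)// (@ff_zone1 j); last by apply/andP; lra.
have := @step_le R (4 - 4 * tau j s' t') (4 - 4 * tau j s t); move=> sl.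
have : step (4 - 4 * tau j s' t') <= step (4 - 4 * tau j s t) by apply: sl; lra.
by nra.
Qed.

Lemma ff_push_in j u v s t s' t' : tau j s t <= 3 / 4 -> tau j s' t' <= tau j s t ->
  0 <= ff u v s t -> 0 <= ff u v s' t'.
Proof.
move=> h1 h2 f0; have o0 := ff_om h1 f0.
have [b0|b0] := leP 0 (bb j u v); first by apply: ff_ring b0; lra.
move: f0; rewrite (@ff_zone2 j)// (@ff_zone2 j); last by lra.
have : step (2 - 4 * tau j s t) <= step (2 - 4 * tau j s' t') by apply: step_le; lra.
by nra.
Qed.

Lemma ff_center j u v s t : tau j s t <= 4^-1 -> ff u v s t = om j u v.
Proof. by move=> h; rewrite (@ff_zone2 j) ?step1; [ring|lra|lra]. Qed.

Lemma ff_disc u v s t : 0 <= ff u v s t -> u ^+ 2 + v ^+ 2 <= rho2.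
Proof.
move=> f0; have [[j h]|h] := pselect (exists j, tau j s t < 1).
  have [h1|h1] := leP (tau j s t) (3 / 4).
    by have := ff_om h1 f0; rewrite /om => h2; apply/ltW/(@in_disc j); lra.
  by have /aa_ge0[] : 0 <= aa u v by apply: (@ff_aa j u v s t) f0; apply/andP; lra.
have /aa_ge0[] // : 0 <= aa u v.
by move: f0; rewrite ff_out// => j; rewrite leNgt; apply/negP => hj; apply: h; exists j.
Qed.

End Profile.

(** * Regularity of the profile *)

Section RealDerivative.
Variable R : realType.
Implicit Types (f g : R -> R) (l m : R).

Definition dv f l := is_derive (0 : R) (1 : R) f l.

Lemma dv_eq f l m : dv f l -> l = m -> dv f m.
Proof. by move=> h <-. Qed.

Lemma dv_near f g l : (\forall t \near (0 : R), f t = g t) -> dv f l -> dv g l.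
Proof.
move=> fg [df Df]; split.
  apply/derivable1_diffP; apply: (eq_near_differentiable fg).
  exact/derivable1_diffP.
by rewrite -Df; apply/esym/near_eq_derive.
Qed.

Lemma dv_ext f g l : (forall t, f t = g t) -> dv f l -> dv g l.
Proof. by move=> fg; have -> : g = f by apply/funext => t. Qed.

Lemma dv_cst (c : R) : dv (fun _ => c) 0. Proof. exact: is_derive_cst. Qed.

Lemma dv_id : dv (fun t => t) 1. Proof. exact: is_derive_id. Qed.

Lemma dvD f g l m : dv f l -> dv g m -> dv (fun t => f t + g t) (l + m).
Proof. by move=> hf hg; exact: (@is_deriveD _ _ _ f g). Qed.

Lemma dvN f l : dv f l -> dv (fun t => - f t) (- l).
Proof. by move=> hf; exact: (@is_deriveN _ _ _ f). Qed.

Lemma dvM f g l m : dv f l -> dv g m -> dv (fun t => f t * g t) (f 0 * m + g 0 * l).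
Proof. by move=> hf hg; exact: (@is_deriveM _ _ f g). Qed.

Lemma dvX2 f l : dv f l -> dv (fun t => f t ^+ 2) (2 * f 0 * l).
Proof.
move=> hf; have -> : (fun t => f t ^+ 2) = (fun t => f t * f t) by apply/funext => t; rewrite expr2.
by apply: dv_eq (dvM hf hf) _; ring.
Qed.

Lemma dv_aff (a b : R) : dv (fun t => a + t * b) b.
Proof. by apply: dv_eq (dvD (dv_cst a) (dvM dv_id (dv_cst b))) _; ring. Qed.

Lemma dv_step f l : dv f l -> dv (fun t => step (f t)) ('D_1 (@step R) (f 0) * l).
Proof.
move=> hf; have hs : is_derive (f 0) (1 : R) (@step R) ('D_1 (@step R) (f 0)).
  split=> //; apply/derivable1_diffP.
  exact: (smooth_on_differentiable (@step_smooth R)).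
by apply: dv_eq (is_derive1_comp hs hf) _.
Qed.

End RealDerivative.

Section Regular.
Variables (R : realType) (N r : nat) (S : 'I_r -> pred nat).
Local Notation st := (@step R).
Local Notation pos i := ((nat_of_ord i).+1%:R : R).
Local Notation hh := (@hh R N).
Local Notation aa := (@aa R N).
Local Notation LL := (@LL R N).

Definition reg2 (g : R -> R -> R) u v := exists2 l : R, l != 0 &
  dv (fun t => g (u + t) v) l \/ dv (fun t => g u (v + t)) l.

Lemma dv_shift (c : R) : dv (fun t => c + t) 1.
Proof. by apply: dv_eq (dvD (dv_cst c) (@dv_id R)) _; rewrite add0r. Qed.

Lemma near_lt (f : R -> R) (c : R) : {for 0, continuous f} -> f 0 < c -> \forall t \near (0 : R), f t < c.
Proof.
move=> cf f0; apply: (cf [set y | y < c]); apply: open_nbhs_nbhs; split=> //.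
Qed.

(** The two factors never vanish together, because the holes lie inside the open disc. On the edge
    of a hole with v = 0 the step takes the value 1/2, so its argument lies strictly between 0 and
    1, where its derivative is nonzero. *)
Lemma reg_aa u v : aa u v = 0 -> reg2 aa u v.
Proof.
move=> /eqP; rewrite mulf_eq0 => /orP[/eqP h|/eqP h].
  have vh : v ^+ 2 <= hh u by lra.
  have d := obstacle_in_disc vh.
  have [v0|v0] := eqVneq v 0; last first.
    exists (2 * v * (rho2 R N - u ^+ 2 - v ^+ 2)); first by rewrite !mulf_neq0//; lra.
    right; have d1 := dvX2 (dv_shift v).
    apply: dv_eq (dvM (dvD d1 (dv_cst (- hh u))) (dvD (dv_cst (rho2 R N - u ^+ 2)) (dvN d1))) _.
    by rewrite /= !addr0 h; ring.
  have [[i ui]|far] := near_or_far N u; last by move: h; rewrite v0 hh_far// expr0n /=; lra.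
  have ui4 : (u - pos i) ^+ 2 <= 4^-1 by lra.
  have h2 : st (1 - 8 * (u - pos i) ^+ 2) = 2^-1 by move: h; rewrite (hh_near ui4) v0 expr0n /=; lra.
  have x0 : 0 < 1 - 8 * (u - pos i) ^+ 2 by rewrite ltNge; apply/negP => /(@step0 R); rewrite h2; lra.
  have x1 : 1 - 8 * (u - pos i) ^+ 2 < 1 by rewrite ltNge; apply/negP => /(@step1 R); rewrite h2; lra.
  have u0 : u - pos i != 0 by apply: contraTneq x1 => ->; rewrite expr0n /= mulr0 subr0 ltxx.
  have D0 := step_derive_neq0 x0 x1.
  exists (16 * (u - pos i) * 'D_1 (@step R) (1 - 8 * (u - pos i) ^+ 2) * (rho2 R N - u ^+ 2 - v ^+ 2)).
    by rewrite !mulf_neq0//; lra.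
  left; apply: (@dv_near _ (fun t => (v ^+ 2 - (st (1 - 8 * (u + t - pos i) ^+ 2) - 2^-1)) *
    (rho2 R N - (u + t) ^+ 2 - v ^+ 2))).
    have : \forall t \near (0 : R), (u + t - pos i) ^+ 2 < 4^-1.
      apply: near_lt; last by rewrite addr0; lra.
      have cq : continuous (fun t : R => (u + t - pos i) ^+ 2) by cont.
      exact: cq.
    apply: filterS => t ht; rewrite /aa (@hh_near _ N i)//; exact: ltW.
  have d1 := dvX2 (dv_shift u).
  have d2 := dvX2 (dvD (dv_shift u) (dv_cst (- pos i))).
  have d3 := dv_step (dvD (dv_cst 1) (dvN (dvM (dv_cst 8) d2))).
  apply: dv_eq (dvM (dvD (dv_cst (v ^+ 2)) (dvN (dvD d3 (dv_cst (- 2^-1)))))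
    (dvD (dvD (dv_cst (rho2 R N)) (dvN d1)) (dv_cst (- v ^+ 2)))) _.
  by rewrite /= !addr0 h2 v0; move: ('D_(1 : R) (@step R) _) => D; field.
have p0 : u != 0 \/ v != 0.
  have [u0|] := eqVneq u 0; last by left.
  right; apply: contra_eq_neq h => ->; rewrite u0 expr0n /= !subr0 /rho2.
  by have := @NS_ge1 R N => n1; rewrite gt_eqF//; nra.
have hv : v ^+ 2 - hh u != 0.
  apply/negP => /eqP h'; have vh : v ^+ 2 <= hh u by lra.
  by have := obstacle_in_disc vh; lra.
have [v0|v0] := eqVneq v 0; last first.
  exists (- (2 * v) * (v ^+ 2 - hh u)); first by rewrite mulf_neq0// oppr_eq0 mulf_neq0.
  right; have d1 := dvX2 (dv_shift v).
  apply: dv_eq (dvM (dvD d1 (dv_cst (- hh u))) (dvD (dv_cst (rho2 R N - u ^+ 2)) (dvN d1))) _.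
  by rewrite /= !addr0 h; ring.
have u0 : u != 0 by case: p0 => //; rewrite v0 eqxx.
(* On the circle rho2 = u^2 the point is far from the obstacles, so hh is constant nearby. *)
have uo : u < 2^-1 \/ N%:R + 2^-1 < u.
  have [|u1] := ltP u 2^-1; [by left|right]; rewrite ltNge; apply/negP => u2.
  move: h; rewrite v0 /rho2 expr0n /= subr0; have : N.+1%:R = N%:R + 1 :> R by rewrite -(natr1 N).
  by move=> ->; have := ler0n R N; nra.
exists (- (2 * u) * (v ^+ 2 - hh u)); first by rewrite mulf_neq0// oppr_eq0 mulf_neq0.
left; have d1 := dvX2 (dv_shift u).
apply: (@dv_near _ (fun t => (v ^+ 2 - - 2^-1) * (rho2 R N - (u + t) ^+ 2 - v ^+ 2))).
  have cu : continuous (fun t : R => u + t) by cont.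
  have cu' : continuous (fun t : R => - (u + t)) by cont.
  case: uo => uo.
    have := near_lt (cu 0) (c := 2^-1); rewrite addr0 => /(_ uo); apply: filterS => t ht.
    by rewrite /aa hh_outside//; left; exact: ltW.
  have := near_lt (cu' 0) (c := - (N%:R + 2^-1)); rewrite addr0 ltrN2 => /(_ uo); apply: filterS => t.
  by rewrite ltrN2 => ht; rewrite /aa hh_outside//; right; exact: ltW.
apply: dv_eq (dvM (dv_cst _) (dvD (dvD (dv_cst (rho2 R N)) (dvN d1)) (dv_cst (- v ^+ 2)))) _.
by rewrite /= hh_outside; [ring|case: uo => ?; [left|right]; exact: ltW].
Qed.

(** Where v = phi u, the inequality forces |u| >= LL. This is beyond all the holes, so [phi j]
    vanishes nearby and the derivative along u is explicit. *)
Lemma reg_psi j u v : 1 <= psi N S j u v -> reg2 (@psi R N r S j) u v.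
Proof.
move=> h; have L2 := @LL_ge2 R N; have [v0|v0] := eqVneq (v - phi N S j u) 0; last first.
  exists (2 * (v - phi N S j u)); first by rewrite mulf_neq0.
  right; apply: dv_eq (dvD (dv_cst ((u / LL) ^+ 2)) (dvX2 (dvD (dv_shift v) (dv_cst (- phi N S j u))))) _.
  by rewrite /= !addr0; ring.
have hu : 1 <= (u / LL) ^+ 2 by move: h; rewrite /psi v0 [0 ^+ 2]expr0n addr0.
have hu2 : LL ^+ 2 <= u ^+ 2 by move: hu; rewrite expr_div_n ler_pdivlMr ?mul1r//; nra.
have N0 := ler0n R N; have LE : LL = 2 * (N%:R + 1) by rewrite /LL -(natr1 N).
have uo : u < 2^-1 \/ N%:R + 2^-1 < u.
  by have [|u1] := ltP u 2^-1; [left|right; rewrite ltNge; apply/negP => u2; nra].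
exists (2 * (u / LL) * LL^-1).
  have u0 : u != 0 by apply/negP => /eqP u0; move: hu2; rewrite u0; nra.
  by rewrite !mulf_neq0// invr_eq0; lra.
left; apply: (@dv_near _ (fun t => ((u + t) / LL) ^+ 2 + v ^+ 2)).
  have cu : continuous (fun t : R => u + t) by cont.
  have cu' : continuous (fun t : R => - (u + t)) by cont.
  case: uo => uo.
    have := near_lt (cu 0) (c := 2^-1); rewrite addr0 => /(_ uo); apply: filterS => t ht.
    by rewrite /psi phi_outside ?subr0//; left; exact: ltW.
  have := near_lt (cu' 0) (c := - (N%:R + 2^-1)); rewrite addr0 ltrN2 => /(_ uo); apply: filterS => t.
  by rewrite ltrN2 => ht; rewrite /psi phi_outside ?subr0//; right; exact: ltW.
apply: dv_eq (dvD (dvX2 (dvM (dv_shift u) (dv_cst LL^-1))) (dv_cst (v ^+ 2))) _.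
by rewrite /= !addr0; ring.
Qed.

Lemma reg_comp (G : R -> R) (G' : R -> R) (g : R -> R -> R) u v :
  (forall f l, dv f l -> dv (fun t => G (f t)) (G' (f 0) * l)) -> G' (g u v) != 0 ->
  reg2 g u v -> reg2 (fun u v => G (g u v)) u v.
Proof.
move=> hG G0 [l l0 h]; exists (G' (g u v) * l); first by rewrite mulf_neq0.
by case: h => /hG; rewrite addr0 => h; [left|right].
Qed.

Lemma reg_bb j u v : bb N S j u v = 0 -> reg2 (@bb R N r S j) u v.
Proof.
rewrite /bb => /eqP h; apply: (@reg_comp (fun x => (x - 1) * (2 - x)) (fun x => 3 - 2 * x)).
- move=> f l hf; apply: dv_eq (dvM (dvD hf (dv_cst (- 1))) (dvD (dv_cst 2) (dvN hf))) _.
  by rewrite /=; ring.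
- by move: h; rewrite mulf_eq0 => /orP[] /eqP h; apply/negP => /eqP; lra.
- by apply: reg_psi; move: h; rewrite mulf_eq0 => /orP[] /eqP h; lra.
Qed.

Lemma reg_om j u v : om N S j u v = 0 -> reg2 (@om R N r S j) u v.
Proof.
rewrite /om => h; apply: (@reg_comp (fun x => 3 - x) (fun x => - 1)).
- by move=> f l hf; apply: dv_eq (dvD (dv_cst 3) (dvN hf)) _; ring.
- by rewrite oppr_eq0 oner_eq0.
- by apply: reg_psi; lra.
Qed.

(* At a zero of ff the gradient is nonzero, either in the (u, v)-direction or radially around q_j. *)
Lemma reg_ff u v s t : ff N S u v s t = 0 ->
  reg2 (fun u v => ff N S u v s t) u v \/
  exists (j : 'I_r) (l : R), l != 0 /\ dv (fun x => ff N S u v (s + x * (s - 4 * (nat_of_ord j)%:R)) (t + x * t)) l.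
Proof.
move=> f0; have [[j hj]|out] := pselect (exists j : 'I_r, tau j s t < 1); last first.
  left; have oE u' v' : ff N S u' v' s t = aa u' v'.
    by apply: ff_out => j; rewrite leNgt; apply/negP => h; apply: out; exists j.
  have -> : (fun u v => ff N S u v s t) = aa by apply/funext => x; apply/funext => y.
  by apply: reg_aa; rewrite -oE.
have tauE x : tau j (s + x * (s - 4 * (nat_of_ord j)%:R)) (t + x * t) = (1 + x) ^+ 2 * tau j s t.
  by rewrite /tau; ring.
have ctau : continuous (fun x : R => (1 + x) ^+ 2 * tau j s t) by cont.
have ctau' : continuous (fun x : R => - ((1 + x) ^+ 2 * tau j s t)) by cont.
have dtau : dv (fun x : R => (1 + x) ^+ 2 * tau j s t) (2 * tau j s t).
  by apply: dv_eq (dvM (dvX2 (dv_shift 1)) (dv_cst (tau j s t))) _; rewrite /=; ring.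
have nlt (c : R) : tau j s t < c -> \forall x \near (0 : R), (1 + x) ^+ 2 * tau j s t < c.
  by move=> h; apply: (near_lt (ctau 0)); rewrite addr0 expr1n mul1r.
have ngt (c : R) : c < tau j s t -> \forall x \near (0 : R), c < (1 + x) ^+ 2 * tau j s t.
  move=> h; have := near_lt (ctau' 0) (c := - c); rewrite addr0 expr1n mul1r ltrN2 => /(_ h).
  by apply: filterS => x; rewrite ltrN2.
have [h1|h1] := ltP (3 / 4) (tau j s t).
  right; have z : 2^-1 <= tau j s t <= 4 by apply/andP; lra.
  have x0 : 0 < 4 - 4 * tau j s t by lra.
  have x1 : 4 - 4 * tau j s t < 1 by lra.
  exists j, ('D_1 (@step R) (4 - 4 * tau j s t) * (- 8 * tau j s t) * (bb N S j u v - aa u v)); split.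
    have c0 : - 8 * tau j s t != 0 by apply/negP => /eqP; lra.
    apply: mulf_neq0; first by apply: mulf_neq0 => //; exact: step_derive_neq0.
    (* Equality would give bb = aa = ff = 0, whereas [bb >= 0] forces [aa > 0]. *)
    apply/negP => /eqP ba; have e : bb N S j u v = aa u v by lra.
    move: f0; rewrite (@ff_zone1 R N r S j u v s t z) e subrr mulr0 addr0 => a0.
    by have := @bb_aa R N r S j u v; rewrite e a0 lexx ltxx => /(_ isT).
  apply: (@dv_near _ (fun x => aa u v + st (4 - 4 * ((1 + x) ^+ 2 * tau j s t)) * (bb N S j u v - aa u v))).
    have l1 : 2^-1 < tau j s t by lra.
    have l2 : tau j s t < 4 by lra.
    apply: filterS2 (ngt _ l1) (nlt _ l2) => x y1 y2.
    by rewrite (@ff_zone1 _ _ _ _ j) tauE// !ltW.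
  apply: dv_eq (dvD (dv_cst _) (dvM (dv_step (dvD (dv_cst 4) (dvN (dvM (dv_cst 4) dtau)))) (dv_cst _))) _.
  by rewrite /= addr0 expr1n mul1r; ring.
have [h2|h2] := leP (tau j s t) 4^-1.
  left; have oE u' v' : ff N S u' v' s t = om N S j u' v' by exact: ff_center.
  have -> : (fun u v => ff N S u v s t) = om N S j by apply/funext => x; apply/funext => y.
  by apply: reg_om; rewrite -oE.
have [h3|h3] := leP 2^-1 (tau j s t).
  left; have oE u' v' : ff N S u' v' s t = bb N S j u' v'.
    by rewrite (@ff_zone2 _ _ _ _ j)// step0 ?mul0r ?addr0//; lra.
  have -> : (fun u v => ff N S u v s t) = bb N S j by apply/funext => x; apply/funext => y.
  by apply: reg_bb; rewrite -oE.
right; have x0 : 0 < 2 - 4 * tau j s t by lra.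
have x1 : 2 - 4 * tau j s t < 1 by lra.
exists j, ('D_1 (@step R) (2 - 4 * tau j s t) * (- 8 * tau j s t) * (om N S j u v - bb N S j u v)); split.
  have c0 : - 8 * tau j s t != 0 by apply/negP => /eqP; lra.
  apply: mulf_neq0; first by apply: mulf_neq0 => //; exact: step_derive_neq0.
  apply/negP => /eqP ba; have e : om N S j u v = bb N S j u v by lra.
  move: f0; rewrite (@ff_zone2 R N r S j u v s t h1) e subrr mulr0 addr0 => a0.
  by have := @bb_om R N r S j u v; rewrite e a0 lexx ltxx => /(_ isT).
apply: (@dv_near _ (fun x => bb N S j u v + st (2 - 4 * ((1 + x) ^+ 2 * tau j s t)) * (om N S j u v - bb N S j u v))).
  have l1 : tau j s t < 3 / 4 by lra.
  apply: filterS (nlt _ l1) => x y1.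
  by rewrite (@ff_zone2 _ _ _ _ j) tauE// ltW.
apply: dv_eq (dvD (dv_cst _) (dvM (dv_step (dvD (dv_cst 2) (dvN (dvM (dv_cst 4) dtau)))) (dv_cst _))) _.
by rewrite /= addr0 expr1n mul1r; ring.
Qed.

End Regular.

Section GramCriterion.
Variables (R : realType) (k : nat).

Lemma gram_neq0 (M : 'M[R]_(k, 2)) :
  (forall a b : R, (forall i, a * M i 0 + b * M i 1 = 0) -> a = 0 /\ b = 0) -> gram M != 0.
Proof.
move=> h; apply/negP => /det0P[v v0 vM].
have : v *m M^T *m (v *m M^T)^T = 0 by rewrite trmx_mul trmxK mulmxA -(mulmxA v) vM mul0mx.
move=> /matrixP/(_ 0 0); rewrite !mxE => e.
have e0 i : (v *m M^T) 0 i = 0.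
  apply/eqP; rewrite -sqrf_eq0; apply/eqP.
  apply: (@psumr_eq0P _ _ predT (fun i => (v *m M^T) 0 i ^+ 2)) => // [j _|]; first exact: sqr_ge0.
  by rewrite -[RHS]e; apply: eq_bigr => j _; rewrite !mxE expr2.
have [i|a0 b0] := h (v 0 0) (v 0 1).
  have := e0 i; rewrite mxE big_ord_recl big_ord1 !mxE.
  by have -> : lift ord0 ord0 = 1 :> 'I_2 by apply: val_inj.
move/negP: v0; apply; apply/eqP/rowP => j; rewrite mxE.
case: (unliftP 0 j) => [l ->|-> //]; rewrite (ord1 l) (_ : lift 0 0 = 1)//.
exact: val_inj.
Qed.

Lemma line_derive (f : 'rV[R]_k -> R) x w l : dv (fun t => f (x + t *: w)) l -> 'D_w f x = l.
Proof.
move=> [_ <-]; rewrite /derive.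
have -> // : (fun h : R => h^-1 *: ((f \o shift x) (h *: w) - f x)) =
  (fun h : R => h^-1 *: (((fun t => f (x + t *: w)) \o shift 0) (h *: 1) - f (x + 0 *: w))).
apply/funext => h; rewrite /=.
by rewrite [h%:A + 0]addr0 scale0r addr0 [h%:A]mulr1 [h *: w + x]addrC.
Qed.

End GramCriterion.

(** * The level set in Euclidean space and its normal frame *)

Section Level.
Variables (R : realType) (n : nat).
Hypothesis n3 : (3 <= n)%N.
Local Notation K := (2 * n + 2)%N.
Local Notation E := 'rV[R]_K.
Variables (N r : nat) (S : 'I_r -> pred nat).

Let K0 : (0 < K)%N. Proof. by rewrite addn2. Qed.

(** Coordinates are addressed by numbers: 0, 1 for p, then 2, 3 for q, then 4, 5 for z, and from 6
    on for y. A number out of range falls back to coordinate 0. *)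
Definition ix (c : nat) : 'I_K := insubd (Ordinal K0) c.

Lemma ixE c : (c < K)%N -> ix c = c :> nat.
Proof. by move=> h; rewrite val_insubd h. Qed.

Let ixs c : (c < 8)%N -> ix c = c :> nat.
Proof. by move=> h; apply: ixE; lia. Qed.

Definition ysq (x : E) : R := \sum_(i < K | (6 <= i)%N) x 0 i ^+ 2.
(** The radius leaves a margin around the discs tau < 1: where z = 0 on the level set, |q| is above
    4r + 5, and [ff] does not depend on q nearby. *)
Definition Rq2 : R := (4 * r%:R + 10) ^+ 2.
Definition FF (x : E) : R :=
  ysq x - ff N S (x 0 (ix 0)) (x 0 (ix 1)) (x 0 (ix 2)) (x 0 (ix 3)).
Definition SS (x : E) : R :=
  2^-1 * (x 0 (ix 2) ^+ 2 + x 0 (ix 3) ^+ 2 + x 0 (ix 4) ^+ 2 + x 0 (ix 5) ^+ 2 - Rq2).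
Definition Phi (x : E) : 'rV[R]_2 := \row_j (if j == 0 then FF x else SS x).

Lemma Phi_eq0 x : Phi x = 0 <-> FF x = 0 /\ SS x = 0.
Proof.
split=> [/rowP h|[h1 h2]]; first by have := h 0; have := h 1; rewrite !mxE.
by apply/rowP => j; rewrite !mxE; case: ifP.
Qed.

Let sid : smooth_on setT (fun x : E => x). Proof. exact: smooth_on_id. Qed.

Let sco i : smooth_on setT (fun x : E => x 0 i).
Proof. by move=> j; apply: (Ck_coord openT); exact: sid. Qed.

Let sstep (g : E -> R) : smooth_on setT g -> smooth_on setT (fun x => step (g x)).
Proof. by move=> gs j; apply: (Ck_comp_R openT openT) => //; exact: step_smooth. Qed.

Let sD (f g : E -> R) : smooth_on setT f -> smooth_on setT g -> smooth_on setT (fun x => f x + g x).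
Proof. by move=> sf sg j; exact: (Ck_add openT). Qed.

Let sN (f : E -> R) : smooth_on setT f -> smooth_on setT (fun x => - f x).
Proof. by move=> sf j; exact: (Ck_opp openT). Qed.

Let sM (f g : E -> R) : smooth_on setT f -> smooth_on setT g -> smooth_on setT (fun x => f x * g x).
Proof. by move=> sf sg j; exact: (Ck_mul openT). Qed.

Let sX (f : E -> R) m : smooth_on setT f -> smooth_on setT (fun x => f x ^+ m).
Proof. by move=> sf j; exact: (Ck_exp openT). Qed.

Let sS (I : Type) (s : seq I) (P : pred I) (f : I -> E -> R) :
  (forall i, smooth_on setT (f i)) -> smooth_on setT (fun x => \sum_(i <- s | P i) f i x).
Proof. by move=> sf j; apply: (Ck_sum openT) => i _; exact: sf. Qed.

Let sC (c : R) : smooth_on setT (fun _ : E => c). Proof. exact: smooth_on_cst. Qed.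

Ltac smth := repeat first [exact: sC | exact: sco | apply: sS => ? | apply: sD | apply: sN
  | apply: sstep | apply: sM | apply: sX].

Lemma FF_smooth : smooth_on setT FF.
Proof. by rewrite /FF /ysq /ff /aa /bb /om /psi /phi /hh /tau; smth. Qed.

Lemma SS_smooth : smooth_on setT SS. Proof. by rewrite /SS; smth. Qed.

Lemma Phi_smooth : smooth_on setT Phi.
Proof.
move=> j; apply: (Ck_mxE openT) => a b.
apply: (@eq_Ck _ _ _ openT _ _ (fun x => if b == 0 then FF x else SS x)) => [x _|].
  by rewrite mxE.
by case: (b == 0); [exact: FF_smooth|exact: SS_smooth].
Qed.

Let dPhi x : differentiable Phi x.
Proof. exact: (smooth_on_differentiable Phi_smooth). Qed.

Lemma jacobian_entry i j x : 'J Phi x i j = 'D_('e_i) Phi x 0 j.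
Proof.
rewrite (deriveEjacobian _ (dPhi x)).
by have := rowE i ('J Phi x) => /matrixP /(_ 0 j); rewrite mxE => ->.
Qed.

Lemma derive_Phi (w x : E) : 'D_w Phi x = \row_j (if j == 0 then 'D_w FF x else 'D_w SS x).
Proof.
rewrite derive_mx; last exact: diff_derivable.
apply/rowP => j; rewrite !mxE; case: ifP => j0; congr ('D_w _ x); apply/funext => y; by rewrite mxE j0.
Qed.

Lemma jacobian_FF i x : 'J Phi x i 0 = 'D_('e_i) FF x.
Proof. by rewrite jacobian_entry derive_Phi mxE. Qed.

Lemma jacobian_SS i x : 'J Phi x i 1 = 'D_('e_i) SS x.
Proof. by rewrite jacobian_entry derive_Phi mxE. Qed.

Lemma jacobian_smooth : smooth_on setT (fun x => 'J Phi x).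
Proof.
move=> l; apply: (Ck_mxE openT) => i j.
apply: (@eq_Ck _ _ _ openT _ _ (fun x => 'D_('e_i) Phi x 0 j)) => [x _|].
  by rewrite jacobian_entry.
by apply: (Ck_coord openT); have [_] := Phi_smooth l.+1; exact.
Qed.

Lemma derive_FF_line (w x : E) l : (forall i : 'I_K, (6 <= i)%N -> w 0 i = 0) ->
  dv (fun t => - ff N S (x 0 (ix 0) + t * w 0 (ix 0)) (x 0 (ix 1) + t * w 0 (ix 1))
    (x 0 (ix 2) + t * w 0 (ix 2)) (x 0 (ix 3) + t * w 0 (ix 3))) l -> 'D_w FF x = l.
Proof.
move=> w6 h; apply: line_derive.
have -> : (fun t => FF (x + t *: w)) = (fun t => ysq x +
    - ff N S (x 0 (ix 0) + t * w 0 (ix 0)) (x 0 (ix 1) + t * w 0 (ix 1))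
    (x 0 (ix 2) + t * w 0 (ix 2)) (x 0 (ix 3) + t * w 0 (ix 3))).
  apply/funext => t; rewrite /FF !mxE; congr (_ - _).
  by apply: eq_bigr => i i6; rewrite !mxE w6// mulr0 addr0.
by apply: dv_eq (dvD (dv_cst (ysq x)) h) _; rewrite add0r.
Qed.

Lemma derive_SS c (x : E) : (2 <= c < 6)%N -> 'D_('e_(ix c)) SS x = x 0 (ix c).
Proof.
move=> c26; apply: line_derive.
have e d t : (d < 6)%N -> (x + t *: 'e_(ix c)) 0 (ix d) = x 0 (ix d) + t * (c == d)%:R.
  by move=> d6; rewrite !mxE eqxx /= eq_sym -val_eqE /= !ixs//; lia.
have -> : (fun t => SS (x + t *: 'e_(ix c))) = (fun t => 2^-1 * (
    (x 0 (ix 2) + t * (c == 2)%:R) ^+ 2 + (x 0 (ix 3) + t * (c == 3)%:R) ^+ 2 +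
    (x 0 (ix 4) + t * (c == 4)%:R) ^+ 2 + (x 0 (ix 5) + t * (c == 5)%:R) ^+ 2 + - Rq2)).
  by apply/funext => t; rewrite /SS !e.
apply: dv_eq (dvM (dv_cst 2^-1) (dvD (dvD (dvD (dvD (dvX2 (dv_aff _ _)) (dvX2 (dv_aff _ _)))
  (dvX2 (dv_aff _ _))) (dvX2 (dv_aff _ _))) (dv_cst (- Rq2)))) _.
by case: c c26 {e} => [|[|[|[|[|[|c]]]]]]//= _; rewrite /= !mul0r !addr0; field.
Qed.

(** The partner of a coordinate for the standard complex structure, which pairs 2i with 2i + 1. *)
Definition sw (i : 'I_K) : 'I_K := ix (if odd i then i.-1 else i.+1).

Lemma swE i : sw i = (if odd i then i.-1 else i.+1) :> nat.
Proof. by apply: ixE; have := ltn_ord i; case: ifP; lia. Qed.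

Lemma swK : involutive sw.
Proof. by move=> i; apply: val_inj; rewrite /= swE swE; case: (boolP (odd i)) => oi; case: ifP; lia. Qed.

Definition sg (i : 'I_K) : R := if odd i then 1 else - 1.

Lemma sg_sw i : sg (sw i) = - sg i.
Proof. by rewrite /sg swE; case: (boolP (odd i)) => oi; case: ifP => //; rewrite ?opprK//; lia. Qed.

Lemma sg2 i : sg i * sg i = 1.
Proof. by rewrite /sg; case: ifP => _; ring. Qed.

Definition J0 : 'M[R]_K := \matrix_(i, j) (sg i * (j == sw i)%:R).

Lemma mulJ0 l (M : 'M[R]_(K, l)) i j : (J0 *m M) i j = sg i * M (sw i) j.
Proof.
rewrite mxE (bigD1 (sw i))//= mxE eqxx mulr1 big1 ?addr0// => h hi.
by rewrite mxE (negbTE hi) mulr0 mul0r.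
Qed.

Lemma J0_sqr : J0 *m J0 = - 1%:M.
Proof.
apply/matrixP => i j; rewrite mulJ0 !mxE sg_sw swK mulrA mulrN sg2 mulN1r.
by rewrite eq_sym; case: eqP.
Qed.

Lemma J0_tr : J0^T = - J0.
Proof.
apply/matrixP => i j; rewrite !mxE; have -> : (i == sw j) = (j == sw i).
  by apply/eqP/eqP => ->; rewrite swK.
by case: eqP => [->|_]; rewrite ?mulr0 ?oppr0// sg_sw !mulr1.
Qed.

(** This is dS plus the constant covector along coordinate 0, which keeps it nonzero even where q =
    z = 0. [Psi] has the columns J0 w and w, so it spans a complex line at every point. *)
Definition wv (x : E) (i : 'I_K) : R :=
  if (i : nat) == 0%N then 1 else if (2 <= i < 6)%N then x 0 i else 0.

Definition Psi (x : E) : 'M[R]_(K, 2) :=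
  \matrix_(i, j) (if j == 0 then sg i * wv x (sw i) else wv x i).

Lemma Psi_smooth : smooth_on setT Psi.
Proof.
have swv i : smooth_on setT (fun x => wv x i).
  rewrite /wv; case: eqP => _; first exact: sC.
  by case: (2 <= i < 6)%N; [exact: sco|exact: sC].
move=> l; apply: (Ck_mxE openT) => i j.
apply: (@eq_Ck _ _ _ openT _ _ (fun x => if j == 0 then sg i * wv x (sw i) else wv x i)) => [x _|].
  by rewrite mxE.
by case: (j == 0); [apply: sM; [exact: sC|]|]; exact: swv.
Qed.

(** Exchanging partners changes the sign of each product w_i (J0 w)_i, so the two columns are
    orthogonal; they have equal length because [J0] only permutes entries up to sign. *)
Lemma Psi_orth x : exists2 c : R, c != 0 & (Psi x)^T *m Psi x = c%:M.
Proof.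
exists (\sum_i wv x i ^+ 2).
  rewrite (bigD1 (ix 0))//= gt_eqF// ltr_wpDr ?sumr_ge0// => [i _|]; first exact: sqr_ge0.
  by rewrite /wv ixs//= expr1n.
have e1 : \sum_i (sg i * wv x (sw i)) * wv x i = 0.
  have : \sum_i (sg i * wv x (sw i)) * wv x i = - \sum_i (sg i * wv x (sw i)) * wv x i.
    rewrite {1}(reindex_inj (inv_inj swK)) -sumrN /=; apply: eq_bigr => i _.
    by rewrite sg_sw swK; ring.
  by lra.
apply/matrixP => i j; rewrite mxE mxE.
case: (unliftP 0 i) => [a ->|->]; case: (unliftP 0 j) => [b ->|->]; rewrite ?(ord1 a) ?(ord1 b).
- by rewrite eqxx mulr1n; apply: eq_bigr => l _; rewrite !mxE /= expr2.
- rewrite [RHS](_ : _ = 0)//; rewrite -[RHS]e1; apply: eq_bigr => l _; rewrite !mxE /=; ring.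
- by rewrite [RHS](_ : _ = 0)//; rewrite -[RHS]e1; apply: eq_bigr => l _; rewrite !mxE /=.
- rewrite eqxx mulr1n (reindex_inj (inv_inj swK)); apply: eq_bigr => l _; rewrite !mxE /=.
  by rewrite swK mulrACA sg2 mul1r expr2.
Qed.

Lemma Psi_gram x : gram (Psi x) != 0.
Proof. by have [c c0 e] := Psi_orth x; rewrite /gram e det_scalar expf_neq0. Qed.

(** On the columns of [Psi] the matrix [J0] acts as the quarter turn [jj]. As both matrices are
    antisymmetric, the same holds for the transposed columns, and the two actions match in the
    projection. *)
Lemma J0_gproj x : J0 *m gproj (Psi x) = gproj (Psi x) *m J0.
Proof.
pose jj : 'M[R]_2 := \matrix_(i, j) (if i == j then 0 else if i == 0 then 1 else - 1).
have jjT : jj^T = - jj.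
  apply/matrixP => i j; rewrite !mxE eq_sym; case: eqP => [_|ij]; first by rewrite oppr0.
  case: (unliftP 0 i) ij => [a ->|->]; case: (unliftP 0 j) => [b ->|->] ij; rewrite ?(ord1 a) ?(ord1 b) ?opprK//=.
  by case: ij; rewrite (ord1 a) (ord1 b).
have JP : J0 *m Psi x = Psi x *m jj.
  apply/matrixP => i j; rewrite mulJ0 !mxE big_ord_recl big_ord1 !mxE /=.
  case: (unliftP 0 j) => [b ->|->]; rewrite ?(ord1 b) /=; first by ring.
  rewrite sg_sw swK; transitivity (- (sg i * sg i) * wv x i); first by ring.
  by rewrite sg2; ring.
have PJ : (Psi x)^T *m J0 = jj *m (Psi x)^T.
  apply: trmx_inj; rewrite !trmx_mul trmxK J0_tr jjT mulNmx mulmxN JP.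
  by [].
have [c c0 e] := Psi_orth x.
have adjE : \adj ((Psi x)^T *m Psi x) = c%:M.
  rewrite e; have := mul_mx_adj (c%:M : 'M[R]_2); rewrite det_scalar mul_scalar_mx.
  move=> /(congr1 (fun M => c^-1 *: M)); rewrite scalerA mulVf// scale1r => ->.
  by rewrite scale_scalar_mx expr2 mulKf.
rewrite /gproj adjE mul_mx_scalar -!scalemxAl -!scalemxAr; congr (_ *: _).
by rewrite mulmxA JP -!mulmxA PJ.
Qed.

(* Looking at the z-rows, or at the q-rows when z = 0, a vanishing combination must be a multiple of dF. *)
Lemma frame_gram x s : Phi x = 0 -> 0 <= s <= 1 -> gram (frame_path (fun y => 'J Phi y) Psi s x) != 0.
Proof.
move=> /Phi_eq0[F0 S0] _; apply: gram_neq0 => a b h.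
have fpE i j : frame_path (fun y => 'J Phi y) Psi s x i j = (1 - s) * 'J Phi x i j + s * Psi x i j.
  by rewrite /frame_path [LHS]mxE [X in X + _]mxE [X in _ + X]mxE.
(* In a row where dF vanishes, the first column reduces to s J0 w, and the second one is x for every
   [s], since dS and w agree there. *)
have row c d : (2 <= c < 6)%N -> (2 <= d < 6)%N -> sw (ix c) = ix d ->
    'D_('e_(ix c)) FF x = 0 -> a * s * sg (ix c) * x 0 (ix d) + b * x 0 (ix c) = 0.
  move=> c26 d26 cd Dc; have := h (ix c).
  rewrite !fpE jacobian_FF jacobian_SS Dc derive_SS//= !mxE /= cd /wv !ixs; try lia.
  by rewrite c26 d26; case: eqP => [|_]; [lia|]; case: eqP => [|_]; [lia|] => <-; ring.
have pair c : (c == 2)%N || (c == 4)%N -> 'D_('e_(ix c)) FF x = 0 -> 'D_('e_(ix c.+1)) FF x = 0 ->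
    x 0 (ix c) ^+ 2 + x 0 (ix c.+1) ^+ 2 != 0 -> a * s = 0 /\ b = 0.
  move=> c24 D0 D1 nz.
  have w1 : sw (ix c) = ix c.+1 by apply: val_inj; rewrite /= swE !ixs ?ifF//; case/orP: c24 => /eqP ->.
  have w2 : sw (ix c.+1) = ix c by rewrite -w1 swK.
  have r1 := @row c c.+1 _ _ w1 D0; have r2 := @row c.+1 c _ _ w2 D1.
  have {}r1 := r1 ltac:(lia) ltac:(lia); have {}r2 := r2 ltac:(lia) ltac:(lia).
  have s2 : sg (ix c.+1) = - sg (ix c) by rewrite -w1 sg_sw.
  rewrite s2 in r2; have sE := sg2 (ix c).
  set g := sg _ in r1 r2 sE; set X := x 0 (ix c) in r1 r2 nz; set Y := x 0 (ix c.+1) in r1 r2 nz.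
  have e1 : b * (X ^+ 2 + Y ^+ 2) = 0.
    have -> : b * (X ^+ 2 + Y ^+ 2) = X * (a * s * g * Y + b * X) + Y * (a * s * - g * X + b * Y) by ring.
    by rewrite r1 r2 !mulr0 addr0.
  have e2 : a * s * (X ^+ 2 + Y ^+ 2) = 0.
    have -> : a * s * (X ^+ 2 + Y ^+ 2) = g * g * (a * s * (X ^+ 2 + Y ^+ 2)) by rewrite sE mul1r.
    have -> : g * g * (a * s * (X ^+ 2 + Y ^+ 2)) = g * (Y * (a * s * g * Y + b * X) - X * (a * s * - g * X + b * Y)) by ring.
    by rewrite r1 r2 !mulr0 subr0 mulr0.
  by split; apply/eqP; [move/eqP: e2|move/eqP: e1]; rewrite mulf_eq0 (negbTE nz) orbF.
have w6 c : (c < 6)%N -> forall i : 'I_K, (6 <= i)%N -> ('e_(ix c) : E) 0 i = 0.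
  by move=> c6 i i6; rewrite mxE eqxx /= -val_eqE /= ixs; [case: eqP => //; lia|lia].
have eix c d : (c < 6)%N -> (d < 6)%N -> ('e_(ix c) : E) 0 (ix d) = (d == c)%:R.
  by move=> c6 d6; rewrite mxE eqxx /= -val_eqE /= !ixs//; lia.
have unitD c l : (c < 6)%N -> dv (fun t => - ff N S
    (if 0%N == c then x 0 (ix 0) + t else x 0 (ix 0)) (if 1%N == c then x 0 (ix 1) + t else x 0 (ix 1))
    (if 2%N == c then x 0 (ix 2) + t else x 0 (ix 2)) (if 3%N == c then x 0 (ix 3) + t else x 0 (ix 3))) l ->
    'D_('e_(ix c)) FF x = l.
  move=> c6 h1; apply: derive_FF_line; first exact: w6.
  rewrite !(eix c)//.
  have e (y t : R) (e : bool) : y + t * e%:R = if e then y + t else y.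
    by case: e; rewrite ?mulr1 ?mulr0 ?addr0.
  by under eq_fun do rewrite !e.
have asb : a * s = 0 /\ b = 0.
  have [z0|z0] := eqVneq (x 0 (ix 4) ^+ 2 + x 0 (ix 5) ^+ 2) 0; last first.
    by apply: (pair 4%N); [|apply: unitD; rewrite //=; exact: dv_cst|apply: unitD; rewrite //=; exact: dv_cst|].
  have r0 := ler0n R r.
  have qR : x 0 (ix 2) ^+ 2 + x 0 (ix 3) ^+ 2 = Rq2.
    by move: S0; rewrite /SS => /eqP; rewrite mulf_eq0 invr_eq0 pnatr_eq0 /= => /eqP; lra.
  have far s' t' : (4 * r%:R + 5) ^+ 2 < s' ^+ 2 + t' ^+ 2 ->
      ff N S (x 0 (ix 0)) (x 0 (ix 1)) s' t' = aa N (x 0 (ix 0)) (x 0 (ix 1)).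
    move=> h1; apply: ff_out => j; rewrite /tau.
    have j0 := ler0n R j; have jr : (j : nat)%:R <= r%:R :> R by rewrite ler_nat ltnW.
    set q := (nat_of_ord j)%:R in j0 jr *; rewrite leNgt; apply/negP => h2.
    have : t' ^+ 2 < 1 by have := sqr_ge0 (s' - 4 * q); lra.
    have h3 : (s' - 4 * q) ^+ 2 < 1 by have := sqr_ge0 t'; lra.
    have : -1 < s' - 4 * q < 1 by apply/andP; split; nra.
    by move=> /andP[? ?] ?; nra.
  have cq (e f : R) : (4 * r%:R + 5) ^+ 2 < x 0 (ix 2) ^+ 2 + x 0 (ix 3) ^+ 2 -> \forall t \near (0 : R),
      (4 * r%:R + 5) ^+ 2 < (x 0 (ix 2) + t * e) ^+ 2 + (x 0 (ix 3) + t * f) ^+ 2.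
    move=> h1; have c0 : continuous (fun t : R => - ((x 0 (ix 2) + t * e) ^+ 2 + (x 0 (ix 3) + t * f) ^+ 2)) by cont.
    have := near_lt (c0 0) (c := - (4 * r%:R + 5) ^+ 2); rewrite !mul0r !addr0 ltrN2 => /(_ h1).
    by apply: filterS => t; rewrite ltrN2.
  have big : (4 * r%:R + 5) ^+ 2 < x 0 (ix 2) ^+ 2 + x 0 (ix 3) ^+ 2 by rewrite qR /Rq2; nra.
  apply: (pair 2%N); [by []| | |by rewrite qR /Rq2; apply/negP => /eqP; nra].
    apply: unitD; first by [].
    apply: (@dv_near _ (fun t => - aa N (x 0 (ix 0)) (x 0 (ix 1)))); last exact: dv_cst.
    by apply: filterS (cq 1 0 big) => t; rewrite mulr1 mulr0 addr0 => ht; rewrite /= far.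
  apply: unitD; first by [].
  apply: (@dv_near _ (fun t => - aa N (x 0 (ix 0)) (x 0 (ix 1)))); last exact: dv_cst.
  by apply: filterS (cq 0 1 big) => t; rewrite mulr1 mulr0 addr0 => ht; rewrite /= far.
(* If [a] were nonzero, then s = 0 and dF = 0. This gives y = 0 and ff = 0 at a critical point of
   [ff], against [reg_ff]. *)
case: asb => as0 b0; split=> //; apply: contrapT => /eqP a0.
have s0 : s = 0 by move/eqP: as0; rewrite mulf_eq0 (negbTE a0) => /eqP.
have D0 i : 'D_('e_i) FF x = 0.
  have := h i; rewrite b0 mul0r addr0 fpE s0 subr0 mul1r mul0r addr0 jacobian_FF.
  by move=> /eqP; rewrite mulf_eq0 (negbTE a0) => /eqP.
have Dw (w : E) : 'D_w FF x = 0.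
  have := derive_Phi w x; rewrite deriveEjacobian// => /rowP/(_ 0); rewrite !mxE /= => <-.
  by apply: big1 => i _; rewrite jacobian_FF D0 mulr0.
have y0 : ysq x = 0.
  apply: big1 => i i6; have : 'D_('e_i) FF x = 2 * x 0 i.
    apply: line_derive.
    have e j t : (x + t *: 'e_i) 0 j = x 0 j + t * (j == i)%:R by rewrite !mxE eqxx.
    have ne c : (c < 6)%N -> (ix c == i) = false.
      by move=> c6; apply/negbTE; rewrite -val_eqE /= ixs; lia.
    have -> : (fun t => FF (x + t *: 'e_i)) = (fun t => (x 0 i + t * 1) ^+ 2 +
        (\sum_(j < K | (6 <= j)%N && (j != i)) x 0 j ^+ 2 -
         ff N S (x 0 (ix 0)) (x 0 (ix 1)) (x 0 (ix 2)) (x 0 (ix 3)))).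
      apply/funext => t; rewrite /FF /ysq (bigD1 i)//= !e eqxx !ne// !mulr0 !addr0 -addrA.
      by congr (_ + (_ - _)); apply: eq_bigr => j /andP[_ /negbTE ji]; rewrite e ji mulr0 addr0.
    by apply: dv_eq (dvD (dvX2 (dv_aff _ _)) (dv_cst _)) _; rewrite /= mul0r !addr0 mulr1.
  by rewrite D0 => /esym/eqP; rewrite mulf_eq0 pnatr_eq0 /= => /eqP ->; rewrite expr0n.
have f0 : ff N S (x 0 (ix 0)) (x 0 (ix 1)) (x 0 (ix 2)) (x 0 (ix 3)) = 0.
  by move: F0; rewrite /FF y0; lra.
case: (reg_ff f0) => [[l l0 [hl|hl]]|[j [l [l0 hl]]]]; move/negP: l0; apply; apply/eqP/oppr_inj; rewrite oppr0.
- by rewrite -(Dw 'e_(ix 0)); apply/esym/unitD; last exact: dvN hl.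
- by rewrite -(Dw 'e_(ix 1)); apply/esym/unitD; last exact: dvN hl.
pose w : E := (x 0 (ix 2) - 4 * (nat_of_ord j)%:R) *: 'e_(ix 2) + x 0 (ix 3) *: 'e_(ix 3).
have wE d : (d < 6)%N -> w 0 (ix d) = (x 0 (ix 2) - 4 * (nat_of_ord j)%:R) * (d == 2)%:R + x 0 (ix 3) * (d == 3)%:R.
  by move=> d6; rewrite [LHS]mxE [X in X + _]mxE [X in _ + X]mxE !eix.
have w0 : w 0 (ix 0) = 0 by rewrite wE//= !mulr0 addr0.
have w1 : w 0 (ix 1) = 0 by rewrite wE//= !mulr0 addr0.
have w2 : w 0 (ix 2) = x 0 (ix 2) - 4 * (nat_of_ord j)%:R by rewrite wE//= mulr1 mulr0 addr0.
have w3 : w 0 (ix 3) = x 0 (ix 3) by rewrite wE//= mulr1 mulr0 add0r.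
rewrite -(Dw w); apply/esym/derive_FF_line.
  by move=> i i6; rewrite [LHS]mxE [X in X + _]mxE [X in _ + X]mxE !w6// !mulr0 addr0.
apply: dv_ext (dvN hl) => t; rewrite w0 w1 w2 w3.
have -> : x 0 (ix 0) + t * 0 = x 0 (ix 0) by rewrite mulr0 addr0.
by have -> : x 0 (ix 1) + t * 0 = x 0 (ix 1) by rewrite mulr0 addr0.
Qed.

Lemma Phi_regular x : Phi x = 0 -> \rank ('J Phi x) = 2%N.
Proof.
move=> Z; have s01 : 0 <= (0 : R) <= 1 by apply/andP; lra.
have := frame_gram Z s01; rewrite /frame_path subr0 scale1r scale0r addr0 => g.
apply/eqP; rewrite eqn_leq rank_leq_col /=.
have : \rank (('J Phi x)^T *m 'J Phi x) = 2%N by apply: mxrank_unit; rewrite unitmxE unitfE.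
by move=> e; have := mxrankM_maxr ('J Phi x)^T ('J Phi x); rewrite e.
Qed.

Lemma ff_le u v s t : u ^+ 2 + v ^+ 2 <= rho2 R N -> ff N S u v s t <= (rho2 R N + 1) * rho2 R N + 4.
Proof.
move=> d; have r1 : 0 <= rho2 R N by rewrite /rho2 mulr_ge0// sqr_ge0.
have h1 : aa N u v <= (rho2 R N + 1) * rho2 R N.
  have := hh_le N u; have := sqr_ge0 u; have := sqr_ge0 v; rewrite /aa => v0 u0 hl.
  have hg : - 2^-1 <= hh N u by rewrite /hh lerDr; apply: sumr_ge0 => i _; exact: step_ge0.
  have [a0|a0] := leP 0 (v ^+ 2 - hh N u); last by nra.
  by apply: ler_pM => //; lra.
have h2 j : bb N S j u v <= 1 by rewrite /bb; move: (psi _ _ _ _ _) => p; have := sqr_ge0 (p - 3 / 2); nra.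
have h3 j : om N S j u v <= 3.
  by rewrite /om /psi; have := sqr_ge0 (u / LL R N); have := sqr_ge0 (v - phi N S j u); lra.
have M0 : 0 <= (rho2 R N + 1) * rho2 R N by rewrite mulr_ge0//; lra.
have [[j h]|h] := pselect (exists j : 'I_r, tau j s t < 1); last first.
  by rewrite ff_out; [lra|move=> j; rewrite leNgt; apply/negP => hj; apply: h; exists j].
have [hj|hj] := leP (tau j s t) (3 / 4).
  rewrite (ff_zone2 _ _ _ _ hj); have := step_ge0 (2 - 4 * tau j s t); have := step_le1 (2 - 4 * tau j s t).
  by have := h2 j; have := h3 j; nra.
rewrite (@ff_zone1 _ _ _ _ j); last by apply/andP; lra.
by have := step_ge0 (4 - 4 * tau j s t); have := step_le1 (4 - 4 * tau j s t); have := h2 j; nra.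
Qed.

Lemma ysq_ge0 x : 0 <= ysq x. Proof. by apply: sumr_ge0 => i _; exact: sqr_ge0. Qed.

Lemma level_bounded x : Phi x = 0 -> sqn x <= rho2 R N + Rq2 + ((rho2 R N + 1) * rho2 R N + 4).
Proof.
move=> /Phi_eq0[F0 S0].
have f0 : ff N S (x 0 (ix 0)) (x 0 (ix 1)) (x 0 (ix 2)) (x 0 (ix 3)) = ysq x by move: F0; rewrite /FF; lra.
have d : x 0 (ix 0) ^+ 2 + x 0 (ix 1) ^+ 2 <= rho2 R N.
  by apply: (@ff_disc _ _ _ S _ _ (x 0 (ix 2)) (x 0 (ix 3))); rewrite f0 ysq_ge0.
have := ff_le (x 0 (ix 2)) (x 0 (ix 3)) d; rewrite f0 => y1.
have K6 : (6 <= K)%N by lia.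
rewrite /sqn (bigID (fun i : 'I_K => (i < 6)%N))/= (big_ord_narrow K6).
have -> : \sum_(i < K | ~~ (i < 6)%N) x 0 i ^+ 2 = ysq x by apply: eq_bigl => i; rewrite -leqNgt.
have ixw (i : 'I_6) : widen_ord K6 i = ix i by apply: val_inj; rewrite /= ixs//; have := ltn_ord i; lia.
under eq_bigr do rewrite ixw.
rewrite !big_ord_recr big_ord0 /= add0r; move: S0; rewrite /SS => S0; lra.
Qed.

Lemma level_compact : compact [set x : E | Phi x = 0].
Proof.
apply: (sqn_compact _ (fun x => @level_bounded x)).
apply: (@preimage_closed _ _ Phi [set 0]); last by apply: accessible_closed_set1; apply: hausdorff_accessible; exact: norm_hausdorff.
by move=> x _; apply: differentiable_continuous; exact: dPhi.
Qed.

Theorem level_embedded : exists A : E -> 'M[R]_K,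
  [/\ smooth_on setT A, forall x, A x *m A x = - 1%:M &
      forall x (v : E), Phi x = 0 -> v *m 'J Phi x = 0 -> v *m A x *m 'J Phi x = 0].
Proof.
pose Nf x := FF x ^+ 2 + SS x ^+ 2.
have NZ x : Nf x = 0 <-> Phi x = 0.
  rewrite Phi_eq0 /Nf; split=> [h|[-> ->]]; last by rewrite expr0n addr0.
  have := sqr_ge0 (FF x); have := sqr_ge0 (SS x) => h1 h2.
  by split; apply/eqP; rewrite -sqrf_eq0; apply/eqP; lra.
have r0 : 0 <= rho2 R N by rewrite /rho2 mulr_ge0// sqr_ge0.
have [||||||||||A [sA A2 AZ]] := @extend_J R K (fun y => 'J Phi y) Psi Nf J0 (rho2 R N + Rq2 + ((rho2 R N + 1) * rho2 R N + 4)).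
- exact: jacobian_smooth.
- exact: Psi_smooth.
- by apply: sD; apply: sX; [exact: FF_smooth|exact: SS_smooth].
- by move=> x; rewrite addr_ge0 ?sqr_ge0.
- have M0 : 0 <= (rho2 R N + 1) * rho2 R N by rewrite mulr_ge0//; lra.
  have : 0 <= Rq2 by exact: sqr_ge0.
  by lra.
- by move=> x /NZ; exact: level_bounded.
- exact: J0_sqr.
- by move=> x s /NZ; exact: frame_gram.
- exact: Psi_gram.
- exact: J0_gproj.
by exists A; split=> // x v /NZ; exact: AZ.
Qed.

End Level.

(** * The plane region and the rings *)

Section WindowIndex.
Variables (R : realType) (N : nat).

(** The index of the gap at [u]. It jumps at the centres of the holes, which are never reached by
    points of the region with v = 0. *)
Definition nn (u : R) : nat := (\sum_(i < N) nat_of_bool ((i.+1)%:R <= u)%R)%N.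

Lemma nnE n u : (n <= N)%N -> n = 0%N \/ n%:R <= u -> n = N \/ u < n.+1%:R -> nn u = n.
Proof.
move=> nN hl hr; rewrite /nn.
have -> : (\sum_(i < N) nat_of_bool ((i.+1)%:R <= u)%R = \sum_(i < N) nat_of_bool (i < n))%N.
  apply: eq_bigr => i _; congr nat_of_bool; apply/idP/idP => [iu|ni].
    rewrite ltnNge; apply/negP => ni; case: hr => [nE|un]; first by have := ltn_ord i; lia.
    have : n.+1%:R <= i.+1%:R :> R by rewrite ler_nat.
    by lra.
  case: hl => [n0|nu]; first by lia.
  by apply: le_trans nu; rewrite ler_nat.
elim: {hr} N nN => [|M ih] nM; first by rewrite big_ord0; lia.
rewrite big_ord_recr /=; have [nM'|Mn] := leqP n M; first by rewrite ih//; lia.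
have nE : n = M.+1 by lia.
rewrite nE.
under eq_bigr => i _ do rewrite (ltn_trans (ltn_ord i) (ltnSn M)).
by rewrite sum_nat_const card_ord muln1 ?ltnSn addn1.
Qed.

Lemma nn_ex (u : R) : exists n, [/\ (n <= N)%N, n = 0%N \/ n%:R <= u & n = N \/ u < n.+1%:R].
Proof.
elim: N => [|M [n [nM h1 h2]]]; first by exists 0%N; split=> //; left.
have [Mu|uM] := leP M.+1%:R u; first by exists M.+1; split; [|right|left].
exists n; split=> //; first exact: leqW.
by right; case: h2 => [->|].
Qed.

Lemma near_gt (c u : R) : c < u -> \forall u' \near u, c < u'.
Proof. by move=> cu; apply: open_nbhs_nbhs; split=> //; exact: open_gt. Qed.

Lemma near_ltr (c u : R) : u < c -> \forall u' \near u, u' < c.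
Proof. by move=> cu; apply: open_nbhs_nbhs; split=> //; exact: open_lt. Qed.

Definition window n (u : R) := [/\ (n <= N)%N, n = 0%N \/ n%:R < u & n = N \/ u < n.+1%:R].

Lemma window_nn n u : window n u -> nn u = n.
Proof. by move=> [nN h1 h2]; apply: nnE => //; case: h1; [left|right; exact: ltW]. Qed.

Lemma window_near n u : window n u -> \forall u' \near u, window n u'.
Proof.
move=> [nN h1 h2].
have l1 : \forall u' \near u, n = 0%N \/ n%:R < u'.
  case: h1 => [n0|/near_gt]; last by apply: filterS => u'; right.
  by apply: (@filterE _ (nbhs u) (nbhs_filter u)) => u'; left.
have l2 : \forall u' \near u, n = N \/ u' < n.+1%:R.
  case: h2 => [n0|/near_ltr]; last by apply: filterS => u'; right.
  by apply: (@filterE _ (nbhs u) (nbhs_filter u)) => u'; left.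
by apply: filterS2 l1 l2 => u' a b.
Qed.

Lemma window_ex (u : R) : (forall i : 'I_N, u != i.+1%:R) -> exists n, window n u.
Proof.
move=> h; have [n [nN h1 h2]] := nn_ex u; exists n; split=> //.
case: h1 => [|nu]; [by left|].
case: n nN nu h2 => [|n] nN nu h2; first by left.
by right; rewrite lt_neqAle nu andbT eq_sym; exact: (h (Ordinal nN)).
Qed.

Lemma nn_cross (i : 'I_N) (u : R) : i%:R < u < i.+2%:R ->
  nn u = (if u < i.+1%:R then i : nat else i.+1).
Proof.
move=> /andP[h1 h2]; case: ltP => h; apply: nnE.
- exact: ltnW.
- by right; exact: ltW.
- by right.
- exact: ltn_ord.
- by right.
- by right.
Qed.

End WindowIndex.

Section PlanePart.
Variables (R : realType) (N : nat).
Local Notation X2 := (R * R)%type.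
Local Notation hh := (@hh R N).
Local Notation LL := (@LL R N).
Local Notation nn := (@nn R N).

(** Beyond all the holes and the points [p0] and [p1], while the rectangle |u| <= UU, |v| <= 1 still
    lies in the large disc. *)
Definition UU : R := 2 * LL.
Definition PP := [set p : X2 | 0 <= aa N p.1 p.2].
Definition Box := [set p : X2 | [/\ - UU <= p.1 <= UU, - 1 <= p.2 <= 1 & hh p.1 <= p.2 ^+ 2]].
Definition wmid (n : nat) : R := n%:R + 2^-1.
(** [p0] and [p1] are the ends of the curve psi = 3/2, midway between the borders of a ring. Since
    [phi j] vanishes there, they are common to all the rings. *)
Definition p0 : X2 := (- (Num.sqrt (3 / 2) * LL), 0).
Definition p1 : X2 := (Num.sqrt (3 / 2) * LL, 0).

Lemma sqrt32 : 1 < Num.sqrt (3 / 2 : R) < 3 / 2.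
Proof.
have h : Num.sqrt (3 / 2 : R) ^+ 2 = 3 / 2 by rewrite sqr_sqrtr//; lra.
by have := sqrtr_ge0 (3 / 2 : R); move=> h0; apply/andP; split; nra.
Qed.

Lemma LLE : LL = 2 * (N%:R + 1). Proof. by rewrite /LL -(natr1 N). Qed.

Lemma UU_rho : UU ^+ 2 + 1 <= rho2 R N.
Proof. by rewrite /UU /LL /rho2; have := @NS_ge1 R N; nra. Qed.

Lemma BoxP : Box `<=` PP.
Proof.
move=> [u v] [/= /andP[u1 u2] /andP[v1 v2] h]; apply/aa_ge0; split=> //=.
by have := UU_rho; nra.
Qed.

Lemma conv_gt (c x y s : R) : c < x -> c < y -> 0 <= s <= 1 -> c < x + s * (y - x).
Proof.
move=> cx cy /andP[s0 s1]; have [xy|yx] := leP x y; first by nra.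
have -> : x + s * (y - x) = y + (1 - s) * (x - y) by ring.
by nra.
Qed.

Lemma conv_lt (c x y s : R) : x < c -> y < c -> 0 <= s <= 1 -> x + s * (y - x) < c.
Proof.
move=> cx cy s01; have xc : - c < - x by lra.
have yc : - c < - y by lra.
by have := conv_gt xc yc s01; lra.
Qed.

Lemma half_sq (x : R) : 2^-1 <= x \/ x <= - 2^-1 -> 4^-1 <= x ^+ 2.
Proof. by case=> h; nra. Qed.

Lemma shrink_sq (c u s : R) : 0 <= c <= u \/ u <= c <= 0 -> 0 <= s <= 1 ->
  (u + s * (c - u)) ^+ 2 <= u ^+ 2.
Proof.
move=> h /andP[s0 s1]; case: h => /andP[c0 cu].
  have l1 : 0 <= s * (u - c) by apply: mulr_ge0; lra.
  have l2 : 0 <= (1 - s) * (u - c) by apply: mulr_ge0; lra.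
  by nra.
have l1 : 0 <= s * (c - u) by apply: mulr_ge0; lra.
have l2 : 0 <= (1 - s) * (c - u) by apply: mulr_ge0; lra.
by nra.
Qed.

Definition pole (b : bool) : R := if b then 1 else - 1.

Lemma pole_sq b : pole b ^+ 2 = 1.
Proof. by case: b; rewrite /pole ?sqrrN expr1n. Qed.

Lemma raise_sq (b : bool) (v s : R) : (if b then 0 <= v else v <= 0) -> - 1 <= v <= 1 -> 0 <= s <= 1 ->
  let x := pole b + s * (v - pole b) in
  [/\ - 1 <= x <= 1, v ^+ 2 <= x ^+ 2 & if b then 0 <= x else x <= 0].
Proof.
move=> hb /andP[v1 v2] /andP[s0 s1]; rewrite /pole; case: b hb => hb /=.
  have l1 : 0 <= s * (1 - v) by apply: mulr_ge0; lra.
  have l2 : 0 <= (1 - s) * (1 - v) by apply: mulr_ge0; lra.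
  have l3 : v <= 1 + s * (v - 1) by lra.
  by split; [apply/andP; lra|nra|lra].
have l1 : 0 <= s * (v + 1) by apply: mulr_ge0; lra.
have l2 : 0 <= (1 - s) * (v + 1) by apply: mulr_ge0; lra.
have l3 : - 1 + s * (v - - 1) <= v by lra.
by split; [apply/andP; lra|nra|lra].
Qed.

(** On the way to the middle of the gap, the distance to each hole centre either does not decrease
    or is at least 1/2. *)
Lemma wmid_hh n u : window N n u -> forall s, 0 <= s <= 1 ->
  hh (wmid n + s * (u - wmid n)) <= hh u.
Proof.
move=> [nN h1 h2] s s01; have /andP[s0 s1] := s01; apply: hh_mono => i.
have [ni|ni] := ltnP i n.
  have in1 : i.+1%:R <= n%:R :> R by rewrite ler_nat.
  have nu : n%:R < u by case: h1 => //; lia.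
  have [uw|uw] := leP (wmid n) u.
    have l1 : 0 <= s * (u - wmid n) by apply: mulr_ge0; lra.
    by left; apply: half_sq; left; rewrite {1}/wmid; lra.
  have l1 : 0 <= (1 - s) * (wmid n - u) by apply: mulr_ge0; lra.
  have l2 : u <= wmid n + s * (u - wmid n) by lra.
  by right; nra.
have in1 : n.+1%:R <= i.+1%:R :> R by rewrite ler_nat.
have un : u < n.+1%:R by case: h2 => // nE; have := ltn_ord i; lia.
have nS : n.+1%:R = n%:R + 1 :> R by rewrite -(natr1 n).
have [uw|uw] := leP u (wmid n).
  have l1 : 0 <= s * (wmid n - u) by apply: mulr_ge0; lra.
  by left; apply: half_sq; right; rewrite {1}/wmid; lra.
have l1 : 0 <= (1 - s) * (u - wmid n) by apply: mulr_ge0; lra.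
have l2 : wmid n + s * (u - wmid n) <= u by lra.
by right; nra.
Qed.

Lemma hh_wmid n : (n <= N)%N -> hh (wmid n) = - 2^-1.
Proof.
move=> nN; apply: hh_far => i; rewrite /wmid.
have [ni|ni] := ltnP i n.
  have : i.+1%:R <= n%:R :> R by rewrite ler_nat.
  by nra.
have : n.+1%:R <= i.+1%:R :> R by rewrite ler_nat.
by rewrite -(natr1 n); nra.
Qed.

Lemma window_mid n : (n <= N)%N -> window N n (wmid n).
Proof.
by move=> nN; split=> //; right; rewrite /wmid ?[X in _ < X]mulrSr -?(natr1 n); lra.
Qed.

Lemma wmid_UU n : (n <= N)%N -> - UU <= wmid n <= UU.
Proof.
move=> nN; have : n%:R <= N%:R :> R by rewrite ler_nat.
have := ler0n R n; rewrite /UU LLE /wmid => n0 n1; apply/andP; split; lra.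
Qed.

Lemma p0_Box : Box p0.
Proof.
have /andP[s1 s2] := sqrt32; have L2 := @LL_ge2 R N; split; rewrite /=.
- by rewrite /UU; apply/andP; split; nra.
- by apply/andP; split; lra.
- rewrite hh_outside; first by rewrite expr0n /=; lra.
  by left; nra.
Qed.

Lemma p0_window : window N 0 p0.1.
Proof.
have /andP[s1 s2] := sqrt32; have L2 := @LL_ge2 R N.
by split=> //; [left|right; rewrite /=; nra].
Qed.

Lemma zero_gap u v : hh u <= v ^+ 2 -> v = 0 -> forall i : 'I_N, u != i.+1%:R.
Proof.
move=> h v0 i; apply/negP => /eqP ui; move: h.
rewrite v0 expr0n /= (@hh_near R N i); last by rewrite ui subrr expr0n /=; lra.
by rewrite ui subrr expr0n /= mulr0 subr0 step1//; lra.
Qed.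

Definition wpt n : X2 := (wmid n, 0).

Section Functor.
Variables (K : groupType) (kap : (R -> X2) -> R -> R -> K).
Hypothesis fk : functor PP kap.

Let ccl := @cl_cont R.

(** The half is moved vertically to the line v = 1 or v = - 1, which misses all the holes, and then
    contracted along this line. *)
Lemma flat_side (b : bool) : flat kap [set p | Box p /\ (if b then 0 <= p.2 else p.2 <= 0)].
Proof.
set c := pole b; have c2 : c ^+ 2 = 1 by exact: pole_sq.
have c11 : - 1 <= c <= 1 by rewrite /c /pole; case: (b); apply/andP; lra.
have cB : Box (0, c).
  split=> //=; last by rewrite c2; have := hh_le N (0 : R); lra.
  by have := @LL_ge2 R N; rewrite /UU => ?; apply/andP; lra.
apply: (flat_homotopy fk (F := fun s p => (p.1, c + cl s * (p.2 - c)))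
  (B := [set p | Box p /\ p.2 = c])).
- by move=> T f g cf cg _; cont.
- move=> s [u v] [[/= u1 v1 h] hb]; apply: BoxP.
  have [x1 x2 _] := raise_sq hb v1 (cl_itv s).
  by split=> //=; exact: le_trans h _.
- by move=> [u v] [_ _]; rewrite cl1 mul1r addrC subrK.
- move=> [u v] [[/= u1 v1 h] hb]; rewrite cl0 mul0r addr0; split=> //; split=> //=.
  by rewrite c2; have := hh_le N u; lra.
apply: (flat_homotopy fk (F := fun s p => (cl s * p.1, p.2)) (B := [set (0, c)])).
- by move=> T f g cf cg _; cont.
- move=> s [u v] [[/= /andP[u1 u2] v1 h] hb]; apply: BoxP.
  have /andP[s0 s1] := cl_itv s; have L2 := @LL_ge2 R N; have UE : UU = 2 * LL by [].
  split=> //=; first by apply/andP; split; nra.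
  by rewrite hb c2; have := hh_le N (cl s * u); lra.
- by move=> [u v] [_ /= ->]; rewrite cl1 mul1r.
- by move=> [u v] [_ /= ->]; rewrite cl0 mul0r.
by apply: (flat_point fk); exact: BoxP.
Qed.

Definition strip n := [set p | Box p /\ window N n p.1].

Lemma strip_segment n u v s : strip n (u, v) -> 0 <= s <= 1 -> strip n (wmid n + s * (u - wmid n), v).
Proof.
move=> [[/= /andP[u1 u2] v1 h] w] s01; have /andP[s0 s1] := s01; have [nN w1 w2] := w.
have /andP[m1 m2] := wmid_UU nN; split.
  split=> //=; first by apply/andP; split; nra.
  by apply: le_trans h; exact: wmid_hh.
have [_ m3 m4] := window_mid nN; split=> //=.
  case: m3 => [n0|m3]; [by left|case: w1 => [n0|w1]; [by left|right; exact: conv_gt]].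
by case: m4 => [n0|m4]; [left|case: w2 => [n0|w2]; [left|right; exact: conv_lt]].
Qed.

Lemma mid_Box n v : (n <= N)%N -> - 1 <= v <= 1 -> strip n (wmid n, v).
Proof.
move=> nN v1; split; last exact: window_mid.
by split=> //=; [exact: wmid_UU|rewrite hh_wmid//; have := sqr_ge0 v; lra].
Qed.

Lemma flat_strip n : (n <= N)%N -> flat kap (strip n).
Proof.
move=> nN; apply: (flat_homotopy fk (F := fun s p => (wmid n + cl s * (p.1 - wmid n), p.2))
  (B := [set p | p.1 = wmid n /\ - 1 <= p.2 <= 1])).
- by move=> T f g cf cg _; cont.
- by move=> s [u v] h; apply: BoxP; have [] := strip_segment h (cl_itv s).
- by move=> [u v] _; rewrite cl1 mul1r addrC subrK.
- by move=> [u v] [[/= _ v1 _] _]; rewrite cl0 mul0r addr0.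
apply: (flat_homotopy fk (F := fun s p => (p.1, cl s * p.2)) (B := [set wpt n])).
- by move=> T f g cf cg _; cont.
- move=> s [u v] [/= -> /andP[v1 v2]]; have /andP[s0 s1] := cl_itv s.
  have [] // := @mid_Box n (cl s * v) nN; first by apply/andP; split; nra.
  by move=> hB _; exact: BoxP.
- by move=> [u v] _; rewrite cl1 mul1r.
- by move=> [u v] [/= -> _]; rewrite cl0 mul0r.
by apply: (flat_point fk); apply: BoxP; have [] := @mid_Box n 0 nN; first by apply/andP; lra.
Qed.

Definition up (p : X2) : bool := 0 <= p.2.

Definition side (b : bool) := [set p | Box p /\ (if b then 0 <= p.2 else p.2 <= 0)].

Lemma strip_conn n p (b : bool) : strip n p -> (if b then 0 <= p.2 else p.2 <= 0) ->
  conn R (strip n `&` side b) (wpt n) p.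
Proof.
case: p => u v sp hb; have [[/= u1 /andP[v1 v2] h] w] := sp; have [nN _ _] := w.
apply: (@conn_trans _ _ _ _ (wmid n, v)).
  have e0 : wpt n = (wmid n, 0 * v) by rewrite mul0r.
  have e1 : (wmid n, v) = (wmid n, 1 * v) by rewrite mul1r.
  rewrite e0 e1; apply: (@conn_curve R _ _ (fun t => (wmid n, t * v))); first by cont.
  move=> t /andP[t0 t1]; have [|B W] := @mid_Box n (t * v) nN; first by apply/andP; split; nra.
  by split=> //; split=> //=; case: b hb => /= hb; nra.
have e0 : (wmid n, v) = (wmid n + 0 * (u - wmid n), v) by rewrite mul0r addr0.
have e1 : (u, v) = (wmid n + 1 * (u - wmid n), v) by rewrite mul1r addrC subrK.
rewrite e0 e1; apply: (@conn_curve R _ _ (fun t => (wmid n + t * (u - wmid n), v))); first by cont.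
move=> t t01; have [B W] := strip_segment sp t01.
by split=> //; split.
Qed.

Lemma side_conn (b : bool) p q : side b p -> side b q -> conn R (side b) p q.
Proof.
set c := pole b; suff h p' : side b p' -> conn R (side b) p' (0, c).
  by move=> hp hq; apply: conn_trans (h p hp) (conn_sym (h q hq)).
have c2 : c ^+ 2 = 1 by exact: pole_sq.
have L2 := @LL_ge2 R N; have UE : UU = 2 * LL by [].
case: p' => u v [[/= u12 v12 h] hb]; have /andP[u1 u2] := u12; apply: (@conn_trans _ _ _ _ (u, c)).
  have e0 : (u, v) = (u, c + (1 - 0) * (v - c)) by congr pair; ring.
  have e1 : (u, c) = (u, c + (1 - 1) * (v - c)) by congr pair; ring.
  rewrite [X in conn _ _ X _]e0 [X in conn _ _ _ X]e1.
  apply: (@conn_curve R _ _ (fun t => (u, c + (1 - t) * (v - c)))); first by cont.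
  move=> t /andP[t0 t1]; have [|x1 x2 x3] := @raise_sq b v (1 - t) hb v12; first by apply/andP; lra.
  by split=> //; split=> //=; exact: le_trans h _.
have e0 : (u, c) = ((1 - 0) * u, c) by rewrite subr0 mul1r.
have e1 : (0, c) = ((1 - 1) * u, c) by rewrite subrr mul0r.
rewrite e0 e1; apply: (@conn_curve R _ _ (fun t => ((1 - t) * u, c))); first by cont.
move=> t /andP[t0 t1]; split; last by rewrite /c /pole; case: (b) => /=; lra.
split=> //=; first by apply/andP; split; nra.
  by rewrite /c /pole; case: (b) => /=; apply/andP; lra.
by rewrite c2; have := hh_le N ((1 - t) * u); lra.
Qed.

Definition lev (X : nat -> K) (p : X2) : K := if up p then 1%g else X (nn p.1).

(* The cocycle on PP with value X n on a small path that crosses the window n upwards. *)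
Definition cP (X : nat -> K) (p q : X2) : K :=
  if up p == up q then 1%g else (lev X p * (lev X q)^-1)%g.

Variables (lam ups : nat -> R -> X2).
Hypothesis lamP : forall n, (n <= N)%N -> [/\ path_in (side false) (lam n), lam n 0 = p0 & lam n 1 = wpt n].
Hypothesis upsP : forall n, (n <= N)%N -> [/\ path_in (side true) (ups n), ups n 0 = wpt n & ups n 1 = p0].

(** The gap loop: below the holes from [p0] to the gap [n], then back above them. *)
Definition XX n : K := (kap (lam n) 0 1 * kap (ups n) 0 1)%g.

(** The cochain consists of the potentials of the two halves, normalized at [p0]. Near the axis a
    short path stays in one gap, whose strip is flat. The potential of the strip relates those of
    the two halves, and the discrepancy is the gap loop. *)
Lemma Box_local : exists e : X2 -> K, forall p, Box p -> exists2 U, nbhs p U &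
  forall g, path_in (Box `&` U) g -> (e (g 0%R) * kap g 0 1 * (e (g 1%R))^-1)%g = cP XX (g 0) (g 1).
Proof.
have [dU hU] := flat_side true; have [dL hL] := flat_side false.
pose d (b : bool) := if b then dU else dL.
have hd b g : path_in (side b) g -> kap g 0 1 = ((d b (g 0%R))^-1 * d b (g 1%R))%g.
  by case: b; [exact: hU|exact: hL].
pose e p := ((d (up p) p0)^-1 * d (up p) p)%g; exists e.
have sideE p : Box p -> side (up p) p by rewrite /side /up => B; split=> //; case: leP => // /ltW.
pose l b n := ((d b p0)^-1 * d b (wpt n))%g.
have XE n : (n <= N)%N -> XX n = (l false n * (l true n)^-1)%g.
  move=> nN; have [p1' l0 l1] := lamP nN; have [p2 u0 u1] := upsP nN.
  by rewrite /XX (hd _ _ p1') (hd _ _ p2) l0 l1 u0 u1 /l /d invgM invgK.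
have same b U : (forall q, U q -> up q = b) -> forall g, path_in (Box `&` U) g ->
    (e (g 0%R) * kap g 0 1 * (e (g 1%R))^-1)%g = cP XX (g 0) (g 1).
  move=> Ub g [cg Bg]; have ub t : up (g t) = b by have [_ /Ub] := Bg t.
  have pg : path_in (side b) g.
    by split=> // t; have [B _] := Bg t; have := sideE _ B; rewrite ub.
  by rewrite /cP /e !ub eqxx (hd _ _ pg) !invgM !invgK !mulgA; rewrite !(mulgVK, mulgK) mulVg.
move=> [u v] B; have [v0|v0|v0] := ltgtP v 0.
- exists [set q | q.2 < 0]; last by apply: (same false) => q; rewrite /up /= leNgt => ->.
  exact: (cvg_snd (near_ltr v0)).
- exists [set q | 0 < q.2]; last by apply: (same true) => q; rewrite /up /= => /ltW.
  exact: (cvg_snd (near_gt v0)).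
have [_ _ h] := B; have [n wn] := window_ex (zero_gap h v0).
have [nN _ _] := wn; have [dn hn] := flat_strip nN.
exists [set q | window N n q.1]; first exact: (cvg_fst (window_near wn)).
have eE q : strip n q -> e q = (l (up q) n * (dn (wpt n))^-1 * dn q)%g.
  move=> sq; have [Bq _] := sq; have [_ hb] := sideE _ Bq.
  have [g [[cg Sg] g0 g1]] := strip_conn sq hb.
  have s1 : path_in (strip n) g by split=> // t; have [] := Sg t.
  have s2 : path_in (side (up q)) g by split=> // t; have [] := Sg t.
  have := hn g s1; rewrite (hd _ _ s2) g0 g1 => e1.
  by rewrite /l /e -!mulgA -e1 mulVKg.
move=> g [cg Bg]; have sg : path_in (strip n) g by [].
rewrite !eE; [|exact: sg.2|exact: sg.2].
rewrite (hn g sg) !invgM !invgK !mulgA !(mulgVK, mulgK).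
have wg t : nn (g t).1 = n by apply: window_nn; have [] := sg.2 t.
rewrite /cP /lev !wg XE//; case: (up (g 0)); case: (up (g 1)); rewrite /=.
all: rewrite ?invgM ?invgK ?invg1 ?mul1g ?mulg1 ?mulgV //.
all: by rewrite /l /d ?mulgA ?mulgK ?mulVg.
Qed.

Definition kappa (p : X2) : X2 := (clab (- UU) UU p.1, clab (- 1) 1 p.2).

Lemma clab_le (a b t : R) : a <= b -> (t <= a -> clab a b t = a) /\ (b <= t -> clab a b t = b).
Proof.
move=> ab; rewrite /clab; split=> h; first by rewrite min_l ?max_l//; lra.
by rewrite min_r ?max_r.
Qed.

Lemma clab_cases (a b t : R) : a <= b ->
  [\/ t <= a /\ clab a b t = a, a <= t <= b /\ clab a b t = t | b <= t /\ clab a b t = b].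
Proof.
move=> ab; have [c1 c2] := clab_le t ab.
have [ta|at_] := leP t a; first by apply: Or31; rewrite c1.
have [bt|tb] := leP b t; first by apply: Or33; rewrite c2.
have atb : a <= t <= b by apply/andP; lra.
by apply: Or32; rewrite clabK.
Qed.

(** Clamping does not increase |u| or |v|, so the segment stays in the large disc. If it changes v,
    then |v| >= 1 all along, away from the holes; if it changes u alone, the segment runs beyond the
    first or the last hole. *)
Lemma kappa_segment (u v s : R) : PP (u, v) -> 0 <= s <= 1 ->
  PP (u + s * ((kappa (u, v)).1 - u), v + s * ((kappa (u, v)).2 - v)).
Proof.
have L2 := @LL_ge2 R N; have UE : UU = 2 * LL by [].
move=> /aa_ge0[/= h d] /andP[s0 s1]; apply/aa_ge0 => /=.
have U0 : - UU <= UU by lra.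
have i1 : - 1 <= 1 :> R by lra.
set a := u + _; set b := v + _.
have a2 : a ^+ 2 <= u ^+ 2.
  apply: shrink_sq; last by apply/andP.
  rewrite /kappa /=; case: (clab_cases u U0) => -[c ->]; [right|case: (leP 0 u) => u0; [left|right]|left]; apply/andP; lra.
have b2 : b ^+ 2 <= v ^+ 2.
  apply: shrink_sq; last by apply/andP.
  rewrite /kappa /=; case: (clab_cases v i1) => -[c ->]; [right|case: (leP 0 v) => u0; [left|right]|left]; apply/andP; lra.
split; last by lra.
have [b1|b1] : 1 <= b ^+ 2 \/ b = v.
- rewrite /b /kappa /=; case: (clab_cases v i1) => -[c ->].
  + have l1 : 0 <= (1 - s) * (- 1 - v) by apply: mulr_ge0; lra.
    have l2 : v + s * (- 1 - v) <= - 1 by lra.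
    by left; nra.
  + by right; rewrite subrr mulr0 addr0.
  + have l1 : 0 <= (1 - s) * (v - 1) by apply: mulr_ge0; lra.
    have l2 : 1 <= v + s * (1 - v) by lra.
    by left; nra.
- by have := hh_le N a; lra.
have out : a = u \/ (a <= 2^-1 \/ N%:R + 2^-1 <= a).
  have LE := LLE; rewrite /a /kappa /=; case: (clab_cases u U0) => -[c ->].
  - by right; left; nra.
  - by left; rewrite subrr mulr0 addr0.
  - by right; right; have := ler0n R N; nra.
by case: out => [->|out]; [rewrite b1|rewrite hh_outside//; have := sqr_ge0 b; lra].
Qed.

Lemma kappa_Box p : PP p -> Box (kappa p).
Proof.
have L2 := @LL_ge2 R N; have UE : UU = 2 * LL by [].
case: p => u v hP; have s01 : 0 <= (1 : R) <= 1 by apply/andP; lra.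
have /aa_ge0[/= h _] := kappa_segment hP s01.
split; [by apply: clab_itv; lra|by apply: clab_itv; lra|].
by move: h; rewrite !mul1r (addrC u) (addrC v) !subrK.
Qed.

Lemma kappa_up p : up (kappa p) = up p.
Proof.
rewrite /up /kappa /=; have i1 : - 1 <= 1 :> R by lra.
by case: (clab_cases p.2 i1) => -[c ->] //; apply/idP/idP; lra.
Qed.

Lemma kappa_nn p : nn (kappa p).1 = nn p.1.
Proof.
have L2 := @LL_ge2 R N; have UE : UU = 2 * LL by []; have LE := LLE; have N0 := ler0n R N.
have U0 : - UU <= UU by lra.
rewrite /kappa /=; case: (clab_cases p.1 U0) => -[c ->] //.
  rewrite !(@nnE R N 0)//; try (by left); right; lra.
by rewrite !(@nnE R N N)//; try (by left); right; lra.
Qed.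

(** The retraction [kappa] preserves the half-plane and the gap of a point, so the values of [cP] on
    the rectangle carry over; the tracks of the retraction enter the cochain. *)
Theorem PP_local : exists e : X2 -> K, forall p, PP p -> exists2 U, nbhs p U &
  forall g, path_in (PP `&` U) g -> (e (g 0%R) * kap g 0 1 * (e (g 1%R))^-1)%g = cP XX (g 0) (g 1).
Proof.
have [e he] := Box_local.
pose F (s : R) (p : X2) : X2 := (p.1 + (1 - cl s) * ((kappa p).1 - p.1), p.2 + (1 - cl s) * ((kappa p).2 - p.2)).
have cka : continuous kappa.
  have c1 := @clab_cont R (- UU) UU; have c2 := @clab_cont R (- 1) 1; rewrite /kappa; cont.
exists (fun p => e (kappa p) * kap (F^~ p) 0 1)%g => p Pp.
have [U nU h] := he _ (kappa_Box Pp).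
exists (kappa @^-1` U); first exact: cka.
move=> g [cg Pg].
have F1 : F 1 \o g = g.
  by apply/funext => t; rewrite /F /= cl1 subrr !mul0r !addr0; case: (g t).
have F0 : F 0 \o g = kappa \o g.
  by apply/funext => t; rewrite /F /= cl0 subr0 !mul1r (addrC (g t).1) (addrC (g t).2) !subrK.
have cH : continuous (fun z : R * R => F z.1 (g z.2)).
  by have ccl' := @cl_cont R; rewrite /F; cont.
have AH (z : R * R) : PP (F z.1 (g z.2)).
  have [Pz _] := Pg z.2; rewrite /F; case: (g z.2) Pz => u v Pz; apply: kappa_segment => //.
  by have := cl_itv z.1; move=> /andP[? ?]; apply/andP; lra.
have := kap_homotopy fk 0 1 AH cH; rewrite F1 F0 => ->.
have pk : path_in (Box `&` U) (kappa \o g).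
  by split=> [|t]; [apply: contcomp|have [Pt Ut] := Pg t; split; [exact: kappa_Box|]].
have := h _ pk; rewrite /cP /lev /= !kappa_up !kappa_nn => <-.
by rewrite !invgM !mulgA !(mulgVK, mulgK).
Qed.

End Functor.

End PlanePart.

Section RingPart.
Variables (R : realType) (N r : nat) (S : 'I_r -> pred nat).
Local Notation X2 := (R * R)%type.
Local Notation LL := (@LL R N).
Local Notation phi := (@phi R N r S).
Local Notation psi := (@psi R N r S).

Lemma step_cont : continuous (@step R).
Proof. by move=> x; exact: (@step_smooth R 0%N). Qed.

Lemma phi_cont j : continuous (phi j).
Proof.
have sc := step_cont; rewrite /phi; apply: contM; first exact: contcst.
by apply: cont_sum => i; apply: (contcomp sc); cont.
Qed.

Lemma hh_cont : continuous (@hh R N).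
Proof.
have sc := step_cont; rewrite /hh; apply: contD; last exact: contcst.
by apply: cont_sum => i; apply: (contcomp sc); cont.
Qed.

Definition ring j := [set p : X2 | 1 <= psi j p.1 p.2 <= 2].
Definition low_ring j := [set p : X2 | ring j p /\ p.2 <= phi j p.1].

Lemma ringP j : ring j `<=` @PP R N.
Proof. by move=> p; rewrite /ring /= -bb_ge0 => /bb_aa/ltW. Qed.

Lemma sqrt32E : Num.sqrt (3 / 2 : R) ^+ 2 = 3 / 2.
Proof. by rewrite sqr_sqrtr//; lra. Qed.

Section Potential.
Variables (K : groupType) (X : nat -> K).

(* The class of a loop that encircles the holes of A among the first n ones. *)
Fixpoint Dn (A : pred nat) (n : nat) : K :=
  if n is n'.+1 then (Dn A n' * (if A n then (X n')^-1 * X n else 1))%g else 1%g.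

(** A potential of [cP] on the lower branch of the ring, which passes below the holes of [S j] and
    above the others. *)
Definition dlow j (p : X2) : K := (Dn (S j) (nn N p.1) * (lev N X p)^-1)%g.

Lemma cP_window n (p q : X2) : nn N p.1 = n -> nn N q.1 = n ->
  cP N X p q = (lev N X p * (lev N X q)^-1)%g.
Proof.
move=> pn qn; rewrite /cP /lev pn qn.
by case: (up p); case: (up q); rewrite /= ?mulgV// ?mul1g.
Qed.

(** The index [nn] changes only at a hole centre. At a hole of [S j] the branch runs below the axis,
    and the change of [lev] cancels the new factor of [Dn]; at another hole it runs above the axis,
    and neither changes. *)
Lemma low_ring_local j p : low_ring j p -> exists2 U, nbhs p U & forall x y,
  (low_ring j `&` U) x -> (low_ring j `&` U) y -> cP N X x y = ((dlow j x)^-1 * dlow j y)%g.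
Proof.
case: p => u v [rp vphi]; have [[i ui]|h] := pselect (exists i : 'I_N, u = i.+1%:R); last first.
  have [|n wn] := @window_ex R N u; first by move=> i; apply/eqP => ui; apply: h; exists i.
  exists [set q | window N n q.1]; first exact: (cvg_fst (window_near wn)).
  move=> x y [_ /window_nn xn] [_ /window_nn yn].
  by rewrite (cP_window xn yn) /dlow xn yn !invgM !invgK !mulgA mulgVK.
have cross : \forall q \near (u, v), nn N q.1 = (if q.1 < i.+1%:R then i : nat else i.+1).
  have h1 : i%:R < u by rewrite ui -(natr1 i); lra.
  have h2 : u < i.+2%:R by rewrite ui -(natr1 i.+1); lra.
  have h3 : \forall u' \near u, i%:R < u' /\ u' < i.+2%:R :=
    @filterI _ (nbhs u) (nbhs_filter u) _ _ (near_gt h1) (near_ltr h2).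
  have h4 : \forall u' \near u, nn N u' = (if u' < i.+1%:R then i : nat else i.+1).
    by apply: filterS h3 => u' [q1 q2]; apply: nn_cross; rewrite q1.
  exact: (cvg_fst h4).
have ui4 : (u - i.+1%:R) ^+ 2 <= 4^-1 by rewrite ui subrr expr0n /=; lra.
have DS : S j i.+1 -> (Dn (S j) i.+1 * (X i.+1)^-1 = Dn (S j) i * (X i)^-1)%g.
  by move=> /= ->; rewrite !mulgA mulgK.
have DS' : ~~ S j i.+1 -> Dn (S j) i.+1 = Dn (S j) i by move=> /negbTE /= ->; rewrite mulg1.
have [Si|Si] := boolP (S j i.+1).
  have v0 : v < 0.
    have : v <= 0 by move: vphi; rewrite /= (phi_near _ _ ui4) Si.
    rewrite le_eqVlt => /orP[/eqP v0|//].
    have /aa_ge0[hv _] := ringP rp.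
    by have := zero_gap hv v0 i; rewrite /= ui eqxx.
  have nv : \forall q \near (u, v), q.2 < 0 := cvg_snd (near_ltr v0).
  exists ([set q | nn N q.1 = (if q.1 < i.+1%:R then i : nat else i.+1)] `&` [set q | q.2 < 0]).
    by apply: filterI; [exact: cross|exact: nv].
  have E x : nn N x.1 = (if x.1 < i.+1%:R then i : nat else i.+1) -> x.2 < 0 ->
      up x = false /\ dlow j x = (Dn (S j) i * (X i)^-1)%g.
    move=> xn x0; have ux : up x = false by rewrite /up leNgt x0.
    by split=> //; rewrite /dlow /lev ux xn; case: ifP => _ //; exact: DS.
  move=> x y [_ [xn x0]] [_ [yn y0]]; have [ux ->] := E x xn x0; have [uy ->] := E y yn y0.
  by rewrite /cP ux uy eqxx mulVg.
have v0 : 0 < v.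
  have /andP[_] := rp; rewrite /psi /= (phi_near _ _ ui4) (negbTE Si) step1; last by rewrite ui subrr expr0n /=; lra.
  by have := sqr_ge0 (u / LL); nra.
have nv : \forall q \near (u, v), 0 < q.2 := cvg_snd (near_gt v0).
exists ([set q | nn N q.1 = (if q.1 < i.+1%:R then i : nat else i.+1)] `&` [set q | 0 < q.2]).
  by apply: filterI; [exact: cross|exact: nv].
have E x : nn N x.1 = (if x.1 < i.+1%:R then i : nat else i.+1) -> 0 < x.2 ->
    up x = true /\ dlow j x = Dn (S j) i.
  move=> xn x0; have ux : up x = true by rewrite /up ltW.
  by split=> //; rewrite /dlow /lev ux xn invg1 mulg1; case: ifP => _ //; exact: DS'.
move=> x y [_ [xn x0]] [_ [yn y0]]; have [ux ->] := E x xn x0; have [uy ->] := E y yn y0.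
by rewrite /cP ux uy eqxx mulVg.
Qed.

Definition dring j (p : X2) : K := if phi j p.1 <= p.2 then 1%g else dlow j p.

(* The relation closes the potential up at the right end of the ring, where the two branches meet. *)
Lemma ring_local j p : Dn (S j) N = 1%g -> ring j p -> exists2 U, nbhs p U & forall x y,
  (ring j `&` U) x -> (ring j `&` U) y -> cP N X x y = ((dring j x)^-1 * dring j y)%g.
Proof.
move=> DN; case: p => u v rp.
have cd : continuous (fun q : X2 => q.2 - phi j q.1) by have cphi := phi_cont (j := j); cont.
have [vp|pv|vp] := ltgtP v (phi j u).
- have lp : low_ring j (u, v) by split=> //; exact: ltW.
  have [U nU h] := low_ring_local lp.
  have nd : \forall q \near (u, v), q.2 - phi j q.1 < 0.
    by apply: (cd (u, v) [set y | y < 0]); apply: near_ltr; rewrite /= subr_lt0.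
  exists (U `&` [set q | q.2 - phi j q.1 < 0]); first exact: filterI.
  move=> x y [rx [Ux]]; rewrite /= subr_lt0 => xp [ry [Uy]]; rewrite /= subr_lt0 => yp.
  rewrite h /dring; [|by split=> //; split=> //; exact: ltW|by split=> //; split=> //; exact: ltW].
  by rewrite !leNgt xp yp.
- exists [set q | 0 < q.2 - phi j q.1].
    by apply: (cd (u, v) [set y | 0 < y]); apply: near_gt; rewrite /= subr_gt0.
  have E q : 0 < q.2 - phi j q.1 -> up q = true /\ dring j q = 1%g.
    rewrite subr_gt0 => h; split; last by rewrite /dring ltW.
    by rewrite /up; apply: le_trans (ltW h); exact: phi_ge0.
  by move=> x y [_ /E[ux ->]] [_ /E[uy ->]]; rewrite /cP ux uy eqxx invg1 mulg1.
have hu : LL ^+ 2 <= u ^+ 2.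
  move: rp => /andP[+ _]; rewrite /psi /= vp subrr [0 ^+ 2]expr0n addr0 expr_div_n ler_pdivlMr ?mul1r//.
  by have := @LL_ge2 R N; nra.
have L2 := @LL_ge2 R N; have LE := @LLE R N; have N0 := ler0n R N.
(* The branches meet beyond all the holes: on the left, where n = 0 and [Dn] is an empty product, or
   on the right, where n = N and the hypothesis applies. *)
have [n [un Dn1]] : exists n, (\forall q \near (u, v), nn N q.1 = n /\ phi j q.1 = 0) /\ Dn (S j) n = 1%g.
  have [u0|u0] := leP u 0.
    exists 0%N; split=> //; have h2 : u < 2^-1 by lra.
    have h3 : \forall u' \near u, nn N u' = 0%N /\ phi j u' = 0.
      apply: filterS (near_ltr h2) => q hq; split; first by apply: nnE => //; [left|right; lra].
      by apply: phi_outside; left; exact: ltW.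
    exact: (cvg_fst h3).
  exists N; split=> //; have h2 : N%:R + 2^-1 < u by nra.
  have h3 : \forall u' \near u, nn N u' = N /\ phi j u' = 0.
    apply: filterS (near_gt h2) => q hq; split; first by apply: nnE => //; [right; lra|left].
    by apply: phi_outside; right; exact: ltW.
  exact: (cvg_fst h3).
exists [set q | nn N q.1 = n /\ phi j q.1 = 0] => // x y [_ [xn xp]] [_ [yn yp]].
have E q : nn N q.1 = n -> phi j q.1 = 0 -> dring j q = (lev N X q)^-1%g.
  move=> qn qp; rewrite /dring qp /dlow qn Dn1 mul1g /lev /up.
  by case: (boolP (0 <= q.2)) => q0; rewrite ?q0 ?(negbTE q0) ?invg1.
by rewrite (cP_window xn yn) !E// invgK.
Qed.

End Potential.

(** Abscissa on the curve psi = 3/2, from [p0] to [p1]. The branches below are its upper half for s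
    = 1 and its lower half for s = - 1; intermediate values of [s] sweep the disc between them. *)
Definition uT (t : R) : R := Num.sqrt (3 / 2) * LL * (2 * cl t - 1).
Definition wT (t : R) : R := Num.sqrt (3 / 2 - (uT t / LL) ^+ 2).
Definition branch j (s t : R) : X2 := (uT t, phi j (uT t) + s * wT t).

Lemma uT_sq t : (uT t / LL) ^+ 2 <= 3 / 2.
Proof.
have L2 := @LL_ge2 R N; have /andP[c0 c1] := cl_itv t.
have -> : uT t / LL = Num.sqrt (3 / 2) * (2 * cl t - 1) by rewrite /uT; field; lra.
by rewrite exprMn sqrt32E; nra.
Qed.

Lemma wT_sq t : wT t ^+ 2 = 3 / 2 - (uT t / LL) ^+ 2.
Proof. by rewrite sqr_sqrtr//; have := uT_sq t; lra. Qed.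

Lemma psi_branch j s t : psi j (branch j s t).1 (branch j s t).2 = (uT t / LL) ^+ 2 + s ^+ 2 * wT t ^+ 2.
Proof. by rewrite /psi /branch /=; ring. Qed.

Lemma branch_ring j s t : s ^+ 2 = 1 -> ring j (branch j s t).
Proof. by move=> s1; rewrite /ring /= psi_branch s1 wT_sq; apply/andP; lra. Qed.

Lemma branch_cont j (T : topologicalType) (f g : T -> R) : continuous f -> continuous g ->
  continuous (fun t => branch j (f t) (g t)).
Proof.
move=> cf cg; have ccl := @cl_cont R; have cphi := phi_cont (j := j).
have cu : continuous uT by rewrite /uT; cont.
have cw : continuous wT by apply: contsqrt; cont.
by rewrite /branch; cont.
Qed.

Lemma uT0 : uT 0 = (p0 R N).1.
Proof. by rewrite /uT cl0 /=; ring. Qed.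

Lemma uT1 : uT 1 = (p1 R N).1.
Proof. by rewrite /uT cl1 /=; ring. Qed.

Lemma end_sq (c : bool) : ((-1) ^+ c * (Num.sqrt (3 / 2) * LL) / LL) ^+ 2 = 3 / 2 :> R.
Proof.
have L2 := @LL_ge2 R N.
have -> : (-1) ^+ c * (Num.sqrt (3 / 2) * LL) / LL = (-1) ^+ c * Num.sqrt (3 / 2) by field; lra.
by rewrite exprMn sqrr_sign mul1r sqrt32E.
Qed.

Lemma branch0 j s : branch j s 0 = p0 R N.
Proof.
have /andP[s1 s2] := @sqrt32 R; have L2 := @LL_ge2 R N.
have w0 : wT 0 = 0.
  have e := end_sq true; rewrite expr1 !mulN1r in e.
  by rewrite /wT uT0 /= e subrr sqrtr0.
by rewrite /branch w0 mulr0 addr0 uT0 phi_outside//; left; rewrite /=; nra.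
Qed.

Lemma branch1 j s : branch j s 1 = p1 R N.
Proof.
have /andP[s1 s2] := @sqrt32 R; have L2 := @LL_ge2 R N; have LE := @LLE R N; have N0 := ler0n R N.
have w0 : wT 1 = 0.
  rewrite /wT uT1 /=; have := end_sq false; rewrite expr0 mul1r => ->.
  by rewrite subrr sqrtr0.
by rewrite /branch w0 mulr0 addr0 uT1 phi_outside//; right; rewrite /=; nra.
Qed.

Section Relation.
Variables (K : groupType) (kap : (R -> X2) -> R -> R -> K).
Hypothesis fk : functor (@PP R N) kap.
Variables (lam ups : nat -> R -> X2).
Hypothesis lamP : forall n, (n <= N)%N ->
  [/\ path_in (@side R N false) (lam n), lam n 0 = p0 R N & lam n 1 = wpt R n].
Hypothesis upsP : forall n, (n <= N)%N ->
  [/\ path_in (@side R N true) (ups n), ups n 0 = wpt R n & ups n 1 = p0 R N].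

(** On the upper branch the cocycle is trivial. On the lower one it has the potential [dlow], which
    is 1 at [p0] and the class of the ring at [p1]; equal values on the two branches therefore kill
    this class. *)
Theorem ring_relation j : kap (branch j 1) 0 1 = kap (branch j (- 1)) 0 1 ->
  Dn (XX kap lam ups) (S j) N = 1%g.
Proof.
move=> TB; have [e he] := PP_local fk lamP upsP.
pose X := XX kap lam ups.
have cb s : continuous (branch j s) by apply: branch_cont; cont.
have w0 t : 0 <= wT t by exact: sqrtr_ge0.
have top : (e (p0 R N) * kap (branch j 1%R) 0 1 * (e (p1 R N))^-1 = 1)%g.
  rewrite -(branch0 j 1) -(branch1 j 1).
  have fU : functor (@PP R N `&` [set p | 0 <= p.2]) kap by apply: functor_sub fk => p [].
  apply: (@path_local _ _ _ _ _ kap kap (fun x y k _ => e x * k * (e y)^-1 = 1)%g fU fU) => //.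
  - move=> x y z k l k' l' e1 e2; rewrite -[RHS]mulg1 -{1}e1 -e2 !mulgA; by rewrite mulgVK.
  - move=> x [Px x0]; have [U nU h] := he x Px; exists U => // g [cg Pg].
    have pg : path_in (@PP R N `&` U) g by split=> // t; have [[]] := Pg t.
    have ut t : up (g t) = true by have [[]] := Pg t.
    by rewrite (h g pg) /cP !ut eqxx.
  - split=> // t; split; first by apply/(@ringP j)/branch_ring; rewrite expr1n.
    by rewrite /= mul1r addr_ge0// phi_ge0.
have bot : (e (p0 R N) * kap (branch j (- 1)) 0 1 * (e (p1 R N))^-1 =
    (dlow X j (p0 R N))^-1 * dlow X j (p1 R N))%g.
  rewrite -(branch0 j (- 1)) -(branch1 j (- 1)).
  have fL : functor (low_ring j) kap by apply: functor_sub fk => p [/ringP].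
  apply: (@path_local _ _ _ _ _ kap kap (fun x y k _ => e x * k * (e y)^-1 = (dlow X j x)^-1 * dlow X j y)%g fL fL) => //.
  - move=> x y z k l k' l' e1 e2; have -> : (e x * (k * k') * (e z)^-1 = (e x * k * (e y)^-1) * (e y * k' * (e z)^-1))%g.
      by rewrite !mulgA mulgVK.
    by rewrite e1 e2 -mulgA mulVKg.
  - move=> x Lx; have Px : @PP R N x by have [/ringP] := Lx.
    have [U nU h] := he x Px; have [V nV hV] := low_ring_local X Lx.
    exists (U `&` V); first exact: filterI.
    move=> g [cg Pg]; rewrite h; last by split=> // t; have [[/ringP Pt _] [Ut _]] := Pg t; split.
    by apply: hV; [have [L0 [_ V0]] := Pg 0|have [L1 [_ V1]] := Pg 1]; split.
  - split=> // t; split; first by apply: branch_ring; rewrite sqrrN expr1n.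
    by rewrite /= mulN1r gerDl oppr_le0.
have /andP[s1 s2] := @sqrt32 R; have L2 := @LL_ge2 R N; have LE := @LLE R N; have N0 := ler0n R N.
have d0 : dlow X j (p0 R N) = 1%g.
  by rewrite /dlow /lev /up /= lexx invg1 mulg1 (@nnE R N 0)//; [left|right; nra].
have d1 : dlow X j (p1 R N) = Dn X (S j) N.
  by rewrite /dlow /lev /up /= lexx invg1 mulg1 (@nnE R N N)//; [right; nra|left].
by move: bot; rewrite -TB top d0 d1 invg1 mul1g.
Qed.

End Relation.

End RingPart.

(** * The space of pairs *)

Section SpacePart.
Variables (R : realType) (N r : nat) (S : 'I_r -> pred nat).
Local Notation X2 := (R * R)%type.
Local Notation X4 := ((R * R) * (R * R))%type.
Local Notation phi := (@phi R N r S).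
Local Notation psi := (@psi R N r S).
Local Notation ff := (@ff R N r S).
Local Notation tau := (@tau R r).
Local Notation Rq2 := (@Rq2 R r).
Local Notation p0 := (@p0 R N).
Local Notation p1 := (@p1 R N).
Local Notation center j := (4 * (nat_of_ord j)%:R : R).

Definition WW := [set w : X4 | 0 <= ff w.1.1 w.1.2 w.2.1 w.2.2 /\ w.2.1 ^+ 2 + w.2.2 ^+ 2 <= Rq2].
Definition QQ := [set q : X2 | q.1 ^+ 2 + q.2 ^+ 2 <= Rq2 /\ forall j, 1 <= tau j q.1 q.2].
(** A point to the left of all the discs around the q_j, over which the slice is the disc with
    holes. *)
Definition qs : X2 := (- 3, 0).

Lemma ord_le (j : 'I_r) : 0 <= (nat_of_ord j)%:R :> R /\ (nat_of_ord j)%:R + 1 <= r%:R :> R.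
Proof. by rewrite ler0n natr1 ler_nat ltn_ord. Qed.

Lemma disc_Rq2 j s t : tau j s t <= 4 -> s ^+ 2 + t ^+ 2 <= Rq2.
Proof.
have [j0 j1] := ord_le j; rewrite /tau /Rq2; set c := (nat_of_ord j)%:R in j0 j1 *; move=> h.
have h1 : (s - 4 * c) ^+ 2 <= 4 by have := sqr_ge0 t; lra.
have /andP[h2 h3] : -2 <= s - 4 * c <= 2 by apply/andP; split; nra.
have h4 : t ^+ 2 <= 4 by have := sqr_ge0 (s - 4 * c); lra.
by have r0 := ler0n R r; nra.
Qed.

Lemma tau_big j s t : (4 * r%:R + 5) ^+ 2 <= s ^+ 2 + t ^+ 2 -> 1 <= tau j s t.
Proof.
have [j0 j1] := ord_le j; move=> h; rewrite leNgt; apply/negP => h2; move: h2.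
rewrite /tau; set c := (nat_of_ord j)%:R in j0 j1 * => h2.
have h1 : (s - 4 * c) ^+ 2 < 1 by have := sqr_ge0 t; lra.
have /andP[h3 h4] : -1 < s - 4 * c < 1 by apply/andP; split; nra.
have h5 : t ^+ 2 < 1 by have := sqr_ge0 (s - 4 * c); lra.
by nra.
Qed.

(** The route shrinks |q| to at most 4r + 5, moves away from the axis t = 0 to |t| >= 1, then runs
    horizontally to s = - 3 and vertically to [qs]. A line at height |t| >= 1 meets no open disc tau
    < 1, nor does the line s = - 3. The bound 4r + 5 is beyond the discs and leaves room for the
    vertical motion. *)
Lemma QQ_conn q : QQ q -> conn R QQ q qs.
Proof.
have r0 := ler0n R r; pose c : R := 4 * r%:R + 5; have c0 : 5 <= c by rewrite /c; lra.
have cR : c ^+ 2 + 13 <= Rq2 by rewrite /c /Rq2; nra.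
suff main q' : QQ q' -> q'.1 ^+ 2 + q'.2 ^+ 2 <= c ^+ 2 -> conn R QQ q' qs.
  case: q => s t [/= q1 q2]; have [le|gt] := leP (s ^+ 2 + t ^+ 2) (c ^+ 2); first exact: main.
  pose m := Num.sqrt (s ^+ 2 + t ^+ 2).
  have m2 : m ^+ 2 = s ^+ 2 + t ^+ 2 by rewrite sqr_sqrtr// addr_ge0 ?sqr_ge0.
  have m0 : c < m by have := sqrtr_ge0 (s ^+ 2 + t ^+ 2); rewrite -/m; nra.
  pose l x := (1 - x * (1 - c / m)).
  have cm : 0 <= c / m <= 1 by rewrite divr_ge0 ?ler_pdivrMr ?mul1r; try lra; rewrite ltW; lra.
  have lm x : 0 <= x <= 1 -> c <= l x * m <= m.
    move=> /andP[x0 x1]; have -> : l x * m = m - x * (m - c) by rewrite /l; field; lra.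
    by apply/andP; split; nra.
  have ls x : 0 <= x <= 1 -> (l x * s) ^+ 2 + (l x * t) ^+ 2 = (l x * m) ^+ 2.
    by move=> _; rewrite !exprMn -mulrDr m2.
  have e0 : (s, t) = (l 0 * s, l 0 * t) by rewrite /l !mul0r subr0 !mul1r.
  apply: (@conn_trans _ _ _ _ (l 1 * s, l 1 * t)).
    rewrite [X in conn _ _ X _]e0; apply: (@conn_curve R _ _ (fun x => (l x * s, l x * t))); first by rewrite /l; cont.
    move=> x x01; have /andP[l1 l2] := lm x x01; split=> /=; first by rewrite ls//; nra.
    by move=> j; apply: tau_big; rewrite ls// -/c; nra.
  have i1 : 0 <= (1 : R) <= 1 by apply/andP; lra.
  have lmc : l 1 * m = c by rewrite /l mul1r; field; lra.
  apply: main; last by rewrite /= ls// lmc.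
  split=> [|j] /=; first by rewrite ls// lmc; lra.
  by apply: tau_big; rewrite ls// lmc.
case: q' => s t [/= q1 q2] sc.
have [t2 [t2h t2c]] : exists t2, 1 <= t2 ^+ 2 <= c ^+ 2 + 4 /\ conn R QQ (s, t) (s, t2) /\ s ^+ 2 + t2 ^+ 2 <= c ^+ 2 + 4.
  have [big|small] := leP 4 (t ^+ 2).
    exists t; split; first by have s0 := sqr_ge0 s; apply/andP; lra.
    by split; [exact: conn_refl|lra].
  exists (if 0 <= t then 2 else - 2).
  set b := if 0 <= t then 2 else - 2.
  have b4 : b ^+ 2 = 4 by rewrite /b; case: ifP => _; rewrite ?sqrrN; lra.
  split; first by rewrite b4; apply/andP; nra.
  split; last by rewrite b4; have := sqr_ge0 t; lra.
  have e0 : (s, t) = (s, t + 0 * (b - t)) by rewrite mul0r addr0.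
  have e1 : (s, b) = (s, t + 1 * (b - t)) by rewrite mul1r addrC subrK.
  rewrite [X in conn _ _ X _]e0 [X in conn _ _ _ X]e1.
  apply: (@conn_curve R _ _ (fun x => (s, t + x * (b - t)))); first by cont.
  move=> x /andP[x0 x1].
  have /andP[y1 y2] : t ^+ 2 <= (t + x * (b - t)) ^+ 2 <= 4.
    have /andP[t3 t4] : -2 < t < 2 by apply/andP; split; nra.
    rewrite /b; case: (leP 0 t) => t0.
      have l1 : 0 <= x * (2 - t) by apply: mulr_ge0; lra.
      have l2 : 0 <= (1 - x) * (2 - t) by apply: mulr_ge0; lra.
      by apply/andP; split; nra.
    have l1 : 0 <= x * (t + 2) by apply: mulr_ge0; lra.
    have l2 : 0 <= (1 - x) * (t + 2) by apply: mulr_ge0; lra.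
    by apply/andP; split; nra.
  split=> /=; first by have := sqr_ge0 t; lra.
  by move=> j; apply: le_trans (q2 j) _; rewrite /tau lerD2l.
have [cst sn] := t2c; apply: conn_trans cst _; have /andP[t21 t22] := t2h.
apply: (@conn_trans _ _ _ _ ((- 3 : R), t2)).
  have e0 : (s, t2) = (s + 0 * (- 3 - s), t2) by rewrite mul0r addr0.
  have e1 : (- 3, t2) = (s + 1 * (- 3 - s), t2) by rewrite mul1r addrC subrK.
  rewrite [X in conn _ _ X _]e0 [X in conn _ _ _ X]e1.
  apply: (@conn_curve R _ _ (fun x => (s + x * (- 3 - s), t2))); first by cont.
  move=> x /andP[x0 x1]; split=> /=; last by move=> j; rewrite /tau; have := sqr_ge0 (s + x * (- 3 - s) - center j); lra.
  have y : (s + x * (- 3 - s)) ^+ 2 <= (1 - x) * s ^+ 2 + x * 9.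
    have -> : (1 - x) * s ^+ 2 + x * 9 = (s + x * (- 3 - s)) ^+ 2 + x * (1 - x) * (s + 3) ^+ 2 by ring.
    by rewrite lerDl; apply: mulr_ge0; [apply: mulr_ge0; lra|exact: sqr_ge0].
  have := sqr_ge0 s; have := mulr_ge0 x0 (sqr_ge0 s) => s1 s2; nra.
have e0 : ((- 3 : R), t2) = (- 3, (1 - 0) * t2) by rewrite subr0 mul1r.
have e1 : qs = (- 3, (1 - 1) * t2) by rewrite subrr mul0r.
rewrite e0 e1; apply: (@conn_curve R _ _ (fun x => ((- 3 : R), (1 - x) * t2))); first by cont.
move=> x /andP[x0 x1]; have l : ((1 - x) * t2) ^+ 2 <= t2 ^+ 2 by rewrite exprMn; have := sqr_ge0 t2; nra.
split=> /=; first by lra.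
by move=> j; have [j0 _] := ord_le j; rewrite /tau; have := sqr_ge0 ((1 - x) * t2); nra.
Qed.

Lemma QQ_qs : QQ qs.
Proof.
have r0 := ler0n R r; split; first by rewrite /= /Rq2; nra.
by move=> j; have [j0 _] := ord_le j; rewrite /tau /=; nra.
Qed.

(** Over a point of the ring [j], the parameter q may also enter the disc around q_j; these are the
    positions allowed on the way to its centre. *)
Definition QQj (j : 'I_r) := [set q : X2 | q.1 ^+ 2 + q.2 ^+ 2 <= Rq2 /\ forall i, i != j -> 1 <= tau i q.1 q.2].

Lemma QQj_conn j : conn R (QQj j) qs (center j, 0).
Proof.
have Qm : QQ (center j, - 2).
  have tj : tau j (center j) (- 2) = 4 by rewrite /tau; ring.
  split; first by apply: (@disc_Rq2 j); rewrite /= tj.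
  by move=> i; rewrite /tau /=; have := sqr_ge0 (center j - center i); lra.
have c1 : conn R (QQj j) qs (center j, - 2).
  by apply: conn_sub (conn_sym (QQ_conn Qm)) => q [q1 q2]; split.
apply: conn_trans c1 _.
have e0 : (center j, - 2) = (center j, (- 2 + 0 * 2 : R)) by rewrite mul0r addr0.
have e1 : (center j, 0) = (center j, (- 2 + 1 * 2 : R)) by rewrite mul1r addNr.
rewrite [X in conn _ _ X _]e0 [X in conn _ _ _ X]e1.
apply: (@conn_curve R _ _ (fun x => (center j, - 2 + x * 2))); first by cont.
move=> x /andP[x0 x1]; have tj : tau j (center j) (- 2 + x * 2) <= 4 by rewrite /tau; nra.
split; first exact: disc_Rq2 tj.
by move=> i ij; have := tau_far ij tj; rewrite /=; lra.
Qed.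

Lemma WW_ring j p q : ring N S j p -> QQj j q -> WW (p, q).
Proof.
rewrite /ring /= -bb_ge0 => b0 [q1 q2]; split=> //=.
have [h|h] := leP (tau j q.1 q.2) 4; first exact: ff_ring h b0.
rewrite ff_out; first exact: ltW (bb_aa b0).
by move=> i; have [->|ij] := eqVneq i j; [lra|exact: q2].
Qed.

Lemma WW_PP p q : PP N p -> QQ q -> WW (p, q).
Proof. by move=> Pp [q1 q2]; split=> //=; rewrite ff_out. Qed.

Lemma p0_ring j : ring N S j p0.
Proof. by rewrite -(branch0 N S j 1); apply: branch_ring; rewrite expr1n. Qed.

(** [p0] lies on every ring and outside the holes, hence in every slice. Loops of q can thus be
    contracted over it. *)
Lemma WW_p0 q : q.1 ^+ 2 + q.2 ^+ 2 <= Rq2 -> WW (p0, q).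
Proof.
move=> hq; have [[j h]|h] := pselect (exists j, tau j q.1 q.2 <= 4).
  by split=> //=; apply: (@ff_ring _ _ _ S j) => //; have := p0_ring j; rewrite /ring /= -bb_ge0.
apply: WW_PP; first exact/BoxP/p0_Box.
by split=> // j; rewrite leNgt; apply/negP => hj; apply: h; exists j; lra.
Qed.

Lemma PP_conn p : PP N p -> conn R (PP N) p p0.
Proof.
move=> Pp; apply: (@conn_trans _ _ _ _ (kappa N p)).
  have e0 : p = (p.1 + 0 * ((kappa N p).1 - p.1), p.2 + 0 * ((kappa N p).2 - p.2)).
    by rewrite !mul0r !addr0; case: (p).
  have e1 : kappa N p = (p.1 + 1 * ((kappa N p).1 - p.1), p.2 + 1 * ((kappa N p).2 - p.2)).
    by rewrite !mul1r (addrC p.1) (addrC p.2) !subrK; case: (kappa N p).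
  rewrite [X in conn _ _ X _]e0 [X in conn _ _ _ X]e1.
  apply: (@conn_curve R _ _ (fun x => (p.1 + x * ((kappa N p).1 - p.1), p.2 + x * ((kappa N p).2 - p.2)))).
    by cont.
  by move=> x x01; case: p Pp {e0 e1} => u v Pp; exact: kappa_segment.
have B := kappa_Box Pp; set b := 0 <= (kappa N p).2.
have s1 : side N b (kappa N p) by split=> //; rewrite /b; case: leP => // /ltW.
have s2 : side N b p0 by split; [exact: p0_Box|rewrite /=; case: (b)].
by apply: conn_sub (side_conn s1 s2) => q [/BoxP].
Qed.

Definition VV (j : 'I_r) := [set w : X4 | WW w /\ tau j w.2.1 w.2.2 < 3 / 4].

Definition to_center (j : 'I_r) (x : R) (w : X4) : X4 :=
  (w.1, (center j + cl x * (w.2.1 - center j), cl x * w.2.2)).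

Definition core (j : 'I_r) := [set w : X4 | w.2 = (center j, 0) /\ 0 <= om N S j w.1.1 w.1.2].

(** In the coordinates u and v - phi u the function psi is homogeneous of degree two, so scaling
    contracts the disc psi <= 3. *)
Definition core_contract (j : 'I_r) (x : R) (w : X4) : X4 :=
  ((cl x * w.1.1, phi j (cl x * w.1.1) + cl x * (w.1.2 - phi j w.1.1)), w.2).

Definition core_pt (j : 'I_r) : X4 := ((0, phi j 0), (center j, 0)).

Lemma tau_center j : tau j (center j) 0 = 0. Proof. by rewrite /tau; ring. Qed.

Lemma to_center_VV j x w : VV j w -> VV j (to_center j x w).
Proof.
case: w => [[u v] [s t]] [[/= f0 hq] ht]; rewrite /to_center /=.
have /andP[x0 x1] := cl_itv x.
have tE : tau j (center j + cl x * (s - center j)) (cl x * t) = cl x ^+ 2 * tau j s t by rewrite /tau; ring.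
have t0 := tau_ge0 j s t; have tle : tau j (center j + cl x * (s - center j)) (cl x * t) <= tau j s t.
  by rewrite tE ler_piMl// exprn_ile1.
split; last by rewrite /=; lra.
split=> /=; last by apply: (@disc_Rq2 j); lra.
by apply: (ff_push_in (ltW ht) tle).
Qed.

Lemma to_center_core j w : VV j w -> core j (to_center j 0 w).
Proof.
move=> h; have [[f0 _] _] := to_center_VV 0 h; split.
  by rewrite /to_center /= cl0 !mul0r addr0.
move: f0; rewrite /to_center /= cl0 !mul0r addr0 (@ff_center _ _ _ S j)//.
by rewrite tau_center; lra.
Qed.

Lemma coreW j : core j `<=` VV j.
Proof.
move=> [[u v] q] [/= -> o0]; have tj := tau_center j; split; last by rewrite /= tj; lra.
split=> /=; last by apply: (@disc_Rq2 j); rewrite tj; lra.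
by rewrite (@ff_center _ _ _ S j)// tj; lra.
Qed.

Lemma core_contract_core j x w : core j w -> core j (core_contract j x w).
Proof.
case: w => [[u v] q] [/= -> o0]; split=> //=; have /andP[x0 x1] := cl_itv x; move: o0; rewrite /om => o0.
have -> : psi j (cl x * u) (phi j (cl x * u) + cl x * (v - phi j u)) = cl x ^+ 2 * psi j u v.
  by rewrite /psi; ring.
have p0' : 0 <= psi j u v by rewrite addr_ge0 ?sqr_ge0.
by nra.
Qed.

Lemma to_center_cont j (T : topologicalType) (f : T -> R) (g : T -> X4) :
  continuous f -> continuous g -> continuous (fun t => to_center j (f t) (g t)).
Proof. by move=> cf cg; have ccl := @cl_cont R; rewrite /to_center; cont. Qed.

Lemma core_contract_cont j (T : topologicalType) (f : T -> R) (g : T -> X4) :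
  continuous f -> continuous g -> continuous (fun t => core_contract j (f t) (g t)).
Proof.
by move=> cf cg; have ccl := @cl_cont R; have cp := @phi_cont R N r S j; rewrite /core_contract; cont.
Qed.

Lemma to_center1 j w : to_center j 1 w = w.
Proof. by case: w => [p [s t]]; rewrite /to_center cl1 !mul1r addrC subrK. Qed.

Lemma core_contract1 j w : core_contract j 1 w = w.
Proof. by case: w => [[u v] q]; rewrite /core_contract cl1 !mul1r addrC subrK. Qed.

Lemma core_contract0 j w : core j w -> core_contract j 0 w = core_pt j.
Proof. by case: w => [[u v] q] [/= -> _]; rewrite /core_contract cl0 !mul0r addr0. Qed.

Lemma VV_conn j w : VV j w -> conn R (VV j) w (core_pt j).
Proof.
move=> h; apply: (@conn_trans _ _ _ _ (to_center j 0 w)).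
  rewrite -{1}(to_center1 j w); apply: conn_sym.
  apply: (@conn_curve R _ _ (fun x => to_center j x w)); last by move=> x _; exact: to_center_VV.
  by apply: to_center_cont; cont.
have hc := to_center_core h; rewrite -(core_contract0 hc) -{1}(core_contract1 j (to_center j 0 w)).
apply: conn_sym; apply: (@conn_curve R _ _ (fun x => core_contract j x (to_center j 0 w))).
  by apply: core_contract_cont; cont.
by move=> x _; apply/coreW/core_contract_core.
Qed.

Definition bump (j : 'I_r) (q : X2) : R := Num.max 0 (1 - tau j q.1 q.2).

(** A radial motion away from the nearest centre. At most one [bump] is nonzero, so the sums are
    continuous expressions for a choice of centre. *)
Definition push (x : R) (w : X4) : X4 :=
  (w.1, (w.2.1 + (1 - cl x) * \sum_j bump j w.2 * (w.2.1 - center j),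
         w.2.2 + (1 - cl x) * \sum_j bump j w.2 * w.2.2)).

Lemma push_cont (T : topologicalType) (f : T -> R) (g : T -> X4) :
  continuous f -> continuous g -> continuous (fun t => push (f t) (g t)).
Proof.
move=> cf cg; have ccl := @cl_cont R.
have c0 : continuous (fun t => 1 - cl (f t)) by apply: contD; [exact: contcst|apply: contN; exact: contcomp].
have cb j : continuous (fun t => bump j (g t).2) by rewrite /bump /tau; cont.
have c1 : continuous (fun t => \sum_j bump j (g t).2 * ((g t).2.1 - center j)).
  by apply: cont_sum => j; apply: contM; [exact: cb|cont].
have c2 : continuous (fun t => \sum_j bump j (g t).2 * (g t).2.2).
  by apply: cont_sum => j; apply: contM; [exact: cb|cont].
have d1 := contM c0 c1; have d2 := contM c0 c2; clear cb.
by rewrite /push; cont.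
Qed.

Definition outer := [set w : X4 | WW w /\ forall j, 2^-1 < tau j w.2.1 w.2.2].

Lemma push_far x w : (forall j, 1 <= tau j w.2.1 w.2.2) -> push x w = w.
Proof.
move=> h; have b0 j : bump j w.2 = 0 by rewrite /bump max_l//; have := h j; lra.
rewrite /push !big1 ?mulr0 ?addr0 => [|j _|j _]; rewrite ?b0 ?mul0r//.
by case: w {h b0} => p [s t].
Qed.

Lemma push_near j x w : tau j w.2.1 w.2.2 < 1 ->
  let l := (1 - cl x) * (1 - tau j w.2.1 w.2.2) in
  push x w = (w.1, (w.2.1 + l * (w.2.1 - center j), w.2.2 + l * w.2.2)) /\
  tau j (push x w).2.1 (push x w).2.2 = (1 + l) ^+ 2 * tau j w.2.1 w.2.2.
Proof.
move=> h l; have bj : bump j w.2 = 1 - tau j w.2.1 w.2.2 by rewrite /bump max_r//; lra.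
have b0 i : i != j -> bump i w.2 = 0.
  move=> ij; rewrite /bump max_l//; have : tau j w.2.1 w.2.2 <= 4 by lra.
  by move=> /(tau_far ij); lra.
have e : push x w = (w.1, (w.2.1 + (1 - cl x) * (1 - tau j w.2.1 w.2.2) * (w.2.1 - center j),
    w.2.2 + (1 - cl x) * (1 - tau j w.2.1 w.2.2) * w.2.2)).
  rewrite /push (bigD1 j)//= [X in (_, (_ + _ * X, _))](_ : _ = bump j w.2 * (w.2.1 - center j)); last first.
    by rewrite big1 ?addr0// => i ij; rewrite b0// mul0r.
  rewrite (bigD1 j)//= [X in (_, (_, _ + _ * X))](_ : _ = bump j w.2 * w.2.2); last first.
    by rewrite big1 ?addr0// => i ij; rewrite b0// mul0r.
  by rewrite bj !mulrA.
split=> //; rewrite e.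
by rewrite /l; move: ((1 - cl x) * (1 - _)) => a; rewrite /tau /=; ring.
Qed.

Lemma push_WW x w : outer w -> WW (push x w) /\ PP N (push x w).1.
Proof.
move=> [[f0 hq] ho]; have [[j h]|far] := pselect (exists j, tau j w.2.1 w.2.2 < 1); last first.
  have far' j : 1 <= tau j w.2.1 w.2.2 by rewrite leNgt; apply/negP => h; apply: far; exists j.
  by rewrite push_far//; split=> //; move: f0; rewrite ff_out.
have [e te] := push_near x h; have /andP[x0 x1] := cl_itv x; have hj := ho j.
have t0 := tau_ge0 j w.2.1 w.2.2.
set l := (1 - cl x) * _ in e te; have l0 : 0 <= l by apply: mulr_ge0; lra.
have l1 : l <= 2^-1 by rewrite /l; nra.
have tle : tau j w.2.1 w.2.2 <= tau j (push x w).2.1 (push x w).2.2 by rewrite te; nra.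
have t4 : tau j (push x w).2.1 (push x w).2.2 <= 4 by rewrite te; nra.
split; last by rewrite e; apply: (ff_aa _ f0); apply/andP; split; [exact: ltW hj|lra].
split; last exact: disc_Rq2 t4.
by rewrite {1 2}e; apply: (ff_push_out (ltW hj) tle t4 f0).
Qed.

(** For T = tau between 1/2 and 1, the pushed point has tau = (2 - T)^2 T, which is at least 1
    because T (3 - T) >= 5/4. *)
Lemma push_QQ w : outer w -> PP N (push 0 w).1 /\ QQ (push 0 w).2.
Proof.
move=> ho; have [[_ hq] hP] := push_WW 0 ho; split=> //; split=> //.
have [_ ho'] := ho; have [[j h]|far] := pselect (exists j, tau j w.2.1 w.2.2 < 1); last first.
  have far' j : 1 <= tau j w.2.1 w.2.2 by rewrite leNgt; apply/negP => h; apply: far; exists j.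
  by rewrite push_far.
have [e te] := push_near 0 h; have hj := ho' j; move: te; rewrite cl0 subr0 mul1r => te.
set T := tau j w.2.1 w.2.2 in h hj te.
have t1 : 1 <= tau j (push 0 w).2.1 (push 0 w).2.2.
  rewrite te; have -> : (1 + (1 - T)) ^+ 2 * T = 1 + (1 - T) * (T * (3 - T) - 1) by ring.
  by rewrite lerDl; apply: mulr_ge0; nra.
have t4 : tau j (push 0 w).2.1 (push 0 w).2.2 <= 4 by rewrite te; nra.
by move=> i; have [->|ij] := eqVneq i j => //; have := tau_far ij t4; lra.
Qed.

Lemma push1 w : push 1 w = w.
Proof. by case: w => p [s t]; rewrite /push cl1 subrr !mul0r !addr0. Qed.

Lemma WW_conn w : WW w -> conn R WW w (p0, qs).
Proof.
move=> Ww; have p0q q : q.1 ^+ 2 + q.2 ^+ 2 <= Rq2 -> conn R WW (p0, q) (p0, qs).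
  move=> hq; have [hs _] := QQ_qs.
  have e0 : (p0, q) = (p0, (q.1 + 0 * (qs.1 - q.1), q.2 + 0 * (qs.2 - q.2))).
    by rewrite !mul0r !addr0; case: (q).
  have e1 : (p0, qs) = (p0, (q.1 + 1 * (qs.1 - q.1), q.2 + 1 * (qs.2 - q.2))).
    by rewrite !mul1r (addrC q.1) (addrC q.2) !subrK.
  rewrite [X in conn _ _ X _]e0 [X in conn _ _ _ X]e1.
  apply: (@conn_curve R _ _ (fun x => (p0, (q.1 + x * (qs.1 - q.1), q.2 + x * (qs.2 - q.2))))); first by cont.
  move=> x /andP[x0 x1]; apply: WW_p0; rewrite /= in hs hq *.
  have -> : (q.1 + x * (-3 - q.1)) ^+ 2 + (q.2 + x * (0 - q.2)) ^+ 2 = (1 - x) * (q.1 ^+ 2 + q.2 ^+ 2) +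
    x * ((-3) ^+ 2 + 0 ^+ 2) - x * (1 - x) * ((q.1 + 3) ^+ 2 + q.2 ^+ 2) by ring.
  have : 0 <= x * (1 - x) * ((q.1 + 3) ^+ 2 + q.2 ^+ 2).
    by apply: mulr_ge0; [apply: mulr_ge0; lra|apply: addr_ge0; exact: sqr_ge0].
  by nra.
have [[j h]|far] := pselect (exists j, tau j w.2.1 w.2.2 < 3 / 4).
  have c : core j (p0, (center j, 0)).
    by split=> //; have := p0_ring j; rewrite /ring /om /= => /andP[]; lra.
  have h1 : conn R (VV j) w (p0, (center j, 0)).
    by apply: conn_trans (VV_conn (conj Ww h)) (conn_sym (VV_conn (coreW c))).
  apply: conn_trans (conn_sub _ h1) _; first by move=> ? [].
  by apply: p0q; have [[]] := coreW c.
have ho : outer w.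
  split=> // j; have : 3 / 4 <= tau j w.2.1 w.2.2 by rewrite leNgt; apply/negP => hj; apply: far; exists j.
  by lra.
have [hP hQ] := push_QQ ho.
apply: (@conn_trans _ _ _ _ (push 0 w)).
  rewrite -{1}(push1 w); apply: conn_sym.
  apply: (@conn_curve R _ _ (fun x => push x w)); first by apply: push_cont; cont.
  by move=> x _; have [] := push_WW x ho.
have [hq _] := hQ; apply: conn_trans (p0q _ hq).
move: (push 0 w) hP hQ {hq} => [p q] /= hP hQ.
apply: (@conn_map _ _ _ (PP N) WW (fun p => (p, q))) (PP_conn hP); first by cont.
by move=> p' hp'; exact: WW_PP.
Qed.

End SpacePart.

Section SidePaths.
Variables (R : realType) (N : nat).
Local Notation X2 := (R * R)%type.

(** The paths for the gap 0 are chosen inside its strip, which makes the corresponding gap loop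
    trivial. *)
Lemma side_paths : exists lam ups : nat -> R -> X2, [/\
  forall n, (n <= N)%N -> [/\ path_in (@side R N false) (lam n), lam n 0 = p0 R N & lam n 1 = wpt R n],
  forall n, (n <= N)%N -> [/\ path_in (@side R N true) (ups n), ups n 0 = wpt R n & ups n 1 = p0 R N],
  path_in (@strip R N 0) (lam 0%N) & path_in (@strip R N 0) (ups 0%N)].
Proof.
have s0 : @strip R N 0 (p0 R N) by split; [exact: p0_Box|exact: p0_window].
have sw n b : (n <= N)%N -> @side R N b (wpt R n).
  move=> nN; have [B _] : strip N n (wpt R n) by apply: mid_Box => //; apply/andP; lra.
  by split=> //; rewrite /=; case: (b).
have sp b : @side R N b (p0 R N) by split; [exact: p0_Box|rewrite /=; case: (b)].
have H (b : bool) : exists mu : nat -> R -> X2,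
    (forall n, (n <= N)%N -> [/\ path_in (@side R N b) (mu n), mu n 0 = wpt R n & mu n 1 = p0 R N]) /\
    path_in (@strip R N 0) (mu 0%N).
  have h n : exists g : R -> X2, (n <= N)%N -> [/\ path_in (@side R N b) g, g 0 = wpt R n & g 1 = p0 R N] /\
      (n = 0%N -> path_in (@strip R N 0) g).
    have [nN|nN] := pselect (n <= N)%N; last by exists (fun _ => p0 R N) => /nN.
    case: n nN => [|n] nN.
      have [|g [[cg Ag] g0 g1]] := strip_conn (b := b) s0; first by rewrite /=; case: (b).
      by exists g => _; split; [split=> //|move=> _]; split=> // t; have [] := Ag t.
    by have [g hg] := side_conn (sw n.+1 b nN) (sp b); exists g => _.
  have [mu hmu] := choice h; exists mu; split; first by move=> n nN; have [] := hmu n nN.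
  by have [_ h0] := hmu 0%N (leq0n _); exact: h0.
have [mu [hmu smu]] := H false; have [ups [hups sups]] := H true.
exists (fun n => rev (mu n)), ups; split=> //; last exact: path_rev.
by move=> n nN; have [pm m0 m1] := hmu n nN; rewrite rev0 rev1; split=> //; exact: path_rev.
Qed.

End SidePaths.

Section SpaceFunctor.
Variables (R : realType) (N r : nat) (S : 'I_r -> pred nat).
Local Notation X2 := (R * R)%type.
Local Notation X4 := ((R * R) * (R * R))%type.
Local Notation phi := (@phi R N r S).
Local Notation psi := (@psi R N r S).
Local Notation ff := (@ff R N r S).
Local Notation tau := (@tau R r).
Local Notation Rq2 := (@Rq2 R r).
Local Notation p0 := (@p0 R N).
Local Notation WW := (@WW R N r S).
Local Notation VV := (@VV R N r S).
Local Notation outer := (@outer R N r S).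
Local Notation PP := (@PP R N).
Local Notation QQ := (@QQ R r).
Local Notation qs := (@qs R).
Local Notation center j := (4 * (nat_of_ord j)%:R : R).
Variables (K : groupType) (kap : (R -> X4) -> R -> R -> K).
Hypothesis fk : functor WW kap.

Lemma VV_flat j : flat kap (VV j).
Proof.
apply: (flat_homotopy fk (F := @to_center R r j) (B := core N S j)).
- by move=> T f g cf cg _; exact: to_center_cont.
- by move=> s w /(to_center_VV s)[].
- by move=> w _; exact: to_center1.
- by move=> w; exact: to_center_core.
apply: (flat_homotopy fk (F := core_contract N S j) (B := [set core_pt R N S j])).
- by move=> T f g cf cg _; exact: core_contract_cont.
- by move=> s w /(core_contract_core s)/coreW[].
- by move=> w _; exact: core_contract1.
- by move=> w; exact: core_contract0.
apply: (flat_point fk); suff : VV j (core_pt R N S j) by case.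
apply: coreW; split=> //; rewrite /om /psi /= mul0r subrr expr0n /=; lra.
Qed.

(** For 1/2 < tau < 3/4 the profile is [bb], so the overlap is the product of a ring and an annulus.
    It is therefore connected, as [gen_push] requires. *)
Lemma VVo_ring j w : (VV j `&` outer) w -> ring N S j w.1 /\ 2^-1 < tau j w.2.1 w.2.2 < 3 / 4.
Proof.
move=> [[[f0 _] h1] [_ /(_ j) h2]]; split; last by apply/andP.
move: f0; rewrite (@ff_zone2 _ _ _ _ j); last exact: ltW.
by rewrite step0 ?mul0r ?addr0 ?bb_ge0//; lra.
Qed.

Lemma ring_VVo j (p q : X2) : ring N S j p -> 2^-1 < tau j q.1 q.2 < 3 / 4 -> (VV j `&` outer) (p, q).
Proof.
move=> hp /andP[q1 q2]; have w : WW (p, q).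
  split; last by apply: (@disc_Rq2 _ _ j); lra.
  by apply: (@ff_ring _ _ _ _ j); [lra|rewrite bb_ge0].
split; first by split.
split=> // i; have [->|ij] := eqVneq i j => //.
by have := @tau_far R r i j q.1 q.2 ij; rewrite /=; lra.
Qed.

Lemma ring_conn j (p p' : X2) : ring N S j p -> ring N S j p' -> conn R (ring N S j) p p'.
Proof.
have L2 := @LL_ge2 R N; case: p p' => [u v] [u' v'] h h'.
pose F (z : X2) : X2 := (z.1 * LL R N, phi j (z.1 * LL R N) + z.2).
have FE x y : F (x / LL R N, y - phi j x) = (x, y).
  by rewrite /F /= mulfVK ?(addrC (phi j x)) ?subrK//; lra.
rewrite -(FE u v) -(FE u' v').
apply: (@conn_map _ _ _ [set z : X2 | 1 <= z.1 ^+ 2 + z.2 ^+ 2 <= 2]).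
- by have cp := @phi_cont R N r S j; rewrite /F; cont.
- move=> [x y] /= hz; rewrite /ring /= /psi mulfK; last by lra.
  by rewrite (addrC (phi j _)) addrK.
- by apply: plane_conn.
Qed.

Lemma annulus_conn j (q q' : X2) : 2^-1 < tau j q.1 q.2 < 3 / 4 -> 2^-1 < tau j q'.1 q'.2 < 3 / 4 ->
  conn R [set q : X2 | 2^-1 < tau j q.1 q.2 < 3 / 4] q q'.
Proof.
case: q q' => [s t] [s' t'] /andP[/= h1 h2] /andP[h3 h4].
pose F (z : X2) : X2 := (center j + z.1, z.2).
have FE x y : F (x - center j, y) = (x, y) by rewrite /F /= addrC subrK.
rewrite -(FE s t) -(FE s' t'); set c1 := Num.min (tau j s t) (tau j s' t').
set c2 := Num.max (tau j s t) (tau j s' t').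
have c1h : 2^-1 < c1 by rewrite lt_min h1 h3.
have c2h : c2 < 3 / 4 by rewrite gt_max h2 h4.
apply: (@conn_map _ _ _ [set z : X2 | c1 <= z.1 ^+ 2 + z.2 ^+ 2 <= c2]).
- by rewrite /F; cont.
- move=> [x y] /= /andP[z1 z2].
  have -> : tau j (center j + x) y = x ^+ 2 + y ^+ 2 by rewrite /tau; ring.
  by apply/andP; split; [exact: lt_le_trans c1h z1|exact: le_lt_trans z2 c2h].
- by apply: plane_conn; rewrite ?ge_min ?le_max ?lexx ?orbT//; lra.
Qed.

Lemma VVo_conn j w w' : (VV j `&` outer) w -> (VV j `&` outer) w' -> conn R (VV j `&` outer) w w'.
Proof.
move=> /VVo_ring; case: w => p q [/= hp hq] /VVo_ring; case: w' => p' q' [/= hp' hq'].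
apply: (@conn_trans _ _ _ _ (p', q)).
  apply: (@conn_map _ _ _ (ring N S j) _ (fun z => (z, q))) (ring_conn hp hp'); first by cont.
  by move=> z hz; exact: ring_VVo.
apply: (@conn_map _ _ _ _ _ (fun z => (p', z))) (annulus_conn hq hq'); first by cont.
by move=> z hz; exact: ring_VVo.
Qed.

Local Notation kP := (fun g : R -> X2 => kap (fun t => (g t, qs))).

Lemma kP_functor : functor PP kP.
Proof.
apply: (@functor_pull _ _ _ PP WW K kap (fun p => (p, qs))) => //; first by cont.
by move=> p Pp; apply: WW_PP => //; exact: QQ_qs.
Qed.

Variables (lam ups : nat -> R -> X2).
Hypothesis lamP : forall n, (n <= N)%N ->
  [/\ path_in (@side R N false) (lam n), lam n 0 = p0 & lam n 1 = wpt R n].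
Hypothesis upsP : forall n, (n <= N)%N ->
  [/\ path_in (@side R N true) (ups n), ups n 0 = wpt R n & ups n 1 = p0].
Hypothesis lam0 : path_in (@strip R N 0) (lam 0%N).
Hypothesis ups0 : path_in (@strip R N 0) (ups 0%N).

Lemma XX0 : XX kP lam ups 0 = 1%g.
Proof.
have [d hd] := flat_strip kP_functor (leq0n N).
rewrite /XX (hd _ lam0) (hd _ ups0); have [_ -> ->] := lamP (leq0n N); have [_ -> ->] := upsP (leq0n N).
by rewrite -mulgA mulVKg mulVg.
Qed.

(** Over q_j the slice is a disc that contains both branches and the region between them. They are
    brought there from [qs] along positions of q over which the ring persists, with the ends moving
    along the same paths for both branches. *)
Lemma WW_relation j : Dn (XX kP lam ups) (S j) N = 1%g.
Proof.
have [dl [[cdl Adl] dl0 dl1]] := @QQj_conn R r j.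
apply: (ring_relation kP_functor lamP upsP); rewrite -dl0.
pose qj : X2 := (center j, 0).
have sq s : s ^+ 2 = 1 -> kap (fun t => (branch N S j s t, qj)) 0 1 =
  ((kap (fun x => (p0, dl x)) 0 1)^-1 * kap (fun t => (branch N S j s t, dl 0%R)) 0 1 *
    kap (fun x => (p1 R N, dl x)) 0 1)%g.
  move=> s2; have cb : continuous (branch N S j s) by apply: branch_cont; cont.
  have cH : continuous (fun z : R * R => (branch N S j s z.2, dl z.1)) by cont.
  have := kap_square fk 0 1 cH (fun z => WW_ring (@branch_ring R N r S j s z.2 s2) (Adl z.1)).
  by rewrite /= branch0 branch1 dl1.
have tj : tau j (center j) 0 = 0 by exact: tau_center.
have Wc p : psi j p.1 p.2 <= 3 -> WW (p, qj).
  move=> h; split; last by apply: (@disc_Rq2 _ _ j); rewrite /= tj; lra.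
  by rewrite /= (@ff_center _ _ _ _ j) /om ?tj; lra.
have cc s : psi j (branch N S j (2 * cl s.1 - 1) s.2).1 (branch N S j (2 * cl s.1 - 1) s.2).2 <= 3.
  rewrite psi_branch wT_sq; have /andP[s0 s1] := cl_itv s.1; have h0 := sqr_ge0 (uT N s.2 / LL R N).
  have h1 : (2 * cl s.1 - 1) ^+ 2 <= 1 by nra.
  have h2 := uT_sq N s.2; nra.
(* The parameter of [branch] runs from - 1 to 1, sweeping from the lower to the upper branch with
   fixed ends. *)
have cH : continuous (fun z : R * R => (branch N S j (2 * cl z.1 - 1) z.2, qj)).
  have ccl := @cl_cont R; apply: contpair; last exact: contcst.
  by apply: branch_cont; cont.
have := kap_square fk 0 1 cH (fun z => Wc _ (cc z)).
rewrite /= cl0 cl1.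
have -> : 2 * 0 - 1 = - 1 :> R by ring.
have -> : 2 * 1 - 1 = 1 :> R by ring.
have Wb e : e ^+ 2 = 1 -> forall t, WW (branch N S j e t, qj).
  move=> e2 t; apply: Wc; have := @branch_ring R N r S j e t e2; rewrite /ring /= => /andP[_]; lra.
have one : (1 : R) ^+ 2 = 1 by rewrite expr1n.
have mone : (- 1 : R) ^+ 2 = 1 by rewrite sqrrN expr1n.
have -> : (fun s : R => (branch N S j (2 * cl s - 1) 0, qj)) = fun=> (p0, qj).
  by apply/funext => s; rewrite branch0.
have -> : (fun s : R => (branch N S j (2 * cl s - 1) 1, qj)) = fun=> (p1 R N, qj).
  by apply/funext => s; rewrite branch1.
rewrite !(kap_cst fk); first last.
- by rewrite -(branch0 N S j 1); exact: Wb.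
- by rewrite -(branch1 N S j 1); exact: Wb.
rewrite invg1 mul1g mulg1 !sq// => e.
by apply: (mulgI (kap (fun x => (p0, dl x)) 0 1)^-1%g); apply: (mulIg (kap (fun x => (p1 R N, dl x)) 0 1)).
Qed.

Variable G : K -> Prop.
Hypothesis G1 : G 1%g.
Hypothesis GM : forall k l, G k -> G l -> G (k * l)%g.
Hypothesis GX : forall n, (n <= N)%N -> G (XX kP lam ups n) /\ G (XX kP lam ups n)^-1%g.

Lemma PP_gen : exists e, gen_in G kP PP e.
Proof.
have [e he] := PP_local kP_functor lamP upsP; exists e => g pg.
apply: (path_local (Q := fun x y k _ => G (e x * k * (e y)^-1)%g) kP_functor kP_functor) pg.
  move=> x y z k l k' l' h1 h2; have := GM h1 h2.
  by rewrite !mulgA mulgVK.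
move=> p Pp; have [U nU hU] := he p Pp; exists U => // g' pg'; rewrite (hU _ pg').
have nN (u : R) : (nn N u <= N)%N.
  rewrite /nn -[X in (_ <= X)%N](@card_ord N) -sum1_card; apply: leq_sum => i _; exact: leq_b1.
have [h1 h2] := GX (nN (g' 0%R).1); have [h3 h4] := GX (nN (g' 1%R).1).
by rewrite /cP /lev; case: (up _); case: (up _); rewrite /= ?invg1 ?mul1g ?mulg1.
Qed.

(** On the product of [PP] and [QQ] the loops of q die over [p0], so gap loops suffice. The part
    outside the cores deforms into this product, and the cores are flat pieces with connected
    overlaps. *)
Lemma WW_gen : exists e, gen_in G kap WW e.
Proof.
have [eP hP] := PP_gen; have [hs hsq] := QQ_qs R r.
have flat0 : flat kap [set w : X4 | w.1 = p0 /\ QQ w.2].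
  apply: (flat_homotopy fk (B := [set (p0, qs)])
    (F := fun x w => (w.1, (qs.1 + cl x * (w.2.1 - qs.1), qs.2 + cl x * (w.2.2 - qs.2))))).
  - by move=> T f g cf cg _; have ccl := @cl_cont R; cont.
  - move=> x [p q] /= [-> [hq _]]; apply: WW_p0; have /andP[x0 x1] := cl_itv x.
    rewrite /= in hs hq *; move: (cl x) x0 x1 => y y0 y1.
    have -> : (-3 + y * (q.1 - - 3)) ^+ 2 + (0 + y * (q.2 - 0)) ^+ 2 = y * (q.1 ^+ 2 + q.2 ^+ 2) +
      (1 - y) * ((-3) ^+ 2 + 0 ^+ 2) - y * (1 - y) * ((q.1 + 3) ^+ 2 + q.2 ^+ 2) by ring.
    have : 0 <= y * (1 - y) * ((q.1 + 3) ^+ 2 + q.2 ^+ 2).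
      by apply: mulr_ge0; [apply: mulr_ge0; lra|apply: addr_ge0; exact: sqr_ge0].
    by nra.
  - by move=> [p [s t]] _; rewrite cl1 !mul1r !(addrC _ (_ - _)) !subrK.
  - by move=> [p [s t]] /= [-> _]; rewrite cl0 !mul0r !addr0.
  by apply: (flat_point fk); apply: WW_p0.
have [e1 h1] := gen_product fk (fun p q => @WW_PP R N r S p q)
  (@PP_conn R N) (@QQ_conn R r) flat0 hP.
have [e2 h2] : exists e, gen_in G kap outer e.
  apply: (gen_homotopy fk (F := @push R r) _ _ _ _ _ h1).
  - by move=> w [].
  - by move=> T f g cf cg _; exact: push_cont.
  - by move=> s w /(push_WW s)[].
  - by move=> w _; exact: push1.
  - by move=> w /push_QQ.
apply: (gen_push GM fk (V := VV) _ _ VV_flat _ VVo_conn _ h2).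
- by move=> w [].
- move=> w Ww; have ct j : continuous (fun w : X4 => tau j w.2.1 w.2.2) by rewrite /tau; cont.
  have [[j h]|far] := pselect (exists j, tau j w.2.1 w.2.2 < 3 / 4).
    exists [set w | tau j w.2.1 w.2.2 < 3 / 4]; last by right; exists j => ? [].
    by apply: (ct j w [set y | y < 3 / 4]); exact: near_ltr.
  exists [set w | forall j, 2^-1 < tau j w.2.1 w.2.2]; last by left=> ? [].
  apply: (@filter_forall _ _ _ (nbhs w) (nbhs_filter w)) => j.
  apply: (ct j w [set y | 2^-1 < y]); apply: near_gt.
  have : 3 / 4 <= tau j w.2.1 w.2.2 by rewrite leNgt; apply/negP => hj; apply: far; exists j.
  by lra.
- move=> j; exists (p0, (center j + 4 / 5, 0)); apply: ring_VVo; first exact: p0_ring.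
  have e : tau j (center j + 4 / 5) 0 = 16 / 25 by rewrite /tau; field.
  by rewrite /= e; apply/andP; lra.
- move=> i j w [_ h1'] [_ h2']; apply/eqP; apply/negPn/negP => ij.
  by have := @tau_far R r i j w.2.1 w.2.2 ij; lra.
Qed.

End SpaceFunctor.

(** * From the level set to the space of pairs *)

Lemma bsq_act (R : realType) k (I : pred 'I_k) (m a : 'rV[R]_k) : bunit I a -> bsq I (act I m a) = bsq I m.
Proof.
move=> ua; transitivity (bsq I (bnorm I m *: a)).
  by apply: eq_bigr => j Ij; rewrite !mxE Ij.
by rewrite bsqZ (_ : bsq I a = 1)// mulr1 sqr_sqrtr// bsq_ge0.
Qed.

Lemma bsq_act_off (R : realType) k (I I' : pred 'I_k) (m a : 'rV[R]_k) :
  (forall j, I' j -> ~~ I j) -> bsq I' (act I m a) = bsq I' m.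
Proof. by move=> h; apply: eq_bigr => j /h /negbTE Ij; rewrite !mxE Ij. Qed.

Section Suspension.
Variables (R : realType) (n : nat).
Hypothesis n3 : (3 <= n)%N.
Local Notation K := (2 * n + 2)%N.
Local Notation E := 'rV[R]_K.
Variables (N r : nat) (S : 'I_r -> pred nat).
Local Notation X4 := ((R * R) * (R * R))%type.
Local Notation ff := (@ff R N r S).
Local Notation Rq2 := (@Rq2 R r).
Local Notation WW := (@WW R N r S).
Local Notation ix := (@ix n).
Local Notation Phi := (@Phi R n N r S).

Let ixs c : (c < 8)%N -> ix c = c :> nat.
Proof. by move=> h; apply: ixE; lia. Qed.

Definition ZZ := [set x : E | Phi x = 0].
Definition Iy (j : 'I_K) := (6 <= j)%N.
Definition Iz (j : 'I_K) := (4 <= j < 6)%N.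
Definition base (x : E) : X4 := ((x 0 (ix 0), x 0 (ix 1)), (x 0 (ix 2), x 0 (ix 3))).
(** A section of [base]: z and y point along coordinates 4 and 6, with the lengths imposed by the
    two equations. *)
Definition section (w : X4) : E := \row_(j < K)
  nth 0 [:: w.1.1; w.1.2; w.2.1; w.2.2; Num.sqrt (Rq2 - (w.2.1 ^+ 2 + w.2.2 ^+ 2)); 0;
            Num.sqrt (ff w.1.1 w.1.2 w.2.1 w.2.2)] j.

Lemma bsq_z (x : E) : bsq Iz x = x 0 (ix 4) ^+ 2 + x 0 (ix 5) ^+ 2.
Proof.
rewrite /bsq (bigD1 (ix 4)) /=; last by rewrite /Iz ixs.
rewrite (bigD1 (ix 5)) /=; last by rewrite /Iz -val_eqE /= !ixs.
rewrite big1 ?addr0// => j /andP[/andP[h1 h2] h3].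
by move: h1 h2 h3; rewrite /Iz -!val_eqE /= !ixs//; lia.
Qed.

Lemma ZZP (x : E) : ZZ x <-> bsq Iy x = ff (base x).1.1 (base x).1.2 (base x).2.1 (base x).2.2 /\
  (base x).2.1 ^+ 2 + (base x).2.2 ^+ 2 + bsq Iz x = Rq2.
Proof.
rewrite /ZZ /= Phi_eq0 /FF /SS (_ : ysq x = bsq Iy x)// bsq_z /=; split=> -[h1 h2]; split; lra.
Qed.

Lemma base_WW x : ZZ x -> WW (base x).
Proof.
move=> /ZZP[h1 h2]; split; first by rewrite -h1 bsq_ge0.
by have := bsq_ge0 Iz x; lra.
Qed.

Lemma section_entry w c : (c < 8)%N -> section w 0 (ix c) =
  nth 0 [:: w.1.1; w.1.2; w.2.1; w.2.2; Num.sqrt (Rq2 - (w.2.1 ^+ 2 + w.2.2 ^+ 2)); 0;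
            Num.sqrt (ff w.1.1 w.1.2 w.2.1 w.2.2)] c.
Proof. by move=> c8; rewrite mxE ixs. Qed.

Lemma sectionK w : base (section w) = w.
Proof. by rewrite /base !section_entry//; case: w => [[u v] [s t]]. Qed.

Lemma section_z w : WW w -> bsq Iz (section w) = Rq2 - (w.2.1 ^+ 2 + w.2.2 ^+ 2).
Proof. by move=> [_ h]; rewrite bsq_z !section_entry//= expr0n addr0 sqr_sqrtr; lra. Qed.

Lemma section_y w : WW w -> bsq Iy (section w) = ff w.1.1 w.1.2 w.2.1 w.2.2.
Proof.
move=> [h _]; rewrite /bsq (bigD1 (ix 6)) /=; last by rewrite /Iy ixs.
rewrite section_entry//= sqr_sqrtr// big1 ?addr0// => j /andP[j6].
rewrite -val_eqE /= ixs// => j6'; rewrite mxE nth_default ?expr0n//=.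
by move: j6 j6'; rewrite /Iy; lia.
Qed.

Lemma section_ZZ w : WW w -> ZZ (section w).
Proof. by move=> Ww; apply/ZZP; rewrite sectionK section_y// section_z//; split=> //; ring. Qed.

Lemma ff_cont (T : topologicalType) (g : T -> X4) : continuous g ->
  continuous (fun t => ff (g t).1.1 (g t).1.2 (g t).2.1 (g t).2.2).
Proof.
move=> cg; have sc := @step_cont R; have hc := @hh_cont R N; have cp j := @phi_cont R N r S j.
have cphi j : continuous (fun t => phi N S j (g t).1.1) by apply: (contcomp (cp j)); cont.
have cpsi j : continuous (fun t => psi N S j (g t).1.1 (g t).1.2).
  have := cphi j; rewrite /psi; move: (fun t => phi N S j (g t).1.1) => f cf.
  apply: contD; first by clear cphi; cont.
  apply: contX; apply: contD; [by clear cphi; cont|].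
  by apply: contN; exact: cphi.
clear cphi cp.
have caa : continuous (fun t => aa N (g t).1.1 (g t).1.2).
  by clear cpsi; rewrite /aa; cont.
have cbb j : continuous (fun t => bb N S j (g t).1.1 (g t).1.2).
  by rewrite /bb; apply: contM; apply: contD; try exact: contcst; try apply: contN; exact: cpsi.
have com j : continuous (fun t => om N S j (g t).1.1 (g t).1.2).
  by rewrite /om; apply: contD; [exact: contcst|apply: contN; exact: cpsi].
have cst a b j : continuous (fun t => step (a - b * tau j (g t).2.1 (g t).2.2)).
  by clear cpsi caa cbb com; rewrite /tau; cont.
rewrite /ff; apply: contD; first exact: caa.
apply: cont_sum => j; apply: contD; apply: contM; try exact: cst.
  by apply: contD; [exact: cbb|apply: contN; exact: caa].
by apply: contD; [exact: com|apply: contN; exact: cbb].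
Qed.

Lemma section_cont : continuous section.
Proof.
have cid : continuous (fun w : X4 => w) by exact: contid.
have cff := ff_cont cid.
apply: cont_row => j; rewrite (_ : (fun t => _) = fun w : X4 =>
  nth 0 [:: w.1.1; w.1.2; w.2.1; w.2.2; Num.sqrt (Rq2 - (w.2.1 ^+ 2 + w.2.2 ^+ 2)); 0;
            Num.sqrt (ff w.1.1 w.1.2 w.2.1 w.2.2)] j); last by apply/funext => w; rewrite mxE.
case: j => j _ /=.
do 4 (case: j => [|j] /=; first by clear cff; cont).
case: j => [|j] /=; first by apply: contsqrt; clear cff; cont.
case: j => [|j] /=; first exact: contcst.
case: j => [|j] /=; first by apply: contsqrt; exact: cff.
by rewrite nth_nil; exact: contcst.
Qed.

Lemma base_cont : continuous base.
Proof. by rewrite /base; do ! apply: contpair; apply: cont_entry; exact: contid. Qed.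

Lemma act_base (I : pred (ordinal K)) (m a : E) : (forall c, (c < 4)%N -> ~~ I (ix c)) -> base (act I m a) = base m.
Proof. by move=> h; rewrite /base !mxE !(negbTE (h _ _)). Qed.

Lemma y_off c : (c < 4)%N -> ~~ Iy (ix c). Proof. by move=> h; rewrite /Iy ixs; lia. Qed.
Lemma z_off c : (c < 4)%N -> ~~ Iz (ix c). Proof. by move=> h; rewrite /Iz ixs; lia. Qed.
Lemma yz_off j : Iy j -> ~~ Iz j. Proof. by rewrite /Iy /Iz; lia. Qed.
Lemma zy_off j : Iz j -> ~~ Iy j. Proof. by rewrite /Iy /Iz; lia. Qed.

Lemma y_act (m a : E) : ZZ m -> bunit Iy a -> ZZ (act Iy m a).
Proof.
move=> /ZZP[h1 h2] ua; apply/ZZP; rewrite act_base; last exact: y_off.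
by rewrite bsq_act// bsq_act_off//; exact: zy_off.
Qed.

Lemma z_act (m a : E) : ZZ m -> bunit Iz a -> ZZ (act Iz m a).
Proof.
move=> /ZZP[h1 h2] ua; apply/ZZP; rewrite act_base; last exact: z_off.
by rewrite bsq_act// bsq_act_off//; exact: yz_off.
Qed.

Let Iy6 : Iy (ix 6). Proof. by rewrite /Iy ixs. Qed.
Let Iy7 : Iy (ix 7). Proof. by rewrite /Iy ixs. Qed.
Let Iz4 : Iz (ix 4). Proof. by rewrite /Iz ixs. Qed.
Let Iz5 : Iz (ix 5). Proof. by rewrite /Iz ixs. Qed.
Let y67 : ix 6 != ix 7. Proof. by rewrite -val_eqE /= !ixs. Qed.
Let z45 : ix 4 != ix 5. Proof. by rewrite -val_eqE /= !ixs. Qed.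

Lemma collapse_ZZ x : ZZ x -> collapse Iz (ix 4) (collapse Iy (ix 6) x) = section (base x).
Proof.
move=> Zx; have uy := bunit_delta R Iy6; have [h1 h2] := (ZZP x).1 Zx.
have nz : bnorm Iz (collapse Iy (ix 6) x) = Num.sqrt (Rq2 - ((base x).2.1 ^+ 2 + (base x).2.2 ^+ 2)).
  by rewrite /bnorm bsq_act_off; [congr Num.sqrt; lra|exact: zy_off].
have ny : bnorm Iy x = Num.sqrt (ff (base x).1.1 (base x).1.2 (base x).2.1 (base x).2.2).
  by rewrite /bnorm h1.
apply/rowP => j; rewrite [LHS]mxE nz [collapse Iy _ _ _ _]mxE ny /section.
rewrite [RHS]mxE; move: (Num.sqrt _) (Num.sqrt _) => a b.
have e c : (c < 8)%N -> (j == ix c) = (j == c :> nat) by move=> c8; rewrite -val_eqE /= ixs.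
have x0 c : (c < 8)%N -> j = c :> nat -> x 0 j = x 0 (ix c).
  by move=> c8 jc; congr (x 0 _); apply: val_inj; rewrite /= ixs.
rewrite !mxE !eqxx !e//= /Iz /Iy /base /=.
case jE: (nat_of_ord j) => [|[|[|[|[|[|[|l]]]]]]] //=; rewrite ?mulr1 ?mulr0//; try exact: x0.
by rewrite nth_nil.
Qed.

Lemma act_conn (I : pred (ordinal K)) i1 i2 (m : E) : I i1 -> I i2 -> i1 != i2 -> (forall m a, ZZ m -> bunit I a -> ZZ (act I m a)) ->
  ZZ m -> conn R ZZ m (collapse I i1 m).
Proof.
move=> I1 I2 i12 h Zm; rewrite /collapse -{1}(@act_bdir R K I i1 m).
apply: (@conn_map _ _ _ (@bunit R K I) _ (act I m)).
- by apply: act_cont; [exact: contcst|exact: contid].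
- by move=> a; exact: h.
- by apply: (sphere_conn I1 I2 i12); [exact: bdir_unit|exact: bunit_delta].
Qed.

Definition z0 : E := section (p0 R N, qs R).

Lemma ZZ_conn x : ZZ x -> conn R ZZ x z0.
Proof.
move=> Zx; apply: conn_trans (act_conn Iy6 Iy7 y67 y_act Zx) _.
have Zy : ZZ (collapse Iy (ix 6) x) by apply: y_act => //; exact: bunit_delta.
apply: conn_trans (act_conn Iz4 Iz5 z45 z_act Zy) _.
rewrite collapse_ZZ//; apply: (@conn_map _ _ _ WW _ section).
- exact: section_cont.
- exact: section_ZZ.
- by apply: WW_conn; exact: base_WW.
Qed.

Lemma ZZ_reach (I : pred (ordinal K)) m m' : ZZ m' -> bsq I m' = 0 -> ZZ m -> exists2 m', bnorm I m' = 0 & conn R ZZ m m'.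
Proof.
move=> Zm' e Zm; exists m'; first by rewrite /bnorm e sqrtr0.
by apply: conn_trans (ZZ_conn Zm) (conn_sym (ZZ_conn Zm')).
Qed.

(** A point of the outer circle, where [aa] vanishes and the sphere of y collapses. Moving to such a
    point kills the loops of the fibre, which for n = 3 is a circle. *)
Lemma y_zero : exists2 m, ZZ m & bsq Iy m = 0.
Proof.
pose w : X4 := ((- Num.sqrt (rho2 R N), 0), qs R).
have r0 : 0 <= rho2 R N by rewrite /rho2 mulr_ge0// sqr_ge0.
have f0 : ff w.1.1 w.1.2 w.2.1 w.2.2 = 0.
  rewrite ff_out; first by rewrite /aa /w /= sqrrN sqr_sqrtr// expr0n subrr subr0 mulr0.
  by move=> j; have [_] := QQ_qs R r; exact.
have Ww : WW w by split; [rewrite f0|have [] := QQ_qs R r].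
by exists (section w); [exact: section_ZZ|rewrite section_y].
Qed.

(** The z-circle collapses where |q| attains the radius of the sphere S = 0, and [p0] is available
    over such q. *)
Lemma z_zero : exists2 m, ZZ m & bsq Iz m = 0.
Proof.
pose w : X4 := (p0 R N, (4 * r%:R + 10, 0)).
have e : w.2.1 ^+ 2 + w.2.2 ^+ 2 = Rq2 by rewrite /= /Rq2; ring.
have Ww : WW w by apply: WW_p0; rewrite e.
by exists (section w); [exact: section_ZZ|rewrite section_z// e subrr].
Qed.

Variables (G : groupType) (kap : (R -> E) -> R -> R -> G) (fk : functor ZZ kap).

Lemma ZZ_flat m : ZZ m -> exists2 U, nbhs m U & flat kap (ZZ `&` U).
Proof.
move=> Zm; pose M := level_manifold (@Phi_smooth R n N r S) (@Phi_regular R n n3 N r S).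
have [a _ am] := @atlas_cover _ _ M (exist _ m (mem_set Zm)).
by have := chart_flat fk am.
Qed.

(** Collapsing the direction of y, then that of z, gives [section \o base]; the cochains of the two
    collapses multiply. *)
Theorem ZZ_kap : exists e : E -> G, forall g, path_in ZZ g ->
  kap g 0 1 = (e (g 0%R) * kap (section \o (base \o g)) 0 1 * (e (g 1%R))^-1)%g.
Proof.
have [my Zmy my0] := y_zero; have [mz Zmz mz0] := z_zero.
have [ey hy] := collapse_kap Iy6 Iy7 y67 fk y_act (fun m Zm _ => ZZ_flat Zm) (fun m Zm => ZZ_reach Zmy my0 Zm).
have [ez hz] := collapse_kap Iz4 Iz5 z45 fk z_act (fun m Zm _ => ZZ_flat Zm) (fun m Zm => ZZ_reach Zmz mz0 Zm).
exists (fun x => ey x * ez (collapse Iy (ix 6) x))%g => g pg; rewrite (hy g pg).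
have pc : path_in ZZ (collapse Iy (ix 6) \o g).
  case: pg => cg Zg; split=> [|t]; last by apply: y_act => //; exact: bunit_delta.
  by apply: contcomp => //; apply: act_cont; [exact: contid|exact: contcst].
rewrite (hz _ pc) /=.
have -> : collapse Iz (ix 4) \o (collapse Iy (ix 6) \o g) = section \o (base \o g).
  by apply/funext => t; apply: collapse_ZZ; case: pg.
by rewrite invgM !mulgA.
Qed.

End Suspension.

(** * Holonomy in the presented group *)

Section SpaceCocycle.
Variables (R : realType) (N r : nat) (S : 'I_r -> pred nat).
Local Notation X2 := (R * R)%type.
Local Notation X4 := ((R * R) * (R * R))%type.
Local Notation tau := (@tau R r).
Local Notation p0 := (@p0 R N).
Local Notation WW := (@WW R N r S).
Local Notation PP := (@PP R N).
Local Notation qs := (@qs R).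
Variables (K : groupType) (X : nat -> K).
Hypothesis X0 : X 0 = 1%g.
Hypothesis DX : forall j, Dn X (S j) N = 1%g.

Lemma PP_potential (p : X2) : PP p -> exists g : X2 -> K, exists2 U, nbhs p U &
  forall x y, U x -> U y -> cP N X x y = ((g x)^-1 * g y)%g.
Proof.
case: p => u v /aa_ge0[/= h _].
have c2 : continuous (fun q : X2 => q.2) by cont.
have [v0|vn|v0] := ltgtP v 0.
- exists (fun=> 1%g), [set q | q.2 < 0].
    by apply: (c2 (u, v) [set y | y < 0]); exact: near_ltr.
  by move=> x y /= hx hy; rewrite /cP /up !leNgt hx hy invg1 mul1g.
- exists (fun=> 1%g), [set q | 0 < q.2].
    by apply: (c2 (u, v) [set y | 0 < y]); exact: near_gt.
  by move=> x y /= hx hy; rewrite /cP /up !ltW// invg1 mul1g.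
have [n wn] := window_ex (zero_gap h v0).
have c1 : continuous (fun q : X2 => q.1) by cont.
exists (fun q => (lev N X q)^-1)%g, [set q | window N n q.1].
  by apply: (c1 (u, v) [set y | window N n y]); exact: window_near.
by move=> x y /window_nn hx /window_nn hy; rewrite invgK (cP_window _ hx hy).
Qed.

(* The value of the cocycle on a path that leaves the core j at a point over p is dring j p. *)
Definition cW (x y : X4) : K :=
  match [pick j | tau j x.2.1 x.2.2 < 3 / 5], [pick j | tau j y.2.1 y.2.2 < 3 / 5] with
  | Some _, Some _ => 1%g
  | None, None => cP N X x.1 y.1
  | Some j, None => dring N S X j y.1
  | None, Some j => (dring N S X j x.1)^-1%g
  end.

Lemma tau_cont j : continuous (fun w : X4 => tau j w.2.1 w.2.2).
Proof. by rewrite /tau; cont. Qed.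

Lemma pick_core j (w : X4) : tau j w.2.1 w.2.2 < 3 / 5 -> [pick i | tau i w.2.1 w.2.2 < 3 / 5] = Some j.
Proof.
move=> h; case: pickP => [i hi|/(_ j)]; last by rewrite h.
congr Some; apply/eqP; apply/negPn/negP => ij.
by have := @tau_far R r i j w.2.1 w.2.2 ij; lra.
Qed.

Lemma pick_out (w : X4) : (forall j, 3 / 5 <= tau j w.2.1 w.2.2) -> [pick i | tau i w.2.1 w.2.2 < 3 / 5] = None.
Proof. by move=> h; case: pickP => // j; have := h j; rewrite leNgt => /negbTE ->. Qed.

(** The threshold 3/5 lies in the zone 1/2 < tau < 3/4, where the slice is the ring. There [dring],
    cut off to 1 in the core, is a potential, and its existence is exactly what the triviality of
    the rings provides. *)
Lemma cW_local : local_cocycle WW cW.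
Proof.
move=> w Ww; have cfst : continuous (fun w : X4 => w.1) by cont.
have [[j h]|h1] := pselect (exists j, tau j w.2.1 w.2.2 < 3 / 5).
  exists [set w | tau j w.2.1 w.2.2 < 3 / 5].
    by apply: (@tau_cont j w [set y | y < 3 / 5]); exact: near_ltr.
  by exists (fun=> 1%g) => x y [_ hx] [_ hy]; rewrite /cW !(pick_core (j := j))// invg1 mul1g.
have ge j : 3 / 5 <= tau j w.2.1 w.2.2 by rewrite leNgt; apply/negP => h; apply: h1; exists j.
have [[j h]|h2] := pselect (exists j, tau j w.2.1 w.2.2 < 3 / 4); last first.
  have ge' j : 3 / 4 <= tau j w.2.1 w.2.2 by rewrite leNgt; apply/negP => h; apply: h2; exists j.
  have ho : outer N S w by split=> // j; have := ge' j; lra.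
  have [_] := push_WW 1 ho; rewrite push1 => Pw; have [g [U nU hU]] := PP_potential Pw.
  exists ([set w | U w.1] `&` [set w | forall j, 3 / 5 < tau j w.2.1 w.2.2]).
    apply: filterI; first exact: (cfst w U nU).
    apply: (@filter_forall _ _ _ (nbhs w) (nbhs_filter w)) => j.
    by apply: (@tau_cont j w [set y | 3 / 5 < y]); apply: near_gt; have := ge' j; lra.
  exists (fun w => g w.1) => x y [_ [Ux hx]] [_ [Uy hy]].
  by rewrite /cW !pick_out ?hU// => j; exact: ltW.
have rw x : WW x -> 2^-1 < tau j x.2.1 x.2.2 < 3 / 4 -> ring N S j x.1.
  move=> [f0 _] /andP[x1 x2]; move: f0; rewrite (@ff_zone2 _ _ _ _ j); last exact: ltW.
  by rewrite step0 ?mul0r ?addr0 ?bb_ge0//; lra.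
have hj : 2^-1 < tau j w.2.1 w.2.2 < 3 / 4 by have := ge j; move=> ?; apply/andP; lra.
have [U nU hU] := ring_local (DX j) (rw w Ww hj).
exists ([set w | U w.1] `&` [set w | 2^-1 < tau j w.2.1 w.2.2 < 3 / 4]).
  apply: filterI; first exact: (cfst w U nU).
  have /andP[j1 j2] := hj.
  have n1 : \forall x \near w, 2^-1 < tau j x.2.1 x.2.2.
    by apply: (@tau_cont j w [set y | 2^-1 < y]); exact: near_gt.
  have n2 : \forall x \near w, tau j x.2.1 x.2.2 < 3 / 4.
    by apply: (@tau_cont j w [set y | y < 3 / 4]); exact: near_ltr.
  by apply: filterS (filterI n1 n2) => x [x1 x2]; apply/andP.
have out (x : X4) : 2^-1 < tau j x.2.1 x.2.2 < 3 / 4 -> ~~ (tau j x.2.1 x.2.2 < 3 / 5) ->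
    [pick i | tau i x.2.1 x.2.2 < 3 / 5] = None.
  rewrite -leNgt => /andP[x1 x2] x3; apply: pick_out => i; have [->//|ij] := eqVneq i j.
  by have := @tau_far R r i j x.2.1 x.2.2 ij; lra.
exists (fun x => if tau j x.2.1 x.2.2 < 3 / 5 then 1%g else dring N S X j x.1).
move=> x y [Wx [Ux hx]] [Wy [Uy hy]]; rewrite /cW.
case: ifP => [x3|/negbT x3]; [rewrite (pick_core x3)|rewrite (out x hx x3)];
  (case: ifP => [y3|/negbT y3]; [rewrite (pick_core y3)|rewrite (out y hy y3)]).
- by rewrite invg1 mul1g.
- by rewrite invg1 mul1g.
- by rewrite mulg1.
- by apply: hU; split=> //; exact: rw.
Qed.

Lemma cW_qs (p p' : X2) : cW (p, qs) (p', qs) = cP N X p p'.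
Proof.
have [_ h] := QQ_qs R r.
by rewrite /cW !pick_out//= => j; have := h j; rewrite /=; lra.
Qed.

Local Notation hl := (hol cW).

Lemma hol_ups (g : R -> X2) : path_in (@side R N true) g -> hl (fun t => (g t, qs)) 0 1 = 1%g.
Proof.
move=> [cg sg]; have hs := QQ_qs R r.
rewrite (@hol_flat R X4 WW K cW [set w | side N true w.1 /\ w.2 = qs] (fun=> 1%g)).
- by rewrite invg1 mul1g.
- by move=> [p q] [/= [Bp _] ->]; apply: WW_PP => //; exact: BoxP.
- move=> w _; exists setT; first exact: filterT.
  move=> [p q] [p' q'] [[/= [_ hp] ->] _] [[/= [_ hp'] ->] _].
  by rewrite cW_qs /cP /up hp hp' invg1 mul1g.
- by split=> [|t]; [apply: contpair; [exact: cg|exact: contcst]|split; [exact: sg|]].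
Qed.

Lemma hol_lam (g : R -> X2) n : (n <= N)%N -> path_in (@side R N false) g -> g 0 = p0 -> g 1 = wpt R n ->
  hl (fun t => (g t, qs)) 0 1 = X n.
Proof.
move=> nN [cg sg] g0 g1; have hs := QQ_qs R r.
(* In the lower half [up] holds only for points with v = 0; reaching the axis in the gap [n]
   contributes [X n]. *)
pose q (w : X4) := if up w.1 then X (nn N w.1.1) else 1%g.
rewrite (@hol_flat R X4 WW K cW [set w | side N false w.1 /\ w.2 = qs] q).
- rewrite /q g0 g1 /up /= lexx (window_nn (@window_mid R N n nN)) (window_nn (p0_window R N)) X0.
  by rewrite invg1 mul1g.
- by move=> [p q'] [/= [Bp _] ->]; apply: WW_PP => //; exact: BoxP.
- move=> [[u v] q0] [/= [[/= _ _ Bp] vle] q0E].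
  have c2 : continuous (fun q : X4 => q.1.2) by cont.
  have c1 : continuous (fun q : X4 => q.1.1) by cont.
  have [v0|v0] := ltP v 0.
    exists [set w : X4 | w.1.2 < 0].
      by apply: (c2 ((u, v), q0) [set y | y < 0]); exact: near_ltr.
    move=> [p q1] [p' q1'] [[/= _ ->] hp] [[/= _ ->] hp'].
    by rewrite cW_qs /cP /q /up /= !leNgt hp hp' invg1 mul1g.
  have {}v0 : v = 0 by apply/le_anti; rewrite vle v0.
  have [m wm] := window_ex (zero_gap Bp v0).
  exists [set w : X4 | window N m w.1.1].
    by apply: (c1 ((u, v), q0) [set y | window N m y]); exact: window_near.
  move=> [p q1] [p' q1'] [[/= _ ->] /window_nn hp] [[/= _ ->] /window_nn hp'].
  rewrite /= in hp hp'; rewrite cW_qs /cP /q /lev /= hp hp'.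
  by case: (up p); case: (up p'); rewrite /= ?invg1 ?mul1g ?mulg1 ?mulVg.
- by split=> [|t]; [apply: contpair; [exact: cg|exact: contcst]|split; [exact: sg|]].
Qed.

End SpaceCocycle.

(** * Words *)

Section Words.
Variables (k : nat) (rels : seq (word k)).
Local Notation L := ('I_k * bool)%type.
Local Notation inv l := (l.1, ~~ l.2).
Local Notation Pg := (presented_group rels).
Local Open Scope quotient_scope.
Local Notation pcls := (\pi_(presented_group rels)).

(* The words x x^-1 make the gaps labelled by x and x^-1 inverse to each other. *)
Definition relators : seq (word k) := rels ++ [seq [:: l; inv l] | l <- enum {: L}].

Definition block (w : word k) : seq (option L) := flatten [seq [:: None; Some l] | l <- w].

(** The leading [None] belongs to the gap 0, to the left of all the holes. Each letter is preceded
    by an unlabelled gap, so the hole between them carries the letter alone. *)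
Definition labels : seq (option L) := None :: flatten [seq block w | w <- relators].

Definition last_label : nat := (size labels).-1.

Definition label i : option L := nth None labels i.

Lemma label_None w m : nth None (block w) m.*2 = None.
Proof. by elim: w m => [|l w ih] [|m] //=; rewrite ?nth_nil// ih. Qed.

Lemma label_Some l0 w m : (m < size w)%N -> nth None (block w) m.*2.+1 = Some (nth l0 w m).
Proof. by elim: w m => [|l w ih] [|m] //= h; rewrite ih. Qed.

Lemma size_block w : size (block w) = (size w).*2.
Proof. by elim: w => //= l w ->. Qed.

Lemma labels_split w : w \in relators -> exists s1 s2, labels = None :: s1 ++ block w ++ s2.
Proof.
rewrite /labels; elim: relators => //= v s ih; rewrite in_cons => /orP[/eqP->|/ih[s1 [s2 [e]]]].
  by exists [::], (flatten [seq block u | u <- s]).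
by exists (block v ++ s1), s2; rewrite e !seq.catA.
Qed.

Lemma mem_inv_relator (l : L) : [:: l; inv l] \in relators.
Proof. by rewrite mem_cat; apply/orP; right; apply/mapP; exists l => //; rewrite mem_enum. Qed.

Lemma mem_labels (l : L) : Some l \in labels.
Proof.
have [s1 [s2 ->]] := labels_split (mem_inv_relator l).
by rewrite in_cons !mem_cat /= !in_cons eqxx !orbT.
Qed.

Definition ev (K : groupType) (y : L -> K) (w : word k) : K := foldr (fun l a => y l * a)%g 1%g w.

Lemma ev_cat (K : groupType) (y : L -> K) u v : ev y (u ++ v) = (ev y u * ev y v)%g.
Proof. by elim: u => [|l u ih] /=; rewrite ?mul1g// ih mulgA. Qed.

Lemma Dn_eq (K : groupType) (X X' : nat -> K) (A A' : pred nat) n :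
  (forall i, (i <= n)%N -> X i = X' i /\ A i = A' i) -> Dn X A n = Dn X' A' n.
Proof.
elim: n => //= n ih h; rewrite ih; last by move=> i ni; apply: h; exact: leqW.
by have [-> ->] := h n.+1 (leqnn _); have [-> _] := h n (leqnSn _).
Qed.

Lemma Dn_stop (K : groupType) (X : nat -> K) (A : pred nat) n m : (n <= m)%N ->
  (forall i, (n < i <= m)%N -> ~~ A i) -> Dn X A m = Dn X A n.
Proof.
move=> nm h; rewrite -(subnKC nm); have : (n + (m - n) <= m)%N by lia.
elim: (m - n)%N => [|d ih] hd; first by rewrite addn0.
rewrite addnS /= ih; last by lia.
by rewrite (negbTE (h _ _)) ?mulg1//; lia.
Qed.

(** The product over consecutive holes telescopes. *)
Lemma Dn_itv (K : groupType) (X : nat -> K) a b n : (a <= b <= n)%N ->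
  Dn X (fun i => a < i <= b)%N n = ((X a)^-1 * X b)%g.
Proof.
move=> /andP[ab bn]; rewrite (Dn_stop X bn) => [|i]; last by lia.
suff h d : (a + d <= b)%N -> Dn X (fun i => a < i <= b)%N (a + d)%N = ((X a)^-1 * X (a + d)%N)%g.
  by rewrite -(subnKC ab) in h *; exact: h.
elim: d => [|d ih] h.
  by rewrite addn0 mulVg (@Dn_stop _ _ _ 0)// => i; lia.
by rewrite addnS /= ih; [rewrite ifT ?mulgA ?mulgK//|]; lia.
Qed.

(** A block preceded by [a] entries after the initial [None] has its unlabelled gaps at a + 1, a +
    3, ... and its letters at a + 2, a + 4, ...; hole [i] lies just before gap [i]. *)
Definition letters (a m : nat) (i : nat) : bool := (a < i <= a + m.*2)%N && ~~ odd (i - a).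

(** Each selected hole contributes the inverse of an unlabelled gap times a letter. The set [A] does
    not depend on the group, so the same ring gives the relator in the presented group and in
    pi_1. *)
Lemma Dn_block w : w \in relators ->
  exists A : pred nat, forall (K : groupType) (x : option L -> K) (X : nat -> K), x None = 1%g ->
  (forall i, (i <= last_label)%N -> X i = x (label i)) -> Dn X A last_label = ev (x \o Some) w.
Proof.
move=> /labels_split[s1 [s2 e]]; exists (letters (size s1) (size w)) => K x X x0 hX.
have Ne : last_label = (size s1 + ((size w).*2 + size s2))%N by rewrite /last_label e /= !size_cat size_block.
set a := size s1 in Ne *; rewrite (@Dn_stop _ _ _ (a + (size w).*2)%N) => [||i]; [|lia|by rewrite /letters; lia].
suff h m : (m <= size w)%N -> Dn X (letters a (size w)) (a + m.*2) = ev (x \o Some) (take m w).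
  by rewrite h// take_size.
elim: m => [|m ih] mw.
  by rewrite addn0 take0 (@Dn_stop _ _ _ 0)// => i; rewrite /letters; lia.
case wE : w mw ih => [//|l0 w'] mw ih; rewrite -wE in mw ih *.
rewrite (take_nth l0)// -cats1 ev_cat -ih; last exact: ltnW.
have l1 : letters a (size w) (a + m.*2).+1 = false by rewrite /letters; lia.
have l2 : letters a (size w) (a + m.*2).+2 = true.
  by rewrite /letters; move: mw; set sw := size w; move: sw => sw; lia.
rewrite doubleS !addnS /= l1 l2.
rewrite mulg1 !hX; try lia.
have -> : label (a + m.*2).+1 = None.
  by rewrite /label e /= nth_cat -/a ltnNge leq_addr /= addKn nth_cat size_block ltn_double mw label_None.
have -> : label (a + m.*2).+2 = Some (nth l0 w m).
  by rewrite /label e -addnS /= nth_cat -/a ltnNge leq_addr /= addKn nth_cat size_block ltn_Sdouble mw (label_Some l0).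
by rewrite x0 invg1 mul1g mulg1.
Qed.

Lemma pres_catl w u v : presentation_eq rels u v -> presentation_eq rels (w ++ u) (w ++ v).
Proof.
elim=> {u v} [u|u v _|u v t _ + _|u v i b|u v r rr].
- exact: pres_refl.
- exact: pres_sym.
- exact: pres_trans.
- by rewrite !(seq.catA w); exact: pres_cancel.
- by rewrite !(seq.catA w); exact: pres_relator.
Qed.

Lemma pres_catr w u v : presentation_eq rels u v -> presentation_eq rels (u ++ w) (v ++ w).
Proof.
elim=> {u v} [u|u v _|u v t _ + _|u v i b|u v r rr].
- exact: pres_refl.
- exact: pres_sym.
- exact: pres_trans.
- by rewrite -!(seq.catA _ _ w); exact: pres_cancel.
- by rewrite -!(seq.catA _ _ w); exact: pres_relator.
Qed.

Lemma clsP u v : pcls u = pcls v <-> presentation_eq rels u v.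
Proof. by split=> [/eqmodP/asboolP|h] //; apply/eqmodP/asboolP. Qed.

Lemma pcls_cat u v : pcls (u ++ v) = (pcls u * pcls v)%g.
Proof.
apply/clsP; apply: pres_sym; apply: (@pres_trans _ _ _ (u ++ repr (pcls v))).
  by apply/pres_catr/clsP; rewrite reprK.
by apply/pres_catl/clsP; rewrite reprK.
Qed.

Definition gen_cls (l : L) : Pg := pcls [:: l].

Lemma ev_cls w : ev gen_cls w = pcls w.
Proof. by elim: w => //= l w ->; rewrite -[in RHS]cat1s pcls_cat. Qed.

Lemma relator_cls w : w \in relators -> pcls w = 1%g.
Proof.
rewrite mem_cat => /orP[wr|/mapP[[i b] _ ->]]; apply/clsP.
  by have := pres_relator [::] [::] wr; rewrite cats0.
exact: (pres_cancel rels [::] [::]).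
Qed.

Definition target_label (o : option L) : Pg := if o is Some l then gen_cls l else 1%g.

Definition target i : Pg := target_label (label i).

Section Evaluation.
Variables (K : groupType) (Y : nat -> K).
Hypothesis Y0 : Y 0 = 1%g.
Hypothesis YA : forall A : pred nat, Dn target A last_label = 1%g -> Dn Y A last_label = 1%g.

Lemma label_eq a b : (a <= last_label)%N -> (b <= last_label)%N -> label a = label b -> Y a = Y b.
Proof.
wlog ab : a b / (a <= b)%N => [W|] ha hb e.
  by case/orP: (leq_total a b) => h; [exact: W|apply/esym/W].
have h : (a <= b <= last_label)%N by rewrite ab.
have := YA (A := fun i => a < i <= b)%N; rewrite !Dn_itv// /target e mulVg => /(_ erefl) h'.
by rewrite -[LHS]mulg1 -h' mulVKg.
Qed.

(** The first occurrence stands for all gaps with the same label, which agree by [label_eq]. *)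
Definition value (o : option L) : K := Y (index o labels).

Lemma value_label i : (i <= last_label)%N -> Y i = value (label i).
Proof.
move=> hi; have sl : (i < size labels)%N by rewrite /last_label /labels /= in hi *.
apply: label_eq => //; first by rewrite -ltnS; apply: leq_trans (_ : _ < size labels)%N _; rewrite ?index_mem ?mem_nth.
by rewrite /label nth_index// mem_nth.
Qed.

Lemma value_None : value None = 1%g. Proof. by rewrite /value /labels /= Y0. Qed.

Lemma value_relator w : w \in relators -> ev (value \o Some) w = 1%g.
Proof.
move=> wr; have [A hA] := Dn_block wr; rewrite -(hA _ _ Y value_None value_label).
apply: YA; rewrite (hA _ target_label)//.
rewrite -(relator_cls wr) -ev_cls.
by elim: (w) => //= l v ->.
Qed.

Lemma value_inv (l : L) : value (Some (inv l)) = (value (Some l))^-1%g.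
Proof.
have := value_relator (mem_inv_relator l); rewrite /= mulg1 => h.
by rewrite -[RHS]mulg1 -h mulKg.
Qed.

Lemma ev_pres u v : presentation_eq rels u v -> ev (value \o Some) u = ev (value \o Some) v.
Proof.
elim=> {u v} [u|u v _ ->|u v t _ -> _ ->|u v i b|u v w wr] //; rewrite !ev_cat.
  by rewrite (value_relator (mem_inv_relator (i, b))) mul1g.
by rewrite (value_relator (w := w)) ?mul1g// /relators mem_cat wr.
Qed.

Definition values (g : K) := exists w, g = ev (value \o Some) w.

Lemma values1 : values 1%g. Proof. by exists [::]. Qed.

Lemma valuesM g h : values g -> values h -> values (g * h)%g.
Proof. by move=> [u ->] [v ->]; exists (u ++ v); rewrite ev_cat. Qed.

Lemma values_label i : (i <= last_label)%N -> values (Y i) /\ values (Y i)^-1%g.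
Proof.
move=> /value_label ->; case: (label i) => [l|]; last by rewrite value_None invg1; split; exact: values1.
by split; [exists [:: l]|exists [:: inv l]; rewrite /= value_inv]; rewrite /= mulg1.
Qed.

End Evaluation.
End Words.

(** * The realization theorem *)

Lemma path_connected_level (R : realType) k (A : set 'rV[R]_k) (z : 'rV[R]_k) :
  A z -> (forall x, A x -> conn R A x z) -> connected [set: set_type A].
Proof.
move=> Az Ac; pose z1 : set_type A := exist _ z (mem_set Az).
have h (x : set_type A) : exists g : R -> set_type A, [/\ continuous g, g 0 = x & g 1 = z1].
  have [g [[cg Ag] g0 g1]] := Ac _ (set_valP x).
  exists (fun t => exist _ (g t) (mem_set (Ag t))); split; try exact: val_inj.
  by move=> t; apply: to_subset_continuousP; exact: cg.
have [g hg] := choice h.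
rewrite (_ : [set: set_type A] = \bigcup_(x in [set: set_type A]) (range (g x))); last first.
  apply/esym/seteqP; split=> // x _; exists x => //; exists 0 => //; by have [] := hg x.
apply: bigcup_connected; first by exists z1 => x _; exists 1 => //; have [] := hg x.
move=> x _; apply: connected_continuous_connected.
  by apply/connected_intervalP => ? ? ? ? ? ?.
by apply: continuous_subspaceT; have [] := hg x.
Qed.

Lemma iso_trans (G H K : groupType) : isomorphic_groups G H -> isomorphic_groups H K -> isomorphic_groups G K.
Proof.
move=> [f bf] [g bg].
have fM : {morph g \o f : x y / (x * y)%g >-> (x * y)%g} by move=> x y; rewrite /= !gmulfM.
exists (HB.pack (g \o f) (isMultiplicative.Build G K (g \o f) fM) : {multiplicative G -> K}).
exact: bij_comp.
Qed.

Lemma conjg_eq1 (G : groupType) (a b : G) : (a * b * a^-1)%g = 1%g -> b = 1%g.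
Proof. by move=> h; apply: (mulgI a); apply: (mulIg a^-1%g); rewrite h mulg1 mulgV. Qed.

Section Realization.
Variables (R : realType) (n : nat).
Hypothesis n3 : (3 <= n)%N.
Variables (k : nat) (rels : seq (word k)).
Local Open Scope quotient_scope.
Local Notation pcls := (\pi_(presented_group rels)).
Local Notation N := (last_label rels).
Local Notation target := (target rels).
Local Notation X2 := (R * R)%type.
Local Notation X4 := ((R * R) * (R * R))%type.
Variables (r : nat) (S : 'I_r -> pred nat).
Hypothesis DS : forall j, Dn target (S j) N = 1%g.
Hypothesis SA : forall A : pred nat, Dn target A N = 1%g -> exists j, forall i, (i <= N)%N -> S j i = A i.
Local Notation Z := (@ZZ R n N r S).
Local Notation M := (level_manifold (@Phi_smooth R n N r S) (@Phi_regular R n n3 N r S)).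

(** The holonomy map [phi] sends each gap loop to a conjugate of its label, hence is surjective.
    Every class in pi_1 is a conjugate of a word in gap loops; if its image is trivial, the word is
    trivial in the presented group, and the ring relations make it trivial in pi_1. *)
Lemma pi1_level (x : set_type Z) : isomorphic_groups (pi1 R x) (presented_group rels).
Proof.
have Zx : Z (set_val x) := set_valP x.
have pc w : Z w -> exists g : R -> _, [/\ path_in Z g, g 0 = set_val x & g 1 = w].
  by move=> Zw; exact: conn_trans (ZZ_conn n3 Zx) (conn_sym (ZZ_conn n3 Zw)).
have [kap [fk ksurj kuniv]] := universal_functor pc.
have [e1 he1] := ZZ_kap n3 fk.
pose kW (g : R -> X4) := kap (section n N S \o g).
have fW : functor (WW N S) kW.
  by apply: (functor_pull _ _ fk) => [|w]; [exact: section_cont|exact: section_ZZ].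
have [lam [ups [lamP upsP lam0 ups0]]] := side_paths R N.
pose kP (g : R -> X2) := kW (fun t => (g t, qs R)).
pose Y := XX kP lam ups.
have Y0 : Y 0 = 1%g := XX0 fW lamP upsP lam0 ups0.
have YA A : Dn target A N = 1%g -> Dn Y A N = 1%g.
  move=> /SA[j hj]; rewrite -(WW_relation fW lamP upsP j).
  by apply: Dn_eq => i iN; rewrite hj.
have [e2 he2] := WW_gen fW lamP upsP (values1 rels Y) (@valuesM _ rels _ Y) (values_label Y0 YA).
(* The values at the base point of the two cochains, from the collapse and from the generation by
   gap loops. *)
pose c := (e1 (set_val x) * (e2 (base (set_val x)))^-1)%g.
have kE q : exists w, q = (c * ev (value rels Y \o Some) w * c^-1)%g.
  have [g [pg g0 g1] ->] := ksurj q.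
  have pb : path_in (WW N S) (base (n:=n) \o g).
    case: pg => cg Zg; split=> [|t]; last exact: base_WW.
    by apply: contcomp => //; exact: base_cont.
  have [w] := he2 _ pb; rewrite /= g0 g1 => hw; exists w; rewrite -hw (he1 _ pg) g0 g1 /c.
  by rewrite invgM invgK !mulgA !mulgVK.
clearbody c; have lc : local_cocycle (@WW R N r S) (cW N S target) := cW_local DS.
have fh : functor Z (fun g : R -> 'rV[R]_(2 * n + 2) => hol (cW N S target) (base (n:=n) \o g)).
  have := @functor_pull _ _ _ Z (WW N S) _ (hol (cW N S target)) (base (n:=n)) (@base_cont R n) (@base_WW R n n3 N r S) (@hol_functor _ _ _ _ _ lc); exact.
have [phi [f hf]] := kuniv _ _ fh.
have pq b mu : path_in (@side R N b) mu -> path_in Z (section n N S \o (fun t => (mu t, qs R))).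
  move=> [cm sm]; split=> [|t].
    by apply: contcomp; [exact: section_cont|apply: contpair; [exact: cm|exact: contcst]].
  by apply: section_ZZ => //; apply: WW_PP; [apply: BoxP; have [] := sm t|exact: QQ_qs].
pose f0 := f (section n N S (p0 R N, qs R)).
have baseK mu : base (n:=n) \o (section n N S \o (fun t : R => (mu t, qs R))) = fun t => (mu t, qs R).
  by apply/funext => t; rewrite /= sectionK.
have T0 : target 0 = 1%g by [].
have phiY i : (i <= N)%N -> phi (Y i) = (f0 * target i * f0^-1)%g.
  move=> iN; have [pl l0 l1] := lamP i iN; have [pu u0 u1] := upsP i iN.
  rewrite /Y /XX gmulfM /kP /kW !hf; [|exact: pq pu|exact: pq pl].
  (* The holonomy of the gap loop comes entirely from its lower path; the values of [f] at the
     middle of the gap cancel. *)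
  rewrite !baseK (hol_ups S target pu) (hol_lam S T0 iN pl l0 l1) /= l0 l1 u0 u1 mulg1 -/f0.
  by rewrite !mulgA mulgVK.
have phi1 : phi 1%g = 1%g by apply: (mulgI (phi 1%g)); rewrite -gmulfM !mulg1.
have phiV q : phi q^-1%g = (phi q)^-1%g.
  by apply: (mulgI (phi q)); rewrite -gmulfM !mulgV.
have phiev w : phi (ev (value rels Y \o Some) w) = (f0 * pcls w * f0^-1)%g.
  rewrite -ev_cls; elim: w => [|l w ih] /=; first by rewrite phi1 mulg1 mulgV.
  rewrite gmulfM ih {1}/value phiY; last first.
    by rewrite /last_label -ltnS prednK// index_mem mem_labels.
  rewrite /target /label nth_index ?mem_labels//=.
  by rewrite !mulgA mulgVK.
have phi_inj : injective phi.
  move=> q q' e; suff h p : phi p = 1%g -> p = 1%g.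
    by apply: (mulIg q'^-1%g); rewrite mulgV; apply: h; rewrite gmulfM phiV e mulgV.
  have [w ->] := kE p; rewrite !gmulfM (phiV c) phiev => h.
  have : pcls w = pcls [::].
    by rewrite (conjg_eq1 (conjg_eq1 h)).
  by move=> /clsP/(ev_pres Y0 YA) -> /=; rewrite mulg1 mulgV.
have phi_surj q : exists p, phi p = q.
  pose w := repr (f0^-1 * q * f0)%g; exists (ev (value rels Y \o Some) w); rewrite phiev reprK.
  by rewrite !mulgA mulgV mul1g mulgK.
have [psi psiK] := choice phi_surj; exists phi, psi => // p.
by apply: phi_inj; rewrite psiK.
Qed.

End Realization.

Theorem theorem3 (R : realType) (G : groupType) (n : nat) :
  finitely_presented G -> (3 <= n)%N ->
  exists (M : manifold R (2 * n)%N) (J : almost_complex M),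
    [/\ closed_manifold M,
        [set: M] !=set0,
        connected [set: M],
        (forall x : M, isomorphic_groups (pi1 R x) G) &
        exists (Jhat : almost_complex (euclidean R (2 * n + 2)%N))
               (f : smoothMap M (euclidean R (2 * n + 2)%N)),
          pseudo_holomorphic_embedding J Jhat f].
Proof.
move=> [k [rels isoG]] n3.
pose N := last_label rels.
pose good (A : {set 'I_N.+1}) := Dn (target rels) (fun i => inord i \in A) N == 1%g.
(* One ring for every set of holes with trivial class. There are finitely many of them, as only the
   indices up to [N] matter. *)
pose r := #|[set A | good A]%SET|.
pose S (j : 'I_r) : pred nat := fun i => inord i \in enum_val j.
have DS j : Dn (target rels) (S j) N = 1%g.
  by have := enum_valP j; rewrite inE => /eqP.
have SA (A : pred nat) : Dn (target rels) A N = 1%g -> exists j, forall i, (i <= N)%N -> S j i = A i.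
  move=> h; pose B := [set i : 'I_N.+1 | A i]%SET.
  have BA i : (i <= N)%N -> (inord i \in B) = A i by move=> iN; rewrite inE inordK.
  have gB : B \in [set A | good A]%SET.
    rewrite inE /good; apply/eqP; rewrite -[RHS]h; apply: Dn_eq => i iN; split=> //; exact: BA.
  by exists (enum_rank_in gB B) => i iN; rewrite /S enum_rankK_in// BA.
have [A [sA A2 AI]] := level_embedded R n3 N S.
pose M := level_manifold (@Phi_smooth R n N r S) (@Phi_regular R n n3 N r S).
have Zz : ZZ N S (z0 R n N S) by have [] := conn_in (ZZ_conn n3 (section_ZZ n3 (@WW_p0 R N r S _ (QQ_qs R r).1))).
exists M, (level_acs _ _ sA A2 AI); split.
- exact: (@level_closed _ _ _ _ _ (@level_compact R n n3 N r S)).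
- by exists (exist _ (z0 R n N S) (mem_set Zz)).
- by apply: (path_connected_level Zz) => x; exact: ZZ_conn.
- by move=> x; apply: iso_trans isoG; exact: (pi1_level n3 DS SA).
- by exists (euclidean_acs sA A2), (level_inclusion _ _); exact: level_embedding.
Qed.
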